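(* Let $n\ge 3$ and let $(M,g,u)$ be a static triple with positive cosmological constant, i.e. $M$ is a connected compact $n$-dimensional smooth manifold with non-empty smooth boundary $\partial M$, $g$ is a smooth Riemannian metric on $M$, and $u\in C^\infty(M)$ satisfies $u\,\mathrm{Ric}=\mathrm{D}^2u+n\,u\,g$ and $\Delta u=-n\,u$ in $M$, $u>0$ in the interior of $M$ and $u=0$ on $\partial M$. Then $$\max_{\Sigma\in\pi_0(\partial M)}\kappa(\Sigma)\ \ge\ 1 .$$ Moreover, if equality holds, then, up to a normalization of $u$, the triple $(M,g,u)$ is isometric to the de Sitter solution.
   Context: $\mathrm{Ric}$, $\mathrm{D}$, $\mathrm{D}^2$, $\Delta$ are the Ricci tensor, Levi-Civita connection, Hessian and Laplace-Beltrami operator of $g$. The equations imply that the scalar curvature is $\mathrm{R}\equiv n(n-1)$. It is known that $|\mathrm{D}u|$ is constant and positive on each connected component of $\partial M$. $\pi_0(\partial M)$ is the set of connected components of $\partial M$ (called horizons). Set $u_{\max}=\max_M u$. The surface gravity of $\Sigma\in\pi_0(\partial M)$ is $\kappa(\Sigma)=|\mathrm{D}u|_{|\Sigma}/u_{\max}$. The de Sitter solution is the triple $(M_0,g_0,u_0)$ with $M_0=\overline{B(0,1)}\subset\mathbb{R}^n$, $g_0=\frac{d|x|\otimes d|x|}{1-|x|^2}+|x|^2g_{\mathbb{S}^{n-1}}$, $u_0=\sqrt{1-|x|^2}$, where $g_{\mathbb{S}^{n-1}}$ is the standard round metric and $g_0,u_0$ are extended smoothly through the origin and up to the boundary (so it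 is a closed round unit hemisphere with its height function). ''Up to a normalization of $u$, $(M,g,u)$ is isometric to $(M_0,g_0,u_0)$'' means that there are a constant $c>0$ and an isometry $\Phi:(M,g)\to(M_0,g_0)$ with $u=c\,u_0\circ\Phi$. *)

(* Defs.v *)
From HB Require Import structures.
From mathcomp Require Import all_boot all_order all_algebra perm ring.
From mathcomp Require Import all_classical all_reals all_analysis.

Set Implicit Arguments.
Unset Strict Implicit.
Unset Printing Implicit Defensive.

Import Order.TTheory GRing.Theory Num.Theory.
Import numFieldNormedType.Exports.

Local Open Scope classical_set_scope.
Local Open Scope ring_scope.

(* The greatest element of a set of reals.  A set without greatest element gets
   the default value 0. *)
Definition max_of (R : realType) (S : set R) : R :=
  xget 0 [set m | S m /\ forall s, S s -> s <= m].

(* [set x | 0 <= x_0]; writing the first index as "any i with value 0" avoids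
   assuming that the dimension is a successor. *)
Definition half_space (R : realType) n : set 'rV[R]_n :=
  [set x | forall i : 'I_n, i = 0%N :> nat -> 0 <= x 0 i].

(* C^k on the open set U, by iterated partial derivatives. *)
Fixpoint Ck_on (R : realType) n (k : nat) (U : set 'rV[R]_n)
    (F : 'rV[R]_n -> R) : Prop :=
  (forall x, U x -> {for x, continuous F}) /\
  if k is k'.+1 then
    forall i : 'I_n, (forall x, U x -> derivable F x (delta_mx 0 i)) /\
                     Ck_on k' U (fun x => 'D_(delta_mx 0 i) F x)
  else True.

(* On an arbitrary set A, smooth means locally extendable to a smooth function
   on an open subset of R^n. *)
Definition smooth_on (R : realType) n (A : set 'rV[R]_n) (f : 'rV[R]_n -> R) :=
  forall x, A x -> exists (U : set 'rV[R]_n) (F : 'rV[R]_n -> R),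
    [/\ open U, U x, forall k, Ck_on k U F &
        forall y, A y -> U y -> F y = f y].

(* Partial derivative of a function on (a relatively open subset of) the half
   space: two-sided, except for the normal derivative at the boundary, which is
   the right one. *)
Definition pd (R : realType) n (i : 'I_n) (f : 'rV[R]_n -> R) (x : 'rV[R]_n)
    : R :=
  lim ((fun h : R => h^-1 * (f (x + h *: delta_mx 0 i) - f x))
    @ within [set h | half_space (x + h *: delta_mx 0 i)] (0 : R)^').

(* Row a is the a-th partial derivative of f. *)
Definition jacobian_mx (R : realType) n m (f : 'rV[R]_n -> 'rV[R]_m)
    (x : 'rV[R]_n) : 'M[R]_(n, m) :=
  \matrix_(a, b) pd a (fun y => f y 0 b) x.

(* Tensors in local coordinates; G y is the matrix of the metric at y. *)
Section LocalGeometry.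
Variables (R : realType) (n : nat) (G : 'rV[R]_n -> 'M[R]_n).

(* Gamma^c_ab *)
Definition christoffel (c a b : 'I_n) (y : 'rV[R]_n) : R :=
  2^-1 * \sum_d invmx (G y) c d *
    (pd a (fun z => G z b d) y + pd b (fun z => G z a d) y
     - pd d (fun z => G z a b) y).

(* R^l_kij, i.e. R(d_i, d_j) d_k = R^l_kij d_l *)
Definition riemann (l k i j : 'I_n) (y : 'rV[R]_n) : R :=
  pd i (christoffel l j k) y - pd j (christoffel l i k) y
  + \sum_m (christoffel l i m y * christoffel m j k y
            - christoffel l j m y * christoffel m i k y).

Definition ricci (y : 'rV[R]_n) : 'M[R]_n :=
  \matrix_(j, k) \sum_i riemann i k i j y.

Definition hessian (f : 'rV[R]_n -> R) (y : 'rV[R]_n) : 'M[R]_n :=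
  \matrix_(a, b) (pd a (pd b f) y - \sum_c christoffel c a b y * pd c f y).

Definition laplacian (f : 'rV[R]_n -> R) (y : 'rV[R]_n) : R :=
  \tr (invmx (G y) *m hessian f y).

Definition grad_norm (f : 'rV[R]_n -> R) (y : 'rV[R]_n) : R :=
  let df : 'rV[R]_n := \row_a pd a f y in
  Num.sqrt ((df *m invmx (G y) *m df^T) 0 0).

End LocalGeometry.

(* An atlas with values in the half space together with the matrices of a metric
   in its charts.  A chart and its inverse are total functions, meaningful only
   on [chart_dom i] and on [chart_cod g i] respectively; the axioms are in
   [riemannian_manifold]. *)
Record riemannian_data (R : realType) (n : nat) (M : Type) := RiemannianData {
  chart_idx : Type;
  chart_dom : chart_idx -> set M;
  chart : chart_idx -> M -> 'rV[R]_n;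
  chart_inv : chart_idx -> 'rV[R]_n -> M;
  chart_metric : chart_idx -> 'rV[R]_n -> 'M[R]_n
}.

Definition chart_cod (R : realType) n (M : Type) (g : riemannian_data R n M)
    (i : chart_idx g) : set 'rV[R]_n :=
  chart i @` chart_dom i.

Section MapsInCharts.
Variables (R : realType) (n : nat) (M N : topologicalType).
Variables (g : riemannian_data R n M) (h : riemannian_data R n N).
Variable Phi : M -> N.

Definition local_map (i : chart_idx g) (j : chart_idx h) (x : 'rV[R]_n)
    : 'rV[R]_n := chart j (Phi (chart_inv i x)).

Definition overlap (i : chart_idx g) (j : chart_idx h) : set M :=
  chart_dom i `&` Phi @^-1` chart_dom j.

Definition smooth_in_charts :=
  forall (i : chart_idx g) (j : chart_idx h) (a : 'I_n),
    smooth_on (chart i @` overlap i j) (fun x => local_map i j x 0 a).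

(* The pullback of h by Phi is g. *)
Definition preserves_metric :=
  forall (i : chart_idx g) (j : chart_idx h) (p : M), overlap i j p ->
    let J := jacobian_mx (local_map i j) (chart i p) in
    chart_metric i (chart i p) = J *m chart_metric j (chart j (Phi p)) *m J^T.

Definition smooth_map := continuous Phi /\ smooth_in_charts.

End MapsInCharts.

Section Manifolds.
Variables (R : realType) (n : nat) (M : topologicalType).
Variable g : riemannian_data R n M.

(* M is a smooth n-dimensional manifold with (possibly empty) boundary, and g a
   smooth Riemannian metric on it. *)
Record riemannian_manifold : Prop := {
  mfd_hausdorff : hausdorff_space M;
  mfd_second_countable : @second_countable M;
  chart_cover : forall p, exists i : chart_idx g, chart_dom i p;
  chart_dom_open : forall i : chart_idx g, open (chart_dom i);
  chart_cod_open : forall i : chart_idx g,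
    exists2 O : set 'rV[R]_n, open O & chart_cod i = O `&` @half_space R n;
  chartK : forall (i : chart_idx g) p,
    chart_dom i p -> chart_inv i (chart i p) = p;
  chart_continuous : forall i : chart_idx g,
    {within chart_dom i, continuous (chart i)};
  chart_inv_continuous : forall i : chart_idx g,
    {within chart_cod i, continuous (chart_inv i)};
  transition_smooth : smooth_in_charts g g id;
  metric_smooth : forall (i : chart_idx g) (a b : 'I_n),
    smooth_on (chart_cod i) (fun x => chart_metric i x a b);
  metric_symmetric : forall (i : chart_idx g) x, chart_cod i x ->
    (chart_metric i x)^T = chart_metric i x;
  metric_positive : forall (i : chart_idx g) x, chart_cod i x ->
    forall v : 'rV[R]_n, v != 0 -> 0 < (v *m chart_metric i x *m v^T) 0 0;
  metric_transition : preserves_metric g g id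
}.

Definition boundary : set M :=
  [set p | exists (i : chart_idx g) (a : 'I_n),
    [/\ chart_dom i p, a = 0%N :> nat & chart i p 0 a = 0]].

Definition horizons : set (set M) :=
  [set connected_component boundary p | p in boundary].

Variable u : M -> R.

Definition local_fun (i : chart_idx g) (x : 'rV[R]_n) : R := u (chart_inv i x).

Definition smooth_fun :=
  forall i : chart_idx g, smooth_on (chart_cod i) (local_fun i).

(* The value at p of |Du|, read in any chart around p. *)
Definition grad_norm_at (p : M) : R :=
  xget 0 [set grad_norm (chart_metric i) (local_fun i) (chart i p)
         | i in [set i : chart_idx g | chart_dom i p]].

Definition static_equation :=
  forall (i : chart_idx g) x, chart_cod i x ->
    local_fun i x *: ricci (chart_metric i) x
    = hessian (chart_metric i) (local_fun i) x
      + (n%:R * local_fun i x) *: chart_metric i x.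

Definition potential_equation :=
  forall (i : chart_idx g) x, chart_cod i x ->
    laplacian (chart_metric i) (local_fun i) x = - n%:R * local_fun i x.

Record static_triple : Prop := {
  static_manifold : riemannian_manifold;
  static_connected : connected [set: M];
  static_compact : compact [set: M];
  static_boundary : boundary !=set0;
  static_smooth : smooth_fun;
  static_ricci : static_equation;
  static_laplacian : potential_equation;
  static_positive : forall p, ~ boundary p -> 0 < u p;
  static_vanishing : forall p, boundary p -> u p = 0
}.

(* The constant value of |Du| on Sigma, divided by the maximum of u. *)
Definition surface_gravity (Sigma : set M) : R :=
  xget 0 [set k | forall p, Sigma p -> grad_norm_at p = k] / max_of (range u).

End Manifolds.

Section Isometries.
Variables (R : realType) (n : nat) (M N : topologicalType).
Variables (g : riemannian_data R n M) (h : riemannian_data R n N).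

Definition riemannian_isometry (Phi : M -> N) :=
  [/\ smooth_map g h Phi,
      exists Psi : N -> M,
        [/\ cancel Phi Psi, cancel Psi Phi & smooth_map h g Psi] &
      preserves_metric g h Phi].

End Isometries.

Section DeSitter.
Variables (R : realType) (n : nat).
Implicit Types x y : 'rV[R]_n.

Definition sqnorm x : R := \sum_i x 0 i ^+ 2.

Definition closed_unit_ball : set 'rV[R]_n := [set x | sqnorm x <= 1].

Lemma sqnorm0 : sqnorm 0 = 0.
Proof. by rewrite /sqnorm big1 // => i _; rewrite mxE expr0n. Qed.

Lemma closed_unit_ball0 : (0 : 'rV[R]_n) \in closed_unit_ball.
Proof. by rewrite inE /closed_unit_ball /= sqnorm0. Qed.

(* A set coerces to the subtype of its elements, with the subspace topology. *)
Definition dS : topologicalType := (closed_unit_ball : Type).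

Definition to_dS y : dS :=
  insubd (exist _ 0 closed_unit_ball0 : closed_unit_ball) y.

Definition dS_val (p : dS) : 'rV[R]_n := sval p.

Definition dS_potential (p : dS) : R := Num.sqrt (1 - sqnorm (dS_val p)).

(* dr (x) dr / (1 - r^2) + r^2 g_S, where r = |x|, dr = x / r and
   r^2 g_S = |dx|^2 - dr (x) dr.  As 0^-1 = 0, the value at x = 0 is the
   identity, which is the smooth extension. *)
Definition polar_metric x : 'M[R]_n :=
  let r := Num.sqrt (sqnorm x) in
  let dr := r^-1 *: x in
  (1 - r ^+ 2)^-1 *: (dr^T *m dr) + (1%:M - dr^T *m dr).

(* The metric |dy|^2 + ds^2 induced by the graph of s = sqrt (1 - |y|^2). *)
Definition graph_metric y : 'M[R]_n :=
  1%:M + (1 - sqnorm y)^-1 *: (y^T *m y).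

Lemma sqnorm_ge0 x : 0 <= sqnorm x.
Proof. by rewrite sumr_ge0 // => i _; rewrite sqr_ge0. Qed.

Lemma sqnorm_eq0 x : (sqnorm x == 0) = (x == 0).
Proof.
apply/idP/eqP => [|->]; last by rewrite sqnorm0.
rewrite psumr_eq0 => [/allP x0|i _]; last exact: sqr_ge0.
apply/rowP => i; rewrite mxE; apply/eqP.
by rewrite -sqrf_eq0 -[_ == _]/(true ==> _) x0 ?mem_index_enum.
Qed.

(* On the open ball polar_metric is the metric induced by t = dS_potential. *)
Lemma polar_metricE x : sqnorm x < 1 -> polar_metric x = graph_metric x.
Proof.
move=> x1; rewrite /polar_metric /graph_metric sqr_sqrtr ?sqnorm_ge0 //.
set r := Num.sqrt _.
have [->|x0] := eqVneq x 0.
  by rewrite scaler0 !mulmx0 !scaler0 add0r subr0 addr0.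
have r2 : r ^+ 2 = sqnorm x by rewrite sqr_sqrtr ?sqnorm_ge0.
have s0 : sqnorm x != 0 by rewrite sqnorm_eq0.
rewrite addrCA; congr (_ + _).
rewrite [(_ *: x)^T]linearZ /= -scalemxAl -scalemxAr !scalerA -scalerBl.
congr (_ *: _).
rewrite -mulrA.
have -> : r^-1 * r^-1 = (sqnorm x)^-1 by rewrite -invfM -expr2 r2.
have d0 : 1 - sqnorm x != 0 by rewrite subr_eq0 gt_eqF.
by field; rewrite s0 d0.
Qed.

Definition ord_zero (a : 'I_n) : 'I_n :=
  Ordinal (leq_ltn_trans (leq0n a) (ltn_ord a)).

(* The closed ball is a closed hemisphere of the unit sphere of R^n x R, a point
   x being the projection of (x, t) with t = dS_potential x.  Charts:
   - None: the open ball; x is translated into the interior of the half space;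
   - Some (a, s): the x such that x_a has sign (-1)^s, including boundary
     points; in (x, t) the coordinate x_a is dropped, t becomes the coordinate
     0 and x_0 the coordinate a.  These points are the graph of
     x_a = (-1)^s sqrt (1 - |y|^2) over the remaining coordinates y. *)
Definition dS_dom (i : option ('I_n * bool)) : set dS :=
  match i with
  | None => [set p | sqnorm (dS_val p) < 1]
  | Some (a, s) => [set p | 0 < (-1) ^+ s * dS_val p 0 a]
  end.

Definition dS_chart (i : option ('I_n * bool)) (p : dS) : 'rV[R]_n :=
  match i with
  | None => dS_val p + const_mx 1
  | Some (a, _) => \row_b if b == ord_zero a then dS_potential p
                          else dS_val p 0 (tperm (ord_zero a) a b)
  end.

Definition dS_chart_inv (i : option ('I_n * bool)) y : dS :=
  match i with
  | None => to_dS (y - const_mx 1)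
  | Some (a, s) =>
      to_dS (\row_b if b == a then (-1) ^+ s * Num.sqrt (1 - sqnorm y)
                    else y 0 (tperm (ord_zero a) a b))
  end.

Definition dS_chart_metric (i : option ('I_n * bool)) y : 'M[R]_n :=
  match i with
  | None => polar_metric (y - const_mx 1)
  | Some _ => graph_metric y
  end.

Definition dS_metric : riemannian_data R n dS :=
  RiemannianData dS_dom dS_chart dS_chart_inv dS_chart_metric.

End DeSitter.

(* Main.v *)
(* Since u Ric = D^2 u + n u g is traceless, the function w = |Du|^2 + u^2 satisfies
   u Delta w - <Du, Dw> = 2 u |D^2 u + u g|^2 >= 0.  By the maximum principle w <= max_{bd M} |Du|^2,
   and at a maximum point of u this reads max u <= max_{bd M} |Du|.  In the case of equality the
   strong maximum principle makes w constant, so D^2 u = - u g.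

   Normalize u to v with max v = 1, so that |Dv|^2 = 1 - v^2.  Then X = - Dv is homothetic for the
   metric (1 + v)^-2 g: its covariant derivative is the identity.  Hence the squared norm K of the
   curvature satisfies X K = -4 K, and a maximum point of v K shows that K = 0.  The coordinates of
   X in a parallel frame are flat coordinates z with |z|^2 = (1 - v) / (1 + v) <= 1; being star-shaped,
   the closed unit ball develops onto M, and inverse stereographic projection of z is the isometry
   with the hemisphere. *)
From HB Require Import structures.
Require Import Defs.
From mathcomp Require Import all_boot all_order all_algebra perm ring lra.
From mathcomp Require Import all_classical all_reals all_analysis.

Set Implicit Arguments.
Unset Strict Implicit.
Unset Printing Implicit Defensive.

Import Order.TTheory GRing.Theory Num.Theory.
Import numFieldNormedType.Exports.

Local Open Scope classical_set_scope.
Local Open Scope ring_scope.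

(** * Tensor calculus over a ring with commuting derivations *)

(** Dividing by [u] is impossible on the boundary, so the elliptic operator is kept in the form u
    Delta - <Du, D .>, which degenerates there. The strong maximum principle is therefore run at
    interior points of charts only, and its conclusions reach the boundary by density or by the
    static equation itself. For the same reason v K and not K is maximized: the factor v keeps a
    positive maximum off the boundary. The factor (1 + v)^-2 is the one by which stereographic
    projection flattens the hemisphere; it exhibits the position field of R^n as -Dv, so no
    geodesics or exponential maps enter. Tensor identities are proved over an abstract commutative
    ring with commuting derivations; one-sided derivatives at the boundary enter once, when the
    smooth functions on a relatively open set are shown to form such a ring. Global coordinates
    arise by continuing local inverses along the rays of the ball, in place of covering theory;
    compactness of [M] bounds the length of the steps from below. *)

Section MatrixEntries.
Variables (S : pzRingType) (m n : nat).

Lemma addmxE (A B : 'M[S]_(m, n)) i j : (A + B) i j = A i j + B i j.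
Proof. by rewrite mxE. Qed.

Lemma oppmxE (A : 'M[S]_(m, n)) i j : (- A) i j = - A i j.
Proof. by rewrite mxE. Qed.

Lemma mx0E i j : (0 : 'M[S]_(m, n)) i j = 0.
Proof. by rewrite mxE. Qed.

Lemma scalemxE (k : S) (A : 'M[S]_(m, n)) i j : (k *: A) i j = k * A i j.
Proof. by rewrite mxE. Qed.

Lemma trmxE (A : 'M[S]_(m, n)) i j : A^T i j = A j i.
Proof. by rewrite mxE. Qed.

Lemma trmxD (A B : 'M[S]_(m, n)) : (A + B)^T = A^T + B^T.
Proof. by apply/matrixP => i j; rewrite !mxE. Qed.

Lemma trmxN (A : 'M[S]_(m, n)) : (- A)^T = - A^T.
Proof. by apply/matrixP => i j; rewrite !mxE. Qed.

Lemma trmxB (A B : 'M[S]_(m, n)) : (A - B)^T = A^T - B^T.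
Proof. by apply/matrixP => i j; rewrite !mxE. Qed.

Lemma trmx_scale k (A : 'M[S]_(m, n)) : (k *: A)^T = k *: A^T.
Proof. by apply/matrixP => i j; rewrite !mxE. Qed.

Lemma trmx_bigsum I (r : seq I) P (F : I -> 'M[S]_(m, n)) :
  (\sum_(k <- r | P k) F k)^T = \sum_(k <- r | P k) (F k)^T.
Proof. by apply/matrixP => i j; rewrite !(mxE, summxE); apply: eq_bigr => k _; rewrite mxE. Qed.

Lemma mxsumE I (r : seq I) P (F : I -> 'M[S]_(m, n)) i j :
  (\sum_(k <- r | P k) F k) i j = \sum_(k <- r | P k) F k i j.
Proof. by rewrite summxE. Qed.

End MatrixEntries.

Ltac entries := repeat progress
  rewrite ?addmxE ?oppmxE ?scalemxE ?trmxE ?mx0E.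

(* Generalizing the products first keeps [ring] from comparing them up to
   conversion. *)
Ltac mxgen := repeat match goal with
  | |- context [@mulmx ?S ?m ?n ?p ?A ?B] => move: (@mulmx S m n p A B) => ?
  end.
Ltac fungen := repeat match goal with
  | |- context [@fun_of_matrix ?S ?m ?n ?A ?i ?j] =>
      move: (@fun_of_matrix S m n A i j) => ?
  end.
Ltac mxexpand := rewrite ?(mulmxDl, mulmxDr, mulNmx, mulmxN) ?mulmxA.
Ltac mxring := mxgen; apply/matrixP => ? ?; entries; fungen; ring.

(** These three laws are all that the tensor calculus uses of partial derivatives. In this form it
    applies verbatim up to the boundary, where the derivatives are one-sided. *)
Record derivations (S : comPzRingType) n (d : 'I_n -> S -> S) : Prop :=
  Derivations {
    der_add : forall a, {morph d a : x y / x + y};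
    der_mul : forall a x y, d a (x * y) = d a x * y + x * d a y;
    der_comm : forall a b x, d a (d b x) = d b (d a x)
  }.

Section MatrixDerivations.
Variables (S : comPzRingType) (n : nat) (d : 'I_n -> S -> S).
Hypothesis hd : derivations d.

Lemma der0 a : d a 0 = 0.
Proof. by apply: (addrI (d a 0)); rewrite -(der_add hd) !addr0. Qed.

Lemma derN a x : d a (- x) = - d a x.
Proof. by apply: (addrI (d a x)); rewrite -(der_add hd) !subrr der0. Qed.

Lemma derB a x y : d a (x - y) = d a x - d a y.
Proof. by rewrite (der_add hd) derN. Qed.

Lemma der1 a : d a 1 = 0.
Proof.
apply: (addrI (d a 1)); rewrite addr0.
by have := der_mul hd a 1 1; rewrite !mulr1 mul1r => {3}->.
Qed.

Lemma der_sum a I (r : seq I) P (F : I -> S) :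
  d a (\sum_(k <- r | P k) F k) = \sum_(k <- r | P k) d a (F k).
Proof. exact: (big_morph _ (der_add hd a) (der0 a)). Qed.

Lemma der_nat a k : d a k%:R = 0.
Proof. by elim: k => [|k IH]; rewrite ?der0 // -addn1 natrD (der_add hd) IH der1 addr0. Qed.

Definition dmx a p q (A : 'M[S]_(p, q)) := map_mx (d a) A.

Arguments dmx a {p q} A.

Lemma dmxE a p q (A : 'M[S]_(p, q)) i j : dmx a A i j = d a (A i j).
Proof. by rewrite mxE. Qed.

Lemma dmxD a p q (A B : 'M[S]_(p, q)) : dmx a (A + B) = dmx a A + dmx a B.
Proof. by apply/matrixP => i j; rewrite !mxE (der_add hd). Qed.

Lemma dmxN a p q (A : 'M[S]_(p, q)) : dmx a (- A) = - dmx a A.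
Proof. by apply/matrixP => i j; rewrite !mxE derN. Qed.

Lemma dmxB a p q (A B : 'M[S]_(p, q)) : dmx a (A - B) = dmx a A - dmx a B.
Proof. by rewrite dmxD dmxN. Qed.

Lemma dmxM a p q r (A : 'M[S]_(p, q)) (B : 'M[S]_(q, r)) :
  dmx a (A *m B) = dmx a A *m B + A *m dmx a B.
Proof.
apply/matrixP => i j; rewrite !mxE der_sum -big_split; apply: eq_bigr => k _.
by rewrite (der_mul hd) !mxE.
Qed.

Lemma dmxZ a p q k (A : 'M[S]_(p, q)) : dmx a (k *: A) = d a k *: A + k *: dmx a A.
Proof. by apply/matrixP => i j; rewrite !mxE (der_mul hd). Qed.

Lemma dmx0 a p q : dmx a (0 : 'M[S]_(p, q)) = 0.
Proof. by apply/matrixP => i j; rewrite !mxE der0. Qed.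

Lemma dmx_sum a p q I (r : seq I) P (F : I -> 'M[S]_(p, q)) :
  dmx a (\sum_(k <- r | P k) F k) = \sum_(k <- r | P k) dmx a (F k).
Proof. by apply: (big_morph _ _ (dmx0 a p q)) => A B; exact: dmxD. Qed.

Lemma dmxT a p q (A : 'M[S]_(p, q)) : dmx a A^T = (dmx a A)^T.
Proof. by apply/matrixP => i j; rewrite !mxE. Qed.

Lemma dmxC a b p q (A : 'M[S]_(p, q)) : dmx a (dmx b A) = dmx b (dmx a A).
Proof. by apply/matrixP => i j; rewrite !mxE (der_comm hd). Qed.

Lemma dmx_scalar a p k : dmx a (k%:M : 'M[S]_p) = (d a k)%:M.
Proof. by apply/matrixP => i j; rewrite !mxE; case: eqP; rewrite ?mulr1n ?mulr0n ?der0. Qed.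

Lemma dmx1 a p : dmx a (1%:M : 'M[S]_p) = 0.
Proof. by rewrite dmx_scalar der1 raddf0. Qed.

Lemma dmx_delta a p q i j : dmx a (delta_mx i j : 'M[S]_(p, q)) = 0.
Proof. by apply/matrixP => k l; rewrite !mxE der_nat. Qed.

Lemma der_tr a p (A : 'M[S]_p) : d a (\tr A) = \tr (dmx a A).
Proof. by rewrite /mxtrace der_sum; apply: eq_bigr => k _; rewrite mxE. Qed.

Lemma dmx_inv a p (A Ai : 'M[S]_p) : A *m Ai = 1%:M ->
  dmx a Ai = - (Ai *m dmx a A *m Ai).
Proof.
move=> AAi; have AiA := mulmx1C AAi.
have := dmx1 a p; rewrite -AAi dmxM => /(congr1 (mulmx Ai)).
rewrite mulmx0 mulmxDr !mulmxA AiA mul1mx => /eqP.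
by rewrite addrC addr_eq0 => /eqP.
Qed.

Definition grad_col (f : S) : 'cV[S]_n := \col_a d a f.

Lemma grad_colE f a j : grad_col f a j = d a f.
Proof. by rewrite mxE. Qed.

End MatrixDerivations.

Arguments dmx {S n} d a {p q} A.
Arguments grad_colE {S n} d f a j.

Section MatrixIndices.
Variables (S : comPzRingType).

Lemma mul_tr_deltaE n p (A : 'M[S]_(n, p)) (a : 'I_n) (k : 'I_1) j :
  ((delta_mx a 0 : 'cV[S]_n)^T *m A) k j = A a j.
Proof. by rewrite trmx_delta -rowE mxE. Qed.

Lemma mul_deltaE n p (A : 'M[S]_(p, n)) (a : 'I_n) (k : 'I_1) i :
  (A *m (delta_mx a 0 : 'cV[S]_n)) i k = A i a.
Proof. by rewrite (ord1 k) -colE mxE. Qed.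

Lemma mulmxE n m p (A : 'M[S]_(m, n)) (B : 'M[S]_(n, p)) i j :
  (A *m B) i j = \sum_k A i k * B k j.
Proof. by rewrite mxE. Qed.

Lemma mul_row_eq n m p (A B : 'M[S]_(m, n)) (C : 'M[S]_(n, p)) i j :
  row i A = row j B -> forall k, (A *m C) i k = (B *m C) j k.
Proof. by move=> h k; rewrite !mulmxE; apply: eq_bigr => l _; have /rowP/(_ l) := h; rewrite !mxE => ->. Qed.

End MatrixIndices.

(* [(Gam a) b c] is the Christoffel symbol with upper index c and lower indices
   a, b, so that a covector field w, seen as a column, has covariant derivative
   [dmx d a w - Gam a *m w]. *)
Record levi_civita (S : comPzRingType) n (d : 'I_n -> S -> S)
    (G Gi : 'M[S]_n) (Gam : 'I_n -> 'M[S]_n) : Prop := LeviCivita {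
  lc_der : derivations d;
  lc_sym : G^T = G;
  lc_inv : G *m Gi = 1%:M;
  lc_torsion : forall a b, row b (Gam a) = row a (Gam b);
  lc_metric : forall a, dmx d a G = Gam a *m G + G *m (Gam a)^T
}.

(** Minus the commutator of the operators [d a - Gam a] on covectors; in coordinates the entry (k,
    l) is R^l_kab. *)
Definition curv (S : comPzRingType) n (d : 'I_n -> S -> S)
    (Gam : 'I_n -> 'M[S]_n) a b : 'M[S]_n :=
  dmx d a (Gam b) - dmx d b (Gam a) - (Gam a *m Gam b - Gam b *m Gam a).

Lemma curvE (S : comPzRingType) n (d : 'I_n -> S -> S) (Gam : 'I_n -> 'M[S]_n) a b i l :
  curv d Gam a b i l = d a (Gam b i l) - d b (Gam a i l) -
    (\sum_j Gam a i j * Gam b j l - \sum_j Gam b i j * Gam a j l).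
Proof. by rewrite /curv !mxE. Qed.

(** * Symmetries of the curvature and the Bianchi identities *)

Section Curvature.
Variables (S : comPzRingType) (n : nat) (d : 'I_n -> S -> S).
Variables (G Gi : 'M[S]_n) (Gam : 'I_n -> 'M[S]_n).
Hypothesis lc : levi_civita d G Gi Gam.
Hypothesis half : exists h : S, h + h = 1.

Let hd := lc_der lc.
Local Notation Om := (curv d Gam).

Lemma lc_invl : Gi *m G = 1%:M.
Proof. exact: mulmx1C (lc_inv lc). Qed.

Lemma lc_invT : Gi^T = Gi.
Proof.
have h : Gi^T *m G = 1%:M by rewrite -(lc_sym lc) -trmx_mul (lc_inv lc) trmx1.
by rewrite -[LHS]mulmx1 -(lc_inv lc) mulmxA h mul1mx.
Qed.

Lemma lc_torsionE a b c : Gam a b c = Gam b a c.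
Proof. by have /rowP/(_ c) := lc_torsion lc a b; rewrite !mxE. Qed.

Lemma double_inj (x y : S) : x + x = y + y -> x = y.
Proof.
case: half => h h1 xy.
have e z : z = h * (z + z) by rewrite mulrDr -mulrDl h1 mul1r.
by rewrite (e x) (e y) xy.
Qed.

Lemma dmx_metric_inv a : dmx d a Gi = - (Gi *m Gam a + (Gam a)^T *m Gi).
Proof.
rewrite (dmx_inv hd a (lc_inv lc)) (lc_metric lc); congr (- _).
rewrite mulmxDr mulmxDl -!mulmxA (lc_inv lc) mulmx1.
by rewrite [Gi *m (G *m _)]mulmxA lc_invl mul1mx.
Qed.

Lemma curvC a b : Om a b = - Om b a.
Proof. rewrite /curv; mxring. Qed.

(** Expanding both orders of a second derivative of [G] by metric compatibility leaves exactly this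
    identity: the lowered curvature is skew in its matrix indices. *)
Lemma curv_antisym a b : Om a b *m G = - (G *m (Om a b)^T).
Proof.
have := dmxC hd a b G; rewrite !(lc_metric lc) !(dmxD hd) !(dmxM hd) !(dmxT).
rewrite !(lc_metric lc) => E; apply/eqP; rewrite -addr_eq0; apply/eqP.
have -> : 0 = (dmx d a (Gam b) *m G + Gam b *m (Gam a *m G + G *m (Gam a)^T) +
     ((Gam a *m G + G *m (Gam a)^T) *m (Gam b)^T + G *m (dmx d a (Gam b))^T))
  - (dmx d b (Gam a) *m G + Gam a *m (Gam b *m G + G *m (Gam b)^T) +
      ((Gam b *m G + G *m (Gam b)^T) *m (Gam a)^T + G *m (dmx d b (Gam a))^T)).
  by rewrite E subrr.
rewrite /curv !trmxB !trmx_mul; mxexpand.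
mxring.
Qed.

(** Symmetry of [Gam] in its lower indices pairs off the derivative terms and, separately, the
    quadratic terms. *)
Lemma curv_bianchi1 i j k : row k (Om i j) + row i (Om j k) + row j (Om k i) = 0.
Proof.
have e a b c : (Gam a *m Gam c) b = (Gam b *m Gam c) a.
  by apply: funext => l; apply: mul_row_eq; exact: lc_torsion lc _ _.
apply/rowP => l.
have r0 p (A : 'M[S]_n) : row p A 0 l = A p l by rewrite mxE.
entries; rewrite !r0 /curv; entries; rewrite !dmxE.
rewrite (e j k i) (e i k j) (e i j k).
rewrite (lc_torsionE j k) (lc_torsionE i k) (lc_torsionE j i); mxgen; fungen; ring.
Qed.

(** The octahedron argument: the four Bianchi identities on the indices a, b, k, l, combined with
    signs and the two skew symmetries, leave twice the difference of the two sides. *)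
Lemma curv_pair a b k l : (Om a b *m G) k l = (Om k l *m G) a b.
Proof.
pose F i j p q := (Om i j *m G) p q.
have s1 i j p q : F i j p q = - F j i p q by rewrite /F curvC mulNmx oppmxE.
have s2 i j p q : F i j p q = - F i j q p.
  by rewrite /F {1}curv_antisym oppmxE -{1}(lc_sym lc) -trmx_mul trmxE.
have s3 i j p q : F i j p q + F j p i q + F p i j q = 0.
  have := curv_bianchi1 i j p => /(congr1 (fun r => (r *m G) 0 q)).
  have r0 c (A : 'M[S]_n) : row c A 0 q = A c q by rewrite mxE.
  by rewrite !mulmxDl mul0mx -!row_mul; entries; rewrite !r0.
apply: double_inj; rewrite -/(F a b k l) -/(F k l a b).
have h1 := s3 a b k l; have h2 := s3 b k l a; have h3 := s3 k l a b; have h4 := s3 l a b k.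
have h2' : - F b k a l - F k l a b + F b l a k = 0.
  by rewrite -h2 (s2 b k l a) (s2 k l b a) (s1 l b k a) (s2 b l k a) opprK.
have h3' : F k l a b + F l a k b + F k a b l = 0.
  by rewrite -h3 (s1 a k l b) (s2 k a l b) opprK.
have h4' : - F l a k b - F a b k l + F b l a k = 0.
  by rewrite -h4 (s2 l a b k) (s2 a b l k).
apply/eqP; rewrite -subr_eq0; apply/eqP.
have -> : F a b k l + F a b k l - (F k l a b + F k l a b) =
    (F a b k l + F b k a l + F k a b l) + (- F b k a l - F k l a b + F b l a k)
    - (F k l a b + F l a k b + F k a b l) - (- F l a k b - F a b k l + F b l a k).
  by fungen; rewrite /F; fungen; ring.
by rewrite h1 h2' h3' h4' !subr0 addr0.
Qed.

(** Only the matrix indices are differentiated covariantly. For a matrix-valued two-form the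
    corrections on the form indices cancel in cyclic sums, by torsion-freeness. *)
Definition covd a (A : 'M[S]_n) := dmx d a A - (Gam a *m A - A *m Gam a).

(** The Jacobi identity for the operators [d a - Gam a]. *)
Lemma curv_bianchi2 a b c : covd a (Om b c) + covd b (Om c a) + covd c (Om a b) = 0.
Proof.
rewrite /covd /curv !(dmxB hd) !(dmxM hd) (dmxC hd b a) (dmxC hd c b) (dmxC hd c a).
mxexpand.
move: (dmx d a (dmx d b _)) (dmx d a (dmx d c _)) (dmx d b (dmx d c _)) => ? ? ?.
mxring.
Qed.

End Curvature.

(** * Curvature in the direction of a homothetic vector field *)

Section HomotheticField.
Variables (S : comPzRingType) (n : nat) (d : 'I_n -> S -> S).
Variables (G Gi : 'M[S]_n) (Gam : 'I_n -> 'M[S]_n) (X : 'cV[S]_n).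
Hypothesis lc : levi_civita d G Gi Gam.
Hypothesis half : exists h : S, h + h = 1.
(* The covariant derivative of the vector field X is the identity. *)
Hypothesis hX : forall a, dmx d a X + (Gam a)^T *m X = delta_mx a 0.

Let hd := lc_der lc.
Local Notation Om := (curv d Gam).

Lemma dmx_homothetic a : dmx d a X = delta_mx a 0 - (Gam a)^T *m X.
Proof. by rewrite -(hX a) addrK. Qed.

(** Curvature acts on [X] as the commutator of second covariant derivatives; the first derivative of
    [X] is the identity, which is parallel, so the commutator vanishes. *)
Lemma curv_homothetic a b : (Om a b)^T *m X = 0.
Proof.
have := dmxC hd a b X; rewrite !dmx_homothetic !(dmxB hd) !(dmx_delta hd).
rewrite !(dmxM hd) !dmxT !dmx_homothetic => E.
have s : (Gam a)^T *m delta_mx b 0 = (Gam b)^T *m (delta_mx a 0 : 'cV[S]_n).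
  by apply/matrixP => i j; rewrite !mul_deltaE !trmxE (lc_torsionE lc).
move: E; rewrite /curv !trmxB !trmx_mul; mxexpand.
rewrite s => /eqP; rewrite -subr_eq0 => /eqP E.
by rewrite -[RHS]oppr0 -E; mxring.
Qed.

(** Pair symmetry moves [X] from the matrix slot, where [curv_homothetic] applies, to a form
    slot. *)
Lemma contract_curv b : \sum_a X a 0 *: Om a b = 0.
Proof.
have h : (\sum_a X a 0 *: Om a b) *m G = 0.
  apply/matrixP => k l; rewrite mulmx_suml mxsumE mx0E.
  have := congr1 (fun M => (M^T *m G) 0 b) (curv_homothetic k l).
  rewrite trmx0 mul0mx mx0E trmx_mul trmxK -mulmxA mulmxE => E; rewrite -[RHS]E.
  apply: eq_bigr => a _.
  by rewrite -scalemxAl scalemxE (curv_pair lc half) trmxE.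
by rewrite -[LHS]mulmx1 -(lc_inv lc) mulmxA h mul0mx.
Qed.

Let N := \sum_a X a 0 *: Gam a.

Lemma contract_GamE b a : ((Gam b)^T *m X) a 0 = N b a.
Proof.
rewrite mulmxE /N mxsumE; apply: eq_bigr => c _.
by rewrite scalemxE trmxE mulrC (lc_torsionE lc).
Qed.

(** Differentiate the vanishing contraction along [b]: the derivative of [X] is a basis vector minus
    a Christoffel term, which returns [T b] and the [N] correction. *)
Lemma contract_sum_covd (T : 'I_n -> 'M[S]_n) b : \sum_a X a 0 *: T a = 0 ->
  \sum_a X a 0 *: covd d Gam b (T a) = - T b + \sum_a N b a *: T a.
Proof.
move=> h; have := congr1 (dmx d b) h.
rewrite (dmx_sum hd) (dmx0 hd).
under eq_bigr do rewrite (dmxZ hd).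
rewrite big_split /= => /eqP; rewrite addrC addr_eq0 => /eqP E.
have -> : \sum_a X a 0 *: covd d Gam b (T a) =
    \sum_a X a 0 *: dmx d b (T a) - (Gam b *m \sum_a X a 0 *: T a -
      (\sum_a X a 0 *: T a) *m Gam b).
  rewrite mulmx_sumr mulmx_suml -!sumrB; apply: eq_bigr => a _.
  by rewrite -scalemxAr -scalemxAl -!scalerBr.
rewrite h mulmx0 mul0mx subrr subr0 E.
have -> : \sum_a d b (X a 0) *: T a = T b - \sum_a N b a *: T a.
  have e a : d b (X a 0) = (a == b)%:R - N b a.
    rewrite -contract_GamE -dmxE dmx_homothetic addmxE oppmxE; congr (_ - _).
    by rewrite mxE eqxx andbT.
  under eq_bigr do rewrite e scalerBl.
  rewrite sumrB; congr (_ - _).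
  by rewrite (bigD1 b) //= eqxx scale1r big1 ?addr0 // => a /negbTE ->; rewrite scale0r.
by rewrite opprB addrC.
Qed.

(** The second Bianchi identity trades differentiation along [X] for derivatives of contractions
    with [X], and these contractions vanish. The [N] terms are the corrections on form indices that
    [covd] omits, so the tensorial content is that the full covariant derivative of the curvature
    along [X] is -2 times the curvature. *)
Lemma contract_covd_curv b c : \sum_a X a 0 *: covd d Gam a (Om b c) =
  - (Om b c + Om b c) + \sum_a N b a *: Om a c + \sum_a N c a *: Om b a.
Proof.
have e a : covd d Gam a (Om b c) = covd d Gam b (Om a c) - covd d Gam c (Om a b).
  have := curv_bianchi2 lc a b c.
  rewrite (curvC d Gam c a).
  have -> A : covd d Gam b (- A) = - covd d Gam b A.
    by rewrite /covd (dmxN hd) mulmxN mulNmx !opprD opprK.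
  by move=> /eqP; rewrite -addrA addr_eq0 => /eqP ->; rewrite opprD opprK.
under eq_bigr do rewrite e scalerBr.
rewrite sumrB (contract_sum_covd _ (contract_curv c)) (contract_sum_covd _ (contract_curv b)).
rewrite (curvC d Gam c b).
have -> : \sum_a N c a *: Om a b = - \sum_a N c a *: Om b a.
  by rewrite -sumrN; apply: eq_bigr => a _; rewrite curvC scalerN.
move: (\sum_a N b a *: Om a c) (\sum_a N c a *: Om b a) (Om b c) => A B C.
by mxring.
Qed.

End HomotheticField.

Definition contract (S : comPzRingType) n (P : 'M[S]_n) (F : 'I_n -> 'I_n -> S) : S :=
  \sum_b \sum_b' P b b' * F b b'.

(** The squared norm of the curvature; the minus sign is there because matrices that are skew for
    the metric satisfy tr(T T) <= 0. *)
Definition curv_norm (S : comPzRingType) n (d : 'I_n -> S -> S)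
    (Gi : 'M[S]_n) (Gam : 'I_n -> 'M[S]_n) : S :=
  - contract Gi (fun b b' => contract Gi (fun c c' =>
      \tr (curv d Gam b c *m curv d Gam b' c'))).

Section ContractDerivation.
Variables (S : comPzRingType) (n : nat) (del : S -> S).
Hypothesis delD : {morph del : x y / x + y}.
Hypothesis delM : forall x y, del (x * y) = del x * y + x * del y.
Variables (P N : 'M[S]_n).
Hypothesis delP : forall b b', del (P b b') = - ((P *m N) b b' + (N^T *m P) b b').

Let del0 : del 0 = 0.
Proof. by apply: (addrI (del 0)); rewrite -delD !addr0. Qed.

Lemma contract_mull F :
  contract (N^T *m P) F = contract P (fun b b' => \sum_a N b a * F a b').
Proof.
rewrite /contract exchange_big [RHS]exchange_big /=; apply: eq_bigr => b' _.
under eq_bigr do rewrite mulmxE mulr_suml.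
under [RHS]eq_bigr do rewrite mulr_sumr.
rewrite exchange_big; apply: eq_bigr => a _; apply: eq_bigr => b _.
by rewrite trmxE; ring.
Qed.

Lemma contract_mulr F :
  contract (P *m N) F = contract P (fun b b' => \sum_a N b' a * F b a).
Proof.
rewrite /contract; apply: eq_bigr => b _.
under eq_bigr do rewrite mulmxE mulr_suml.
under [RHS]eq_bigr do rewrite mulr_sumr.
rewrite exchange_big; apply: eq_bigr => a _; apply: eq_bigr => b' _.
by ring.
Qed.

(** [delP] says that [P] is parallel for the connection matrix [N], so the [N] corrections of [F]
    cancel against those of [P]. *)
Lemma del_contract F E :
  (forall b b', del (F b b') =
     E b b' + \sum_a N b a * F a b' + \sum_a N b' a * F b a) ->
  del (contract P F) = contract P E.
Proof.
move=> h.
have -> : del (contract P F) = contract P (fun b b' => del (F b b'))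
    - (contract (P *m N) F + contract (N^T *m P) F).
  rewrite /contract (big_morph _ delD del0) -!big_split -sumrB.
  apply: eq_bigr => b _; rewrite (big_morph _ delD del0) -!big_split -sumrB.
  by apply: eq_bigr => b' _; rewrite delM delP /=; ring.
rewrite contract_mull contract_mulr /contract -!big_split -sumrB.
apply: eq_bigr => b _; rewrite -!big_split -sumrB; apply: eq_bigr => b' _ /=.
by rewrite h; ring.
Qed.

Lemma contract_sum I (r : seq I) (c : I -> S) F :
  contract P (fun b b' => \sum_(a <- r) c a * F a b b') =
  \sum_(a <- r) c a * contract P (F a).
Proof.
rewrite /contract; under [RHS]eq_bigr do rewrite mulr_sumr.
rewrite [RHS]exchange_big; apply: eq_bigr => b _ /=.
under [RHS]eq_bigr do rewrite mulr_sumr.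
rewrite [RHS]exchange_big; apply: eq_bigr => b' _ /=.
by rewrite mulr_sumr; apply: eq_bigr => a _; rewrite mulrCA.
Qed.

Lemma contractD F F' :
  contract P (fun b b' => F b b' + F' b b') = contract P F + contract P F'.
Proof.
rewrite /contract -big_split; apply: eq_bigr => b _.
by rewrite -big_split; apply: eq_bigr => b' _; rewrite mulrDr.
Qed.

Lemma contractZ k F :
  contract P (fun b b' => k * F b b') = k * contract P F.
Proof.
rewrite /contract mulr_sumr; apply: eq_bigr => b _.
by rewrite mulr_sumr; apply: eq_bigr => b' _; rewrite mulrCA.
Qed.

Lemma del_contract2 (B : 'I_n -> 'I_n -> 'I_n -> 'I_n -> S) k :
  (forall b c b' c', del (B b c b' c') = k * B b c b' c'
    + \sum_a N b a * B a c b' c' + \sum_a N c a * B b a b' c'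
    + \sum_a N b' a * B b c a c' + \sum_a N c' a * B b c b' a) ->
  let K := contract P (fun b b' => contract P (fun c c' => B b c b' c')) in
  del K = k * K.
Proof.
move=> h /=; rewrite -contractZ; apply: del_contract => b b'.
rewrite (del_contract (E := fun c c' => k * B b c b' c' +
  \sum_a N b a * B a c b' c' + \sum_a N b' a * B b c a c')).
  by rewrite !contractD contractZ !contract_sum.
by move=> c c'; rewrite h; ring.
Qed.

End ContractDerivation.

Section CurvatureNorm.
Variables (S : comPzRingType) (n : nat) (d : 'I_n -> S -> S).
Variables (G Gi : 'M[S]_n) (Gam : 'I_n -> 'M[S]_n) (X : 'cV[S]_n).
Hypothesis lc : levi_civita d G Gi Gam.

Let hd := lc_der lc.
Let N := \sum_a X a 0 *: Gam a.

Definition deriv_along x := \sum_a X a 0 * d a x.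
Local Notation del := deriv_along.

Lemma deriv_alongD : {morph del : x y / x + y}.
Proof.
move=> x y; rewrite /del -big_split; apply: eq_bigr => a _ /=.
by rewrite (der_add hd) mulrDr.
Qed.

Lemma deriv_alongM x y : del (x * y) = del x * y + x * del y.
Proof.
rewrite /del mulr_suml mulr_sumr -big_split; apply: eq_bigr => a _ /=.
by rewrite (der_mul hd); ring.
Qed.

Lemma deriv_alongN x : del (- x) = - del x.
Proof. by rewrite /del -sumrN; apply: eq_bigr => a _; rewrite (derN hd) mulrN. Qed.

Lemma deriv_along_inv b b' : del (Gi b b') = - ((Gi *m N) b b' + (N^T *m Gi) b b').
Proof.
rewrite /del /N trmx_bigsum mulmx_sumr mulmx_suml !mxsumE -big_split -sumrN.
apply: eq_bigr => a _ /=.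
by rewrite -dmxE (dmx_metric_inv lc) trmx_scale -scalemxAl -scalemxAr; entries; ring.
Qed.

(** The connection acts on matrices by commutators, whose contributions cancel under the trace. *)
Lemma deriv_along_tr (A C : 'M[S]_n) : del (\tr (A *m C)) =
  \tr ((\sum_a X a 0 *: covd d Gam a A) *m C) +
  \tr ((\sum_a X a 0 *: covd d Gam a C) *m A).
Proof.
rewrite /del !mulmx_suml !raddf_sum -big_split; apply: eq_bigr => a _ /=.
rewrite (der_tr hd) (dmxM hd) -!scalemxAl !mxtraceZ -mulrDr /covd.
congr (_ * _); rewrite !mxtraceD; mxexpand.
have trB (M M' : 'M[S]_n) : \tr (M - M') = \tr M - \tr M' by rewrite raddfB.
rewrite !trB [\tr (A *m dmx d a C)]mxtrace_mulC.
have -> : \tr (Gam a *m A *m C) = \tr (C *m Gam a *m A).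
  by rewrite mxtrace_mulC mulmxA.
have -> : \tr (Gam a *m C *m A) = \tr (A *m Gam a *m C).
  by rewrite mxtrace_mulC mulmxA.
ring.
Qed.

(** The coefficient -4 collects -2 from each of the two factors of the trace. *)
Lemma deriv_along_tr2 (T : 'I_n -> 'I_n -> 'M[S]_n) :
  (forall b c, \sum_a X a 0 *: covd d Gam a (T b c) =
    - (T b c + T b c) + \sum_a N b a *: T a c + \sum_a N c a *: T b a) ->
  let B b c b' c' := \tr (T b c *m T b' c') in
  forall b c b' c', del (B b c b' c') = - 4%:R * B b c b' c'
    + \sum_a N b a * B a c b' c' + \sum_a N c a * B b a b' c'
    + \sum_a N b' a * B b c a c' + \sum_a N c' a * B b c b' a.
Proof.
move=> h B b c b' c'; rewrite {1}/B deriv_along_tr !h.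
have e b0 c0 b1 c1 : \tr ((- (T b0 c0 + T b0 c0) + \sum_a N b0 a *: T a c0 +
    \sum_a N c0 a *: T b0 a) *m T b1 c1) = - 2%:R * B b0 c0 b1 c1 +
    \sum_a N b0 a * B a c0 b1 c1 + \sum_a N c0 a * B b0 a b1 c1.
  rewrite !mulmxDl !mxtraceD !mulmx_suml mulNmx mulmxDl raddfN /= mxtraceD.
  rewrite !raddf_sum /=; congr (_ + _ + _).
  - by rewrite /B; ring.
  - by apply: eq_bigr => a _; rewrite -scalemxAl mxtraceZ.
  - by apply: eq_bigr => a _; rewrite -scalemxAl mxtraceZ.
have BC x y z t : B x y z t = B z t x y by rewrite /B mxtrace_mulC.
rewrite !e (BC b' c').
under [in X in _ + (_ + X + _)]eq_bigr do rewrite BC.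
under [in X in _ + (_ + X)]eq_bigr do rewrite BC.
by ring.
Qed.

Hypothesis half : exists h : S, h + h = 1.
Hypothesis hX : forall a, dmx d a X + (Gam a)^T *m X = delta_mx a 0.

Lemma deriv_along_curv_norm :
  del (curv_norm d Gi Gam) = - 4%:R * curv_norm d Gi Gam.
Proof.
rewrite /curv_norm deriv_alongN mulrN; congr (- _).
apply: (del_contract2 deriv_alongD deriv_alongM deriv_along_inv).
apply: deriv_along_tr2 => b c; exact: contract_covd_curv lc half hX b c.
Qed.

End CurvatureNorm.

(** * Uniqueness of the Levi-Civita connection and behaviour under pullback *)

Section LeviCivitaUnique.
Variables (S : comPzRingType) (n : nat) (d : 'I_n -> S -> S).
Hypothesis half : exists h : S, h + h = 1.

(** The lowered difference of the two connections is symmetric in its first two indices and skew in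
    its last two. Cycling the indices shows that such a tensor equals its own opposite. *)
Lemma levi_civita_unique (G Gi Gi' : 'M[S]_n) (Gam Gam' : 'I_n -> 'M[S]_n) :
  levi_civita d G Gi Gam -> levi_civita d G Gi' Gam' ->
  forall a, Gam a = Gam' a.
Proof.
move=> lc lc' a.
pose T a b c := ((Gam a - Gam' a) *m G) b c.
have sym a0 b c : T a0 b c = T b a0 c.
  apply: mul_row_eq; rewrite !raddfB /=.
  by rewrite (lc_torsion lc) (lc_torsion lc').
have asym a0 b c : T a0 b c = - T a0 c b.
  have := lc_metric lc a0; rewrite (lc_metric lc') => E.
  suff h : (Gam a0 - Gam' a0) *m G = - ((Gam a0 - Gam' a0) *m G)^T.
    by rewrite /T {1}h oppmxE trmxE.
  rewrite trmx_mul trmxB (lc_sym lc) mulmxBl mulmxBr.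
  apply/eqP; rewrite -subr_eq0; apply/eqP.
  transitivity ((Gam a0 *m G + G *m (Gam a0)^T) - (Gam' a0 *m G + G *m (Gam' a0)^T)).
    by mxring.
  by rewrite E subrr.
have T0 a0 b c : T a0 b c = 0.
  have e : T a0 b c = - T a0 b c.
    by rewrite {1}sym asym sym asym opprK sym asym.
  by apply: (double_inj half); rewrite addr0 {1}e addNr.
have h : (Gam a - Gam' a) *m G = 0.
  by apply/matrixP => i j; rewrite mx0E -(T0 a i j).
apply/eqP; rewrite -subr_eq0; apply/eqP.
by rewrite -[LHS]mulmx1 -(lc_inv lc) mulmxA h mul0mx.
Qed.

Definition christoffel_mx (h : S) (G Gi : 'M[S]_n) (a : 'I_n) : 'M[S]_n :=
  \matrix_(b, c) (h * \sum_e Gi c e * (d a (G b e) + d b (G a e) - d e (G a b))).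

Lemma christoffel_levi_civita (h : S) (G Gi : 'M[S]_n) :
  derivations d -> h + h = 1 -> G^T = G -> G *m Gi = 1%:M ->
  levi_civita d G Gi (christoffel_mx h G Gi).
Proof.
move=> hd h1 GT GGi.
have GS i j : G i j = G j i by rewrite -[in LHS]GT mxE.
have GiT : Gi^T = Gi.
  have e : Gi^T *m G = 1%:M by rewrite -GT -trmx_mul GGi trmx1.
  by rewrite -[LHS]mulmx1 -GGi mulmxA e mul1mx.
(* Lowering the upper index removes [Gi]; both axioms then reduce to Christoffel symbols of the
   first kind. *)
have low a b k : (christoffel_mx h G Gi a *m G) b k =
    h * (d a (G b k) + d b (G a k) - d k (G a b)).
  pose L : 'rV[S]_n := \row_e (d a (G b e) + d b (G a e) - d e (G a b)).
  have -> : (christoffel_mx h G Gi a *m G) b k = h * ((L *m Gi) *m G) 0 k.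
    rewrite !mulmxE mulr_sumr; apply: eq_bigr => c _.
    rewrite !mxE -mulrA; congr (_ * (_ * _)); apply: eq_bigr => e _.
    by rewrite mxE mulrC -[Gi in LHS]GiT mxE.
  by rewrite -mulmxA (mulmx1C GGi) mulmx1 mxE.
split=> // [a b|a].
  apply/rowP => c; rewrite !mxE; congr (_ * _); apply: eq_bigr => e _.
  by rewrite (GS a b); ring.
have -> : G *m (christoffel_mx h G Gi a)^T = (christoffel_mx h G Gi a *m G)^T.
  by rewrite trmx_mul GT.
apply/matrixP => b c; rewrite addmxE trmxE !low dmxE (GS c b).
rewrite (GS a b) (GS a c).
have e x : x = (h + h) * x by rewrite h1 mul1r.
by rewrite [LHS]e; ring.
Qed.

End LeviCivitaUnique.

Section Pullback.
Variables (S S' : comPzRingType) (n : nat).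
Variables (d : 'I_n -> S -> S) (d' : 'I_n -> S' -> S').
Variables (tau : {rmorphism S' -> S}) (J Ji : 'M[S]_n).
Hypothesis half : exists h : S, h + h = 1.
Hypothesis chain : forall a x, d a (tau x) = \sum_c J a c * tau (d' c x).
Hypothesis closed : forall a b c, d a (J b c) = d b (J a c).
Hypothesis JJi : J *m Ji = 1%:M.
Variables (G Gi : 'M[S]_n) (Gam : 'I_n -> 'M[S]_n).
Variables (G' Gi' : 'M[S']_n) (Gam' : 'I_n -> 'M[S']_n).
Hypothesis lc : levi_civita d G Gi Gam.
Hypothesis lc' : levi_civita d' G' Gi' Gam'.
Hypothesis GJ : G = J *m map_mx tau G' *m J^T.

Let hd := lc_der lc.
Let pull a := \sum_c J a c *: map_mx tau (Gam' c).

Lemma chain_mx a p q (A : 'M[S']_(p, q)) :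
  dmx d a (map_mx tau A) = \sum_c J a c *: map_mx tau (dmx d' c A).
Proof.
apply/matrixP => i j; rewrite !mxE chain summxE; apply: eq_bigr => c _.
by rewrite !mxE.
Qed.

(** The transformation law of Christoffel symbols, without computing them: the right-hand side times
    [Ji] satisfies the axioms of the Levi-Civita connection of [G], which is unique.
    Torsion-freeness comes from [closed]. *)
Lemma gauge a : Gam a *m J = dmx d a J + J *m pull a.
Proof.
have JiJ := mulmx1C JJi.
pose Gt a := (dmx d a J + J *m pull a) *m Ji.
suff lct : levi_civita d G Gi Gt.
  by rewrite (levi_civita_unique half lc lct) /Gt -mulmxA JiJ mulmx1.
split; rewrite ?(lc_sym lc) ?(lc_inv lc) //.
  move=> {}a b; apply/rowP => k; rewrite !mxE; apply: eq_bigr => l _.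
  congr (_ * _); rewrite !addmxE !dmxE closed; congr (_ + _).
  rewrite !mulmxE /pull.
  under eq_bigr do rewrite mxsumE mulr_sumr.
  under [RHS]eq_bigr do rewrite mxsumE mulr_sumr.
  rewrite exchange_big; apply: eq_bigr => i _; apply: eq_bigr => j _.
  by rewrite !scalemxE !mxE (lc_torsionE lc') mulrCA.
move=> {}a; rewrite {1}GJ !(dmxM hd) chain_mx dmxT.
have -> : \sum_c J a c *: map_mx tau (dmx d' c G') =
    pull a *m map_mx tau G' + map_mx tau G' *m (pull a)^T.
  rewrite /pull trmx_bigsum mulmx_suml mulmx_sumr -big_split; apply: eq_bigr => c _ /=.
  rewrite (lc_metric lc') map_mxD !map_mxM -map_trmx trmx_scale -scalemxAl -scalemxAr.
  by rewrite -scalerDr.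
have e1 : Ji *m G = map_mx tau G' *m J^T.
  by rewrite GJ !mulmxA JiJ mul1mx.
have e2 : G *m Ji^T = J *m map_mx tau G'.
  by rewrite GJ -!mulmxA -trmx_mul JiJ trmx1 mulmx1.
rewrite /Gt trmx_mul -(mulmxA _ Ji) e1 (mulmxA G) e2 trmxD trmx_mul.
by mxexpand; mxring.
Qed.

(** Differentiate the gauge law in both directions and subtract: the second derivatives of [J] agree
    by commutation, and the first derivatives of [J] inside [pull] agree by [closed]. *)
Lemma curv_pull a b :
  curv d Gam a b *m J = J *m \sum_c \sum_e (J a c * J b e) *: map_mx tau (curv d' Gam' c e).
Proof.
pose cross a b := \sum_c \sum_e (J a c * J b e) *: map_mx tau (dmx d' c (Gam' e)).
have dpull a0 b0 : dmx d a0 (pull b0) =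
    \sum_c d a0 (J b0 c) *: map_mx tau (Gam' c) + cross a0 b0.
  rewrite /pull (dmx_sum hd) /cross exchange_big -big_split; apply: eq_bigr => c _ /=.
  rewrite (dmxZ hd) chain_mx scaler_sumr; congr (_ + _); apply: eq_bigr => e _.
  by rewrite scalerA mulrC.
have -> : \sum_c \sum_e (J a c * J b e) *: map_mx tau (curv d' Gam' c e) =
    cross a b - cross b a - (pull a *m pull b - pull b *m pull a).
  have pp x y : pull x *m pull y =
      \sum_c \sum_e (J x c * J y e) *: map_mx tau (Gam' c *m Gam' e).
    rewrite /pull mulmx_suml; apply: eq_bigr => c _; rewrite mulmx_sumr.
    by apply: eq_bigr => e _; rewrite -scalemxAl -scalemxAr map_mxM scalerA.
  rewrite !pp /cross [X in _ - X - _]exchange_big [X in _ - (_ - X)]exchange_big.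
  rewrite -!sumrB; apply: eq_bigr => c _; rewrite -!sumrB; apply: eq_bigr => e _.
  by rewrite /curv !map_mxB /= !(mulrC (J b _)) -!scalerBr.
have E := dmxC hd a b J.
have ga := gauge a; have gb := gauge b.
have da := congr1 (dmx d b) ga; have db := congr1 (dmx d a) gb.
move: da db; rewrite !(dmxD hd) !(dmxM hd) !dpull -E => da db.
have sy : \sum_c d b (J a c) *: map_mx tau (Gam' c) = \sum_c d a (J b c) *: map_mx tau (Gam' c).
  by apply: eq_bigr => c _; rewrite closed.
have ea : dmx d a J = Gam a *m J - J *m pull a by rewrite ga addrK.
have eb : dmx d b J = Gam b *m J - J *m pull b by rewrite gb addrK.
rewrite sy in da.
rewrite /curv; mxexpand.
have xa : dmx d b (Gam a) *m J = dmx d a (dmx d b J) +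
    (dmx d b J *m pull a + J *m (\sum_c d a (J b c) *: map_mx tau (Gam' c) + cross b a)) - Gam a *m dmx d b J.
  by rewrite -da addrK.
have xb : dmx d a (Gam b) *m J = dmx d a (dmx d b J) +
    (dmx d a J *m pull b + J *m (\sum_c d a (J b c) *: map_mx tau (Gam' c) + cross a b)) - Gam b *m dmx d a J.
  by rewrite -db addrK.
move: (dmx d a (dmx d b J)) (cross a b) (cross b a) xa xb => DD cab cba -> ->.
rewrite ea eb; move: (pull a) (pull b) (\sum_c _) => pa pb sc.
by mxexpand; mxring.
Qed.

Lemma map_curv_tr c e c' e' :
  \tr (map_mx tau (curv d' Gam' c e) *m map_mx tau (curv d' Gam' c' e')) =
  tau (\tr (curv d' Gam' c e *m curv d' Gam' c' e')).
Proof. by rewrite -map_mxM -trace_map_mx. Qed.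

(** The matrix part of the curvature is conjugated by [J], which traces do not see. Each of the four
    form indices brings a factor [J], and the two inverse metrics absorb them through [GiJ]. *)
Lemma curv_norm_pull : curv_norm d Gi Gam = tau (curv_norm d' Gi' Gam').
Proof.
have JiJ := mulmx1C JJi.
have GiJ : J^T *m Gi *m J = map_mx tau Gi'.
  have h : map_mx tau G' *m (J^T *m Gi *m J) = 1%:M.
    have -> : map_mx tau G' = Ji *m G *m Ji^T.
      by rewrite GJ !mulmxA JiJ mul1mx -mulmxA -trmx_mul JiJ trmx1 mulmx1.
    rewrite !mulmxA -[Ji *m G *m Ji^T *m J^T]mulmxA -trmx_mul JJi trmx1 mulmx1.
    by rewrite -[Ji *m G *m Gi]mulmxA (lc_inv lc) mulmx1.
  have h' := congr1 (map_mx tau) (lc_inv lc'); move: h'; rewrite map_mxM map_mx1 => h'.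
  by rewrite -[LHS]mul1mx -(mulmx1C h') -mulmxA h mulmx1.
have ct (F : 'I_n -> 'I_n -> S) :
    contract Gi (fun b b' => \sum_c J b c * \sum_c' J b' c' * F c c') =
    contract (map_mx tau Gi') F.
  rewrite -GiJ /contract.
  under [RHS]eq_bigr => c _ do under eq_bigr => c' _ do
    rewrite mulmxE mulr_suml.
  under [RHS]eq_bigr do rewrite exchange_big.
  rewrite [RHS]exchange_big [LHS]exchange_big /=; apply: eq_bigr => b' _.
  under [RHS]eq_bigr do under eq_bigr do rewrite mulmxE !mulr_suml.
  under [LHS]eq_bigr do rewrite mulr_sumr.
  rewrite [LHS]exchange_big; apply: eq_bigr => c _ /=.
  rewrite [RHS]exchange_big; apply: eq_bigr => b _ /=.
  by rewrite !mulr_sumr; apply: eq_bigr => c' _; rewrite trmxE; ring.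
have trE b c b' c' : \tr (curv d Gam b c *m curv d Gam b' c') =
    \sum_p J b p * \sum_p' J b' p' * \sum_q J c q * \sum_q' J c' q' *
      tau (\tr (curv d' Gam' p q *m curv d' Gam' p' q')).
  have cE x y : curv d Gam x y =
      J *m (\sum_c \sum_e (J x c * J y e) *: map_mx tau (curv d' Gam' c e)) *m Ji.
    by rewrite -curv_pull -mulmxA JJi mulmx1.
  rewrite (cE b) (cE b') -!mulmxA (mulmxA Ji J) JiJ mul1mx mxtrace_mulC.
  rewrite -!mulmxA JiJ mulmx1.
  rewrite mulmx_suml raddf_sum; apply: eq_bigr => p _ /=.
  rewrite mulmx_sumr raddf_sum mulr_sumr; apply: eq_bigr => p' _ /=.
  rewrite mulmx_suml raddf_sum !mulr_sumr; apply: eq_bigr => q _ /=.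
  rewrite mulmx_sumr raddf_sum !mulr_sumr; apply: eq_bigr => q' _ /=.
  rewrite -scalemxAl -scalemxAr !mxtraceZ map_curv_tr; ring.
have cE (Sx : comPzRingType) (P : 'M[Sx]_n) F F' : (forall b b', F b b' = F' b b') -> contract P F = contract P F'.
  by move=> h; apply: eq_bigr => b _; apply: eq_bigr => b' _; rewrite h.
rewrite /curv_norm rmorphN; congr (- _).
transitivity (contract Gi (fun b b' => \sum_p J b p * \sum_p' J b' p' *
    contract (map_mx tau Gi') (fun q q' => tau (\tr (curv d' Gam' p q *m curv d' Gam' p' q'))))).
  apply: (@cE) => b b'.
  under [RHS]eq_bigr do under eq_bigr do rewrite -ct.
  under [RHS]eq_bigr do rewrite -contract_sum.
  rewrite -contract_sum; apply: (@cE) => c c'; rewrite trE.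
  by [].
rewrite ct /contract rmorph_sum; apply: eq_bigr => b _; rewrite rmorph_sum.
apply: eq_bigr => b' _; rewrite rmorphM mxE; congr (_ * _).
rewrite rmorph_sum; apply: eq_bigr => c _; rewrite rmorph_sum.
by apply: eq_bigr => c' _; rewrite rmorphM mxE.
Qed.

End Pullback.

(** * Bochner's formula and its static version *)

Section Bochner.
Variables (S : comPzRingType) (n : nat) (d : 'I_n -> S -> S).
Variables (G Gi : 'M[S]_n) (Gam : 'I_n -> 'M[S]_n).
Hypothesis lc : levi_civita d G Gi Gam.

Let hd := lc_der lc.
Local Notation Om := (curv d Gam).

Definition hess (f : S) : 'M[S]_n :=
  \matrix_(a, b) (d a (d b f) - (Gam a *m grad_col d f) b 0).

Definition laplace f := \tr (Gi *m hess f).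

Definition grad_vec f : 'cV[S]_n := Gi *m grad_col d f.

Definition sqgrad f : S := ((grad_col d f)^T *m Gi *m grad_col d f) 0 0.

Definition ricci_mx : 'M[S]_n := \matrix_(j, k) \sum_i Om i j k i.

Lemma hessT f : (hess f)^T = hess f.
Proof.
apply/matrixP => a b; rewrite !mxE (der_comm hd); congr (_ - _).
by apply: eq_bigr => c _; rewrite (lc_torsionE lc).
Qed.

Lemma dmx_grad_col f a : dmx d a (grad_col d f) = (row a (hess f))^T + Gam a *m grad_col d f.
Proof. by apply/matrixP => b j; rewrite (ord1 j); entries; rewrite !mxE subrK. Qed.

Lemma dmx_grad_vec f a :
  dmx d a (grad_vec f) = Gi *m (row a (hess f))^T - (Gam a)^T *m grad_vec f.
Proof.
rewrite /grad_vec (dmxM hd) dmx_grad_col (dmx_metric_inv lc).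
by move: (grad_col d f) => w; mxexpand; rewrite opprD; mxexpand; mxring.
Qed.

Lemma grad_colD f g : grad_col d (f + g) = grad_col d f + grad_col d g.
Proof. by apply/matrixP => b j; rewrite !mxE (der_add hd). Qed.

Lemma grad_colM f g : grad_col d (f * g) = g *: grad_col d f + f *: grad_col d g.
Proof. by apply/matrixP => b j; rewrite !mxE (der_mul hd); ring. Qed.

Lemma hessD f g : hess (f + g) = hess f + hess g.
Proof.
apply/matrixP => a b; entries; rewrite [LHS]mxE [hess f a b]mxE [hess g a b]mxE.
by rewrite grad_colD mulmxDr !(der_add hd); entries; ring.
Qed.

Lemma hess_sq f : hess (f * f) =
  (2%:R * f) *: hess f + 2%:R *: (grad_col d f *m (grad_col d f)^T).
Proof.
apply/matrixP => a b; entries; rewrite [LHS]mxE [hess f a b]mxE.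
have -> : (grad_col d f *m (grad_col d f)^T) a b = d a f * d b f.
  by rewrite mulmxE big_ord1 !mxE.
rewrite grad_colM mulmxDr -scalemxAr; entries.
rewrite !(der_mul hd) !(der_add hd) !(der_mul hd); fungen; ring.
Qed.

Lemma tr_outer (c : 'cV[S]_n) (w : 'rV[S]_n) : \tr (c *m w) = (w *m c) 0 0.
Proof. by rewrite mxtrace_mulC [LHS]big_ord1. Qed.

Lemma laplaceD f g : laplace (f + g) = laplace f + laplace g.
Proof. by rewrite /laplace hessD mulmxDr mxtraceD. Qed.

Lemma laplace_sq f : laplace (f * f) = 2%:R * f * laplace f + 2%:R * sqgrad f.
Proof.
rewrite /laplace hess_sq mulmxDr mxtraceD -!scalemxAr !mxtraceZ.
by rewrite mulmxA tr_outer /sqgrad mulmxA.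
Qed.

Lemma grad_col_sqgrad f : grad_col d (sqgrad f) = 2%:R *: (hess f *m grad_vec f).
Proof.
apply/matrixP => a j; rewrite (ord1 j) [LHS]mxE scalemxE.
have -> : (hess f *m grad_vec f) a 0 = (row a (hess f) *m grad_vec f) 0 0.
  by rewrite -row_mul [RHS]mxE.
rewrite /sqgrad -dmxE !(dmxM hd) dmxT dmx_grad_col (dmx_metric_inv lc) /grad_vec.
set w := grad_col d f; set h := row a (hess f).
have e : (w^T *m Gi *m h^T) 0 0 = (h *m Gi *m w) 0 0.
  by rewrite -[RHS]trmxE !trmx_mul (lc_invT lc) mulmxA.
rewrite trmxD trmxK trmx_mul; mxexpand; rewrite opprD; mxexpand; entries; rewrite e.
by mxgen; fungen; ring.
Qed.

(** Bochner's formula. Second derivatives of the squared gradient involve third derivatives of [f]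
    in the wrong order for a trace; reordering them creates curvature, which the trace turns into
    Ricci. *)
Lemma laplace_sqgrad f : laplace (sqgrad f) = 2%:R *
  ((\sum_c grad_vec f c 0 * d c (laplace f))
   + ((grad_vec f)^T *m ricci_mx *m grad_vec f) 0 0
   + \tr ((Gi *m hess f) *m (Gi *m hess f))).
Proof.
set v := grad_vec f; set H := hess f.
pose DH a := dmx d a H - Gam a *m H - H *m (Gam a)^T.
have hs a b : hess (sqgrad f) a b = 2%:R * ((DH a *m v) b 0 + (H *m Gi *m H) b a).
  have -> : hess (sqgrad f) a b =
      (dmx d a (grad_col d (sqgrad f)) - Gam a *m grad_col d (sqgrad f)) b 0.
    by rewrite addmxE oppmxE dmxE !mxE.
  rewrite grad_col_sqgrad (dmxZ hd) (der_nat hd) scale0r add0r -scalemxAr -scalerBr.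
  rewrite scalemxE (dmxM hd) dmx_grad_vec -/v -/H; congr (_ * _).
  have -> : (H *m Gi *m H) b a = (H *m (Gi *m (row a H)^T)) b 0.
    by rewrite tr_row hessT colE !mulmxA mul_deltaE.
  rewrite /DH; mxexpand; entries; mxgen; fungen; ring.
(* The Ricci identity: the covariant derivative [DH] of the Hessian is symmetric up to the curvature
   applied to the gradient. *)
have cod a b c : DH a b c = DH c b a - (Om a c *m grad_col d f) b 0.
  have W x y : H y x = (dmx d x (grad_col d f) - Gam x *m grad_col d f) y 0.
    by rewrite -[H]hessT trmxE /H mxE; entries; rewrite !mxE.
  have dW x y z : DH x y z =
      (dmx d x (dmx d z (grad_col d f) - Gam z *m grad_col d f)
       - Gam x *m (dmx d z (grad_col d f) - Gam z *m grad_col d f)) y 0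
      - (H *m (Gam x)^T) y z.
    rewrite /DH; entries; congr (_ - _ - _); first by rewrite !dmxE W.
    by rewrite !mulmxE; apply: eq_bigr => k _; rewrite W.
  rewrite !dW.
  have -> : (H *m (Gam a)^T) b c = (H *m (Gam c)^T) b a.
    rewrite !mulmxE; apply: eq_bigr => k _.
    by rewrite !trmxE (lc_torsionE lc).
  rewrite !(dmxB hd) !(dmxM hd) (dmxC hd a c) /curv; mxexpand.
  by entries; mxgen; fungen; ring.
have trDH c : \tr (Gi *m DH c) = d c (laplace f).
  rewrite /laplace (der_tr hd) (dmxM hd) (dmx_metric_inv lc) -/H /DH.
  have trB (A B : 'M[S]_n) : \tr (A - B) = \tr A - \tr B by rewrite raddfB.
  have trN (A : 'M[S]_n) : \tr (- A) = - \tr A by rewrite raddfN.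
  mxexpand; rewrite opprD; mxexpand; rewrite !(mxtraceD, trN).
  rewrite [\tr ((Gam c)^T *m Gi *m H)]mxtrace_mulC mulmxA.
  have -> : \tr (H *m (Gam c)^T *m Gi) = \tr (Gi *m H *m (Gam c)^T).
    by rewrite mxtrace_mulC mulmxA.
  by mxgen; ring.
have step : \sum_a (Gi *m (\matrix_(b, c) (DH b *m v) c 0)) a a =
    (\sum_c v c 0 * d c (laplace f)) + (v^T *m ricci_mx *m v) 0 0.
  transitivity (\sum_c v c 0 * (\tr (Gi *m DH c)
      - \sum_b (Gi *m (Om b c *m grad_col d f)) b 0)).
    under eq_bigr do rewrite mulmxE.
    rewrite exchange_big.
    transitivity (\sum_b \sum_a \sum_c v c 0 * (Gi b a * DH c a b - Gi b a * (Om b c *m grad_col d f) a 0)).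
      apply: eq_bigr => b _; apply: eq_bigr => a _.
      rewrite mxE mulmxE mulr_sumr; apply: eq_bigr => c _.
      have gs : Gi a b = Gi b a by rewrite -[in LHS](lc_invT lc) trmxE.
      rewrite (cod b a c) gs.
      by move: (DH c a b) ((Om b c *m _) a 0) (v c 0) (Gi b a) => *; ring.
    under eq_bigr do rewrite exchange_big.
    rewrite exchange_big; apply: eq_bigr => c _ /=.
    under eq_bigr do rewrite -mulr_sumr.
    rewrite -mulr_sumr; congr (_ * _).
    rewrite /mxtrace -sumrB; apply: eq_bigr => b _.
    by rewrite !mulmxE -sumrB; apply: eq_bigr.
  under eq_bigr do rewrite trDH mulrBr.
  rewrite sumrB; congr (_ + _).
  have e b c : Gi *m (Om b c *m grad_col d f) = - ((Om b c)^T *m v).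
    have -> : grad_col d f = G *m v by rewrite /v /grad_vec mulmxA (lc_inv lc) mul1mx.
    rewrite (mulmxA (Om b c)) (curv_antisym lc) mulNmx mulmxN !mulmxA.
    by rewrite (lc_invl lc) mul1mx.
  under eq_bigr do under eq_bigr do rewrite e oppmxE.
  rewrite -sumrN -mulmxA mulmxE; apply: eq_bigr => c _.
  rewrite trmxE sumrN mulrN opprK; congr (_ * _).
  under eq_bigr do rewrite mulmxE.
  rewrite exchange_big mulmxE; apply: eq_bigr => k _.
  by rewrite [ricci_mx c k]mxE mulr_suml; apply: eq_bigr => i _; rewrite trmxE.
rewrite -step -mulmxA -[Gi *m (H *m _)]/(Gi *m _) /laplace.
have -> : hess (sqgrad f) = 2%:R *: ((\matrix_(b, c) (DH b *m v) c 0) + H *m Gi *m H).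
  apply/matrixP => a b; rewrite hs scalemxE addmxE; congr (_ * (_ + _)); first by rewrite [RHS]mxE.
  by rewrite -[RHS]trmxE !trmx_mul (lc_invT lc) hessT mulmxA.
by rewrite -scalemxAr mxtraceZ mulmxDr mxtraceD !mulmxA.
Qed.

(** Multiplication by [u] lets the static equation replace the Ricci term; the term <Du, D^2u Du>
    this creates is exactly the one that the drift removes. The summand [u * u] of [w] completes the
    square in the Hessian. *)
Lemma static_bochner u :
  u *: ricci_mx = hess u + (n%:R * u) *: G -> laplace u = - n%:R * u ->
  let w := sqgrad u + u * u in
  let B := Gi *m (hess u + u *: G) in
  u * laplace w - \sum_a grad_vec u a 0 * d a w = 2%:R * u * \tr (B *m B).
Proof.
move=> hR hL w B.
set v := grad_vec u.
have q (A : 'M[S]_n) : (v^T *m A *m v) 0 0 = \sum_a v a 0 * (A *m v) a 0.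
  by rewrite -mulmxA mulmxE; apply: eq_bigr => a _; rewrite trmxE.
have Gv : G *m v = grad_col d u by rewrite /v /grad_vec mulmxA (lc_inv lc) mul1mx.
have sg : (v^T *m G *m v) 0 0 = sqgrad u.
  by rewrite /sqgrad -mulmxA Gv /v /grad_vec trmx_mul (lc_invT lc).
have e1 : \sum_c v c 0 * d c (laplace u) = - n%:R * sqgrad u.
  rewrite -sg q Gv hL mulr_sumr; apply: eq_bigr => c _.
  by rewrite mulNr (derN hd) (der_mul hd) (der_nat hd) grad_colE; ring.
have e2 : u * (v^T *m ricci_mx *m v) 0 0 = (v^T *m hess u *m v) 0 0 + n%:R * u * sqgrad u.
  by rewrite -scalemxE scalemxAl scalemxAr hR mulmxDr mulmxDl addmxE -scalemxAr -scalemxAl scalemxE sg.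
have e3 : \sum_a v a 0 * d a w = 2%:R * (v^T *m hess u *m v) 0 0 + 2%:R * u * sqgrad u.
  rewrite -sg !q !mulr_sumr -big_split; apply: eq_bigr => a _ /=.
  have -> : d a w = (grad_col d w) a 0 by rewrite mxE.
  rewrite /w grad_colD grad_col_sqgrad grad_colM Gv; entries; ring.
have e4 : \tr (B *m B) = \tr ((Gi *m hess u) *m (Gi *m hess u)) - n%:R * u * u.
  have -> : B = Gi *m hess u + u%:M.
    by rewrite /B mulmxDr -scalemxAr (lc_invl lc) scalemx1.
  rewrite mulmxDr !mulmxDl !mxtraceD mul_scalar_mx mul_mx_scalar mul_scalar_mx.
  rewrite mxtraceZ -[\tr (Gi *m hess u)]/(laplace u) hL scale_scalar_mx mxtrace_scalar.
  by rewrite -mulr_natl; ring.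
rewrite e3 e4 /w laplaceD laplace_sqgrad -/v e1 laplace_sq hL.
move: e2; move: (\tr _) ((v^T *m ricci_mx *m v) 0 0) ((v^T *m hess u *m v) 0 0) (sqgrad u) => t r h s e2.
have -> : u * (2%:R * (- n%:R * s + r + t) + (2%:R * u * (- n%:R * u) + 2%:R * s)) =
  2%:R * (u * (- n%:R * s + t) + u * r) + u * (2%:R * u * (- n%:R * u) + 2%:R * s) by ring.
by rewrite e2; ring.
Qed.

End Bochner.

(** * The conformal metric (1 + u)^-2 G *)

Section Conformal.
Variables (S : comPzRingType) (n : nat) (d : 'I_n -> S -> S).
Variables (G Gi : 'M[S]_n) (Gam : 'I_n -> 'M[S]_n).
Hypothesis lc : levi_civita d G Gi Gam.
(* [psi] is the inverse of the conformal factor [1 + u]. *)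
Variables (u psi : S).
Hypothesis psiE : psi * (1 + u) = 1.

Let hd := lc_der lc.
Let du := grad_col d u.
Let v := grad_vec d Gi u.

Definition conf_metric := psi ^+ 2 *: G.
Definition conf_inv := (1 + u) ^+ 2 *: Gi.
(** The standard formula for the metric e^(2 phi) G, with phi = - log (1 + u) and hence d phi = -
    psi du. *)
Definition conf_gam a := Gam a -
  psi *: (du *m (delta_mx a 0 : 'cV_n)^T + (d a u)%:M - G *m delta_mx a 0 *m v^T).

Let Gv : G *m v = du.
Proof. by rewrite /v /grad_vec mulmxA (lc_inv lc) mul1mx. Qed.

Let vG : v^T *m G = du^T.
Proof. by have := congr1 trmx Gv; rewrite trmx_mul (lc_sym lc). Qed.

Lemma der_psi a : d a psi = - (psi ^+ 2 * d a u).
Proof.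
have := congr1 (d a) psiE; rewrite (der_mul hd) (der_add hd) (der1 hd) add0r => /(congr1 (fun x => x * psi)).
rewrite mul0r mulrDl -mulrA [(1 + u) * psi]mulrC psiE mulr1 => /eqP.
rewrite addr_eq0 => /eqP ->; ring.
Qed.

Lemma conf_gamE a b c : conf_gam a b c = Gam a b c -
  psi * (d b u * (c == a)%:R + d a u * (b == c)%:R - G b a * v c 0).
Proof.
rewrite /conf_gam; entries; congr (_ - _ * (_ + _ - _)).
- by rewrite mulmxE big_ord1 /du grad_colE trmxE mxE eqxx andbT.
- by rewrite mxE mulr_natr.
- by rewrite mulmxE big_ord1 trmxE mul_deltaE.
Qed.

Lemma conf_levi_civita : levi_civita d conf_metric conf_inv conf_gam.
Proof.
split=> // [|| a b | a].
- by rewrite /conf_metric trmx_scale (lc_sym lc).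
- rewrite /conf_metric /conf_inv -scalemxAl -scalemxAr scalerA (lc_inv lc) -exprMn.
  by rewrite psiE expr1n scale1r.
- have GS i j : G i j = G j i by rewrite -[in LHS](lc_sym lc) trmxE.
  apply/rowP => c; rewrite mxE [RHS]mxE !conf_gamE (lc_torsionE lc) (GS a b).
  by rewrite (eq_sym a c) (eq_sym b c); ring.
- rewrite /conf_metric (dmxZ hd) (lc_metric lc) -scalemxAl -scalemxAr -scalerDr.
  have -> : d a (psi ^+ 2) = - (2%:R * psi ^+ 3 * d a u).
    by rewrite expr2 (der_mul hd) der_psi; ring.
  set e := delta_mx a 0 : 'cV[S]_n.
  pose A := du *m e^T + (d a u)%:M - G *m e *m v^T.
  have AG : A *m G + G *m A^T = (2%:R * d a u) *: G.
    have -> : G *m A^T = (A *m G)^T by rewrite trmx_mul (lc_sym lc).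
    rewrite /A !mulmxBl !mulmxDl -[G *m e *m _ *m _]mulmxA vG mul_scalar_mx.
    rewrite trmxB trmxD trmx_scale (lc_sym lc) !trmx_mul !trmxK (lc_sym lc).
    by rewrite !mulmxA; mxring.
  have -> : conf_gam a *m G + G *m (conf_gam a)^T = Gam a *m G + G *m (Gam a)^T - psi *: (A *m G + G *m A^T).
    rewrite /conf_gam -/e -/A trmxB trmx_scale; generalize A => A'.
    rewrite mulmxBl mulmxBr -scalemxAl -scalemxAr scalerDr.
    by mxring.
  rewrite AG scalerBr !scalerA addrC -scaleNr; congr (_ + _).
  by congr (_ *: _); ring.
Qed.

Hypothesis hessu : hess d Gam u = - u *: G.
Hypothesis normu : sqgrad d Gi u = 1 - u ^+ 2.

(** Obata's equation contributes u times the basis vector and the conformal correction contributes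
    psi (1 - u^2) = 1 - u times it. That the sum is 1 is what singles out this conformal factor. *)
Lemma conf_homothetic a : dmx d a (- v) + (conf_gam a)^T *m (- v) = delta_mx a 0.
Proof.
set e := delta_mx a 0 : 'cV[S]_n.
have ev : (e^T *m du) = (d a u)%:M.
  by apply/matrixP => i j; rewrite !ord1 mul_tr_deltaE /du grad_colE mxE eqxx mulr1n.
have vdu : du^T *m v = (1 - u ^+ 2)%:M.
  apply/matrixP => i j; rewrite !ord1 -normu /sqgrad /v /grad_vec mulmxA.
  by rewrite [RHS]mxE eqxx mulr1n.
have rowu : (row a (hess d Gam u))^T = - u *: (G *m e).
  by rewrite tr_row (hessT lc) hessu colE -scalemxAl.
have ->: dmx d a (- v) = u *: e + (Gam a)^T *m v.
  rewrite (dmxN hd) (dmx_grad_vec lc) rowu -scalemxAr mulmxA (lc_invl lc) mul1mx.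
  by rewrite scaleNr -/v; mxring.
have -> : (conf_gam a)^T *m (- v) = - ((Gam a)^T *m v) +
    psi *: (e *m (du^T *m v) + d a u *: v - v *m ((G *m e)^T *m v)).
  rewrite /conf_gam -/e trmxB trmx_scale trmxB trmxD !trmx_mul !trmxK tr_scalar_mx.
  rewrite mulmxN mulmxBl -scalemxAl mulmxBl mulmxDl mul_scalar_mx -!mulmxA.
  by mxring.
have -> : (G *m e)^T *m v = (d a u)%:M.
  by rewrite trmx_mul (lc_sym lc) -mulmxA Gv ev.
rewrite vdu !mul_mx_scalar addrK scalerA addrA addrK -scalerDl.
have -> : u + psi * (1 - u ^+ 2) = u + psi * (1 + u) * (1 - u) by ring.
by rewrite psiE mul1r addrC subrK scale1r.
Qed.

Lemma conf_norm : ((- v)^T *m conf_metric *m (- v)) 0 0 = psi ^+ 2 * (1 - u ^+ 2).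
Proof.
rewrite /conf_metric -scalemxAr -scalemxAl scalemxE -normu; congr (_ * _).
rewrite mulmxN trmxN mulNmx mulNmx opprK vG /sqgrad /v /grad_vec mulmxA //.
Qed.

Lemma deriv_along_potential : deriv_along d (- v) u = - (1 - u ^+ 2).
Proof.
rewrite -normu /deriv_along /sqgrad -mulmxA mulmxE -sumrN; apply: eq_bigr => a _.
by rewrite oppmxE trmxE grad_colE /v /grad_vec; ring.
Qed.

End Conformal.

(** * Parallel coframes and affine coordinates *)

Section ParallelFrame.
Variables (S : comPzRingType) (n : nat) (d : 'I_n -> S -> S).
Variables (G Gi : 'M[S]_n) (Gam : 'I_n -> 'M[S]_n).
Hypothesis lc : levi_civita d G Gi Gam.

Let hd := lc_der lc.

(** The columns of [J] are parallel covector fields, so their inner products are constant. *)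
Lemma parallel_gram (J : 'M[S]_n) : (forall a, dmx d a J = Gam a *m J) ->
  forall a, dmx d a (J^T *m Gi *m J) = 0.
Proof.
move=> hJ a; rewrite !(dmxM hd) dmxT hJ (dmx_metric_inv lc) trmx_mul.
by mxexpand; rewrite opprD; mxexpand; mxring.
Qed.

(** The pairings of a homothetic field with parallel covectors have these covectors as
    differentials: they are affine coordinates, with the field as position vector. *)
Lemma parallel_coord (J : 'M[S]_n) (X : 'cV[S]_n) :
  (forall a, dmx d a J = Gam a *m J) ->
  (forall a, dmx d a X + (Gam a)^T *m X = delta_mx a 0) ->
  forall a, dmx d a (J^T *m X) = (row a J)^T.
Proof.
move=> hJ hX a; rewrite (dmxM hd) dmxT hJ trmx_mul (dmx_homothetic hX).
rewrite mulmxBr mulmxA addrC subrK; apply/matrixP => i j.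
by rewrite (ord1 j) mul_deltaE !mxE.
Qed.

Hypothesis half : exists h : S, h + h = 1.

(** If closed forms are orthonormal they are parallel: [dmx d a J *m Ji] satisfies the Levi-Civita
    axioms for [J *m J^T], the torsion axiom being closedness. *)
Lemma isometric_parallel (J Ji : 'M[S]_n) : J *m Ji = 1%:M -> J *m J^T = G ->
  (forall a b c, d a (J b c) = d b (J a c)) -> forall a, dmx d a J = Gam a *m J.
Proof.
move=> JJi JJT closed a.
have JiJ := mulmx1C JJi.
suff lct : levi_civita d G Gi (fun a => dmx d a J *m Ji).
  by rewrite (levi_civita_unique half lc lct) -mulmxA JiJ mulmx1.
split; rewrite ?(lc_sym lc) ?(lc_inv lc) //.
  move=> {}a b; apply/rowP => k; rewrite !mxE; apply: eq_bigr => l _.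
  by rewrite !dmxE closed.
move=> {}a; rewrite -{1}JJT (dmxM hd) dmxT; congr (_ + _).
  by rewrite -JJT -!mulmxA [Ji *m _]mulmxA JiJ mul1mx.
by rewrite trmx_mul -JJT !mulmxA -[J *m J^T *m _]mulmxA -trmx_mul JiJ trmx1 mulmx1.
Qed.

Lemma parallel_quotient (J Ji J' : 'M[S]_n) : J *m Ji = 1%:M ->
  (forall a, dmx d a J = Gam a *m J) -> (forall a, dmx d a J' = Gam a *m J') ->
  forall a, dmx d a (Ji *m J') = 0.
Proof.
move=> JJi hJ hJ' a; rewrite (dmxM hd) (dmx_inv hd a JJi) hJ hJ'.
rewrite -!mulmxA JJi mulmx1 mulNmx -!mulmxA; exact: addNr.
Qed.

End ParallelFrame.

(** * Functions of class C^k *)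

Section RealContinuity.
Variables (R : realType) (T : topologicalType).
Implicit Types (F H : T -> R).
Lemma contD x F H : {for x, continuous F} -> {for x, continuous H} -> {for x, continuous (fun y => F y + H y)}.
Proof. move=> cF cH; exact: (cvgD cF cH). Qed.
Lemma contM x F H : {for x, continuous F} -> {for x, continuous H} -> {for x, continuous (fun y => F y * H y)}.
Proof. move=> cF cH; exact: (cvgM cF cH). Qed.
Lemma contV x F : F x != 0 -> {for x, continuous F} -> {for x, continuous (fun y => (F y)^-1)}.
Proof. move=> F0 cF; exact: (cvgV F0 cF). Qed.
Lemma cont_near x F H : (\forall y \near x, F y = H y) -> {for x, continuous F} -> {for x, continuous H}.
Proof.
move=> e cF; have ex := nbhs_singleton e.
rewrite /prop_for /continuous_at -ex.
by apply: cvg_trans cF; apply: near_eq_cvg.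
Qed.
End RealContinuity.

Section Calculus.
Variables (R : realType).

Definition evec n (i : 'I_n) : 'rV[R]_n := delta_mx 0 i.

Definition Cinf_on n (U : set 'rV[R]_n) (F : 'rV[R]_n -> R) := forall k, Ck_on k U F.

Section Ck.
Variables (n : nat).
Implicit Types (U : set 'rV[R]_n) (F H : 'rV[R]_n -> R).

Lemma Ck_on_sub k U U' F : U' `<=` U -> Ck_on k U F -> Ck_on k U' F.
Proof.
move=> sU; elim: k F => [|k IH] F [cF dF]; split=> //; try by move=> x /sU/cF.
by move=> i; have [d c] := dF i; split=> [x /sU/d|]; last exact: IH.
Qed.

Lemma Ck_on_cont k U F : Ck_on k U F -> forall x, U x -> {for x, continuous F}.
Proof. by case: k => [|k] []. Qed.

Lemma Ck_on_derivable k U F : Ck_on k.+1 U F ->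
  forall i x, U x -> derivable F x (evec i).
Proof. by move=> [_ h] i x; have [d _] := h i; exact: d. Qed.

Lemma Ck_on_derive k U F : Ck_on k.+1 U F -> forall i, Ck_on k U ('D_(evec i) F).
Proof. by move=> [_ h] i; have [] := h i. Qed.

Lemma Ck_on_pred k U F : Ck_on k.+1 U F -> Ck_on k U F.
Proof.
elim: k F => [|k IH] F [cF dF]; split=> //.
by move=> i; have [d c] := dF i; split=> //; exact: IH.
Qed.

Lemma open_near U (P : 'rV[R]_n -> Prop) : open U -> (forall x, U x -> P x) ->
  forall x, U x -> \forall y \near x, P y.
Proof. by move=> oU h x Ux; have := open_nbhs_nbhs (conj oU Ux); apply: filterS. Qed.

Lemma eq_on_derive U F H v : open U -> (forall x, U x -> F x = H x) ->
  forall x, U x -> 'D_v F x = 'D_v H x.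
Proof. by move=> oU e x Ux; apply: near_eq_derive; exact: (open_near oU e). Qed.

Lemma Ck_on_eq k U F H : open U -> (forall x, U x -> F x = H x) ->
  Ck_on k U F -> Ck_on k U H.
Proof.
move=> oU; elim: k F H => [|k IH] F H e [cF dF].
  by split=> // x Ux; apply: cont_near (cF x Ux); exact: (open_near oU e).
split.
  by move=> x Ux; apply: cont_near (cF x Ux); exact: (open_near oU e).
move=> i; have [d c] := dF i; split.
  by move=> x Ux; apply: near_eq_derivable (d x Ux); exact: (open_near oU e).
by apply: IH c => x Ux; apply: (eq_on_derive _ oU e).
Qed.

Lemma Ck_on_cst k U c : Ck_on k U (cst c).
Proof.
have cc (a : R) : forall x : 'rV[R]_n, U x -> {for x, continuous (cst a)}.
  by move=> x _; exact: cst_continuous.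
elim: k c => [|k IH] c; split; try exact: cc; first by [].
move=> i; split; first by move=> x _; exact: derivable_cst.
suff -> : 'D_(delta_mx 0 i) (cst c) = cst 0 :> ('rV[R]_n -> R) by exact: IH.
by apply/funext => x; rewrite derive_cst.
Qed.

Lemma Ck_on_intro k U F (D : 'I_n -> 'rV[R]_n -> R) : open U ->
  (forall x, U x -> {for x, continuous F}) ->
  (forall i x, U x -> is_derive x (evec i) F (D i x)) ->
  (forall i, Ck_on k U (D i)) -> Ck_on k.+1 U F.
Proof.
move=> oU cF dF cD; split=> // i; split=> [x Ux|].
  by have [] := dF i x Ux.
by apply: Ck_on_eq (cD i) => // x Ux; have [_ ->] := dF i x Ux.
Qed.

Lemma Ck_on_is_derive k U F : Ck_on k.+1 U F ->
  forall i x, U x -> is_derive x (evec i) F ('D_(evec i) F x).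
Proof. by move=> h i x Ux; apply: derivableP; exact: Ck_on_derivable h i x Ux. Qed.

Lemma Ck_on_add k U F H : open U -> Ck_on k U F -> Ck_on k U H ->
  Ck_on k U (fun x => F x + H x).
Proof.
move=> oU; elim: k F H => [|k IH] F H cF cH.
  split=> // x Ux; apply: contD; [exact: (Ck_on_cont cF)|exact: (Ck_on_cont cH)].
apply: (Ck_on_intro (D := fun i x => 'D_(evec i) F x + 'D_(evec i) H x)) => //.
- move=> x Ux; apply: contD; [exact: (Ck_on_cont cF)|exact: (Ck_on_cont cH)].
- move=> i x Ux; have dF := Ck_on_is_derive cF i Ux; have dH := Ck_on_is_derive cH i Ux.
  exact: is_deriveD.
- by move=> i; apply: IH; exact: Ck_on_derive.
Qed.

Lemma Ck_on_mul k U F H : open U -> Ck_on k U F -> Ck_on k U H ->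
  Ck_on k U (fun x => F x * H x).
Proof.
move=> oU; elim: k F H => [|k IH] F H cF cH.
  split=> // x Ux; apply: contM; [exact: (Ck_on_cont cF)|exact: (Ck_on_cont cH)].
apply: (Ck_on_intro (D := fun i x => F x * 'D_(evec i) H x + H x * 'D_(evec i) F x)) => //.
- move=> x Ux; apply: contM; [exact: (Ck_on_cont cF)|exact: (Ck_on_cont cH)].
- move=> i x Ux; have dF := Ck_on_is_derive cF i Ux; have dH := Ck_on_is_derive cH i Ux.
  exact: is_deriveM.
- move=> i; apply: Ck_on_add => //; apply: IH; try exact: Ck_on_derive;
    exact: Ck_on_pred.
Qed.

Lemma Ck_on_scale k U c F : open U -> Ck_on k U F -> Ck_on k U (fun x => c * F x).
Proof. by move=> oU cF; apply: Ck_on_mul => //; exact: Ck_on_cst. Qed.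

Lemma Ck_on_opp k U F : open U -> Ck_on k U F -> Ck_on k U (fun x => - F x).
Proof.
move=> oU cF; apply: Ck_on_eq (Ck_on_scale (-1) oU cF) => // x _; exact: mulN1r.
Qed.

Lemma Ck_on_sum k U I (r : seq I) (P : pred I) (F : I -> 'rV[R]_n -> R) : open U ->
  (forall i, P i -> Ck_on k U (F i)) -> Ck_on k U (fun x => \sum_(i <- r | P i) F i x).
Proof.
move=> oU cF; elim: r => [|i r IH].
  by apply: Ck_on_eq (Ck_on_cst k U 0) => // x _; rewrite big_nil.
have [Pi|nPi] := boolP (P i).
  by apply: Ck_on_eq (Ck_on_add oU (cF i Pi) IH) => // x _; rewrite big_cons Pi.
by apply: Ck_on_eq IH => // x _; rewrite big_cons (negbTE nPi).
Qed.

Lemma is_derive_coord x i j :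
  is_derive x (evec i) (fun y : 'rV[R]_n => y 0 j) ((i == j)%:R).
Proof.
have h : is_derive x (evec i) (id : 'rV[R]_n -> 'rV[R]_n) (evec i) by exact: is_derive_id.
have [d e] := h.
have dj := (derivable_mxP _ _ _).1 d 0 j.
split => //; have := derive_mx d; rewrite e => /rowP/(_ j).
by rewrite !mxE eqxx /= eq_sym.
Qed.

Lemma Ck_on_coord k U j : open U -> Ck_on k U (fun y => y 0 j).
Proof.
move=> oU.
have c x : {for x, continuous (fun y : 'rV[R]_n => y 0 j)} by exact: coord_continuous.
case: k => [|k]; first by split.
apply: (Ck_on_intro (D := fun i _ => (i == j)%:R)) => //.
  by move=> i x _; exact: is_derive_coord.
by move=> i; exact: Ck_on_cst.
Qed.

Lemma Ck_on_inv k U F : open U -> (forall x, U x -> F x != 0) -> Ck_on k U F ->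
  Ck_on k U (fun x => (F x)^-1).
Proof.
move=> oU F0; elim: k => [|k IH] cF.
  by split=> // x Ux; apply: contV; [exact: F0|exact: (Ck_on_cont cF)].
have ci := IH (Ck_on_pred cF).
apply: (Ck_on_intro (D := fun i x => - ((F x)^-1 * (F x)^-1 * 'D_(evec i) F x))) => //.
- by move=> x Ux; apply: contV; [exact: F0|exact: (Ck_on_cont cF)].
- move=> i x Ux; have dF := @Ck_on_derivable _ _ _ cF i x Ux.
  split; first exact: derivableV (F0 _ Ux) dF.
  by rewrite (deriveV (F0 _ Ux) dF) -mulNr -expr2 exprVn.
- move=> i; apply: Ck_on_opp => //; apply: Ck_on_mul => //; last exact: Ck_on_derive.
  by apply: Ck_on_mul.
Qed.

Lemma cvg_line (V : normedModType R) (x v : V) : h *: v + x @[h --> (0:R)^'] --> x.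
Proof.
rewrite -[X in _ --> X]add0r -(scale0r v).
by apply: cvgD; [apply: cvgZr_tmp; apply: nbhs_dnbhs|exact: cvg_cst].
Qed.

(** A difference quotient of [S] is that of [F] divided by the sum of the two values of [S]. Thus
    continuity of [S] already gives its derivative, and the formula for it feeds the induction. *)
Lemma Ck_on_root k U F (S : 'rV[R]_n -> R) : open U -> (forall x, U x -> {for x, continuous S}) ->
  (forall x, U x -> S x != 0 /\ S x * S x = F x) -> Ck_on k U F -> Ck_on k U S.
Proof.
move=> oU cS hS; elim: k => [|k IH] cF; first by split.
have ck := IH (Ck_on_pred cF).
apply: (Ck_on_intro (D := fun i x => 'D_(evec i) F x * (S x + S x)^-1)) => //.
  move=> i x Ux; have [S0 SF] := hS x Ux.
  have dF := Ck_on_is_derive cF i Ux.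
  have S20 : S x + S x != 0 by rewrite -mulr2n mulrn_eq0 negb_or.
  have lim : h^-1 *: (S (h *: evec i + x) - S x) @[h --> 0^'] --> 'D_(evec i) F x * (S x + S x)^-1.
    have cSh : S (h *: evec i + x) @[h --> (0:R)^'] --> S x.
      exact: (cvg_comp _ _ (@cvg_line _ x (evec i)) (cS x Ux)).
    have [/cvg_ex[l Fl] Fe] := dF.
    have {}Fe : l = 'D_(evec i) F x by apply/esym/cvg_lim.
    rewrite Fe in Fl.
    have nS : \forall h \near 0^', S (h *: evec i + x) + S x != 0.
      by apply: cvgr_neq0 S20; exact: (cvgD cSh (cvg_cst (S x))).
    have nU : \forall h \near 0^', U (h *: evec i + x).
      by apply: (@cvg_line _ x (evec i)); exact: open_nbhs_nbhs.
    have L : (h^-1 *: ((F \o shift x) (h *: evec i) - F x)) *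
        (S (h *: evec i + x) + S x)^-1 @[h --> (0:R)^'] --> 'D_(evec i) F x * (S x + S x)^-1.
      by apply: cvgM => //; apply: cvgV => //; apply: cvgD => //; exact: cvg_cst.
    apply: cvg_trans L; apply: near_eq_cvg; near=> h.
    have Uh : U (h *: evec i + x) by near: h.
    have nz : S (h *: evec i + x) + S x != 0 by near: h.
    have [_ e1] := hS _ Uh.
    have e2 : F (h *: evec i + x) - F x = (S (h *: evec i + x) - S x) * (S (h *: evec i + x) + S x).
      by rewrite -e1 -SF; ring.
    by rewrite /= e2 /GRing.scale /= -mulrA mulfK.
  split; first by apply/cvg_ex; eexists; exact: lim.
  exact/cvg_lim.
move=> i; apply: Ck_on_mul => //; first exact: Ck_on_derive.
apply: Ck_on_inv => //; last exact: Ck_on_add.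
by move=> x Ux; have [S0 _] := hS x Ux; rewrite -mulr2n mulrn_eq0 negb_or.
Unshelve. all: by end_near. Qed.


Lemma line_derive (V W : normedModType R) (F : V -> W) x v t :
  derivable F (x + t *: v) v ->
  is_derive t 1 (fun s : R => F (x + s *: v)) ('D_v F (x + t *: v)).
Proof.
move=> dF; split.
  move/derivable1P: dF => dF; apply/derivable1P.
  have -> // : (fun h : R => F (x + (h *: (1 : R) + t) *: v)) =
      (fun h : R => F (h *: v + (x + t *: v))).
  by apply/funext => h; rewrite [h *: 1]mulr1 scalerDl addrCA.
rewrite /derive; set g1 := (X in lim (X @ _)); set g2 := (X in _ = lim (X @ _)).
suff -> : g1 = g2 by [].
by apply/funext => h; rewrite /g1 /g2 /= [h *: 1]mulr1 scalerDl addrCA.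
Qed.

Lemma mvt_line (V : normedModType R) (F : V -> R) x v (c : R) :
  (forall t : R, `|t| <= `|c| -> derivable F (x + t *: v) v) ->
  exists2 t : R, `|t| <= `|c| & F (x + c *: v) - F x = c * 'D_v F (x + t *: v).
Proof.
move=> dF.
have dd (t : R) : `|t| <= `|c| ->
  is_derive t 1 (fun s : R => F (x + s *: v)) ('D_v F (x + t *: v)).
  by move=> h; apply: line_derive; exact: dF.
have main a b : a <= b -> (forall t, t \in `[a, b]%R -> `|t| <= `|c|) ->
  exists2 t : R, `|t| <= `|c| & F (x + b *: v) - F (x + a *: v) = (b - a) * 'D_v F (x + t *: v).
  move=> ab hab.
  have [||t] := @MVT_segment R (fun s => F (x + s *: v)) (fun t => 'D_v F (x + t *: v)) a b ab.
  - by move=> t th; apply: dd; apply: hab; move: th; rewrite !in_itv /= => /andP[/ltW -> /ltW ->].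
  - by apply: derivable_within_continuous => t th; have [] := dd t (hab t th).
  by move=> /hab th e; exists t => //; rewrite e mulrC.
have [c0|c0] := leP 0 c.
  have [|t th] := main 0 c c0; last by rewrite scale0r addr0 subr0 => e; exists t.
  by move=> t; rewrite in_itv /= => /andP[t0 tc]; rewrite !ger0_norm.
have [|t th] := main c 0 (ltW c0).
  by move=> t; rewrite in_itv /= => /andP[t0 tc]; rewrite !ler0_norm ?lerN2 // ltW.
by rewrite scale0r addr0 sub0r => e; exists t; rewrite // -opprB e mulNr opprK.
Qed.

End Ck.

(** * Strict differentiability, chain rule, second derivatives *)

Section StrictDerivative.
Variables (n : nat).
Implicit Types (U : set 'rV[R]_n) (F : 'rV[R]_n -> R).

Definition grad F x : 'cV[R]_n := \col_i 'D_(evec i) F x.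

Lemma coord_le_norm (x : 'rV[R]_n) i : `|x 0 i| <= `|x|.
Proof.
rewrite [leRHS]/Num.Def.normr/= mx_normrE.
by apply: (le_trans _ (le_bigmax _ (fun ij : 'I_1 * 'I_n => `|x ij.1 ij.2|) (0, i))).
Qed.

Lemma norm_le_coord (x : 'rV[R]_n) (c : R) : 0 <= c -> (forall i, `|x 0 i| <= c) -> `|x| <= c.
Proof.
move=> c0 h; rewrite [leLHS]/Num.Def.normr/= mx_normrE bigmax_le // => -[i j] _ /=.
by rewrite (ord1 i).
Qed.

Lemma norm_lt_coord (x : 'rV[R]_n) (c : R) : 0 < c -> (forall i, `|x 0 i| < c) -> `|x| < c.
Proof.
move=> c0 h; rewrite [ltLHS]/Num.Def.normr/= mx_normrE bigmax_lt // => -[i j] _ /=.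
by rewrite (ord1 i).
Qed.

Lemma nearS (T : topologicalType) (x : T) (P Q : T -> Prop) :
  (forall y, P y -> Q y) -> (\forall y \near x, P y) -> \forall y \near x, Q y.
Proof. by move=> h; exact: filterS. Qed.

Lemma nearI (T : topologicalType) (x : T) (P Q : T -> Prop) :
  (\forall y \near x, P y) -> (\forall y \near x, Q y) -> \forall y \near x, P y /\ Q y.
Proof. exact: filterI. Qed.

Lemma near_forall (T : topologicalType) (I : finType) (P : I -> T -> Prop) (x : T) :
  (forall i, \forall y \near x, P i y) -> \forall y \near x, forall i, P i y.
Proof. by move=> h; exact: (@filter_forall _ _ _ _ (nbhs_filter x) h). Qed.

(** Passing from [z] to [y] one coordinate at a time makes a difference of values telescope into
    differences along the axes. *)
Definition hybrid (k : nat) (y z : 'rV[R]_n) : 'rV[R]_n :=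
  \row_i if (i < k)%N then y 0 i else z 0 i.

Lemma hybrid0 y z : hybrid 0 y z = z.
Proof. by apply/rowP => i; rewrite mxE. Qed.

Lemma hybridn y z : hybrid n y z = y.
Proof. by apply/rowP => i; rewrite mxE ltn_ord. Qed.

Lemma hybridS (k : 'I_n) y z :
  hybrid k.+1 y z = hybrid k y z + (y - z) 0 k *: evec k.
Proof.
apply/rowP => i; rewrite !mxE ltnS leq_eqVlt eqxx /= (inj_eq val_inj).
have [->|ik] := eqVneq i k; first by rewrite ltnn mulr1 addrC subrK.
by rewrite mulr0 addr0.
Qed.

Lemma hybrid_ball k x y z (r : R) : `|x - y| < r -> `|x - z| < r -> `|x - hybrid k y z| < r.
Proof.
move=> xy xz; have r0 := le_lt_trans (normr_ge0 _) xy.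
apply: norm_lt_coord => // i; rewrite !mxE; case: ifP => _.
  by have := le_lt_trans (coord_le_norm (x - y) i) xy; rewrite !mxE.
by have := le_lt_trans (coord_le_norm (x - z) i) xz; rewrite !mxE.
Qed.

(** The mean value theorem on each coordinate step replaces partial derivatives at intermediate
    points by those at [x], by their continuity. Two moving points are allowed because the inverse
    function theorem needs a contraction. *)
Lemma strict_derivative U F x (e : R) : open U -> Ck_on 1 U F -> U x -> 0 < e ->
  exists2 r : R, 0 < r & forall y z, `|x - y| < r -> `|x - z| < r ->
    `|F y - F z - ((y - z) *m grad F x) 0 0| <= e * `|y - z|.
Proof.
move=> oU cF Ux e0.
(* Each of the [n] coordinate steps may cost [e']; the successor avoids division by zero. *)
pose e' := e / n.+1%:R.
have e'0 : 0 < e' by rewrite divr_gt0.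
have near_x : \forall y \near x, U y /\ forall i, `|'D_(evec i) F x - 'D_(evec i) F y| < e'.
  have nU : nbhs x U by exact: open_nbhs_nbhs.
  have nD : \forall y \near x, forall i, `|'D_(evec i) F x - 'D_(evec i) F y| < e'.
    apply: near_forall => i.
    have cD := Ck_on_cont (Ck_on_derive cF i) Ux.
    by have /cvgrPdist_lt/(_ _ e'0) := cD.
  by near=> y; split; near: y.
have [r /= r0 hr] := (nbhs_ballP _ _).1 near_x.
(* An intermediate point is within r/3 of [x] plus at most the distance of [y] and [z], which is
   below 2r/3. *)
exists (r / 3) => [|y z xy xz]; first by rewrite divr_gt0.
have inb w : `|x - w| < r -> U w /\ forall i, `|'D_(evec i) F x - 'D_(evec i) F w| < e'.
  by move=> h; apply: hr; rewrite mx_norm_ball.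
have -> : F y - F z - ((y - z) *m grad F x) 0 0 = \sum_(k < n)
    (F (hybrid k.+1 y z) - F (hybrid k y z) - (y - z) 0 k * 'D_(evec k) F x).
  rewrite sumrB; congr (_ - _); last first.
    by rewrite mxE; apply: eq_bigr => i _; rewrite !mxE.
  rewrite -(big_mkord xpredT (fun k => F (hybrid k.+1 y z) - F (hybrid k y z))).
  by rewrite telescope_sumr // hybrid0 hybridn.
have term (k : 'I_n) : `|F (hybrid k.+1 y z) - F (hybrid k y z) - (y - z) 0 k * 'D_(evec k) F x|
    <= e' * `|y - z|.
  have hk (t : R) : `|t| <= `|(y - z) 0 k| -> `|x - (hybrid k y z + t *: evec k)| < r.
    move=> ht; rewrite opprD addrA.
    apply: le_lt_trans (ler_normB _ _) _.
    have -> : r = r / 3 + (r / 3 + r / 3) by field.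
    apply: ltrD; first exact: hybrid_ball.
    apply: le_lt_trans (_ : `|y - z| < _).
      rewrite normrZ; apply: le_trans (_ : `|t| * 1 <= _).
        rewrite ler_wpM2l // norm_le_coord // => i; rewrite !mxE /=.
        by case: eqP; rewrite ?normr1 ?normr0.
      by rewrite mulr1 (le_trans ht) // coord_le_norm.
    have -> : y - z = (x - z) - (x - y) by rewrite opprB [RHS]addrC addrA subrK.
    by rewrite (le_lt_trans (ler_normB _ _)) // ltrD.
  rewrite hybridS.
  have [t /hk ht ->] := @mvt_line 'rV[R]_n F (hybrid k y z) (evec k) ((y - z) 0 k)
    (fun t ht => @Ck_on_derivable n 0 U F cF k _ (inb _ (hk t ht)).1).
  rewrite -mulrBr normrM mulrC; apply: ler_pM => //; last exact: coord_le_norm.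
  by rewrite distrC ltW // ((inb _ ht).2 k).
apply: le_trans (ler_norm_sum _ _ _) _.
apply: le_trans (_ : \sum_(k < n) e' * `|y - z| <= _); first exact: ler_sum.
rewrite sumr_const card_ord -mulr_natl mulrA ler_wpM2r //.
by rewrite /e' mulrCA ler_piMr ?(ltW e0) // ler_pdivrMr // mul1r ler_nat leqnSn.
Unshelve. all: by end_near. Qed.

Lemma derivable_cvg (V : normedModType R) (F : V -> R) x v : derivable F x v ->
  h^-1 * (F (h *: v + x) - F x) @[h --> (0:R)^'] --> 'D_v F x.
Proof. exact. Qed.

Lemma cvg_is_derive (V : normedModType R) (F : V -> R) x v (l : R) :
  h^-1 * (F (h *: v + x) - F x) @[h --> (0:R)^'] --> l -> is_derive x v F l.
Proof. by move=> h; split; [apply/cvg_ex; exists l|exact/cvg_lim]. Qed.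

(** The strict derivative of [F] at [T x] is applied to the pair [T (h *: v + x)], [T x]; so [T]
    needs a derivative in the direction [v] only. *)
Lemma chain_rule (V : normedModType R) U F (T : V -> 'rV[R]_n) (x v : V) :
  open U -> Ck_on 1 U F -> U (T x) ->
  (forall b, derivable (fun y => T y 0 b) x v) ->
  is_derive x v (fun y => F (T y))
    (\sum_b 'D_v (fun y => T y 0 b) x * 'D_(evec b) F (T x)).
Proof.
move=> oU cF Ux dT; apply: cvg_is_derive.
set L := \sum_b _.
pose tau h b := h^-1 * (T (h *: v + x) 0 b - T x 0 b).
have ct b : tau h b @[h --> (0:R)^'] --> 'D_v (fun y => T y 0 b) x by exact: derivable_cvg.
have cL : \sum_b tau h b * 'D_(evec b) F (T x) @[h --> (0:R)^'] --> L.
  have -> : (fun h => \sum_b tau h b * 'D_(evec b) F (T x)) =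
      \sum_b (fun h => tau h b * 'D_(evec b) F (T x)).
    by apply/funext => h; rewrite fct_sumE.
  rewrite /L; elim/big_ind2 : _ => [|f l f' l' cf cf'|b _].
  - exact: cvg_cst.
  - exact: cvgD.
  - by apply: cvgM => //; exact: cvg_cst.
apply/cvgrPdist_le => e e0.
(* Bounds the difference quotients [tau h b] for small h, since each of them is within 1 of its
   limit. *)
pose C := 1 + \sum_b `|'D_v (fun y => T y 0 b) x|.
have C0 : 0 < C by rewrite ltr_pwDl // sumr_ge0.
have eC : 0 < e / 2 / C by rewrite !divr_gt0.
have [r r0 hr] := strict_derivative oU cF Ux eC.
have nL : \forall h \near (0:R)^', `|L - \sum_b tau h b * 'D_(evec b) F (T x)| <= e / 2.
  by have /cvgrPdist_le := cL; apply; rewrite divr_gt0.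
have nt : \forall h \near (0:R)^', forall b, `|tau h b| <= C.
  apply: filter_forall => b.
  have /cvgrPdist_le/(_ 1 ltr01) := ct b; apply: filterS => h hh.
  rewrite -[tau h b](subKr ('D_v (fun y => T y 0 b) x)) (le_trans (ler_normB _ _)) //.
  rewrite addrC lerD // (bigD1 b) //= lerDl sumr_ge0 //.
have n0 : \forall h \near (0:R)^', h != 0 by exact: nbhs_dnbhs_neq.
have nr : \forall h \near (0:R)^', `|h| < r / C by apply: dnbhs0_lt; rewrite divr_gt0.
near=> h.
have h0 : h != 0 by near: h.
have hC : forall b, `|tau h b| <= C by near: h.
have T_tau b : T (h *: v + x) 0 b - T x 0 b = h * tau h b by rewrite /tau mulVKf.
have nT : `|T (h *: v + x) - T x| <= `|h| * C.
  apply: norm_le_coord => [|b]; first by rewrite mulr_ge0 // ltW.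
  by rewrite !mxE T_tau normrM ler_wpM2l.
have hrC : `|h| * C < r by rewrite -ltr_pdivlMr //; near: h.
have := hr (T (h *: v + x)) (T x).
rewrite subrr normr0 => /(_ _ r0) H; have {H} := H _.
rewrite distrC (le_lt_trans nT hrC) => /(_ isT) H.
have -> : e = e / 2 + e / 2 by field.
rewrite -[L](subrK (\sum_b tau h b * 'D_(evec b) F (T x))) -addrA.
rewrite (le_trans (ler_normD _ _)) // lerD //; first by near: h.
have -> : \sum_b tau h b * 'D_(evec b) F (T x) =
    h^-1 * ((T (h *: v + x) - T x) *m grad F (T x)) 0 0.
  rewrite mxE mulr_sumr; apply: eq_bigr => b _.
  by rewrite !mxE mulrA.
rewrite -mulrBr normrM normfV ler_pdivrMl ?normr_gt0 // distrC (le_trans H) //.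
rewrite (le_trans (ler_wpM2l _ nT)) //; first by rewrite !divr_ge0 // ltW.
by rewrite mulrCA [e / 2 / C * C]divfK ?gt_eqF.
Unshelve. all: by end_near. Qed.

Lemma dir_derive U F x v : open U -> Ck_on 1 U F -> U x ->
  is_derive x v F (\sum_b v 0 b * 'D_(evec b) F x).
Proof.
move=> oU cF Ux.
have dv : is_derive x v (id : 'rV[R]_n -> 'rV[R]_n) v by exact: is_derive_id.
have [d1 d2] := dv.
have db b : derivable (fun y : 'rV[R]_n => y 0 b) x v by exact: ((derivable_mxP _ _ _).1 d1 0 b).
have e b : 'D_v (fun y : 'rV[R]_n => y 0 b) x = v 0 b.
  by have := derive_mx d1; rewrite d2 => /rowP/(_ b); rewrite !mxE.
have := @chain_rule 'rV[R]_n U F id x v oU cF Ux db.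
by under eq_bigr do rewrite e.
Qed.

End StrictDerivative.

Lemma rV_cont (T : topologicalType) n (f : T -> 'rV[R]_n) x :
  (forall b, {for x, continuous (fun y => f y 0 b)}) -> {for x, continuous f}.
Proof.
move=> h; apply/cvgrPdist_le => e e0.
have : \forall y \near x, forall b, `|f x 0 b - f y 0 b| <= e.
  by apply: near_forall => b; have /cvgrPdist_le := h b; apply.
apply: filterS => y hy; apply: norm_le_coord; first exact: ltW.
by move=> b; rewrite !mxE.
Qed.

Lemma Ck_on_comp n m k (U : set 'rV[R]_n) (V : set 'rV[R]_m) F (T : 'rV[R]_n -> 'rV[R]_m) :
  open U -> open V -> (forall x, U x -> V (T x)) ->
  (forall b, Ck_on k U (fun x => T x 0 b)) -> Ck_on k V F -> Ck_on k U (fun x => F (T x)).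
Proof.
move=> oU oV UV.
have cc j G : (forall b, Ck_on j U (fun x => T x 0 b)) -> Ck_on j V G ->
    forall x, U x -> {for x, continuous (fun x => G (T x))}.
  move=> cT cG x Ux; apply: (@continuous_comp _ _ _ T G).
    by apply: rV_cont => b; exact: (Ck_on_cont (cT b)).
  by apply: (Ck_on_cont cG); exact: UV.
elim: k F => [|k IH] F cT cF; first by split => //; exact: cc.
apply: (Ck_on_intro (D := fun i x => \sum_b 'D_(evec i) (fun y => T y 0 b) x * 'D_(evec b) F (T x))) => //.
- exact: cc.
- move=> i x Ux; apply: (@chain_rule m 'rV[R]_n V) => //; last first.
  + by move=> b; exact: (Ck_on_derivable (cT b)).
  + exact: UV.
  + by elim: (k) cF => // j IHj /Ck_on_pred.
- move=> i; apply: Ck_on_sum => // b _; apply: Ck_on_mul => //.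
    exact: Ck_on_derive.
  exact: (IH _ (fun c => Ck_on_pred (cT c)) (Ck_on_derive cF b)).
Qed.

Lemma Ck_on_le n k j (U : set 'rV[R]_n) F : (j <= k)%N -> Ck_on k U F -> Ck_on j U F.
Proof. by move=> /subnK <-; elim: (k - j)%N => // i IH /Ck_on_pred. Qed.

Lemma Schwarz_mvt n (U : set 'rV[R]_n) F x i j (r h : R) : Ck_on 2 U F ->
  (forall y, `|x - y| < r -> U y) -> 0 < h -> h + h < r ->
  exists2 y, `|x - y| <= h + h &
    F (x + h *: evec i + h *: evec j) - F (x + h *: evec j) - (F (x + h *: evec i) - F x)
    = h * h * 'D_(evec j) ('D_(evec i) F) y.
Proof.
move=> cF hU h0 hr.
have ne k : `|evec k : 'rV[R]_n| <= 1.
  by rewrite norm_le_coord // => l; rewrite !mxE /=; case: eqP; rewrite ?normr1 ?normr0.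
have nb (s t : R) : `|s| <= `|h| -> `|t| <= `|h| -> `|x - (x + s *: evec i + t *: evec j)| <= h + h.
  rewrite (gtr0_norm h0) => hs ht.
  rewrite -addrA opprD addrA subrr sub0r normrN (le_trans (ler_normD _ _)) //.
  by rewrite lerD // normrZ -[h]mulr1 ler_pM.
have inU (s t : R) : `|s| <= `|h| -> `|t| <= `|h| -> U (x + s *: evec i + t *: evec j).
  by move=> hs ht; apply: hU; exact: le_lt_trans (nb s t hs ht) hr.
have z0 : `|0 : R| <= `|h| by rewrite normr0.
pose P y := F (y + h *: evec j) - F y.
have dF y : U y -> derivable F y (evec i) by exact: Ck_on_derivable cF i y.
have dP y : U y -> U (y + h *: evec j) ->
    is_derive y (evec i) P ('D_(evec i) F (y + h *: evec j) - 'D_(evec i) F y).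
  move=> Uy Uyh.
  have d1 : is_derive y (evec i) (fun z => F (z + h *: evec j)) ('D_(evec i) F (y + h *: evec j)).
    have := dF _ Uyh => /derivable_cvg c1; apply: cvg_is_derive.
    by under eq_fun do rewrite -addrA.
  have d2 := derivableP (dF _ Uy).
  exact: is_deriveB.
have [|s hs] := @mvt_line 'rV[R]_n P x (evec i) h.
  move=> s hs; have := inU s 0 hs z0; rewrite scale0r addr0 => U1.
  by have [] := dP _ U1 (inU s h hs (lexx _)).
have U1 := inU s 0 hs z0; rewrite scale0r addr0 in U1.
have [_ ->] := dP _ U1 (inU s h hs (lexx _)).
have [|t ht] := @mvt_line 'rV[R]_n ('D_(evec i) F) (x + s *: evec i) (evec j) h.
  by move=> t ht; exact: (@Ck_on_derivable n 0 U _ (Ck_on_derive cF i) j _ (inU s t hs ht)).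
move=> e1 e2; exists (x + s *: evec i + t *: evec j); first exact: nb.
by rewrite -mulrA -e1 -e2 /P; ring.
Qed.

Lemma norm_eps0 (a : R) : (forall e : R, 0 < e -> `|a| <= e) -> a = 0.
Proof.
move=> h; apply/eqP; rewrite -normr_le0 leNgt; apply/negP => a0.
have := h (`|a| / 2) (divr_gt0 a0 (ltr0Sn _ _)); move: a0; move: `|a| => b; lra.
Qed.

Lemma abs_half_tri (a b c e : R) : `|a - c| <= e / 2 -> `|b - c| <= e / 2 -> `|a - b| <= e.
Proof. by rewrite !ler_norml; lra. Qed.

(** The second difference over a small square is symmetric in the two directions, and by
    [Schwarz_mvt] it is h^2 times either mixed derivative at a nearby point; continuity
    concludes. *)
Lemma Schwarz n (U : set 'rV[R]_n) F x i j : open U -> Ck_on 2 U F -> U x ->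
  'D_(evec i) ('D_(evec j) F) x = 'D_(evec j) ('D_(evec i) F) x.
Proof.
move=> oU cF Ux; apply/eqP; rewrite -subr_eq0; apply/eqP.
apply: norm_eps0 => e e0.
have e20 : 0 < e / 2 by rewrite divr_gt0.
have c k l : \forall y \near x,
    `|'D_(evec k) ('D_(evec l) F) x - 'D_(evec k) ('D_(evec l) F) y| <= e / 2.
  have cD := Ck_on_cont (Ck_on_derive (Ck_on_derive cF l) k) Ux.
  by have /cvgrPdist_le/(_ _ e20) := cD.
have nU : nbhs x U by exact: open_nbhs_nbhs.
have : \forall y \near x, [/\ U y,
    `|'D_(evec i) ('D_(evec j) F) x - 'D_(evec i) ('D_(evec j) F) y| <= e / 2 &
    `|'D_(evec j) ('D_(evec i) F) x - 'D_(evec j) ('D_(evec i) F) y| <= e / 2].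
  by apply: nearS (nearI nU (nearI (c i j) (c j i))) => y [h1 [h2 h3]].
move=> /nbhs_ballP[r /= r0 hr].
have {}hr y : `|x - y| < r -> [/\ U y,
    `|'D_(evec i) ('D_(evec j) F) x - 'D_(evec i) ('D_(evec j) F) y| <= e / 2 &
    `|'D_(evec j) ('D_(evec i) F) x - 'D_(evec j) ('D_(evec i) F) y| <= e / 2].
  by move=> h; apply: hr; rewrite mx_norm_ball.
have hU y : `|x - y| < r -> U y by move=> /hr[].
have h0 : 0 < r / 3 by rewrite divr_gt0.
have hh : r / 3 + r / 3 < r by lra.
have [y yx e1] := @Schwarz_mvt n U F x i j r (r / 3) cF hU h0 hh.
have [z zx e2] := @Schwarz_mvt n U F x j i r (r / 3) cF hU h0 hh.
have [_ _ ya] := hr y (le_lt_trans yx hh).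
have [_ za _] := hr z (le_lt_trans zx hh).
have eyz : 'D_(evec j) ('D_(evec i) F) y = 'D_(evec i) ('D_(evec j) F) z.
  have p0 : r / 3 * (r / 3) != 0 by rewrite mulf_neq0 // gt_eqF.
  apply: (mulfI p0); rewrite -[LHS]e1 -[RHS]e2.
  have -> : x + (r / 3) *: evec j + (r / 3) *: evec i = x + (r / 3) *: evec i + (r / 3) *: evec j.
    by rewrite addrAC.
  by ring.
by rewrite eyz in ya; exact: abs_half_tri za ya.
Qed.

Lemma line_Ck n (U : set 'rV[R]_n) F x (v : 'rV[R]_n) t : open U -> Ck_on 1 U F ->
  U (x + t *: v) ->
  is_derive t 1 (fun s : R => F (x + s *: v)) (\sum_b v 0 b * 'D_(evec b) F (x + t *: v)).
Proof.
move=> oU cF Ux; have [d <-] := dir_derive v oU cF Ux.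
exact: line_derive.
Qed.

(** Restrict to lines through [x]. A positive second derivative would make the first derivative
    positive just after [x], and then [F] larger than at [x], by two applications of the mean value
    theorem. *)
Lemma second_order_test n (U : set 'rV[R]_n) F x : open U -> Ck_on 2 U F -> U x ->
  (forall y, U y -> F y <= F x) ->
  (forall i, 'D_(evec i) F x = 0) /\
  forall v : 'rV[R]_n, \sum_i \sum_j v 0 i * v 0 j * 'D_(evec i) ('D_(evec j) F) x <= 0.
Proof.
move=> oU cF Ux hmax.
pose G v y := \sum_b (v : 'rV[R]_n) 0 b * 'D_(evec b) F y.
pose G2 v y := \sum_i (v : 'rV[R]_n) 0 i * 'D_(evec i) (G v) y.
have cG v : Ck_on 1 U (G v).
  apply: Ck_on_sum => // b _; apply: Ck_on_scale => //; exact: Ck_on_derive.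
have cF1 : Ck_on 1 U F by exact: Ck_on_pred.
have [r r0 hr] : exists2 r : R, 0 < r & forall v : 'rV[R]_n, forall t : R, `|t| * (1 + `|v|) < r -> U (x + t *: v).
  have /nbhs_ballP[r /= r0 hr] : nbhs x U by exact: open_nbhs_nbhs.
  exists r => // v t h; apply: hr; rewrite mx_norm_ball /ball_ /= opprD addrA subrr sub0r normrN normrZ.
  by rewrite (le_lt_trans _ h) // ler_wpM2l // lerDr.
have dphi v t : U (x + t *: v) -> is_derive t 1 (fun s : R => F (x + s *: v)) (G v (x + t *: v)).
  by move=> h; exact: (line_Ck oU cF1 h).
have dphi2 v t : U (x + t *: v) -> is_derive t 1 (fun s : R => G v (x + s *: v)) (G2 v (x + t *: v)).
  by move=> h; exact: (line_Ck oU (cG v) h).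
have G0 v : G v x = 0.
  pose s := r / (1 + `|v|).
  have v1 : 0 < 1 + `|v| by rewrite ltr_pwDl.
  have s0 : 0 < s by rewrite divr_gt0.
  have hU t : t \in `]- s, s[%R -> U (x + t *: v).
    rewrite in_itv /= => h; apply: hr; rewrite -ltr_pdivlMr // ltr_norml //.
  have ss : - s < s by rewrite gtrN.
  have z0 : (0 : R) \in `]- s, s[%R by rewrite in_itv /= oppr_lt0 s0.
  have [||_ e] := @derive1_at_max R (fun t => F (x + t *: v)) (- s) s 0 (ltW ss) _ z0.
  - by move=> t /hU h; have [] := dphi v t h.
  - by move=> t /hU h; rewrite scale0r addr0; exact: hmax.
  have [_ E] := dphi v 0 (hU 0 z0); rewrite scale0r addr0 in E.
  by rewrite -E.
split=> [i|v].
  rewrite -[RHS](G0 (evec i)) /G (bigD1 i) //= mxE !eqxx mul1r big1 ?addr0 // => j ji.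
  by rewrite mxE eqxx (negbTE ji) mul0r.
have -> : \sum_i \sum_j v 0 i * v 0 j * 'D_(evec i) ('D_(evec j) F) x = G2 v x.
  apply: eq_bigr => i _.
  have cd j := Ck_on_is_derive (Ck_on_derive cF j) i Ux.
  have -> : 'D_(evec i) (G v) x = \sum_j v 0 j * 'D_(evec i) ('D_(evec j) F) x.
    have -> : G v = \sum_(j < n) (fun y => v 0 j * 'D_(evec j) F y).
      by apply/funext => y; rewrite fct_sumE.
    have dj j : is_derive x (evec i) (fun y => v 0 j * 'D_(evec j) F y) (v 0 j * 'D_(evec i) ('D_(evec j) F) x).
      by have hj := cd j; exact: is_deriveZ.
    rewrite derive_sum; last by move=> j; have [] := dj j.
    by apply: eq_bigr => j _; have [_ ->] := dj j.
  by rewrite mulr_sumr; apply: eq_bigr => j _; rewrite mulrA.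
rewrite leNgt; apply/negP => p0.
have cG2 : {for x, continuous (G2 v)}.
  have c : Ck_on 0 U (G2 v).
    apply: Ck_on_sum => // b _; apply: Ck_on_scale => //; exact: Ck_on_derive.
  exact: (Ck_on_cont c).
have n1 : \forall h \near (0:R)^', 0 < G2 v (h *: v + x).
  have : G2 v (h *: v + x) @[h --> (0:R)^'] --> G2 v x.
    exact: (cvg_comp _ _ (@cvg_line 'rV[R]_n x v) cG2).
  by move=> /cvgr_gt; apply.
have v1 : 0 < 1 + `|v| by rewrite ltr_pwDl.
have [s s0 hs] : exists2 s : R, 0 < s & forall t, 0 < t -> t < s -> 0 < G2 v (x + t *: v) /\ U (x + t *: v).
  have : \forall h \near (0:R)^', 0 < G2 v (h *: v + x) /\ `|h| < r / (1 + `|v|).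
    have n2 : \forall h \near (0:R)^', `|h| < r / (1 + `|v|).
      by apply: dnbhs0_lt; rewrite divr_gt0.
    exact: filterI n1 n2.
  rewrite /dnbhs /within /= => /nbhs_ballP[s /= s0 h].
  exists s; [exact: s0|move=> t t0 ts].
  have tb : ball (0 : R) s t by rewrite /ball /= sub0r normrN gtr0_norm.
  have [] := h t tb (lt0r_neq0 t0); rewrite [t *: v + x]addrC => h1 h2.
  by split=> //; apply: hr; rewrite -(ltr_pdivlMr _ _ v1).
have U0 : U (x + 0 *: v) by rewrite scale0r addr0.
have Ut t : 0 <= t -> t < s -> U (x + t *: v).
  by rewrite le_eqVlt => /orP[/eqP <- //|t0 ts]; have [] := hs t t0 ts.
have t0 : 0 < s / 2 by rewrite divr_gt0.
have ts : s / 2 < s by lra.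
have cw (f df : R -> R) a b : 0 <= a -> b < s -> (forall t, U (x + t *: v) -> is_derive t 1 f (df t)) ->
    {within `[a, b], continuous f}.
  move=> a0 bs h; apply: derivable_within_continuous => t; rewrite in_itv /= => /andP[at_ tb].
  by have [] := h t (Ut t (le_trans a0 at_) (le_lt_trans tb bs)).
have d1 t : t \in `]0, s / 2[%R -> U (x + t *: v).
  by rewrite in_itv /= => /andP[/ltW a b]; apply: Ut => //; exact: lt_trans b ts.
have [c1 c1i e1] := MVT t0 (fun t ht => dphi v t (d1 t ht)) (cw _ _ _ _ (lexx _) ts (dphi v)).
have [c10 c1s] : 0 < c1 /\ c1 < s / 2 by move: c1i; rewrite in_itv /= => /andP[].
have d2 t : t \in `]0, c1[%R -> U (x + t *: v).
  rewrite in_itv /= => /andP[/ltW a b]; apply: Ut => //.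
  exact: lt_trans b (lt_trans c1s ts).
have [c2 c2i e2] := MVT c10 (fun t ht => dphi2 v t (d2 t ht))
  (cw _ _ _ _ (lexx _) (lt_trans c1s ts) (dphi2 v)).
have [c20 c2s] : 0 < c2 /\ c2 < c1 by move: c2i; rewrite in_itv /= => /andP[].
have g2 : 0 < G2 v (x + c2 *: v).
  by have [] := hs c2 c20 (lt_trans c2s (lt_trans c1s ts)).
move: e2; rewrite scale0r addr0 G0 !subr0 => e2.
have g1 : 0 < G v (x + c1 *: v) by rewrite e2 mulr_gt0.
have := hmax _ (Ut _ (ltW t0) ts); rewrite -subr_le0.
move: e1; rewrite scale0r addr0 subr0 => ->.
by rewrite leNgt mulr_gt0.
Qed.

End Calculus.

(** * The ring of smooth functions on a relatively open subset of the half space *)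

Definition rel_open (R : realType) n (A : set 'rV[R]_n) :=
  exists2 O : set 'rV[R]_n, open O & A = O `&` @half_space R n.

Section HalfSpace.
Variables (R : realType) (n : nat).
Implicit Types (A U : set 'rV[R]_n) (f F : 'rV[R]_n -> R).

Lemma rel_openI A U : rel_open A -> open U -> rel_open (A `&` U).
Proof. by move=> [W oW ->] oU; exists (W `&` U); [exact: openI|rewrite setIAC]. Qed.

Lemma half_space_step (x : 'rV[R]_n) i (h : R) : half_space x -> 0 <= h -> half_space (x + h *: evec R i).
Proof.
move=> hx h0 j j0; rewrite !mxE addr_ge0 ?hx // mulr_ge0 // ler0n.
Qed.

Local Notation side x i := (within [set h : R | half_space (x + h *: evec R i)] (0:R)^').

(** Small positive increments are admissible even at boundary points, so the limit defining [pd] is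
    unique. *)
Lemma side_proper (x : 'rV[R]_n) i : half_space x -> ProperFilter (side x i).
Proof.
move=> hx; apply: Build_ProperFilter; move=> P.
move: P => /= /nbhs_ballP[e /= e0 he].
apply: (he (e / 2)).
- rewrite /ball /= sub0r normrN gtr0_norm ?divr_gt0 //.
  by rewrite ltr_pdivrMr // mulr_natr mulr2n ltrDl.
- by rewrite gt_eqF // divr_gt0.
- by apply: half_space_step => //; rewrite divr_ge0 // ltW.
Qed.

Lemma side_near (x : 'rV[R]_n) i A : rel_open A -> A x -> \forall h \near side x i, A (x + h *: evec R i).
Proof.
move=> [W oW ->] [Wx hx]; rewrite near_withinE.
have : \forall h \near (0:R)^', W (h *: evec R i + x).
  by apply: (@cvg_line R 'rV[R]_n x (evec R i)); exact: open_nbhs_nbhs.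
by apply: filterS => h; rewrite addrC.
Qed.

Lemma pd_congr A f g i x : rel_open A -> A x -> (forall y, A y -> f y = g y) ->
  pd i f x = pd i g x.
Proof.
move=> hA Ax e; rewrite /pd; congr (lim _).
have H : \forall h \near side x i, h^-1 * (f (x + h *: evec R i) - f x) =
    h^-1 * (g (x + h *: evec R i) - g x).
  have := side_near i hA Ax; apply: filterS => h Ah.
  by rewrite (e _ Ah) (e _ Ax).
rewrite eqEsubset; split; apply: near_eq_cvg => //.
by apply: filterS H => h ->.
Qed.

(** The filter of [pd] is finer than the two-sided one, so [pd] inherits the derivative of any local
    C^1 extension. All facts about [pd] are reduced to ordinary calculus by this lemma. *)
Lemma pd_ext A U f F i x : rel_open A -> open U -> Ck_on 1 U F -> A x -> U x ->
  (forall y, A y -> U y -> F y = f y) -> pd i f x = 'D_(evec R i) F x.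
Proof.
move=> hA oU cF Ax Ux e.
have hx : half_space x by case: hA Ax => W _ -> [].
have fx : ProperFilter (side x i) by exact: side_proper.
have c := derivable_cvg (@Ck_on_derivable R n 0 U F cF i x Ux).
rewrite (@pd_congr (A `&` U) f F) //; first last.
- by move=> y [Ay Uy]; rewrite e.
- exact: rel_openI.
rewrite /pd; apply: cvg_lim => //.
apply: cvg_trans (cvg_app _ (@cvg_within _ _ _ _)) _.
by under eq_fun => h do rewrite -[x + _]addrC.
Qed.

Lemma smooth_on_sub A A' f : A' `<=` A -> smooth_on A f -> smooth_on A' f.
Proof.
move=> sA h x /sA Ax; have [U [F [oU Ux cF e]]] := h x Ax.
by exists U, F; split=> // y /sA Ay; exact: e.
Qed.

Lemma smooth_on_eq A f g : (forall y, A y -> f y = g y) -> smooth_on A f -> smooth_on A g.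
Proof.
move=> fg h x Ax; have [U [F [oU Ux cF e]]] := h x Ax.
by exists U, F; split=> // y Ay Uy; rewrite -fg // e.
Qed.

Lemma Cinf_smooth_on A U F : open U -> Cinf_on U F -> A `<=` U -> smooth_on A F.
Proof. by move=> oU cF sA x Ax; exists U, F; split=> //; exact: sA. Qed.

Lemma smooth_on_cst A c : smooth_on A (cst c).
Proof. by apply: (@Cinf_smooth_on A setT) => //; [exact: openT|move=> k; exact: Ck_on_cst]. Qed.

Lemma smooth_on_coord A j : smooth_on A (fun y => y 0 j).
Proof.
apply: (@Cinf_smooth_on A setT) => //; first exact: openT.
by move=> k; apply: Ck_on_coord; exact: openT.
Qed.

Lemma smooth_on_op2 (op : R -> R -> R) A f g :
  (forall k U F H, open U -> Ck_on k U F -> Ck_on k U H -> Ck_on k U (fun x : 'rV[R]_n => op (F x) (H x))) ->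
  smooth_on A f -> smooth_on A g -> smooth_on A (fun x => op (f x) (g x)).
Proof.
move=> hop hf hg x Ax.
have [U [F [oU Ux cF eF]]] := hf x Ax; have [V [G [oV Vx cG eG]]] := hg x Ax.
have oUV := openI oU oV.
exists (U `&` V), (fun x => op (F x) (G x)); split=> //.
  by move=> k; apply: hop => //; apply: Ck_on_sub; [|exact: cF| |exact: cG] => y [].
by move=> y Ay [Uy Vy]; rewrite eF ?eG.
Qed.

Lemma smooth_on_add A f g : smooth_on A f -> smooth_on A g -> smooth_on A (fun x => f x + g x).
Proof. by apply: smooth_on_op2 => *; exact: Ck_on_add. Qed.

Lemma smooth_on_mul A f g : smooth_on A f -> smooth_on A g -> smooth_on A (fun x => f x * g x).
Proof. by apply: smooth_on_op2 => *; exact: Ck_on_mul. Qed.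

Lemma smooth_on_opp A f : smooth_on A f -> smooth_on A (fun x => - f x).
Proof.
move=> h; refine (smooth_on_eq _ (smooth_on_mul (@smooth_on_cst A (-1)) h)) => y _.
exact: mulN1r.
Qed.

Lemma smooth_on_sum A I (r : seq I) (P : pred I) (f : I -> 'rV[R]_n -> R) :
  (forall i, P i -> smooth_on A (f i)) -> smooth_on A (fun x => \sum_(i <- r | P i) f i x).
Proof.
move=> h; elim: r => [|i r IH].
  by refine (smooth_on_eq _ (@smooth_on_cst A 0)) => y _; rewrite big_nil.
have [Pi|nPi] := boolP (P i).
  by refine (smooth_on_eq _ (smooth_on_add (h i Pi) IH)) => y _; rewrite big_cons Pi.
by refine (smooth_on_eq _ IH) => y _; rewrite big_cons (negbTE nPi).
Qed.

Lemma Cinf_on_sub U U' F : U' `<=` U -> Cinf_on U F -> Cinf_on U' F.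
Proof. by move=> s h k; exact: Ck_on_sub (h k). Qed.

Lemma cont_open U F (B : set R) : open U -> (forall x, U x -> {for x, continuous F}) ->
  open B -> open (U `&` F @^-1` B).
Proof.
move=> oU cF oB; rewrite openE => x [Ux Bx]; rewrite /interior.
apply: filterI; first exact: open_nbhs_nbhs.
by apply: (cF x Ux); exact: open_nbhs_nbhs.
Qed.

Lemma Cinf_cont U F : Cinf_on U F -> forall x, U x -> {for x, continuous F}.
Proof. by move=> h; exact: (Ck_on_cont (h 0%N)). Qed.

Lemma smooth_on_inv A f : (forall x, A x -> f x != 0) -> smooth_on A f -> smooth_on A (fun x => (f x)^-1).
Proof.
move=> f0 h x Ax; have [U [F [oU Ux cF e]]] := h x Ax.
have oU' : open (U `&` F @^-1` [set y | y != 0]).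
  apply: (cont_open oU (Cinf_cont cF)); exact: open_neq.
exists (U `&` F @^-1` [set y | y != 0]), (fun x => (F x)^-1); split=> //.
- by split=> //=; rewrite e // f0.
- move=> k; apply: Ck_on_inv => //; first by move=> y [].
  by apply: Ck_on_sub (cF k) => y [].
- by move=> y Ay [Uy _]; rewrite e.
Qed.

Lemma smooth_on_pd A f i : rel_open A -> smooth_on A f -> smooth_on A (pd i f).
Proof.
move=> hA h x Ax; have [U [F [oU Ux cF e]]] := h x Ax.
exists U, ('D_(evec R i) F); split=> //.
  by move=> k; exact: (Ck_on_derive (cF k.+1)).
by move=> y Ay Uy; rewrite (pd_ext i hA oU (cF 1%N) Ay Uy e).
Qed.

End HalfSpace.

Lemma smooth_on_comp (R : realType) n m (A : set 'rV[R]_n) (B : set 'rV[R]_m)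
    (f : 'rV[R]_m -> R) (T : 'rV[R]_n -> 'rV[R]_m) :
  (forall x, A x -> B (T x)) -> (forall b, smooth_on A (fun x => T x 0 b)) ->
  smooth_on B f -> smooth_on A (fun x => f (T x)).
Proof.
move=> AB hT hf x Ax; have [V [F [oV Vx cF eF]]] := hf _ (AB x Ax).
have := fun b => hT b x Ax => /choice[U] /choice[H] hH.
pose W := [set y | forall b, U b y].
have oW : open W.
  rewrite openE => y Wy; apply: (@near_forall _ _ (fun b z => U b z)) => b.
  by have [oU _ _ _] := hH b; exact: open_nbhs_nbhs.
pose S y : 'rV[R]_m := \row_b H b y.
have cS y : W y -> {for y, continuous S}.
  move=> Wy; apply: rV_cont => b; have [_ _ cH _] := hH b.
  have -> : (fun z => S z 0 b) = H b by apply/funext => z; rewrite mxE.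
  exact: (Cinf_cont cH (Wy b)).
have oW' : open (W `&` S @^-1` V).
  rewrite openE => y [Wy Vy]; rewrite /interior; apply: filterI; first exact: open_nbhs_nbhs.
  by apply: (cS y Wy); exact: open_nbhs_nbhs.
have ST y : A y -> W y -> S y = T y.
  by move=> Ay Wy; apply/rowP => b; rewrite mxE; have [_ _ _ ->] := hH b; rewrite //; exact: Wy.
have Wx : W x by move=> b; have [] := hH b.
exists (W `&` S @^-1` V), (fun y => F (S y)); split=> //.
- by split=> //; rewrite /preimage /= ST.
- move=> k; apply: (Ck_on_comp oW' oV) (cF k); first by move=> y [].
  move=> b; have [oU _ cH _] := hH b.
  apply: Ck_on_eq oW' _ (Ck_on_sub _ (cH k)); first by move=> y _; rewrite mxE.
  by move=> y [Wy _]; exact: Wy.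
- by move=> y Ay [Wy Vy]; rewrite eF // ST //; exact: AB.
Qed.

Section SmoothRing.
Variables (R : realType) (n : nat) (A : set 'rV[R]_n).

(** The value 0 outside [A] is immaterial: smoothness on [A] and, for relatively open [A], [pd] at
    its points involve values on [A] only. *)
Definition ext (f : {x | A x} -> R) (y : 'rV[R]_n) : R :=
  if pselect (A y) is left h then f (exist _ y h) else 0.

Lemma extE f y (h : A y) : ext f y = f (exist _ y h).
Proof.
rewrite /ext; case: pselect => // h'; congr (f _); congr exist; exact: Prop_irrelevance.
Qed.

Definition smooth_pred : {pred ({x | A x} -> R)} := fun f => `[< smooth_on A (ext f) >].

Lemma smooth_subring : subring_closed smooth_pred.
Proof.
split.
- apply/asboolP; refine (smooth_on_eq _ (@smooth_on_cst R n A 1)) => y Ay.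
  by rewrite extE.
- move=> f g /asboolP hf /asboolP hg; apply/asboolP.
  refine (smooth_on_eq _ (smooth_on_add hf (smooth_on_opp hg))) => y Ay.
  by rewrite !extE.
- move=> f g /asboolP hf /asboolP hg; apply/asboolP.
  refine (smooth_on_eq _ (smooth_on_mul hf hg)) => y Ay.
  by rewrite !extE.
Qed.

HB.instance Definition _ := GRing.isSubringClosed.Build ({x | A x} -> R) smooth_pred smooth_subring.

(** Functions on the subtype rather than total ones, so that two elements are equal as soon as they
    agree on [A]; only then do the ring identities hold as equalities. *)
Record sfun := SFun { sfun_val : {x | A x} -> R; sfun_valP : sfun_val \in smooth_pred }.

HB.instance Definition _ := [isSub for sfun_val].
HB.instance Definition _ := [Choice of sfun by <:].
HB.instance Definition _ := GRing.SubChoice_isSubComPzRing.Build _ _ sfun smooth_subring.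

Definition ev (p : {x | A x}) (f : sfun) : R := sfun_val f p.

Lemma ev_zmod p : zmod_morphism (ev p).
Proof. by move=> f g. Qed.

Lemma ev_monoid p : monoid_morphism (ev p).
Proof. by split => [|f g]. Qed.

HB.instance Definition _ p := GRing.isZmodMorphism.Build sfun R (ev p) (ev_zmod p).
HB.instance Definition _ p := GRing.isMonoidMorphism.Build sfun R (ev p) (ev_monoid p).

Lemma evD p f g : ev p (f + g) = ev p f + ev p g.
Proof. by []. Qed.

Lemma evM p f g : ev p (f * g) = ev p f * ev p g.
Proof. by []. Qed.

Lemma evN p f : ev p (- f) = - ev p f.
Proof. by []. Qed.

Lemma ev1 p : ev p 1 = 1.
Proof. by []. Qed.

Lemma ev0 p : ev p 0 = 0.
Proof. by []. Qed.

Lemma sfun_ext (f g : sfun) : (forall p, ev p f = ev p g) -> f = g.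
Proof. by move=> h; apply: val_inj; apply/funext. Qed.

Lemma sfun_smooth (f : sfun) : smooth_on A (ext (sfun_val f)).
Proof. by have /asboolP := sfun_valP f. Qed.

Lemma mk_sfun_subproof f : smooth_on A f -> (fun p : {x | A x} => f (sval p)) \in smooth_pred.
Proof. by move=> h; apply/asboolP; refine (smooth_on_eq _ h) => y Ay; rewrite extE. Qed.

Definition mk_sfun f (h : smooth_on A f) : sfun := SFun (mk_sfun_subproof h).

Lemma ev_mk p f (h : smooth_on A f) : ev p (mk_sfun h) = f (sval p).
Proof. by []. Qed.

Hypothesis hA : rel_open A.

Definition sder (i : 'I_n) (f : sfun) : sfun := mk_sfun (smooth_on_pd i hA (sfun_smooth f)).

Lemma ev_sder i f p : ev p (sder i f) = pd i (ext (sfun_val f)) (sval p).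
Proof. by []. Qed.

Lemma pd_mk i f (h : smooth_on A f) : forall x, A x ->
  pd i (ext (sfun_val (mk_sfun h))) x = pd i f x.
Proof.
move=> x Ax; apply: (pd_congr i hA Ax) => y Ay; by rewrite extE.
Qed.

Lemma ev_sder_mk i f (h : smooth_on A f) p : ev p (sder i (mk_sfun h)) = pd i f (sval p).
Proof. by case: p => x Ax; rewrite ev_sder pd_mk. Qed.

Lemma sder_local f x : A x -> exists (U : set 'rV[R]_n) (F : 'rV[R]_n -> R),
  [/\ open U, U x, Cinf_on U F,
    forall y, A y -> U y -> F y = ext (sfun_val f) y &
    forall i y, A y -> U y -> pd i (ext (sfun_val f)) y = 'D_(evec R i) F y].
Proof.
move=> Ax; have [U [F [oU Ux cF e]]] := sfun_smooth f Ax.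
exists U, F; split=> // i y Ay Uy; exact: pd_ext hA oU (cF 1%N) Ay Uy e.
Qed.

(** Near each point the functions extend smoothly to an open set, where the ordinary sum and product
    rules and [Schwarz] apply. *)
Lemma sder_derivations : derivations sder.
Proof.
have pair f g x (Ax : A x) : exists (U : set 'rV[R]_n) (F G : 'rV[R]_n -> R),
  [/\ open U, U x, Cinf_on U F, Cinf_on U G &
   forall y, A y -> U y -> [/\ F y = ext (sfun_val f) y, G y = ext (sfun_val g) y,
    forall i, pd i (ext (sfun_val f)) y = 'D_(evec R i) F y &
    forall i, pd i (ext (sfun_val g)) y = 'D_(evec R i) G y]].
  have [U [F [oU Ux cF eF dF]]] := sder_local f Ax.
  have [V [G [oV Vx cG eG dG]]] := sder_local g Ax.
  exists (U `&` V), F, G; split=> //; first exact: openI.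
  - by apply: Cinf_on_sub cF => y [].
  - by apply: Cinf_on_sub cG => y [].
  - by move=> y Ay [Uy Vy]; split; [exact: eF|exact: eG|move=> i; exact: dF|move=> i; exact: dG].
split.
- move=> i f g; apply: sfun_ext => -[x Ax]; rewrite evD !ev_sder.
  have [U [F [G [oU Ux cF cG h]]]] := pair f g x Ax.
  have [_ _ -> ->] := h x Ax Ux.
  have dF := Ck_on_is_derive (cF 1%N) i Ux; have dG := Ck_on_is_derive (cG 1%N) i Ux.
  have [_ <-] := is_deriveD dF dG.
  apply: (pd_ext i hA oU (Ck_on_add oU (cF 1%N) (cG 1%N)) Ax Ux) => y Ay Uy.
  by have [-> -> _ _] := h y Ay Uy; rewrite !extE.
- move=> i f g; apply: sfun_ext => -[x Ax]; rewrite evD !evM !ev_sder.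
  have [U [F [G [oU Ux cF cG h]]]] := pair f g x Ax.
  have [e1 e2 -> ->] := h x Ax Ux; move: e1 e2; rewrite !extE => e1 e2.
  have dF := Ck_on_is_derive (cF 1%N) i Ux; have dG := Ck_on_is_derive (cG 1%N) i Ux.
  have [_ E] := is_deriveM dF dG.
  rewrite /ev /= -e1 -e2.
  transitivity ('D_(evec R i) (F * G) x); last by rewrite E addrC mulrC.
  apply: (pd_ext i hA oU (Ck_on_mul oU (cF 1%N) (cG 1%N)) Ax Ux) => y Ay Uy.
  by have [-> -> _ _] := h y Ay Uy; rewrite !extE.
- move=> i j f; apply: sfun_ext => -[x Ax]; rewrite !ev_sder /=.
  have [U [F [oU Ux cF eF dF]]] := sder_local f Ax.
  have e k l : pd k (ext (sfun_val (sder l f))) x = 'D_(evec R k) ('D_(evec R l) F) x.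
    apply: (pd_ext k hA oU (Ck_on_derive (cF 2%N) l) Ax Ux) => y Ay Uy.
    by rewrite extE /= dF.
  by rewrite !e (Schwarz _ _ oU (cF 2%N) Ux).
Qed.

End SmoothRing.

(** * Positive definite matrices *)

(* Determinants and inverse matrices stay in any class [P] of functions that is
   closed under the field operations and only depends on the values on [A]. *)
Section MatrixClosure.
Variables (T : Type) (R : fieldType) (A : set T) (P : (T -> R) -> Prop).
Hypothesis Pext : forall f g, (forall x, A x -> f x = g x) -> P f -> P g.
Hypothesis Pcst : forall c, P (fun=> c).
Hypothesis Padd : forall f g, P f -> P g -> P (fun x => f x + g x).
Hypothesis Pmul : forall f g, P f -> P g -> P (fun x => f x * g x).
Hypothesis Pinv : forall f, (forall x, A x -> f x != 0) -> P f -> P (fun x => (f x)^-1).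

Lemma closure_sum I (r : seq I) (F : I -> T -> R) :
  (forall i, P (F i)) -> P (fun x => \sum_(i <- r) F i x).
Proof.
move=> h; elim: r => [|i r IH].
  by apply: Pext (Pcst 0) => x _; rewrite big_nil.
by apply: Pext (Padd (h i) IH) => x _; rewrite big_cons.
Qed.

Lemma closure_prod I (r : seq I) (F : I -> T -> R) :
  (forall i, P (F i)) -> P (fun x => \prod_(i <- r) F i x).
Proof.
move=> h; elim: r => [|i r IH].
  by apply: Pext (Pcst 1) => x _; rewrite big_nil.
by apply: Pext (Pmul (h i) IH) => x _; rewrite big_cons.
Qed.

Lemma closure_det n (M : T -> 'M[R]_n) :
  (forall i j, P (fun x => M x i j)) -> P (fun x => \det (M x)).
Proof.
move=> h; apply: closure_sum => s; apply: Pmul; first exact: Pcst.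
by apply: closure_prod => i; exact: h.
Qed.

Lemma closure_invmx n (M : T -> 'M[R]_n) :
  (forall i j, P (fun x => M x i j)) -> (forall x, A x -> M x \in unitmx) ->
  forall i j, P (fun x => invmx (M x) i j).
Proof.
move=> h u i j.
have hd : P (fun x => (\det (M x))^-1).
  by apply: Pinv; [move=> x /u; rewrite unitmxE unitfE|exact: closure_det].
have hc : P (fun x => cofactor (M x) j i).
  apply: Pmul; first exact: Pcst.
  apply: closure_det => k l; apply: Pext (h (lift j k) (lift i l)) => x _.
  by rewrite !mxE.
apply: Pext (Pmul hd hc) => x Ax; rewrite /invmx u //.
by rewrite !mxE.
Qed.

End MatrixClosure.

Section PositiveDefinite.
Variable R : rcfType.

Definition posdef n (G : 'M[R]_n) :=
  forall v : 'rV[R]_n, v != 0 -> 0 < (v *m G *m v^T) 0 0.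

Lemma posdef_unit n (G : 'M[R]_n) : posdef G -> G \in unitmx.
Proof.
move=> h; rewrite -row_free_unit -kermx_eq0; apply/eqP/row_matrixP => i.
rewrite row0; apply/eqP; apply/negPn/negP => /h.
by rewrite -row_mul mulmx_ker row0 mul0mx mxE ltxx.
Qed.

Lemma orthonormal_frame n (G : 'M[R]_n) : G^T = G -> posdef G ->
  exists2 P : 'M[R]_n, P \in unitmx & P *m G *m P^T = 1%:M.
Proof.
elim: n G => [|n IH] G GT Gp.
  by exists 1%:M; rewrite ?unitmx1 // [LHS]flatmx0 [RHS]flatmx0.
pose G' : 'M[R]_(1 + n) := G.
have GT' : G'^T = G' by [].
have Gp' : @posdef (1 + n) G' by exact: Gp.
pose a := ulsubmx G'; pose b := dlsubmx G'; pose D := drsubmx G'.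
have eG : G' = block_mx a b^T b D.
  rewrite -[LHS]submxK; congr block_mx.
  by rewrite /b trmx_dlsub GT'.
pose al := a 0 0.
have aE : a = al%:M by apply/matrixP => i j; rewrite !ord1 [RHS]mxE eqxx mulr1n.
have al0 : 0 < al.
  have e0 : row_mx 1%:M 0 != 0 :> 'rV[R]_(1 + n).
    apply/eqP => /(congr1 lsubmx); rewrite row_mxKl => /matrixP/(_ 0 0).
    by rewrite !mxE eqxx => /eqP; rewrite oner_eq0.
  have := Gp' (row_mx 1%:M 0 : 'rV[R]_(1 + n)) e0.
  rewrite eG mul_row_block !mul0mx !mul1mx !addr0 tr_row_mx mul_row_col.
  by rewrite trmx1 mulmx1 trmx0 mulmx0 addr0.
pose S := D - al^-1 *: (b *m b^T).
have DT : D^T = D by rewrite /D trmx_drsub GT'.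
have ST : S^T = S.
  rewrite /S linearB /= linearZ /= trmx_mul trmxK DT //.
have Sp : posdef S.
  (* The first entry of [w] makes the first entry of [w *m G'] vanish, which leaves the quadratic
     form of [S] at [v]. *)
  move=> v v0; pose w : 'rV[R]_(1 + n) := row_mx (- al^-1 *: (v *m b)) v.
  have w0 : w != 0.
    apply: contra_neq v0 => /(congr1 rsubmx); rewrite row_mxKr => ->.
    by apply/rowP => i; rewrite !mxE.
  have := Gp' w w0; rewrite eG mul_row_block tr_row_mx mul_row_col aE.
  rewrite mul_mx_scalar scalerA mulrN mulfV ?gt_eqF // scaleN1r addNr mul0mx add0r.
  by rewrite /S mulmxBr -scalemxAr mulmxA -!scalemxAl scaleNr addrC.
have [P' P'u P'e] := IH S ST Sp.
pose r := Num.sqrt al.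
have r0 : r != 0 by rewrite gt_eqF // sqrtr_gt0.
have rr : r * r = al by rewrite -expr2 sqr_sqrtr // ltW.
pose P : 'M[R]_(1 + n) := block_mx (r^-1)%:M 0 (- al^-1 *: (P' *m b)) P'.
have PGP : P *m G' *m P^T = 1%:M.
  rewrite /P eG tr_block_mx mulmx_block aE !mul0mx !addr0 mulmx_block.
  rewrite trmx0 !mulmx0 !addr0 !tr_scalar_mx -scalar_mxM -scalar_mxM.
  rewrite (mul_mx_scalar al (- al^-1 *: (P' *m b))) scalerA mulrN mulfV ?gt_eqF // scaleN1r addNr !mul0mx add0r.
  have e1 : r^-1 * al * r^-1 = 1 by rewrite -rr mulKf // mulfV.
  rewrite e1.
  have e2 : (r^-1 * al)%:M *m (- al^-1 *: (P' *m b))^T + (r^-1)%:M *m b^T *m P'^T = 0.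
    rewrite linearZ /= trmx_mul -scalemxAr mul_scalar_mx scalerA mul_scalar_mx.
    rewrite -scalemxAl mulNr mulrCA mulVf ?gt_eqF // mulr1 scaleNr addNr //.
  rewrite e2.
  have e3 : (- al^-1 *: (P' *m b) *m b^T + P' *m D) *m P'^T = 1%:M.
    rewrite -P'e /S mulmxBr; congr (_ *m _); rewrite addrC scaleNr mulNmx; congr (_ - _).
    by rewrite -scalemxAl -scalemxAr mulmxA.
  by rewrite e3 -scalar_mx_block.
have Pu : P \in unitmx.
  have : \det (P *m G' *m P^T) != 0 by rewrite PGP det1 oner_eq0.
  rewrite !det_mulmx det_tr mulf_eq0 negb_or => /andP[_ h].
  by rewrite unitmxE unitfE.
by exists P.
Qed.

Lemma orthonormal_inv n (G P : 'M[R]_n) : P \in unitmx -> P *m G *m P^T = 1%:M ->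
  G \in unitmx -> invmx G = P^T *m P.
Proof.
move=> Pu e Gu.
have e2 : G *m (P^T *m P) = 1%:M.
  have e3 : P *m (G *m P^T) = 1%:M by rewrite mulmxA.
  by rewrite mulmxA; exact: mulmx1C e3.
by rewrite -[LHS]mulmx1 -e2 mulKmx.
Qed.

Lemma sum_sq_eq0 n m (A : 'M[R]_(n, m)) : \sum_i \sum_j A i j ^+ 2 <= 0 -> A = 0.
Proof.
move=> h; apply/matrixP => i j; rewrite mxE; apply/eqP; rewrite -sqrf_eq0 eq_le sqr_ge0 andbT.
apply: le_trans h; rewrite (bigD1 i) //= (bigD1 j) //=.
rewrite -addrA lerDl addr_ge0 //; first by apply: sumr_ge0 => k _; exact: sqr_ge0.
by apply: sumr_ge0 => k _; apply: sumr_ge0 => l _; exact: sqr_ge0.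
Qed.

Lemma trace_sq n m (A : 'M[R]_(n, m)) : \tr (A *m A^T) = \sum_i \sum_j A i j ^+ 2.
Proof. by apply: eq_bigr => i _; rewrite mxE; apply: eq_bigr => j _; rewrite !mxE expr2. Qed.

Lemma trace_comb n m k (a : 'I_k -> R) (V W : 'I_k -> 'M[R]_(n, m)) :
  \tr ((\sum_b a b *: V b) *m (\sum_b a b *: W b)^T) =
  \sum_b \sum_b' a b * a b' * \tr (V b *m (W b')^T).
Proof.
rewrite mulmx_suml raddf_sum; apply: eq_bigr => b _ /=.
rewrite linear_sum mulmx_sumr raddf_sum; apply: eq_bigr => b' _ /=.
by rewrite linearZ /= -scalemxAl -scalemxAr !mxtraceZ mulrA.
Qed.

Lemma contract_gram n (P : 'M[R]_n) (F : 'I_n -> 'I_n -> R) :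
  contract (P^T *m P) F = \sum_i \sum_b \sum_b' P i b * P i b' * F b b'.
Proof.
rewrite /contract exchange_big /= [RHS](eq_bigr (fun i => \sum_b' \sum_b P i b * P i b' * F b b')); last first.
  by move=> i _; rewrite exchange_big.
rewrite [RHS]exchange_big; apply: eq_bigr => b' _.
rewrite [RHS]exchange_big; apply: eq_bigr => b _.
by rewrite mxE mulr_suml; apply: eq_bigr => i _; rewrite mxE.
Qed.

Lemma frame_comb_inv n (V : lmodType R) (P : 'M[R]_n) (v : 'I_n -> V) b : P \in unitmx ->
  \sum_i invmx P b i *: (\sum_c P i c *: v c) = v b.
Proof.
move=> Pu; under eq_bigr do rewrite scaler_sumr.
have e c : \sum_i invmx P b i *: (P i c *: v c) = (b == c)%:R *: v c.
  have := mulVmx Pu => /matrixP/(_ b c); rewrite !mxE => <-.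
  by rewrite scaler_suml; apply: eq_bigr => i _; rewrite scalerA.
rewrite exchange_big (bigD1 b) //= e eqxx scale1r big1 ?addr0 // => c cb.
by rewrite e eq_sym (negbTE cb) scale0r.
Qed.

Section Frame.
Variables (n : nat) (G : 'M[R]_n).
Hypotheses (GT : G^T = G) (Gp : posdef G).

(** In an orthonormal frame the trace is the sum of the squared entries of a symmetric matrix. *)
Lemma trace_inv_sq (T : 'M[R]_n) : T^T = T ->
  0 <= \tr ((invmx G *m T) *m (invmx G *m T)) /\
  (\tr ((invmx G *m T) *m (invmx G *m T)) = 0 -> T = 0).
Proof.
move=> TT; have [P Pu Pe] := orthonormal_frame GT Gp.
pose B := P *m T *m P^T.
have -> : \tr ((invmx G *m T) *m (invmx G *m T)) = \sum_i \sum_j B i j ^+ 2.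
  rewrite -trace_sq (orthonormal_inv Pu Pe (posdef_unit Gp)).
  have -> : B^T = B by rewrite /B !trmx_mul trmxK TT mulmxA.
  by rewrite -!mulmxA mxtrace_mulC /B !mulmxA.
split; first by apply: sumr_ge0 => i _; apply: sumr_ge0 => j _; exact: sqr_ge0.
move=> e; have B0 : B = 0 by apply: sum_sq_eq0; rewrite e.
have PTu : P^T \in unitmx by rewrite unitmx_tr.
have : invmx P *m B *m invmx P^T = 0 by rewrite B0 mulmx0 mul0mx.
by rewrite /B -!mulmxA mulmxV // mulmx1 mulKmx.
Qed.

Lemma trace_inv_le0 (T : 'M[R]_n) :
  (forall v : 'rV[R]_n, (v *m T *m v^T) 0 0 <= 0) -> \tr (invmx G *m T) <= 0.
Proof.
move=> h; have [P Pu Pe] := orthonormal_frame GT Gp.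
rewrite (orthonormal_inv Pu Pe (posdef_unit Gp)) -mulmxA mxtrace_mulC.
apply: sumr_le0 => i _; apply: le_trans (h (row i P)).
have -> // : (P *m T *m P^T) i i = (row i P *m T *m (row i P)^T) 0 0.
by rewrite -row_mul !mxE; apply: eq_bigr => j _; rewrite !mxE.
Qed.

Lemma inv_form_gt0 (w : 'cV[R]_n) : w != 0 -> 0 < (w^T *m invmx G *m w) 0 0.
Proof.
move=> w0; have [P Pu Pe] := orthonormal_frame GT Gp.
rewrite (orthonormal_inv Pu Pe (posdef_unit Gp)) !mulmxA -mulmxA -trmx_mul.
have Pw0 : P *m w != 0.
  apply: contra_neq w0 => e; by rewrite -[w](mulKmx Pu) e mulmx0.
have [i hi] : exists i, (P *m w) i 0 != 0.
  apply/existsP; apply: contraNT Pw0; rewrite negb_exists => /forallP h.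
  by apply/eqP/matrixP => i j; rewrite (ord1 j) [RHS]mxE; apply/eqP/negPn/h.
rewrite mxE (bigD1 i) //= ltr_pwDl //.
  by rewrite mxE -expr2 lt_neqAle sqr_ge0 eq_sym sqrf_eq0 hi.
by apply: sumr_ge0 => j _; rewrite mxE -expr2 sqr_ge0.
Qed.

Lemma inv_form_ge0 (w : 'cV[R]_n) : 0 <= (w^T *m invmx G *m w) 0 0.
Proof.
have [->|w0] := eqVneq w 0; first by rewrite mulmx0 mxE.
by rewrite ltW // inv_form_gt0.
Qed.

(** In an orthonormal frame the matrices [M b c] become skew, so minus the trace of a product is a
    Euclidean inner product; writing the inverse metric as [P^T *m P] turns the contractions into
    sums over frame vectors. Thus [K] is a sum of squared norms, and invertibility of [P] recovers
    [T] from their vanishing. *)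
Lemma curv_norm_real (T : 'I_n -> 'I_n -> 'M[R]_n) :
  (forall b c, T b c *m G = - (G *m (T b c)^T)) ->
  let K := - contract (invmx G) (fun b b' => contract (invmx G) (fun c c' =>
    \tr (T b c *m T b' c'))) in
  0 <= K /\ (K = 0 -> forall b c, T b c = 0).
Proof.
move=> asym K; have [P Pu Pe] := orthonormal_frame GT Gp.
have GiE := orthonormal_inv Pu Pe (posdef_unit Gp).
pose M b c := P *m T b c *m invmx P.
have GPT : G *m P^T = invmx P.
  by rewrite -[LHS](mulKmx Pu) (mulmxA P G) Pe mulmx1.
have MT b c : (M b c)^T = - M b c.
  have e : M b c *m 1%:M = - (1%:M *m (M b c)^T).
    rewrite -Pe /M !trmx_mul !mulmxA (mulmxKV Pu).
    rewrite -[_ *m T b c *m G](mulmxA P) asym mulmxN mulNmx; congr (- _).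
    have -> : P *m G *m P^T *m (invmx P)^T = P *m G.
      by rewrite trmx_inv mulmxK // unitmx_tr.
    by rewrite !mulmxA.
  by rewrite mulmx1 mul1mx in e; rewrite [in RHS]e opprK.
have trE b c b' c' : \tr (T b c *m T b' c') = - \tr (M b c *m (M b' c')^T).
  rewrite MT mulmxN raddfN opprK /M !mulmxA (mulmxKV Pu).
  by rewrite -!mulmxA [RHS]mxtrace_mulC -!mulmxA mulVmx // mulmx1.
pose L j b := \sum_c P j c *: M b c.
pose N i j := \sum_b P i b *: L j b.
have KE : K = \sum_i \sum_j \tr (N i j *m (N i j)^T).
  rewrite /K GiE contract_gram -sumrN; apply: eq_bigr => i _.
  rewrite [RHS](eq_bigr (fun j => \sum_b \sum_b' P i b * P i b' * \tr (L j b *m (L j b')^T))); last first.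
    by move=> j _; rewrite /N trace_comb.
  rewrite [RHS]exchange_big -sumrN; apply: eq_bigr => b _.
  rewrite [RHS]exchange_big -sumrN; apply: eq_bigr => b' _.
  rewrite contract_gram -mulr_sumr -mulrN; congr (_ * _).
  rewrite -sumrN; apply: eq_bigr => j _; rewrite /L trace_comb -sumrN.
  apply: eq_bigr => c _; rewrite -sumrN; apply: eq_bigr => c' _.
  by rewrite trE mulrN opprK.
have N_ge0 i j : 0 <= \tr (N i j *m (N i j)^T).
  rewrite trace_sq; apply: sumr_ge0 => k _; apply: sumr_ge0 => l _; exact: sqr_ge0.
split.
  by rewrite KE; apply: sumr_ge0 => i _; apply: sumr_ge0 => j _.
move=> K0.
have N0 i j : N i j = 0.
  apply: sum_sq_eq0; rewrite -trace_sq -K0 KE (bigD1 i) //= (bigD1 j) //= -addrA lerDl.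
  rewrite addr_ge0 //; first by apply: sumr_ge0.
  by apply: sumr_ge0 => k _; apply: sumr_ge0.
have L0 j b : L j b = 0.
  by rewrite -[L j b](frame_comb_inv (L j) b Pu) big1 // => i _; rewrite [X in _ *: X]N0 scaler0.
move=> b c.
have M0 : M b c = 0.
  by rewrite -[M b c](frame_comb_inv (M b) c Pu) big1 // => i _; rewrite [X in _ *: X]L0 scaler0.
have : invmx P *m M b c *m P = 0 by rewrite M0 mulmx0 mul0mx.
by rewrite /M -!mulmxA mulVmx // mulmx1 mulKmx.
Qed.

End Frame.
End PositiveDefinite.

(** * Geometry in a chart *)

Arguments ev : simpl never.
Arguments sder : simpl never.

Lemma ev_sum (R : realType) n (A : set 'rV[R]_n) (p : {x | A x}) I (r : seq I) (P : pred I) F :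
  ev p (\sum_(i <- r | P i) F i) = \sum_(i <- r | P i) ev p (F i).
Proof. exact: rmorph_sum. Qed.

Section ChartGeometry.
Variables (R : realType) (n : nat) (A : set 'rV[R]_n) (G : 'rV[R]_n -> 'M[R]_n).
Hypothesis hA : rel_open A.

Record chart_metric_on : Prop := ChartMetricOn {
  cm_smooth : forall a b, smooth_on A (fun x => G x a b);
  cm_sym : forall x, A x -> (G x)^T = G x;
  cm_pos : forall x, A x -> posdef (G x)
}.

Hypothesis hG : chart_metric_on.

Lemma smooth_on_invmx a b : smooth_on A (fun x => invmx (G x) a b).
Proof.
apply: (@closure_invmx _ R A (smooth_on A)).
- by move=> f g fg hf; refine (smooth_on_eq fg hf).
- by move=> c; exact: smooth_on_cst.
- by move=> f g hf hg; exact: smooth_on_add.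
- by move=> f g hf hg; exact: smooth_on_mul.
- by move=> f f0 hf; exact: smooth_on_inv.
- by move=> i j; exact: (cm_smooth hG).
- by move=> x Ax; apply: posdef_unit; exact: (cm_pos hG).
Qed.

Local Notation S := (sfun A).
Local Notation d := (sder hA).

Definition s_half : S := mk_sfun (@smooth_on_cst R n A 2^-1).

Lemma s_halfE : s_half + s_half = 1.
Proof. by apply: sfun_ext => p; rewrite evD ev1 !ev_mk /cst; field. Qed.

Lemma ex_half : exists h : S, h + h = 1.
Proof. by exists s_half; exact: s_halfE. Qed.

Definition s_metric : 'M[S]_n := \matrix_(a, b) mk_sfun (cm_smooth hG a b).
Definition s_inv : 'M[S]_n := \matrix_(a, b) mk_sfun (smooth_on_invmx a b).
Definition s_gam : 'I_n -> 'M[S]_n := christoffel_mx d s_half s_metric s_inv.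

Lemma ev_metric p : map_mx (ev p) s_metric = G (sval p).
Proof. by apply/matrixP => i j; rewrite !mxE. Qed.

Lemma ev_inv p : map_mx (ev p) s_inv = invmx (G (sval p)).
Proof. by apply/matrixP => i j; rewrite !mxE. Qed.

Lemma ev_mx_inj k l (M N : 'M[S]_(k, l)) :
  (forall p, map_mx (ev p) M = map_mx (ev p) N) -> M = N.
Proof.
move=> h; apply/matrixP => i j; apply: sfun_ext => p.
by have /matrixP/(_ i j) := h p; rewrite !mxE.
Qed.

Lemma s_metricT : s_metric^T = s_metric.
Proof.
apply: ev_mx_inj => p; rewrite -matrix.map_trmx ev_metric; exact: (cm_sym hG (svalP p)).
Qed.

Lemma s_metric_inv : s_metric *m s_inv = 1%:M.
Proof.
apply: ev_mx_inj => p; rewrite map_mxM ev_metric ev_inv map_mx1 mulmxV //.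
exact: posdef_unit (cm_pos hG (svalP p)).
Qed.

Lemma s_lc : levi_civita d s_metric s_inv s_gam.
Proof.
exact: (christoffel_levi_civita (sder_derivations hA) s_halfE s_metricT s_metric_inv).
Qed.

Lemma ev_gam p a b c : ev p (s_gam a b c) = christoffel G c a b (sval p).
Proof.
rewrite /s_gam /christoffel_mx mxE evM ev_mk /christoffel ev_sum; congr (_ * _).
apply: eq_bigr => e _; rewrite !mxE evM evD evD evN ev_mk !ev_sder_mk //.
Qed.

Lemma ext_ev (f : S) x (Ax : A x) : ext (sfun_val f) x = ev (exist _ x Ax) f.
Proof. by rewrite extE. Qed.

Lemma pd_ext_ev (f : S) (h : 'rV[R]_n -> R) a p : (forall q, ev q f = h (sval q)) ->
  ev p (d a f) = pd a h (sval p).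
Proof.
move=> e; rewrite ev_sder; apply: (pd_congr a hA (svalP p)) => y Ay.
by rewrite ext_ev e.
Qed.

Section Function.
Variables (f : S) (h : 'rV[R]_n -> R).
Hypothesis fh : forall q, ev q f = h (sval q).

Lemma ev_hess p : map_mx (ev p) (hess d s_gam f) = hessian G h (sval p).
Proof.
apply/matrixP => a b; rewrite mxE [hess _ _ _ _ _]mxE evD evN [RHS]mxE; congr (_ - _).
  apply: (pd_ext_ev (h := pd b h)) => q; exact: pd_ext_ev.
rewrite mulmxE ev_sum; apply: eq_bigr => c _.
by rewrite evM ev_gam grad_colE (pd_ext_ev _ _ fh).
Qed.

Lemma ev_laplace p : ev p (laplace d s_inv s_gam f) = laplacian G h (sval p).
Proof.
by rewrite /laplacian -ev_hess -ev_inv -map_mxM trace_map_mx.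
Qed.

Lemma ev_grad_col p : map_mx (ev p) (grad_col d f) = (\row_a pd a h (sval p))^T.
Proof. by apply/matrixP => a j; rewrite mxE grad_colE !mxE (pd_ext_ev _ _ fh). Qed.

Lemma ev_sqgrad p : ev p (sqgrad d s_inv f) =
  ((\row_a pd a h (sval p)) *m invmx (G (sval p)) *m (\row_a pd a h (sval p))^T) 0 0.
Proof.
rewrite -ev_inv -{1}[\row_a _]trmxK -ev_grad_col.
by rewrite matrix.map_trmx -!map_mxM mxE.
Qed.

Lemma ev_grad_norm p : grad_norm G h (sval p) = Num.sqrt (ev p (sqgrad d s_inv f)).
Proof. by rewrite ev_sqgrad. Qed.

End Function.

Lemma ev_curv p i j k l : ev p (curv d s_gam i j k l) = riemann G l k i j (sval p).
Proof.
have key (gam : 'I_n -> 'M[S]_n) : (forall q a b c, ev q (gam a b c) = christoffel G c a b (sval q)) ->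
    ev p (curv d gam i j k l) = riemann G l k i j (sval p).
  move=> eg; rewrite curvE !(evD, evN) /riemann.
  rewrite (pd_ext_ev (h := christoffel G l j k)); last by move=> q; exact: eg.
  rewrite (pd_ext_ev (h := christoffel G l i k)); last by move=> q; exact: eg.
  congr (_ + _); rewrite !ev_sum opprB -sumrB; apply: eq_bigr => m _.
  by rewrite !evM !eg; ring.
by apply: key => q a b c; exact: ev_gam.
Qed.

Lemma ev_ricci p : map_mx (ev p) (ricci_mx d s_gam) = ricci G (sval p).
Proof.
apply/matrixP => j k; rewrite !mxE ev_sum; apply: eq_bigr => i _; exact: ev_curv.
Qed.

Definition interior_pt (x : 'rV[R]_n) := forall i : 'I_n, i = 0%N :> nat -> 0 < x 0 i.

Definition local_max_at (f : S) (p : {x | A x}) :=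
  exists2 e : R, 0 < e & forall q : {x | A x}, `|sval q - sval p| < e -> ev q f <= ev p f.

End ChartGeometry.

(** * Maximum principles *)

Section SquareNorm.
Variables (R : realType) (n : nat).
Implicit Types x y z : 'rV[R]_n.

(** The norm of row vectors is the sup norm, which governs the topology, while [sqnorm] is
    Euclidean; this lemma and the next translate between their balls. *)
Lemma sqnorm_norm x (r : R) : 0 < r -> sqnorm x < r ^+ 2 -> `|x| < r.
Proof.
move=> r0 h; apply: (norm_lt_coord r0) => i.
rewrite -(ltr_pXn2r (n := 2)) ?nnegrE ?normr_ge0 ?(ltW r0) //.
apply: le_lt_trans h; rewrite real_normK ?num_real // /sqnorm (bigD1 i) //= lerDl.
by apply: sumr_ge0 => j _; exact: sqr_ge0.
Qed.

Lemma norm_sqnorm x (r : R) : 0 < r -> `|x| < r / n.+1%:R -> sqnorm x < r ^+ 2.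
Proof.
move=> r0 h; set e := r / n.+1%:R in h.
have n0 : 0 < n.+1%:R :> R by rewrite ltr0n.
have e0 : 0 < e by rewrite divr_gt0.
have le_e i : x 0 i ^+ 2 <= e ^+ 2.
  rewrite -[x 0 i ^+ 2]real_normK ?num_real // ler_pXn2r ?nnegrE ?(ltW e0) //.
  exact: le_trans (coord_le_norm x i) (ltW h).
have re : r = n.+1%:R * e by rewrite /e mulrC divfK // gt_eqF.
apply: (@le_lt_trans _ _ (n%:R * e ^+ 2)).
  rewrite -[n in n%:R]card_ord -sumr_const mulr_suml.
  by apply: ler_sum => i _; rewrite mul1r.
rewrite re [ltRHS]exprMn ltr_pM2r ?exprn_gt0 // -natrX ltr_nat.
by rewrite (leq_trans (ltnSn n)) // -[n.+1]expn1 leq_pexp2l.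
Qed.

Lemma sqnorm_gt0 x : x != 0 -> 0 < sqnorm x.
Proof. by move=> x0; rewrite lt_neqAle sqnorm_ge0 eq_sym sqnorm_eq0 x0. Qed.

Lemma norm_le_sqnorm x : `|x| ^+ 2 <= sqnorm x.
Proof.
have [->|x0] := eqVneq x 0; first by rewrite normr0 expr0n sqnorm_ge0.
have s0 := sqnorm_gt0 x0.
rewrite leNgt; apply/negP => h.
have nx : 0 < `|x| by rewrite normr_gt0.
by have := sqnorm_norm nx h; rewrite ltxx.
Qed.

(** The median form of the parallelogram law; it makes the ball with diameter from [y] to [z] touch
    the larger ball around [y] at [z] only. *)
Lemma sqnorm_mid x y z : sqnorm (x - 2^-1 *: (y + z)) =
  2^-1 * sqnorm (x - y) + 2^-1 * sqnorm (x - z) - 4^-1 * sqnorm (z - y).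
Proof.
rewrite /sqnorm !mulr_sumr -big_split -sumrB; apply: eq_bigr => i _.
by rewrite !mxE /=; field.
Qed.

Lemma sqnorm_cont : continuous (@sqnorm R n).
Proof.
move=> x; have : Ck_on 0 setT (@sqnorm R n).
  apply: Ck_on_sum => [|i _]; first exact: openT.
  by apply: (Ck_on_mul openT (Ck_on_coord 0 i openT) (Ck_on_coord 0 i openT)).
by move/Ck_on_cont => h; exact: h.
Qed.

Lemma subr_cont x : continuous (fun y : 'rV[R]_n => y - x).
Proof.
move=> y; have h : {for y, continuous (fun z : 'rV[R]_n => z)} by exact: cvg_id.
exact: (continuousB h (@cst_continuous _ _ x y)).
Qed.

Lemma dist_cont x : continuous (fun y : 'rV[R]_n => `|y - x|).
Proof.
move=> y; apply: (@continuous_comp _ _ _ (fun y => y - x) Num.norm); first exact: subr_cont.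
exact: norm_continuous.
Qed.

Lemma sqdist_cont x : continuous (fun y : 'rV[R]_n => sqnorm (y - x)).
Proof.
move=> y; apply: (@continuous_comp _ _ _ (fun y => y - x) (@sqnorm R n)); first exact: subr_cont.
exact: sqnorm_cont.
Qed.

Lemma closed_cube_compact x (r : R) : compact [set y : 'rV[R]_n | `|y - x| <= r].
Proof.
apply: bounded_closed_compact.
  exists (`|x| + r); split; first exact: num_real.
  move=> M hM y /= hy; rewrite -[y](subrK x); apply: le_trans (ler_normD _ _) _.
  by rewrite addrC; apply: ltW; apply: le_lt_trans hM; rewrite lerD2l.
have -> : [set y : 'rV[R]_n | `|y - x| <= r] = (fun y => `|y - x|) @^-1` [set t | t <= r] by [].
apply: closed_comp; last exact: closed_le.
by move=> y _; exact: dist_cont.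
Qed.

End SquareNorm.

Section Drift.
Variables (S : comPzRingType) (n : nat) (d : 'I_n -> S -> S).
Variables (G Gi : 'M[S]_n) (Gam : 'I_n -> 'M[S]_n).
Hypothesis lc : levi_civita d G Gi Gam.
Variable u : S.

Let hd := lc_der lc.

(** The weighted Laplacian of the maximum principle, multiplied by [u] so that it makes sense where
    [u] vanishes. *)
Definition drift (F : S) : S :=
  u * laplace d Gi Gam F - \sum_a grad_vec d Gi u a 0 * d a F.

Lemma driftD F H : drift (F + H) = drift F + drift H.
Proof.
rewrite /drift (laplaceD lc).
rewrite (eq_bigr (fun a => grad_vec d Gi u a 0 * d a F + grad_vec d Gi u a 0 * d a H)).
  by rewrite big_split /= mulrDr opprD addrACA.
by move=> a _; rewrite (der_add hd) mulrDr.
Qed.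

Let derZ c a f : (forall a, d a c = 0) -> d a (c * f) = c * d a f.
Proof. by move=> dc; rewrite (der_mul hd) dc mul0r add0r. Qed.

Lemma hessZ c F : (forall a, d a c = 0) -> hess d Gam (c * F) = c *: hess d Gam F.
Proof.
move=> dc; apply/matrixP => a b; rewrite mxE [RHS]mxE [hess _ _ F _ _]mxE !derZ // mulrBr; congr (_ - _).
by rewrite !mulmxE mulr_sumr; apply: eq_bigr => e _; rewrite !grad_colE derZ // mulrCA.
Qed.

Lemma sqgradZ c F : (forall a, d a c = 0) -> sqgrad d Gi (c * F) = c ^+ 2 * sqgrad d Gi F.
Proof.
move=> dc; have e : grad_col d (c * F) = c *: grad_col d F.
  by apply/matrixP => a j; rewrite (ord1 j) scalemxE !grad_colE derZ.
by rewrite /sqgrad e trmx_scale -!scalemxAl -scalemxAr !scalemxE mulrA expr2.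
Qed.

Lemma driftZ c F : (forall a, d a c = 0) -> drift (c * F) = c * drift F.
Proof.
move=> dc; rewrite /drift /laplace hessZ // -scalemxAr mxtraceZ mulrBr mulrCA; congr (_ - _).
by rewrite mulr_sumr; apply: eq_bigr => a _; rewrite derZ // mulrCA.
Qed.

Lemma drift_sq s : drift (s * s) = 2%:R * s * drift s + 2%:R * u * sqgrad d Gi s.
Proof.
rewrite /drift (laplace_sq lc).
rewrite (eq_bigr (fun a => 2%:R * s * (grad_vec d Gi u a 0 * d a s))).
  by rewrite -mulr_sumr; ring.
by move=> a _; rewrite (der_mul hd); ring.
Qed.

End Drift.

Section MaximumPrinciple.
Variables (R : realType) (n : nat) (A : set 'rV[R]_n) (G : 'rV[R]_n -> 'M[R]_n).
Hypotheses (hA : rel_open A) (hG : chart_metric_on A G).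

Local Notation S := (sfun A).
Local Notation d := (sder hA).
Local Notation lap := (laplace d (s_inv hG) (s_gam hA hG)).

Lemma interior_pt_open : open [set x : 'rV[R]_n | interior_pt x].
Proof.
rewrite openE => x hx; rewrite /interior.
apply: (near_forall (P := fun (i : 'I_n) (y : 'rV[R]_n) => i = 0%N :> nat -> 0 < y 0 i)) => i.
have [i0|i0] := eqVneq (i : nat) 0%N; last first.
  by apply: (@nearS _ x (fun=> True)) => [y _ /eqP|]; [rewrite (negbTE i0)|exact: filterT].
have c : {for x, continuous (fun y : 'rV[R]_n => y 0 i)} by exact: coord_continuous.
have := c [set t | 0 < t] _; rewrite /= => h; apply: nearS (h _); first by move=> y.
by apply: open_nbhs_nbhs; split; [exact: open_gt|exact: hx].
Qed.

Lemma interior_half_space (x : 'rV[R]_n) : interior_pt x -> half_space x.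
Proof. by move=> h i i0; exact: ltW (h i i0). Qed.

Lemma interior_near (x : 'rV[R]_n) : A x -> interior_pt x ->
  \forall y \near x, A y /\ interior_pt y.
Proof.
move: hA => [W oW AE]; rewrite AE => -[Wx _] ix.
have h1 : \forall y \near x, W y by exact: open_nbhs_nbhs.
have h2 : \forall y \near x, interior_pt y.
  by apply: (@open_nbhs_nbhs _ x [set y | interior_pt y]); split; first exact: interior_pt_open.
by apply: nearS (nearI h1 h2) => y [Wy iy]; split=> //; split=> //; exact: interior_half_space.
Qed.

Lemma ext_cont (f : S) x : A x -> interior_pt x -> {for x, continuous (ext (sfun_val f))}.
Proof.
move=> Ax ix; have [U [F [oU Ux cF e]]] := sfun_smooth f Ax.
apply: cont_near (Cinf_cont cF Ux).
have hU : \forall y \near x, U y by exact: open_nbhs_nbhs.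
by apply: nearS (nearI hU (interior_near Ax ix)) => y [Uy [Ay _]]; exact: e.
Qed.

Lemma ev_cont (f : S) p (e : R) : 0 < e ->
  exists2 r : R, 0 < r & forall q, `|sval q - sval p| < r -> `|ev q f - ev p f| < e.
Proof.
case: p => x Ax e0; have [U [F [oU Ux cF eF]]] := sfun_smooth f Ax.
have h1 : \forall y \near x, U y by exact: open_nbhs_nbhs.
have h2 : \forall y \near x, `|F y - F x| < e.
  have := Cinf_cont cF Ux; move/cvgr_dist_lt => /(_ e e0).
  by apply: nearS => y; rewrite distrC.
have /nbhs_ballP[r r0 hr] := nearI h1 h2.
exists r => // -[y Ay] /= yr.
have [Uy] : U y /\ `|F y - F x| < e by apply: hr; rewrite -ball_normE /= distrC.
by rewrite (eF y Ay Uy) (eF x Ax Ux) !extE.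
Qed.

(** At a critical point the Christoffel terms of the Hessian drop out, so it is the matrix of second
    partial derivatives; being nonpositive, it has nonpositive trace against the inverse metric. *)
Lemma interior_max (f : S) p : interior_pt (sval p) -> local_max_at f p ->
  (forall a, ev p (d a f) = 0) /\ ev p (lap f) <= 0.
Proof.
move: p => -[x Ax] /= ix [e e0 hmax].
have [U [F [oU Ux cF eF dF]]] := sder_local hA f Ax.
pose V : set 'rV[R]_n := ((U `&` [set y | A y /\ interior_pt y]) `&` ball x e)°.
have oV : open V by exact: open_interior.
have VU y : V y -> [/\ U y, A y & `|y - x| < e].
  by move=> /interior_subset[[Uy [Ay _]]]; rewrite -ball_normE /= distrC.
have Vx : V x.
  have h1 : \forall y \near x, U y by exact: open_nbhs_nbhs.
  have h2 : \forall y \near x, ball x e y by exact: nbhsx_ballx.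
  by apply: nearS (nearI (nearI h1 (interior_near Ax ix)) h2) => y.
have cFV : Ck_on 2 V F by apply: Ck_on_sub (cF 2%N) => y /VU[].
have [D1 D2] := second_order_test oV cFV Vx (fun y Vy => ltac:(
  have [Uy Ay ye] := VU y Vy; rewrite (eF y Ay Uy) (eF x Ax Ux) !extE;
  exact: (hmax (exist _ y Ay) ye))).
have d1 a : ev (exist _ x Ax) (d a f) = 0 by rewrite ev_sder /= dF // D1.
split=> //.
rewrite /laplace -trace_map_mx map_mxM ev_inv; apply: trace_inv_le0.
- exact: (cm_sym hG Ax).
- exact: (cm_pos hG Ax).
move=> v; apply: le_trans (D2 v).
rewrite le_eqVlt; apply/orP; left; apply/eqP.
rewrite mxE exchange_big; apply: eq_bigr => j _ /=.
rewrite !mxE mulr_suml; apply: eq_bigr => i _; rewrite mxE.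
have -> : ev (exist _ x Ax) (hess d (s_gam hA hG) f i j) = 'D_(evec R i) ('D_(evec R j) F) x.
  rewrite /hess mxE evD evN mulmxE ev_sum.
  rewrite big1 => [|c _]; last by rewrite evM grad_colE d1 mulr0.
  rewrite oppr0 addr0 ev_sder /=.
  apply: (pd_ext i hA oU (Ck_on_derive (cF 2%N) j) Ax Ux) => y Ay Uy.
  by rewrite extE -dF.
by rewrite mulrAC.
Qed.

Definition s_cst (c : R) : S := mk_sfun (@smooth_on_cst R n A c).
Definition s_coord i : S := mk_sfun (@smooth_on_coord R n A i).

Lemma ev_cst p c : ev p (s_cst c) = c. Proof. by []. Qed.
Lemma ev_coord p i : ev p (s_coord i) = sval p 0 i. Proof. by []. Qed.

Lemma der_cst a c : d a (s_cst c) = 0.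
Proof.
apply: sfun_ext => -[x Ax]; rewrite ev_sder_mk ev0 /=.
rewrite (pd_ext a hA openT (Ck_on_cst 1 setT c) Ax) ?derive_cst //.
Qed.

Lemma der_coord a i : d a (s_coord i) = (a == i)%:R.
Proof.
apply: sfun_ext => -[x Ax]; rewrite ev_sder_mk /=.
rewrite (pd_ext a hA openT (Ck_on_coord 1 i openT) Ax) //.
have [_ ->] := is_derive_coord x a i.
by case: (a == i); rewrite ?ev1 ?ev0.
Qed.

Let hd := sder_derivations hA.

Local Notation drift_op := (drift d (s_inv hG) (s_gam hA hG)).

Lemma drift_op_interior_max u f p : interior_pt (sval p) -> 0 <= ev p u -> local_max_at f p ->
  ev p (drift_op u f) <= 0.
Proof.
move=> ip u0 /(interior_max ip)[d0 l0].
have e : ev p (\sum_a grad_vec d (s_inv hG) u a 0 * d a f) = 0.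
  by rewrite ev_sum; apply: big1 => a _; rewrite evM d0 mulr0.
by rewrite /drift evD evN e evM subr0 mulr_ge0_le0.
Qed.

Lemma sqgrad_gt0 s p a : ev p (d a s) != 0 -> 0 < ev p (sqgrad d (s_inv hG) s).
Proof.
move=> h.
have -> : ev p (sqgrad d (s_inv hG) s) = ((map_mx (ev p) (grad_col d s))^T *m invmx (G (sval p)) *m
   map_mx (ev p) (grad_col d s)) 0 0.
  by rewrite -(ev_inv hG) matrix.map_trmx -!map_mxM mxE.
apply: inv_form_gt0.
- exact: (cm_sym hG (svalP p)).
- exact: (cm_pos hG (svalP p)).
by apply: contra_neq h => /matrixP/(_ a 0); rewrite !mxE.
Qed.

(** At a zero of [s] the square adds 2 K u |Ds|^2 to the drift of [s], so a large [K] makes the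
    total positive; (1 - a) / b makes it 1. *)
Lemma drift_barrier (u s : S) p : ev p s = 0 -> 0 < ev p u ->
  0 < ev p (sqgrad d (s_inv hG) s) ->
  exists K, 0 < ev p (drift_op u (s + s_cst K * (s * s))).
Proof.
move=> s0 u0 g0; set a := ev p (drift_op u s); set b := 2 * ev p u * ev p (sqgrad d (s_inv hG) s).
have b0 : 0 < b by rewrite mulr_gt0 // mulr_gt0.
exists ((1 - a) / b).
rewrite (driftD (s_lc hA hG)) (driftZ (s_lc hA hG)) => [|e]; last exact: der_cst.
rewrite (drift_sq (s_lc hA hG)) [ev p (_ + _)]evD -/a !evM evD !evM s0 mulr0 mul0r add0r ev_cst.
have -> : ev p 2%:R = 2 :> R by rewrite rmorph_nat.
by rewrite -/b divfK ?gt_eqF // addrC subrK.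
Qed.

(* Hopf's argument: if the contact set were not open it would contain a point [z0] nearest to a
   nearby non-contact point [y]; the ball over the midpoint touches the contact set at [z0] only,
   so adding a small multiple of a barrier positive inside that ball produces an interior maximum
   at which the operator is positive. *)
Lemma strong_max (u F : S) m (p : {x | A x}) : interior_pt (sval p) ->
  (forall q, interior_pt (sval q) -> 0 < ev q u) ->
  (forall q, interior_pt (sval q) -> 0 <= ev q (drift_op u F)) ->
  (forall q, ev q F <= m) -> ev p F = m ->
  exists2 e : R, 0 < e & forall q, `|sval q - sval p| < e -> ev q F = m.
Proof.
move: p => -[p Ap] /= ip u0 LF Fm Fp.
have /nbhs_ballP[r4 r40 hr4] := interior_near Ap ip.
(* The contact point [z0] will lie within 2 r of [p], and the cube [Q] around it has half-width
   below r, so everything happens within 3 r. *)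
pose r := r4 / 4.
have r0 : 0 < r by rewrite divr_gt0.
have hr x : `|x - p| <= 3 * r -> A x /\ interior_pt x.
  move=> h; apply: hr4; rewrite -ball_normE /= distrC; apply: le_lt_trans h _.
  by have -> : r4 = 4 * r; [rewrite /r mulrC divfK|rewrite ltr_pM2r // ltr_nat].
exists (r / n.+1%:R); first by rewrite divr_gt0.
move=> -[y Ay] /= yp; apply/eqP/negPn/negP => Fy.
have syp : sqnorm (p - y) < r ^+ 2 by apply: norm_sqnorm => //; rewrite distrC.
pose K := [set x : 'rV[R]_n | `|x - p| <= 3 * r].
have cK : compact K by exact: closed_cube_compact.
have FK x : K x -> {for x, continuous (ext (sfun_val F))}.
  by move=> /hr[Ax ix]; exact: ext_cont.
pose Z := K `&` [set x | ext (sfun_val F) x = m].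
have kK : closed K by apply: compact_closed cK; exact: norm_hausdorff.
have cZ : compact Z.
  apply: (@subclosed_compact _ Z K) => //; last by move=> x [].
  move=> x hx; have Kx : K x by apply: kK => B /hx[t [[Kt _] Bt]]; exists t.
  split=> //; apply/eqP/negPn/negP => ne.
  have Ax := (hr x Kx).1.
  have lt : ext (sfun_val F) x < m by rewrite lt_neqAle ne extE Fm.
  have : \forall t \near x, ext (sfun_val F) t < m.
    by have := FK x Kx; move/cvgr_lt; apply.
  by move/hx => [t [[_ /= ->]]]; rewrite ltxx.
have Zp : Z p.
  by split; [rewrite /K /= subrr normr0 mulr_ge0 // ltW|rewrite /= extE].
have [z0 /set_mem Zz0 zmin] : exists2 c, c \in Z & forall t, t \in Z -> sqnorm (c - y) <= sqnorm (t - y).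
  apply: (@EVT_min_rV R n (fun x => sqnorm (x - y)) Z) => //; first by exists p.
  by apply: continuous_subspaceT; exact: sqdist_cont.
have {}zmin t : Z t -> sqnorm (z0 - y) <= sqnorm (t - y) by move=> Zt; apply: zmin; rewrite inE.
move: Zz0 => [Kz0 /= Fz0].
have [Az0 iz0] := hr z0 Kz0.
have z0y : z0 - y != 0.
  apply: contra_neq Fy => /eqP; rewrite subr_eq0 => /eqP e.
  by rewrite -Fz0 e extE.
have z0p : `|z0 - p| < 2 * r.
  have e1 : `|z0 - y| < r by apply: sqnorm_norm => //; exact: le_lt_trans (zmin p Zp) syp.
  have e2 : `|p - y| < r by exact: sqnorm_norm.
  have := ler_distD y z0 p; rewrite (distrC y p); lra.
set rho := sqnorm (z0 - y).
have rho0 : 0 < rho by exact: sqnorm_gt0.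
(* [s] is positive exactly inside the Euclidean ball with diameter from [y] to [z0], whose squared
   radius is [rho / 4]. *)
pose y' := 2^-1 *: (y + z0).
pose s : S := s_cst (rho / 4) - \sum_i (s_coord i - s_cst (y' 0 i)) * (s_coord i - s_cst (y' 0 i)).
have evs q : ev q s = rho / 4 - sqnorm (sval q - y').
  rewrite evD evN ev_cst ev_sum; congr (_ - _); apply: eq_bigr => i _.
  by rewrite evM evD evN ev_coord ev_cst !mxE expr2.
(* Contact points are at squared distance at least [rho] from [y]; by [sqnorm_mid] the ball of [s]
   stays away from them quadratically, except at [z0]. *)
have sZ q : Z (sval q) -> ev q s <= - (2^-1 * sqnorm (sval q - z0)).
  move=> /zmin; rewrite evs /y' sqnorm_mid -/rho => h.
  by have := sqnorm_ge0 (sval q - z0); lra.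
pose q0 : {x | A x} := exist _ z0 Az0.
have s0 : ev q0 s = 0.
  by rewrite evs /y' sqnorm_mid /= subrr sqnorm0 -/rho; field.
have [a ha] : exists a, ev q0 (d a s) != 0.
  have [a ha] : exists a, (z0 - y) 0 a != 0.
    apply/existsP; apply: contraNT z0y; rewrite negb_exists => /forallP h.
    by apply/eqP/rowP => a; rewrite [RHS]mxE; apply/eqP/negPn/h.
  exists a.
  have -> : d a s = - (2%:R * (s_coord a - s_cst (y' 0 a))).
    rewrite /s (der_add hd) (derN hd) der_cst add0r (der_sum hd); congr (- _).
    rewrite (bigD1 a) //= big1 => [|i ia].
      rewrite (der_mul hd) (der_add hd) (derN hd) der_cst der_coord eqxx oppr0 addr0.
      by rewrite addr0 mulr_natl mulr1 mul1r mulr2n.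
    rewrite (der_mul hd) (der_add hd) (derN hd) der_cst der_coord eq_sym (negbTE ia).
    by rewrite oppr0 addr0 mul0r mulr0 addr0.
  rewrite evN evM oppr_eq0 mulf_neq0 ?rmorph_nat ?pnatr_eq0 //.
  rewrite evD evN ev_coord ev_cst /= /y' !mxE.
  by move: ha; rewrite !mxE; apply: contra_neq => e; lra.
have [c hc] := drift_barrier s0 (u0 q0 iz0) (sqgrad_gt0 ha).
set h := s + s_cst c * (s * s) in hc.
have evh q : ev q h = ev q s + c * (ev q s * ev q s) by [].
have h0 : ev q0 h = 0 by rewrite evD !evM s0 !mulr0 addr0.
have cs0 : ev q0 (s_cst c * s) = 0 by rewrite evM s0 mulr0.
have [d1 d10 hd1] := ev_cont (drift_op u h) q0 hc.
have [d2 d20 hd2] := ev_cont h q0 ltr01.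
have half0 : 0 < 2^-1 :> R by rewrite invr_gt0.
have [d3 d30 hd3] := ev_cont (s_cst c * s) q0 half0.
pose del := Num.min (Num.min d1 d2) (Num.min d3 r) / 2.
have del0 : 0 < del by rewrite divr_gt0 // !lt_min d10 d20 d30 r0.
have [l1 l2 l3 l4] : [/\ del < d1, del < d2, del < d3 & del < r].
  have e : del < Num.min (Num.min d1 d2) (Num.min d3 r).
    by rewrite /del; move: del0; rewrite /del; lra.
  by move: e; rewrite !lt_min => /andP[/andP[-> ->] /andP[-> ->]].
pose Q := [set x : 'rV[R]_n | `|x - z0| <= del].
have QK x : Q x -> K x.
  by move=> hx; have := ler_distD z0 x p; move: hx; rewrite /Q /K /=; lra.
have hQ x (Ax : A x) : Q x -> [/\ 0 < ev (exist _ x Ax) (drift_op u h),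
    `|ev (exist _ x Ax) h| < 1 & `|ev (exist _ x Ax) (s_cst c * s)| < 2^-1].
  move=> Qx; have Qx' e : del < e -> `|x - z0| < e by move=> le; exact: le_lt_trans Qx le.
  have := hd1 (exist _ x Ax) (Qx' _ l1); have := hd2 (exist _ x Ax) (Qx' _ l2).
  have := hd3 (exist _ x Ax) (Qx' _ l3); rewrite h0 cs0 !subr0 => -> -> h1.
  split=> //; move: h1; rewrite ltr_norml => /andP[h1 _]; lra.
have cQ : compact Q by exact: closed_cube_compact.
have cont_Q (f : S) : {within Q, continuous (ext (sfun_val f))}.
  apply: (@continuous_in_subspaceT _ _ Q) => x /set_mem /QK /hr[Ax ix]; exact: ext_cont.
(* The part of the boundary of the cube where the barrier is nonnegative. A contact point there
   would have [s] negative and |c s| < 1/2, hence a negative barrier. *)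
pose Bd := Q `&` [set x | del <= `|x - z0|] `&` [set x | 0 <= ext (sfun_val h) x].
have BdF x : Bd x -> ext (sfun_val F) x < m.
  move=> [[Qx /= dx] hx]; have [Ax ix] := hr x (QK x Qx).
  rewrite lt_neqAle extE Fm andbT; apply/negP => /eqP Fx.
  have Zx : Z x by split; [exact: QK|rewrite /= extE].
  have sx := sZ (exist _ x Ax) Zx; rewrite /= in sx.
  have sq0 : 0 < sqnorm (x - z0).
    by apply: sqnorm_gt0; rewrite -normr_gt0; exact: lt_le_trans dx.
  have [_ _] := hQ x Ax Qx; rewrite evM ev_cst ltr_norml => /andP[k1 k2].
  move: hx; rewrite /= (ext_ev h Ax) evh.
  move: (ev _ s) sx k1 k2 => t; move: (sqnorm _) sq0 => w w0 tw k1 k2 tt.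
  have t0 : t < 0 by lra.
  have : t * (1 + c * t) < 0 by rewrite nmulr_rlt0 //; lra.
  lra.
have [eta eta0 hBd] : exists2 eta, 0 < eta & forall x, Bd x -> ext (sfun_val F) x <= m - eta.
  have [[x Bx]|nB] := pselect (Bd !=set0); last first.
    by exists 1 => // x Bx; exfalso; apply: nB; exists x.
  have cB : compact Bd.
    apply: (@subclosed_compact _ Bd Q) => //; last by move=> t [[]].
    have kQ : closed Q by apply: compact_closed cQ; exact: norm_hausdorff.
    move=> t ht; have Qt : Q t by apply: kQ => B /ht[w [[[Qw _] _] Bw]]; exists w.
    have [At it] := hr t (QK t Qt).
    split; first split=> //.
      rewrite /= leNgt; apply/negP => lt.
      have : \forall w \near t, `|w - z0| < del.
        have cn : {for t, continuous (fun w : 'rV[R]_n => `|w - z0|)} by exact: dist_cont.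
        by have := cn; move/cvgr_lt; apply.
      by move/ht => [w [[[_ /= k1] _]]]; rewrite ltNge k1.
    rewrite /= leNgt; apply/negP => lt.
    have : \forall w \near t, ext (sfun_val h) w < 0.
      by have := @ext_cont h t At it; move/cvgr_lt; apply.
    by move/ht => [w [[_ /= k1]]]; rewrite ltNge k1.
  have [b /set_mem Bb bmax] : exists2 b, b \in Bd & forall t, t \in Bd ->
      ext (sfun_val F) t <= ext (sfun_val F) b.
    apply: EVT_max_rV => //; first by exists x.
    by apply: continuous_subspaceW (cont_Q F) => t [[]].
  exists (m - ext (sfun_val F) b); first by rewrite subr_gt0; exact: BdF.
  by move=> t Bt; rewrite opprB addrC subrK; apply: bmax; rewrite inE.
(* On the boundary of the cube [gg] is below [m]: where h >= 0 because F <= m - eta and |h| < 1,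
   elsewhere because h < 0. As [gg] equals [m] at [z0], its maximum over the cube is interior. *)
pose gg : S := F + s_cst (eta / 2) * h.
have evg q : ev q gg = ev q F + eta / 2 * ev q h by [].
have [x1 /set_mem Qx1 x1max] : exists2 b, b \in Q & forall t, t \in Q ->
      ext (sfun_val gg) t <= ext (sfun_val gg) b.
  apply: EVT_max_rV => //; first by exists z0; rewrite /Q /= subrr normr0 ltW.
have [Ax1 ix1] := hr x1 (QK x1 Qx1).
have gm : m <= ev (exist _ x1 Ax1) gg.
  have := x1max z0; rewrite (ext_ev gg Az0) (ext_ev gg Ax1) evg -/q0 h0 mulr0 addr0.
  have -> : ev q0 F = m by rewrite -Fz0 extE.
  by apply; rewrite inE /Q /= subrr normr0 ltW.
have [_ hh _] := hQ x1 Ax1 Qx1.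
have x1d : `|x1 - z0| < del.
  rewrite ltNge; apply/negP => dx.
  have [k0|k0] := leP 0 (ev (exist _ x1 Ax1) h).
    have Bx1 : Bd x1 by split=> //; rewrite /= (ext_ev h Ax1).
    have := hBd x1 Bx1; rewrite (ext_ev F Ax1).
    by move: gm; rewrite evg; move: hh; rewrite ltr_norml => /andP[_ k1] k2 k3; nra.
  by have := Fm (exist _ x1 Ax1); move: gm; rewrite evg => k1 k2; nra.
have lmax : local_max_at gg (exist _ x1 Ax1).
  exists (del - `|x1 - z0|); first by rewrite subr_gt0.
  move=> -[t At] /= ht.
  have := x1max t; rewrite !extE; apply; rewrite inE /Q /=.
  by have := ler_distD x1 t z0; lra.
have := @drift_op_interior_max u gg (exist _ x1 Ax1) ix1 (ltW (u0 (exist _ x1 Ax1) ix1)) lmax.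
rewrite (driftD (s_lc hA hG)) (driftZ (s_lc hA hG)) => [|e]; last exact: der_cst.
rewrite evD evM ev_cst => k.
have [k1 _ _] := hQ x1 Ax1 Qx1; have k2 := LF (exist _ x1 Ax1) ix1.
by nra.
Qed.

End MaximumPrinciple.

(** * Change of chart *)

(** Such a [P] is open and closed in [C]. Stating it relative to [C] lets it serve intervals,
    components of the boundary and the whole manifold. *)
Lemma connected_const (T : topologicalType) (C P : set T) p0 : connected C -> C p0 -> P p0 ->
  (forall p, C p -> \forall q \near p, C q -> (P q <-> P p)) -> forall p, C p -> P p.
Proof.
move=> cC Cp0 Pp0 loc p Cp.
suff e : C `&` P = C by have [] : (C `&` P) p by rewrite e.
apply: cC.
- by exists p0.
- exists ([set q | C q -> P q]°); first exact: open_interior.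
  apply/seteqP; split=> q [Cq h]; split=> //.
    by apply: nearS (loc q Cq) => r hr Cr; apply/(hr Cr).
  by apply: (interior_subset h).
- exists (~` ([set q | C q -> ~ P q]°)); first by apply: open_closedC; exact: open_interior.
  apply/seteqP; split=> q [Cq h]; split=> //.
    by move=> /interior_subset/(_ Cq); apply.
  apply: contrapT => nP; apply: h.
  by apply: nearS (loc q Cq) => r hr Cr /(hr Cr).
Qed.

Lemma ext_sval (R : realType) n (A : set 'rV[R]_n) (f : sfun A) (p : {x | A x}) :
  ext (sfun_val f) (sval p) = ev p f.
Proof. by case: p => x Ax; exact: ext_ev. Qed.

Section Pull.
Variables (R : realType) (n : nat) (A B : set 'rV[R]_n) (T : 'rV[R]_n -> 'rV[R]_n).
Hypotheses (hA : rel_open A) (hB : rel_open B).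
Hypothesis hT : forall x, A x -> B (T x).
Hypothesis sT : forall b, smooth_on A (fun x => T x 0 b).

Lemma pd_comp (f : 'rV[R]_n -> R) a x : smooth_on B f -> A x ->
  pd a (fun y => f (T y)) x = \sum_c pd a (fun y => T y 0 c) x * pd c f (T x).
Proof.
move=> sf Ax; have [V [F [oV Vx cF eF]]] := sf _ (hT Ax).
have /choice[U hU] : forall b, exists U : set 'rV[R]_n * ('rV[R]_n -> R),
    [/\ open U.1, U.1 x, Cinf_on U.1 U.2 & forall y, A y -> U.1 y -> U.2 y = T y 0 b].
  by move=> b; have [U [H [oU Ux cH eH]]] := sT b Ax; exists (U, H).
pose T' y : 'rV[R]_n := \row_b (U b).2 y.
have T'x : T' x = T x by apply/rowP => b; rewrite mxE; have [_ Ux _ ->] := hU b.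
pose W := ([set y | forall b, (U b).1 y] `&` [set y | V (T' y)])°.
have oW : open W by exact: open_interior.
have WU y : W y -> (forall b, (U b).1 y) /\ V (T' y) by move=> /interior_subset.
have nU : \forall y \near x, forall b, (U b).1 y.
  by apply: near_forall => b; have [oU Ux _ _] := hU b; exact: open_nbhs_nbhs.
have Wx : W x.
  apply: (nearI nU).
  have c : {for x, continuous T'}.
    apply: rV_cont => b; have [oU Ux cU _] := hU b.
    have -> : (fun y => T' y 0 b) = (U b).2 by apply/funext => y; rewrite mxE.
    exact: (Cinf_cont cU Ux).
  by apply: c; rewrite T'x; exact: open_nbhs_nbhs.
have cT b : Ck_on 1 W (fun y => T' y 0 b).
  have [_ _ cU _] := hU b; apply: (@Ck_on_eq _ _ _ _ (U b).2) => // [y _|]; first by rewrite mxE.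
  by apply: Ck_on_sub (cU 1%N) => y /WU[h _]; exact: h.
have cFT : Ck_on 1 W (fun y => F (T' y)).
  by apply: (@Ck_on_comp _ _ _ _ W V) => // y /WU[].
have eT y : A y -> W y -> T' y = T y.
  by move=> Ay /WU[Uy _]; apply/rowP => b; rewrite mxE; have [_ _ _ ->] := hU b.
rewrite (pd_ext a hA oW cFT Ax Wx); last first.
  by move=> y Ay Wy; have [_ Vy] := WU y Wy; rewrite eT // eF //; [exact: hT|rewrite -eT].
have dT b : derivable (fun y => T' y 0 b) x (evec R a).
  exact: (@Ck_on_derivable R n 0 W _ (cT b) a x Wx).
have VT'x : V (T' x) by rewrite T'x.
have [_ ->] := chain_rule oV (cF 1%N) VT'x dT.
apply: eq_bigr => c _; rewrite T'x; congr (_ * _).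
  by rewrite (pd_ext a hA oW (cT c) Ax Wx) // => y Ay Wy; rewrite eT.
by rewrite (pd_ext c hB oV (cF 1%N) (hT Ax) Vx).
Qed.

Definition jac : 'rV[R]_n -> 'M[R]_n := jacobian_mx T.

Lemma pull_smooth (f : sfun B) : smooth_on A (fun x => ext (sfun_val f) (T x)).
Proof. exact: smooth_on_comp hT sT (sfun_smooth f). Qed.

Definition pullS (f : sfun B) : sfun A := mk_sfun (pull_smooth f).

Definition pull_pt (p : {x | A x}) : {x | B x} := exist _ (T (sval p)) (hT (svalP p)).

Lemma ev_pullS p f : ev p (pullS f) = ev (pull_pt p) f.
Proof. by rewrite ev_mk (ext_ev _ (hT (svalP p))). Qed.

Lemma map_pullS p k l (M : 'M[sfun B]_(k, l)) :
  map_mx (ev p) (map_mx pullS M) = map_mx (ev (pull_pt p)) M.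
Proof. by apply/matrixP => a b; rewrite [LHS]mxE [RHS]mxE -ev_pullS; congr (ev p _); rewrite mxE. Qed.

Lemma pullS_zmod : zmod_morphism pullS.
Proof. by move=> f h; apply: sfun_ext => p; rewrite evD evN !ev_pullS. Qed.

Lemma pullS_monoid : monoid_morphism pullS.
Proof. by split=> [|f h]; apply: sfun_ext => p; rewrite ?evM !ev_pullS. Qed.

HB.instance Definition _ := GRing.isZmodMorphism.Build (sfun B) (sfun A) pullS pullS_zmod.
HB.instance Definition _ := GRing.isMonoidMorphism.Build (sfun B) (sfun A) pullS pullS_monoid.

Definition s_jac : 'M[sfun A]_n := \matrix_(a, c) sder hA a (mk_sfun (sT c)).

Lemma ev_jac p : map_mx (ev p) s_jac = jac (sval p).
Proof. by apply/matrixP => a c; rewrite !mxE ev_sder_mk. Qed.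

Lemma pullS_chain a f : sder hA a (pullS f) = \sum_c s_jac a c * pullS (sder hB c f).
Proof.
apply: sfun_ext => p; rewrite ev_sder_mk ev_sum (pd_comp a (sfun_smooth f) (svalP p)).
by apply: eq_bigr => c _; rewrite evM ev_pullS mxE ev_sder_mk ev_sder.
Qed.

Lemma s_jac_closed a b c : sder hA a (s_jac b c) = sder hA b (s_jac a c).
Proof. by rewrite !mxE (der_comm (sder_derivations hA)). Qed.

Variables (GA GB : 'rV[R]_n -> 'M[R]_n).
Hypotheses (cA : chart_metric_on A GA) (cB : chart_metric_on B GB).
Hypothesis GJ : forall x, A x -> GA x = jac x *m GB (T x) *m (jac x)^T.

Lemma jac_unit x : A x -> jac x \in unitmx.
Proof.
move=> Ax; have := posdef_unit (cm_pos cA Ax); rewrite GJ // !unitmxE !det_mulmx.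
by rewrite !unitrM => /andP[/andP[]].
Qed.

(** Pointwise invertibility suffices, as the entries of the inverse are cofactors divided by a
    nowhere vanishing determinant. *)
Lemma s_unit (N : 'M[sfun A]_n) : (forall p, map_mx (ev p) N \in unitmx) ->
  exists Ni, N *m Ni = 1%:M.
Proof.
move=> u; have h a b : smooth_on A (fun x => invmx (\matrix_(i, j) ext (sfun_val (N i j)) x) a b).
  apply: (@closure_invmx _ R A (smooth_on A)).
  - by move=> f g fg hf; refine (smooth_on_eq fg hf).
  - by move=> c; exact: smooth_on_cst.
  - by move=> f g hf hg; exact: smooth_on_add.
  - by move=> f g hf hg; exact: smooth_on_mul.
  - by move=> f f0 hf; exact: smooth_on_inv.
  - move=> i j; apply: smooth_on_eq (sfun_smooth (N i j)) => y _; by rewrite mxE.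
  - move=> x Ax.
    suff -> : \matrix_(i, j) ext (sfun_val (N i j)) x = map_mx (ev (exist _ x Ax)) N by exact: u.
    by apply/matrixP => i j; rewrite !mxE (ext_ev _ Ax).
exists (\matrix_(a, b) mk_sfun (h a b)).
apply: ev_mx_inj => p; rewrite map_mxM map_mx1.
rewrite -[RHS](mulmxV (u p)); congr (_ *m _).
apply/matrixP => a b; rewrite [LHS]mxE.
have -> : (\matrix_(a, b) mk_sfun (h a b)) a b = mk_sfun (h a b) by rewrite mxE.
rewrite [LHS](_ : _ = invmx (\matrix_(i, j) ext (sfun_val (N i j)) (sval p)) a b) //.
congr (invmx _ _ _).
by apply/matrixP => i j; rewrite [LHS]mxE [RHS]mxE ext_sval.
Qed.

Lemma s_metric_pull : s_metric cA = s_jac *m map_mx pullS (s_metric cB) *m s_jac^T.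
Proof.
apply: ev_mx_inj => p; rewrite !map_mxM -matrix.map_trmx ev_jac ev_metric.
rewrite (GJ (svalP p)); congr (_ *m _ *m _).
by rewrite map_pullS ev_metric.
Qed.

Definition curvK (A' : set 'rV[R]_n) (h' : rel_open A') G' (c' : chart_metric_on A' G') : sfun A' :=
  curv_norm (sder h') (s_inv c') (s_gam h' c').

Lemma curvK_pull p : ev p (curvK hA cA) = ev (pull_pt p) (curvK hB cB).
Proof.
have uj q : map_mx (ev q) s_jac \in unitmx by rewrite ev_jac; exact: (jac_unit (svalP q)).
have [Ji hJ] := s_unit uj.
rewrite /curvK (curv_norm_pull (ex_half A) pullS_chain s_jac_closed hJ (s_lc hA cA) (s_lc hB cB)
  s_metric_pull).
exact: ev_pullS.
Qed.

Lemma sqgrad_pull p f : ev p (sqgrad (sder hA) (s_inv cA) (pullS f)) =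
  ev (pull_pt p) (sqgrad (sder hB) (s_inv cB) f).
Proof.
have evsq (A' : set 'rV[R]_n) (h' : rel_open A') G' (c' : chart_metric_on A' G') q (k : sfun A') :
    ev q (sqgrad (sder h') (s_inv c') k) = ((map_mx (ev q) (grad_col (sder h') k))^T *m
      invmx (G' (sval q)) *m map_mx (ev q) (grad_col (sder h') k)) 0 0.
  by rewrite -(ev_inv c') matrix.map_trmx -!map_mxM mxE.
rewrite !evsq.
have -> : map_mx (ev p) (grad_col (sder hA) (pullS f)) =
    jac (sval p) *m map_mx (ev (pull_pt p)) (grad_col (sder hB) f).
  rewrite -ev_jac; apply/matrixP => a j; rewrite !mxE pullS_chain ev_sum.
  by apply: eq_bigr => c _; rewrite !mxE evM ev_pullS.
have Ap := svalP p; have uJ := jac_unit Ap.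
have uB : GB (T (sval p)) \in unitmx by apply: posdef_unit; exact: (cm_pos cB (hT Ap)).
have uJT : (jac (sval p))^T \in unitmx by rewrite unitmx_tr.
have -> : invmx (GA (sval p)) = invmx (jac (sval p))^T *m invmx (GB (T (sval p))) *m invmx (jac (sval p)).
  have uA : GA (sval p) \in unitmx by apply: posdef_unit; exact: (cm_pos cA Ap).
  have e : GA (sval p) *m (invmx (jac (sval p))^T *m invmx (GB (T (sval p))) *m invmx (jac (sval p))) = 1%:M.
    by rewrite (GJ Ap) -!mulmxA mulKVmx // mulKVmx // mulmxV.
  by rewrite -[RHS](mulKmx uA) e mulmx1.
rewrite trmx_mul !mulmxA (mulmxKV uJ) -[_ *m _^T *m invmx _^T]mulmxA mulmxV // mulmx1.
by [].
Qed.

End Pull.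

(** * Manifolds with boundary *)

Section RestrictMetric.
Variables (R : realType) (n : nat) (A B : set 'rV[R]_n) (G : 'rV[R]_n -> 'M[R]_n).
Hypotheses (hA : rel_open A) (hB : rel_open B) (AB : A `<=` B).

Lemma chart_metric_on_sub : chart_metric_on B G -> chart_metric_on A G.
Proof.
case=> s1 s2 s3; split=> [a b|x /AB|x /AB]; [exact: smooth_on_sub (s1 a b)|exact: s2|exact: s3].
Qed.

Variables (cA : chart_metric_on A G) (cB : chart_metric_on B G).

Let sid b : smooth_on A (fun x => (id x) 0 b).
Proof. exact: smooth_on_coord. Qed.

Lemma jac_id x : A x -> jac (@id 'rV[R]_n) x = 1%:M.
Proof.
move=> Ax; rewrite -(ev_jac hA sid (exist _ x Ax)).
apply/matrixP => a b; rewrite [LHS]mxE [RHS]mxE.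
have -> : s_jac hA sid a b = (a == b)%:R.
  rewrite mxE -(der_coord hA); congr (sder hA a _); exact: val_inj.
by rewrite rmorph_nat.
Qed.

Let GJ x : A x -> G x = jac id x *m G (id x) *m (jac id x)^T.
Proof. by move=> Ax; rewrite jac_id // trmx1 mul1mx mulmx1. Qed.

(** Restriction is treated as pullback by the identity, whose Jacobian is the identity matrix. *)
Lemma curvK_sub x (Ax : A x) :
  ext (sfun_val (curvK hA cA)) x = ext (sfun_val (curvK hB cB)) x.
Proof.
rewrite (ext_ev _ Ax) (ext_ev _ (AB Ax)).
rewrite (curvK_pull hA hB AB sid cA cB GJ (exist _ x Ax)).
by rewrite -!ext_sval.
Qed.

End RestrictMetric.

Section Manifold.
Variables (R : realType) (n : nat) (M : topologicalType) (g : riemannian_data R n M).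
Hypotheses (hm : riemannian_manifold g) (n0 : (0 < n)%N).

Definition ordz : 'I_n := Ordinal n0.

Lemma cod_open (i : chart_idx g) : rel_open (chart_cod i).
Proof. exact: chart_cod_open hm i. Qed.

Lemma cod_metric (i : chart_idx g) : chart_metric_on (chart_cod i) (chart_metric i).
Proof.
split; [exact: metric_smooth hm i|exact: metric_symmetric hm i|exact: metric_positive hm i].
Qed.

Lemma chart_in (i : chart_idx g) p : chart_dom i p -> chart_cod i (chart i p).
Proof. by exists p. Qed.

Lemma inv_dom (i : chart_idx g) x : chart_cod i x -> chart_dom i (chart_inv i x).
Proof. by move=> [p dp <-]; rewrite (chartK hm). Qed.

Lemma chart_invK (i : chart_idx g) x : chart_cod i x -> chart i (chart_inv i x) = x.
Proof. by move=> [p dp <-]; rewrite (chartK hm). Qed.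

Lemma cod_half (i : chart_idx g) x : chart_cod i x -> half_space x.
Proof. by have [W _ ->] := cod_open i => -[]. Qed.

Lemma dom_near (i : chart_idx g) p : chart_dom i p -> \forall q \near p, chart_dom i q.
Proof. by move=> dp; apply: open_nbhs_nbhs; split=> //; exact: chart_dom_open hm i. Qed.

Lemma chart_cont (i : chart_idx g) p : chart_dom i p -> {for p, continuous (chart i)}.
Proof.
move=> dp; have := @chart_continuous _ _ _ _ hm i.
by rewrite continuous_open_subspace; [apply; rewrite inE|exact: chart_dom_open hm i].
Qed.

Lemma chart_img_open (i : chart_idx g) W : open W -> rel_open (chart i @` (chart_dom i `&` W)).
Proof.
move=> oW; have /continuousP/(_ W oW)/open_subspaceP[V oV VE] := @chart_inv_continuous _ _ _ _ hm i.
have -> : chart i @` (chart_dom i `&` W) = chart_cod i `&` V.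
  apply/seteqP; split=> x.
    move=> [p [dp Wp] <-]; have cx := chart_in dp; split=> //.
    have : (chart_inv i @^-1` W `&` chart_cod i) (chart i p) by split=> //; rewrite /preimage /= (chartK hm).
    by rewrite -VE => -[].
  move=> [cx Vx]; exists (chart_inv i x); last exact: chart_invK.
  split; first exact: inv_dom.
  have : (V `&` chart_cod i) x by [].
  by rewrite VE => -[].
by apply: rel_openI => //; exact: cod_open.
Qed.

Lemma rel_open_ball (A : set 'rV[R]_n) x : rel_open A -> A x ->
  exists2 e : R, 0 < e & forall y, half_space y -> `|y - x| < e -> A y.
Proof.
move=> [W oW ->] [Wx hx].
have /nbhs_ballP[e /= e0 he] : nbhs x W by exact: open_nbhs_nbhs.
exists e => // y hy yx; split=> //; apply: he; by rewrite -ball_normE /= distrC.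
Qed.

Lemma inv_near (i : chart_idx g) x (P : set M) : chart_cod i x ->
  (\forall p \near chart_inv i x, P p) ->
  exists2 e : R, 0 < e & forall y, half_space y -> `|y - x| < e -> chart_cod i y /\ P (chart_inv i y).
Proof.
move=> cx hP; have oP : open P° by exact: open_interior.
have hA := chart_img_open i oP.
have Ax : (chart i @` (chart_dom i `&` P°)) x.
  by exists (chart_inv i x); [split; [exact: inv_dom|exact: hP]|exact: chart_invK].
have [e e0 he] := rel_open_ball hA Ax; exists e => // y hy yx.
have [p [dp Pp] <-] := he y hy yx; split; first exact: chart_in.
by rewrite (chartK hm) //; exact: (interior_subset Pp).
Qed.

Lemma chart_near (i : chart_idx g) p (Q : set 'rV[R]_n) (e : R) : chart_dom i p -> 0 < e ->
  (forall y, chart_cod i y -> `|y - chart i p| < e -> Q y) ->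
  \forall q \near p, chart_dom i q /\ Q (chart i q).
Proof.
move=> dp e0 hQ.
have h : \forall q \near p, `|chart i q - chart i p| < e.
  have := chart_cont dp; move/cvgr_dist_lt => /(_ e e0).
  by apply: nearS => q; rewrite distrC.
apply: nearS (nearI (dom_near dp) h) => q [dq qe]; split=> //.
by apply: hQ => //; exact: chart_in.
Qed.

Definition val (i : chart_idx g) (f : sfun (chart_cod i)) (p : M) : R := ext (sfun_val f) (chart i p).

Definition pt (i : chart_idx g) p (dp : chart_dom i p) : {x | chart_cod i x} :=
  exist _ (chart i p) (chart_in dp).

Lemma valE (i : chart_idx g) (f : sfun (chart_cod i)) p (dp : chart_dom i p) :
  val f p = ev (pt dp) f.
Proof. exact: ext_ev. Qed.

Lemma val_cont (i : chart_idx g) (f : sfun (chart_cod i)) p : chart_dom i p ->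
  {for p, continuous (val f)}.
Proof.
move=> dp; apply/cvgrPdist_lt => e e0.
have [r r0 hr] := ev_cont f (pt dp) e0.
have hy y : chart_cod i y -> `|y - chart i p| < r -> `|ext (sfun_val f) y - val f p| < e.
  by move=> cy yr; rewrite (valE f dp) (ext_ev f cy); apply: hr.
by apply: nearS (chart_near dp r0 hy) => q [dq]; rewrite distrC.
Qed.

Section Function.
Variables (u : M -> R).
Hypothesis hu : smooth_fun g u.

Definition chart_fun (i : chart_idx g) : sfun (chart_cod i) := mk_sfun (@hu i).

Lemma val_fun (i : chart_idx g) p : chart_dom i p -> val (chart_fun i) p = u p.
Proof. by move=> dp; rewrite (valE _ dp) ev_mk /local_fun /= (chartK hm). Qed.

End Function.

Lemma glue_cont (u : M -> R) :
  (forall p, exists (i : chart_idx g) (f : sfun (chart_cod i)), chart_dom i p /\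
     forall q, chart_dom i q -> u q = val f q) -> continuous u.
Proof.
move=> h p; have [i [f [dp e]]] := h p.
apply: cont_near (@val_cont i f p dp); apply: nearS (dom_near dp) => q dq.
by rewrite e.
Qed.

Lemma smooth_cont u : smooth_fun g u -> continuous u.
Proof.
move=> hu; apply: glue_cont => p; have [i dp] := chart_cover hm p.
by exists i, (chart_fun hu i); split=> // q dq; rewrite val_fun.
Qed.

Section Transition.
Variables i j : chart_idx g.

Definition trans_dom := chart i @` overlap id i j.
Definition trans := local_map id i j.

Lemma trans_open : rel_open trans_dom.
Proof. exact: chart_img_open (chart_dom_open hm j). Qed.

Lemma trans_sub : trans_dom `<=` chart_cod i.
Proof. by move=> x [p [dp _] <-]; exact: chart_in. Qed.

Lemma trans_in p : chart_dom i p -> chart_dom j p -> trans_dom (chart i p).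
Proof. by move=> di dj; exists p. Qed.

Lemma transE p : chart_dom i p -> trans (chart i p) = chart j p.
Proof. by move=> di; rewrite /trans /local_map (chartK hm). Qed.

Lemma trans_cod x : trans_dom x -> chart_cod j (trans x).
Proof. by move=> [p [di dj] <-]; rewrite transE //; exact: chart_in. Qed.

Lemma trans_smooth b : smooth_on trans_dom (fun x => trans x 0 b).
Proof. exact: transition_smooth hm i j b. Qed.

Lemma trans_metric x : trans_dom x ->
  chart_metric i x = jac trans x *m chart_metric j (trans x) *m (jac trans x)^T.
Proof. by move=> [p ov <-]; rewrite transE; [exact: (@metric_transition _ _ _ _ hm i j p ov)|case: ov]. Qed.

Lemma trans_dom_metric : chart_metric_on trans_dom (chart_metric i).
Proof. by apply: chart_metric_on_sub (cod_metric i); exact: trans_sub. Qed.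

End Transition.

Lemma near_interior (i : chart_idx g) x (e : R) : chart_cod i x -> 0 < e ->
  exists y, [/\ chart_cod i y, `|y - x| < e & interior_pt y].
Proof.
move=> cx e0; have [r r0 hr] := rel_open_ball (cod_open i) cx.
pose t := Num.min e r / 2; have t0 : 0 < t by rewrite divr_gt0 // lt_min e0 r0.
have te : t < Num.min e r by rewrite /t; move: t0; rewrite /t; lra.
move: te; rewrite lt_min => /andP[te tr].
pose y := x + t *: evec R ordz.
have yx : `|y - x| <= t.
  rewrite /y addrC addKr; apply: norm_le_coord; first exact: ltW.
  move=> k; rewrite !mxE normrM (gtr0_norm t0) ler_piMr //; first exact: ltW.
  by case: (_ && _); rewrite ?normr1 ?normr0.
have hy : half_space y by apply: half_space_step; [exact: cod_half cx|exact: ltW].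
exists y; split.
- by apply: hr => //; exact: le_lt_trans yx tr.
- exact: le_lt_trans yx te.
move=> k k0; have kE : k = ordz by apply: val_inj.
by rewrite kE !mxE !eqxx mulr1 ltr_wpDl //; apply: (cod_half cx).
Qed.

Lemma interior_chart (i : chart_idx g) p : chart_dom i p -> ~ boundary g p -> interior_pt (chart i p).
Proof.
move=> dp nb k k0; rewrite lt_neqAle (cod_half (chart_in dp) k0) andbT.
by apply/negP => /eqP e; apply: nb; exists i, k.
Qed.

(** Invariance of the boundary. If another chart places [p] on its boundary, the normal coordinate
    of the transition map has a minimum at an interior point, so a column of an invertible Jacobian
    vanishes. *)
Lemma chart_interior (i : chart_idx g) p : chart_dom i p -> interior_pt (chart i p) -> ~ boundary g p.
Proof.
move=> dp ip [j [a [dj a0 pa]]].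
have Tp := trans_in dp dj; pose q : {x | trans_dom i j x} := exist _ _ Tp.
have lm : local_max_at (- mk_sfun (@trans_smooth i j a)) q.
  exists 1 => // -[y Ty] _; rewrite !evN !ev_mk /= lerN2 transE // pa.
  by have := cod_half (trans_cod Ty); apply.
have [d0 _] := @interior_max R n _ _ (trans_open i j) (trans_dom_metric i j) _ q ip lm.
have uJ := jac_unit (trans_dom_metric i j) (@trans_metric i j) Tp.
have Je : jac (trans i j) (chart i p) *m (delta_mx a 0 : 'cV_n) = 0.
  apply/matrixP => c k; rewrite mul_deltaE [RHS]mxE.
  have := d0 c; rewrite (derN (sder_derivations _)) evN ev_sder_mk => /eqP.
  by rewrite oppr_eq0 => /eqP <-; rewrite mxE.
have := congr1 (mulmx (invmx (jac (trans i j) (chart i p)))) Je; rewrite mulKmx // mulmx0.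
by move/matrixP/(_ a 0); rewrite !mxE !eqxx => /eqP; rewrite oner_eq0.
Qed.

Lemma boundary_closed : closed (boundary g).
Proof.
rewrite -[boundary g]setCK; apply: open_closedC; rewrite openE => p nb.
have [i dp] := chart_cover hm p.
have ip := interior_chart dp nb.
have /nbhs_ballP[e /= e0 he] : nbhs (chart i p) [set y | interior_pt y].
  by apply: open_nbhs_nbhs; split=> //; exact: interior_pt_open.
have hy y : chart_cod i y -> `|y - chart i p| < e -> interior_pt y.
  by move=> _ ye; apply: he; rewrite -ball_normE /= distrC.
by apply: nearS (chart_near dp e0 hy) => q [dq iq]; exact: chart_interior dq iq.
Qed.

Lemma boundary_chart (i : chart_idx g) p : chart_dom i p -> boundary g p -> chart i p 0 ordz = 0.
Proof.
move=> dp bp; apply/eqP/negPn/negP => h; apply: (chart_interior dp _ bp) => k k0.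
have -> : k = ordz by apply: val_inj.
by rewrite lt_neqAle eq_sym h /=; apply: (cod_half (chart_in dp)).
Qed.

Lemma nonboundary_near (p : M) (P : set M) : (\forall q \near p, P q) -> exists q, P q /\ ~ boundary g q.
Proof.
move=> hP; have [i dp] := chart_cover hm p.
have cx := chart_in dp.
have [e e0 he] : exists2 e : R, 0 < e & forall y, half_space y -> `|y - chart i p| < e ->
    chart_cod i y /\ P (chart_inv i y) by apply: inv_near => //; rewrite (chartK hm).
have [y [cy ye iy]] := near_interior cx e0.
have [_ Py] := he y (cod_half cy) ye.
exists (chart_inv i y); split=> //.
by apply: (@chart_interior i); [exact: inv_dom|rewrite chart_invK].
Qed.

(** Every neighborhood of a boundary point contains interior points: move slightly in the normal
    coordinate of a chart. *)
Lemma eq_off_boundary (f h : M -> R) : continuous f -> continuous h ->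
  (forall p, ~ boundary g p -> f p = h p) -> forall p, f p = h p.
Proof.
move=> cf ch e p; apply/eqP; rewrite -subr_eq0; apply/eqP/norm_eps0 => r r0.
have r2 : 0 < r / 2 by rewrite divr_gt0.
have n1 : \forall q \near p, `|f p - f q| < r / 2 by have := cf p; move/cvgr_dist_lt; apply.
have n2 : \forall q \near p, `|h p - h q| < r / 2 by have := ch p; move/cvgr_dist_lt; apply.
have [q [[q1 q2] nb]] := nonboundary_near (nearI n1 n2).
by rewrite -(e q nb) in q2; apply: (abs_half_tri (c := f q)); exact: ltW.
Qed.

Section Invariance.
Variable Gf : forall i : chart_idx g, 'rV[R]_n -> 'M[R]_n.
Hypothesis cG : forall i, chart_metric_on (chart_cod i) (Gf i).
Hypothesis tG : forall i j x, trans_dom i j x ->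
  Gf i x = jac (trans i j) x *m Gf j (trans i j x) *m (jac (trans i j) x)^T.

Lemma trans_dom_metric_gen i j : chart_metric_on (trans_dom i j) (Gf i).
Proof. by apply: chart_metric_on_sub (cG i); exact: trans_sub. Qed.

Lemma curvK_chart i j p : chart_dom i p -> chart_dom j p ->
  val (curvK (cod_open i) (cG i)) p = val (curvK (cod_open j) (cG j)) p.
Proof.
move=> di dj; have Tp := trans_in di dj.
rewrite /val -(curvK_sub (trans_open i j) (cod_open i) (@trans_sub i j) (trans_dom_metric_gen i j) (cG i) Tp).
rewrite (ext_ev _ Tp) (curvK_pull (trans_open i j) (cod_open j) (@trans_cod i j) (@trans_smooth i j)
  (trans_dom_metric_gen i j) (cG j) (@tG i j)).
by rewrite -ext_sval /= transE.
Qed.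

End Invariance.

Lemma sqgrad_chart u (hu : smooth_fun g u) i j p : chart_dom i p -> chart_dom j p ->
  val (sqgrad (sder (cod_open i)) (s_inv (cod_metric i)) (chart_fun hu i)) p =
  val (sqgrad (sder (cod_open j)) (s_inv (cod_metric j)) (chart_fun hu j)) p.
Proof.
move=> di dj; have Tp := trans_in di dj; pose q : {x | trans_dom i j x} := exist _ _ Tp.
have e := sqgrad_pull (trans_open i j) (cod_open j) (@trans_cod i j) (@trans_smooth i j)
  (trans_dom_metric i j) (cod_metric j) (@trans_metric i j) q (chart_fun hu j).
rewrite /val; transitivity (ev (pull_pt (@trans_cod i j) q)
   (sqgrad (sder (cod_open j)) (s_inv (cod_metric j)) (chart_fun hu j))); last first.
  by rewrite -ext_sval /= transE.
rewrite -e (ext_ev _ (chart_in di)).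
rewrite (ev_sqgrad (cod_open i) (cod_metric i) (h := local_fun u i)); last by move=> [y cy].
rewrite (ev_sqgrad (trans_open i j) (trans_dom_metric i j) (h := local_fun u i)) //.
move=> [y Ty]; rewrite ev_pullS ev_mk /local_fun /=.
by move: Ty => [r [ri rj] <-]; rewrite transE // !(chartK hm).
Qed.

End Manifold.

(** * The inequality and the equality case *)

Lemma max_of_eq (R : realType) (S : set R) m : S m -> (forall s, S s -> s <= m) -> max_of S = m.
Proof.
move=> Sm hm; rewrite /max_of; apply: xget_unique => [|y [Sy hy]]; first by split.
by apply/eqP; rewrite eq_le hm // hy.
Qed.

Lemma ev_val (R : realType) n (M : topologicalType) (g : riemannian_data R n M)
    (hm : riemannian_manifold g) (i : chart_idx g) (f : sfun (chart_cod i)) q :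
  ev q f = val f (chart_inv i (sval q)).
Proof. by rewrite /val (chart_invK hm (svalP q)) ext_sval. Qed.

Lemma le_of_sq (R : realDomainType) (a b : R) : 0 <= a -> 0 <= b -> a ^+ 2 <= b ^+ 2 -> a <= b.
Proof. by move=> a0 b0; rewrite ler_pXn2r. Qed.

Section StaticTriple.
Variables (R : realType) (n : nat) (M : topologicalType) (g : riemannian_data R n M) (u : M -> R).
Hypotheses (hst : static_triple g u) (n0 : (0 < n)%N).

Let hm : riemannian_manifold g := static_manifold hst.
Let hu : smooth_fun g u := static_smooth hst.

Local Notation U := (chart_fun hu).
Local Notation d i := (sder (cod_open hm i)).
Local Notation sG i := (s_metric (cod_metric hm i)).
Local Notation sGi i := (s_inv (cod_metric hm i)).
Local Notation Gam i := (s_gam (cod_open hm i) (cod_metric hm i)).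
Local Notation lc i := (s_lc (cod_open hm i) (cod_metric hm i)).
Local Notation sq i := (sqgrad (d i) (sGi i) (U i)).

Lemma potential_ge0 p : 0 <= u p.
Proof.
have [b|nb] := pselect (boundary g p); first by rewrite (static_vanishing hst b).
exact: ltW (static_positive hst nb).
Qed.

Lemma chart_funE i (q : {x | chart_cod i x}) : ev q (U i) = local_fun u i (sval q).
Proof. by []. Qed.

Lemma ring_static i : U i *: ricci_mx (d i) (Gam i) = hess (d i) (Gam i) (U i) + (n%:R * U i) *: sG i.
Proof.
apply: ev_mx_inj => q.
have e : map_mx (ev q) (U i *: ricci_mx (d i) (Gam i)) =
    local_fun u i (sval q) *: ricci (chart_metric i) (sval q).
  by rewrite -(ev_ricci (cod_open hm i) (cod_metric hm i)); apply/matrixP => a b; rewrite !mxE evM.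
rewrite e (@static_ricci _ _ _ _ _ hst i _ (svalP q)).
rewrite -(ev_hess (cod_open hm i) (cod_metric hm i) (@chart_funE i)) -(ev_metric (cod_metric hm i)).
apply/matrixP => a b; rewrite [RHS]mxE addmxE scalemxE [X in X + _]mxE [X in _ * X]mxE.
by rewrite [in RHS]addmxE scalemxE evD evM evM rmorph_nat.
Qed.

Lemma ring_laplace i : laplace (d i) (sGi i) (Gam i) (U i) = - n%:R * U i.
Proof.
apply: sfun_ext => q.
rewrite (ev_laplace (cod_open hm i) (cod_metric hm i) (@chart_funE i)).
by rewrite (@static_laplacian _ _ _ _ _ hst i _ (svalP q)) evM evN rmorph_nat.
Qed.

Lemma val_sq_ge0 i p : chart_dom i p -> 0 <= val (sq i) p.
Proof.
move=> dp; rewrite (valE _ dp) (ev_sqgrad _ _ (@chart_funE i)); set r := \row_a _.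
have cp := chart_in dp.
by have := inv_form_ge0 (cm_sym (cod_metric hm i) cp) (cm_pos (cod_metric hm i) cp) r^T; rewrite trmxK.
Qed.

(** All charts around [p] give the same value by [sqgrad_chart], so the choice made by [xget] is
    harmless. *)
Lemma grad_norm_atE i p : chart_dom i p -> grad_norm_at g u p = Num.sqrt (val (sq i) p).
Proof.
have e j : chart_dom j p -> grad_norm (chart_metric j) (local_fun u j) (chart j p) =
    Num.sqrt (val (sq j) p).
  by move=> dj; rewrite (valE _ dj) -(ev_grad_norm _ _ (@chart_funE j)).
move=> di; rewrite /grad_norm_at; apply: xget_unique.
  by exists i => //; rewrite e.
move=> y [j dj <-]; rewrite e //; congr Num.sqrt; exact: sqgrad_chart.
Qed.

Lemma grad_norm_sqE i p : chart_dom i p -> grad_norm_at g u p ^+ 2 = val (sq i) p.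
Proof. by move=> di; rewrite (grad_norm_atE di) sqr_sqrtr // val_sq_ge0. Qed.

Lemma grad_norm_ge0 p : 0 <= grad_norm_at g u p.
Proof. by have [i di] := chart_cover hm p; rewrite (grad_norm_atE di) sqrtr_ge0. Qed.

Definition energy p := grad_norm_at g u p ^+ 2 + u p ^+ 2.

Local Notation sw i := (sq i + U i * U i).

Lemma val_energy i p : chart_dom i p -> val (sw i) p = energy p.
Proof.
move=> di; rewrite /energy (grad_norm_sqE di) (valE _ di) evD evM -!valE expr2.
by rewrite (val_fun hm).
Qed.

Lemma energy_cont : continuous energy.
Proof.
apply: (glue_cont hm) => p; have [i di] := chart_cover hm p.
by exists i, (sw i); split=> // q dq; rewrite val_energy.
Qed.

Lemma grad_norm_sq_cont : continuous (fun p => grad_norm_at g u p ^+ 2).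
Proof.
apply: (glue_cont hm) => p; have [i di] := chart_cover hm p.
by exists i, (sq i); split=> // q dq; rewrite (grad_norm_sqE dq).
Qed.

Lemma drift_energy i : drift (d i) (sGi i) (Gam i) (U i) (sw i) =
  2%:R * U i * \tr ((sGi i *m (hess (d i) (Gam i) (U i) + U i *: sG i)) *m
                    (sGi i *m (hess (d i) (Gam i) (U i) + U i *: sG i))).
Proof.
have := static_bochner (lc i) (ring_static i) (ring_laplace i).
by rewrite /drift => ->.
Qed.

Lemma sqgrad_sum i f : \sum_a grad_vec (d i) (sGi i) f a 0 * d i a f = sqgrad (d i) (sGi i) f.
Proof.
rewrite /sqgrad -mulmxA mulmxE; apply: eq_bigr => a _.
by rewrite trmxE grad_colE /grad_vec mulrC.
Qed.

Lemma drift_potential_sq i : drift (d i) (sGi i) (Gam i) (U i) (U i * U i) =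
  - (2%:R * n%:R * (U i * U i * U i)).
Proof.
rewrite (drift_sq (lc i)) /drift sqgrad_sum ring_laplace.
by move: (U i) (sqgrad _ _ _) => x y; ring.
Qed.

Lemma trace_ge0 i (q : {x | chart_cod i x}) :
  0 <= ev q (\tr ((sGi i *m (hess (d i) (Gam i) (U i) + U i *: sG i)) *m
                    (sGi i *m (hess (d i) (Gam i) (U i) + U i *: sG i)))).
Proof.
set T := hess _ _ _ + _.
have TT : (map_mx (ev q) T)^T = map_mx (ev q) T.
  rewrite matrix.map_trmx /T trmxD (hessT (lc i)) trmx_scale s_metricT //.
have cq := svalP q.
have [h _] := trace_inv_sq (cm_sym (cod_metric hm i) cq) (cm_pos (cod_metric hm i) cq) TT.
by rewrite -trace_map_mx !map_mxM (ev_inv (cod_metric hm i)).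
Qed.

Lemma interior_pos i (q : {x | chart_cod i x}) : interior_pt (sval q) -> 0 < ev q (U i).
Proof.
move=> iq; apply: (static_positive hst); apply: (@chart_interior _ _ _ _ hm i).
  exact: (inv_dom hm (svalP q)).
by rewrite (chart_invK hm (svalP q)).
Qed.

Lemma drift_energy_ge0 i (q : {x | chart_cod i x}) : interior_pt (sval q) ->
  0 <= ev q (drift (d i) (sGi i) (Gam i) (U i) (sw i)).
Proof.
move=> iq; rewrite drift_energy evM evM rmorph_nat; apply: mulr_ge0; last exact: trace_ge0.
by rewrite mulr_ge0 // ltW // interior_pos.
Qed.

(* Maximum principle for [energy - e u^2], whose drift is positive. *)
Lemma energy_le W : (forall p, boundary g p -> grad_norm_at g u p ^+ 2 <= W) ->
  forall p, energy p <= W.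
Proof.
move=> hW p; rewrite -subr_ge0.
suff h (e : R) : 0 < e -> energy p - W <= e * u p ^+ 2.
  rewrite subr_ge0 leNgt; apply/negP => lt.
  have up0 : 0 < u p.
    rewrite lt_neqAle potential_ge0 andbT; apply/eqP => e0.
    by have := h 1 ltr01; rewrite -e0 expr0n mulr0; lra.
  have u2 : 0 < u p ^+ 2 by rewrite exprn_gt0.
  (* With this [e] the bound becomes half of the excess [energy p - W], which is absurd for a
     positive excess. *)
  have := h ((energy p - W) / (2 * u p ^+ 2)) _; rewrite divr_gt0 ?mulr_gt0 ?subr_gt0 // => /(_ isT).
  have -> : (energy p - W) / (2 * u p ^+ 2) * u p ^+ 2 = (energy p - W) / 2.
    by field; rewrite gt_eqF.
  lra.
move=> e0.
have cu : continuous u by exact: (@smooth_cont _ _ _ _ hm u hu).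
have cF : continuous (fun q => energy q - e * u q ^+ 2).
  move=> q; apply: cvgB; first exact: energy_cont.
  by apply: cvgM; [exact: cvg_cst|apply: cvgM; exact: cu].
have [m _ hmax] : exists2 c, c \in [set: M] & forall t, t \in [set: M] ->
    energy t - e * u t ^+ 2 <= energy c - e * u c ^+ 2.
  apply: (@compact_EVT_max M R (fun q => energy q - e * u q ^+ 2) setT); first by exists p.
    exact: static_compact hst.
  exact: continuous_subspaceT.
suff : energy m - e * u m ^+ 2 <= W by have := hmax p; rewrite in_setT => /(_ isT); lra.
have [bm|nb] := pselect (boundary g m).
  by rewrite /energy (static_vanishing hst bm) expr0n mulr0 subr0 addr0 hW.
have [i di] := chart_cover hm m.
have im := interior_chart hm di nb.
pose F := sw i + s_cst _ (- e) * (U i * U i).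
have vF q (dq : chart_dom i q) : ev (pt dq) F = energy q - e * u q ^+ 2.
  rewrite evD evM ev_cst evM -!(valE _ dq) val_energy // (val_fun hm) //.
  by rewrite mulNr expr2.
have lm : local_max_at F (pt di).
  exists 1 => // q _; have dq := inv_dom hm (svalP q).
  by rewrite (ev_val hm) (valE _ dq) !vF; apply: hmax; rewrite inE.
have := @drift_op_interior_max _ _ _ _ (cod_open hm i) (cod_metric hm i) (U i) F (pt di) im
  (ltW (@interior_pos i (pt di) im)) lm.
rewrite (driftD (lc i)) (driftZ (lc i)); last by move=> a; exact: der_cst.
rewrite drift_potential_sq evD !evM evN !evM ev_cst !rmorph_nat.
have k1 := @drift_energy_ge0 i (pt di) im; have k2 := @interior_pos i (pt di) im.
move: (ev _ (U i)) (ev _ (drift _ _ _ _ _)) k1 k2 => x y y0 x0.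
(* The term - e u^2 contributes 2 n e u^3 > 0 to the drift, whereas the total is nonpositive at an
   interior maximum. *)
have : 0 < e * (2 * n%:R * (x * x * x)).
  by rewrite !mulr_gt0 // ltr0n.
lra.
Qed.

Lemma max_potential : exists pm, [/\ forall p, u p <= u pm, 0 < u pm, ~ boundary g pm &
  grad_norm_at g u pm = 0].
Proof.
have cu : continuous u by exact: (@smooth_cont _ _ _ _ hm u hu).
have [b0 bb0] := static_boundary hst.
have [pm _ hmax'] : exists2 c, c \in [set: M] & forall t, t \in [set: M] -> u t <= u c.
  apply: (@compact_EVT_max M R u setT); first by exists b0.
    exact: static_compact hst.
  exact: continuous_subspaceT.
have hmax p : u p <= u pm by apply: hmax'; rewrite in_setT.
have pos : 0 < u pm.
  (* Some point is off the boundary, and [u] is positive there; so the maximum is positive and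
     cannot be attained on the boundary. *)
  have [q [_ nq]] := nonboundary_near hm n0 (p := b0) (P := setT) filterT.
  exact: lt_le_trans (static_positive hst nq) (hmax q).
have nb : ~ boundary g pm by move=> bm; move: pos; rewrite (static_vanishing hst bm) ltxx.
exists pm; split=> //.
have [i di] := chart_cover hm pm.
have im := interior_chart hm di nb.
have lm : local_max_at (U i) (pt di).
  exists 1 => // q _; rewrite (ev_val hm) (valE _ (inv_dom hm (svalP q))) -!valE !(val_fun hm) //.
  exact: (inv_dom hm (svalP q)).
have [d0 _] := @interior_max _ _ _ _ (cod_open hm i) (cod_metric hm i) (U i) (pt di) im lm.
rewrite (grad_norm_atE di) (valE _ di) -sqgrad_sum ev_sum big1 ?sqrtr0 // => a _.
by rewrite evM d0 mulr0.
Qed.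

(** Where [u] vanishes the static equation reads D^2 u = 0. *)
Lemma hess_boundary i p (di : chart_dom i p) : boundary g p ->
  map_mx (ev (pt di)) (hess (d i) (Gam i) (U i)) = 0.
Proof.
move=> bp; have u0 : ev (pt di) (U i) = 0 by rewrite -valE (val_fun hm) // (static_vanishing hst bp).
apply/matrixP => a b; have := congr1 (fun N : 'M[sfun (chart_cod i)]_n => ev (pt di) (N a b)) (ring_static i).
rewrite scalemxE addmxE scalemxE evD !evM u0 mulr0 !mul0r addr0 => e.
by rewrite [LHS]mxE -e mxE.
Qed.

Lemma der_sq_boundary i p (di : chart_dom i p) a : boundary g p -> ev (pt di) (d i a (sq i)) = 0.
Proof.
move=> bp; have := congr1 (fun N : 'cV[sfun (chart_cod i)]_n => ev (pt di) (N a 0)) (grad_col_sqgrad (lc i) (U i)).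
rewrite grad_colE scalemxE evM mulmxE ev_sum big1 ?mulr0 // => b _.
have := hess_boundary di bp => /matrixP/(_ a b); rewrite [LHS]mxE [RHS]mxE => e.
by rewrite evM e mul0r.
Qed.

(** The differential of |Du|^2 is 2 D^2u(Du, .), which vanishes on the boundary; the mean value
    theorem along a segment in the boundary hyperplane of a chart gives local constancy. *)
Lemma grad_norm_boundary p : boundary g p ->
  \forall q \near p, boundary g q -> grad_norm_at g u q = grad_norm_at g u p.
Proof.
move=> bp; have [i di] := chart_cover hm p.
set x := chart i p; have cx : chart_cod i x := chart_in di.
have [V [F [oV Vx cF eF dF]]] := sder_local (cod_open hm i) (sq i) cx.
have [r1 r10 hr1] := rel_open_ball (cod_open hm i) cx.
have /nbhs_ballP[r2 /= r20 hr2] : nbhs x V by exact: open_nbhs_nbhs.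
pose e := Num.min r1 r2; have e0 : 0 < e by rewrite lt_min r10 r20.
have x0 : x 0 (ordz n0) = 0 by exact: boundary_chart.
have hy y : chart_cod i y -> `|y - x| < e -> y 0 (ordz n0) = 0 ->
    ext (sfun_val (sq i)) y = ext (sfun_val (sq i)) x.
  move=> cy yx y0; pose v := y - x.
  have zt t : `|t| <= `|1 : R| -> let z := x + t *: v in [/\ V z, chart_cod i z & boundary g (chart_inv i z)].
    rewrite normr1 => t1 z.
    have zx : `|z - x| < e.
      rewrite /z addrC addKr normrZ; apply: le_lt_trans yx.
      by rewrite ler_piMl.
    have z0 : z 0 (ordz n0) = 0 by rewrite !mxE x0 y0 subrr mulr0 addr0.
    have hz : half_space z.
      move=> k k0; have -> : k = ordz n0 by apply: val_inj.
      by rewrite z0.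
    move: zx; rewrite lt_min => /andP[z1 z2].
    have cz : chart_cod i z by exact: hr1.
    split=> //; first by apply: hr2; rewrite -ball_normE /= distrC.
    exists i, (ordz n0); split=> //; first exact: inv_dom.
    by rewrite (chart_invK hm).
  have dz t : `|t| <= `|1 : R| -> is_derive (x + t *: v) v F 0.
    move=> /zt[Vz cz bz]; have := dir_derive v oV (cF 1%N) Vz.
    rewrite big1 // => b _; rewrite -(dF b _ cz Vz) (_ : pd b _ _ = 0) ?mulr0 //.
    have := der_sq_boundary (inv_dom hm cz) b bz.
    by rewrite ev_sder /= (chart_invK hm cz).
  have [t t1 ht] := @mvt_line R _ F x v 1 (fun t ht => @ex_derive _ _ _ _ _ _ _ (dz t ht)).
  have Dt : 'D_v F (x + t *: v) = 0 by have [_ ->] := dz t t1.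
  have yE : x + v = y by rewrite /v addrC subrK.
  move: ht; rewrite Dt mulr0 scale1r yE => /eqP; rewrite subr_eq0 => /eqP ht.
  have Vy : V y.
    by have [] := zt 1 (lexx _); rewrite scale1r yE.
  by rewrite -(eF y cy Vy) -(eF x cx Vx).
apply: nearS (chart_near hm di e0 hy) => q [dq hq] bq.
have := hq (boundary_chart hm n0 dq bq); rewrite -/(val (sq i) q) -/(val (sq i) p) => e1.
by rewrite (grad_norm_atE dq) (grad_norm_atE di) e1.
Qed.

(** Constancy of |Du| on the component makes the [xget] of the definition return its value rather
    than the default. *)
Lemma surface_gravityE p pm : boundary g p -> (forall q, u q <= u pm) ->
  surface_gravity g u (connected_component (boundary g) p) = grad_norm_at g u p / u pm.
Proof.
move=> bp hmax; rewrite /surface_gravity.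
have -> : max_of (range u) = u pm by apply: max_of_eq => [|_ [q _ <-]] //; exists pm.
congr (_ / _); pose C := connected_component (boundary g) p.
have Cp : C p by exact: connected_component_refl.
have cst : forall q, C q -> grad_norm_at g u q = grad_norm_at g u p.
  apply: (@connected_const M C (fun q => grad_norm_at g u q = grad_norm_at g u p) p) => //.
    exact: component_connected.
  move=> q Cq; have bq : boundary g q by exact: connected_component_sub Cq.
  apply: nearS (grad_norm_boundary bq) => r hr Cr.
  have br : boundary g r by exact: connected_component_sub Cr.
  by rewrite (hr br); exact: iff_refl.
by apply: xget_unique => // k /(_ p Cp) <-.
Qed.

Lemma max_surface_gravity : exists pm ps,
  [/\ forall p, u p <= u pm, 0 < u pm, ~ boundary g pm /\ grad_norm_at g u pm = 0,
    forall q, boundary g q -> grad_norm_at g u q <= grad_norm_at g u ps &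
    max_of [set surface_gravity g u Sigma | Sigma in horizons g] = grad_norm_at g u ps / u pm].
Proof.
have [pm [hmax pos nb g0]] := max_potential.
have [ps /set_mem bps hps] : exists2 c, c \in boundary g & forall t, t \in boundary g ->
    grad_norm_at g u t ^+ 2 <= grad_norm_at g u c ^+ 2.
  apply: (@compact_EVT_max M R (fun p => grad_norm_at g u p ^+ 2)).
  - exact: static_boundary hst.
  - by apply: subclosed_compact (static_compact hst) _ => //; exact: boundary_closed.
  - by apply: continuous_subspaceT; exact: grad_norm_sq_cont.
have hps' q : boundary g q -> grad_norm_at g u q <= grad_norm_at g u ps.
  move=> bq; apply: le_of_sq; [exact: grad_norm_ge0|exact: grad_norm_ge0|].
  by apply: hps; rewrite inE.
exists pm, ps; split=> //.
apply: max_of_eq.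
  exists (connected_component (boundary g) ps); last exact: surface_gravityE.
  by exists ps.
move=> _ [_ [q bq <-] <-]; rewrite (surface_gravityE bq hmax).
apply: ler_wpM2r; [by rewrite invr_ge0; exact: ltW pos|exact: hps' bq].
Qed.

Lemma energy_local m (i : chart_idx g) (x : 'rV[R]_n) (e : R) : (forall p, energy p <= m) ->
  (forall y : 'rV[R]_n, half_space y -> `|y - x| < e -> chart_cod i y) ->
  forall y y' : 'rV[R]_n, interior_pt y -> interior_pt y' -> `|y - x| < e -> `|y' - x| < e ->
  energy (chart_inv i y) = m -> energy (chart_inv i y') = m.
Proof.
move=> hE he y y' iy iy' ye ye' Ey.
pose z t := y + t *: (y' - y).
have zE t : z t = (1 - t) *: y + t *: y'.
  by rewrite /z scalerBr scalerBl scale1r; rewrite addrCA addrC -!addrA.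
have iz t : `[0 : R, 1]%classic t -> interior_pt (z t).
  rewrite /= in_itv /= => /andP[t0 t1] k k0; rewrite zE !mxE.
  have := iy k k0; have := iy' k k0; have [->|tn] := eqVneq t 0; first by lra.
  move=> h1 h2; have tp : 0 < t by rewrite lt_neqAle eq_sym tn.
  by rewrite ltr_wpDl // ?mulr_gt0 // mulr_ge0 ?subr_ge0 // ltW.
have cz t : `[0 : R, 1]%classic t -> chart_cod i (z t).
  move=> t01; apply: he; first exact: interior_half_space (iz t t01).
  move: t01; rewrite /= in_itv /= => /andP[t0 t1].
  have -> : z t - x = (1 - t) *: (y - x) + t *: (y' - x).
    by rewrite zE; apply/rowP => k; rewrite !mxE; ring.
  apply: le_lt_trans (ler_normD _ _) _; rewrite !normrZ (ger0_norm t0) ger0_norm ?subr_ge0 //.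
  have [->|tn] := eqVneq t 1; first by rewrite subrr mul0r add0r mul1r.
  have : 0 < 1 - t by rewrite subr_gt0 lt_neqAle tn.
  by nra.
have PE t : `[0 : R, 1]%classic t -> energy (chart_inv i (z t)) = ext (sfun_val (sw i)) (z t).
  move=> t01; have c := cz t t01; rewrite -(val_energy (inv_dom hm c)) /val (chart_invK hm c) //.
pose P t := ext (sfun_val (sw i)) (z t) = m.
have c0 : `[0 : R, 1]%classic 0 by rewrite /= in_itv /= lexx ler01.
have c1 : `[0 : R, 1]%classic 1 by rewrite /= in_itv /= lexx ler01.
have z0 : z 0 = y by rewrite /z scale0r addr0.
have z1 : z 1 = y' by rewrite /z scale1r addrC subrK.
have zc t : {for t, continuous z}.
  move=> /=; apply: (@cvgD _ 'rV[R]_n); first exact: cvg_cst.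
  by apply: cvgZr_tmp; exact: cvg_id.
suff : P 1 by rewrite /P -PE // z1.
apply: (@connected_const R^o `[0 : R, 1]%classic P 0) => //.
- by apply/connected_intervalP; exact: interval_is_interval.
- by rewrite /P -PE // z0.
move=> t t01; have ct := cz t t01; have it := iz t t01.
have le_m (q : {y | chart_cod i y}) : ev q (sw i) <= m.
  by rewrite (ev_val hm) val_energy //; exact: (inv_dom hm (svalP q)).
have [Pt|nPt] := pselect (P t).
  have Fm : ev (exist _ (z t) ct) (sw i) = m by rewrite -ext_ev.
  have [r r0 hr] := @strong_max _ _ _ _ (cod_open hm i) (cod_metric hm i) (U i) (sw i) m
    (exist _ (z t) ct) it (fun q hq => interior_pos hq) (fun q hq => drift_energy_ge0 hq) le_m Fm.
  have nr : \forall s \near t, `|z s - z t| < r.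
    by have := zc t; move/cvgr_dist_lt => /(_ r r0); apply: nearS => s; rewrite distrC.
  apply: nearS nr => s zs s01; split=> // _.
  by rewrite /P (ext_ev _ (cz s s01)); exact: hr.
have lt : ext (sfun_val (sw i)) (z t) < m.
  by rewrite lt_neqAle (ext_ev _ ct) le_m andbT -(ext_ev _ ct); apply/eqP.
have cc := @ext_cont _ _ _ (cod_open hm i) (sw i) (z t) ct it.
have cc2 : {for t, continuous (fun s => ext (sfun_val (sw i)) (z s))}.
  exact: (continuous_comp (zc t) cc).
have : \forall s \near t, ext (sfun_val (sw i)) (z s) < m by move: cc2; move/cvgr_lt; apply.
by apply: nearS => s ls s01; split=> // Ps; move: ls; rewrite Ps ltxx.
Qed.

Lemma energy_const m pm : (forall p, energy p <= m) -> ~ boundary g pm -> energy pm = m ->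
  forall p, energy p = m.
Proof.
move=> hE nb Em.
(* [P] speaks of the interior points near [p], so that it makes sense at boundary points too and
   connectedness of [M] itself can be used. *)
pose P (p : M) := \forall q \near p, ~ boundary g q -> energy q = m.
have loc (p : M) : exists2 W, nbhs p W & forall q1 q2, W q1 -> W q2 ->
    ~ boundary g q1 -> ~ boundary g q2 -> energy q1 = m -> energy q2 = m.
  have [i di] := chart_cover hm p.
  have [e e0 he] := rel_open_ball (cod_open hm i) (chart_in di).
  exists [set q | chart_dom i q /\ `|chart i q - chart i p| < e].
    by apply: (@chart_near _ _ _ _ hm i p (fun y => `|y - chart i p| < e) e di e0) => y.
  move=> q1 q2 [d1 h1] [d2 h2] b1 b2 E1; rewrite -(chartK hm d2).
  apply: (@energy_local m i (chart i p) e hE he (chart i q1) (chart i q2)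
    (interior_chart hm d1 b1) (interior_chart hm d2 b2) h1 h2).
  by rewrite (chartK hm).
have spread (p q : M) W : nbhs p W -> nbhs q W -> (forall q1 q2, W q1 -> W q2 ->
    ~ boundary g q1 -> ~ boundary g q2 -> energy q1 = m -> energy q2 = m) -> P p -> P q.
  move=> Wp Wq hW Pp; have [q0 [[Wq0 Eq0] b0]] := nonboundary_near hm n0 (nearI Wp Pp).
  by apply: nearS Wq => q2 W2 b2; exact: (hW q0 q2 Wq0 W2 b0 b2 (Eq0 b0)).
have allP p : P p.
  apply: (@connected_const M setT P pm (static_connected hst)) => //.
    have [W Wp hW] := loc pm; have Wpm := nbhs_singleton Wp; apply: nearS Wp => q Wq bq.
    exact: (hW pm q Wpm Wq nb bq Em).
  move=> q _; have [W Wq hW] := loc q.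
  have := nbhs_interior Wq; apply: nearS => r Wr _.
  by split; [exact: spread Wr Wq hW|exact: spread Wq Wr hW].
move=> p; apply: (eq_off_boundary hm n0 energy_cont (h := cst m)) => [|q bq].
  by move=> q; exact: cvg_cst.
exact: (nbhs_singleton (allP q) bq).
Qed.

Lemma max_surface_gravity_ge1 :
  1 <= max_of [set surface_gravity g u Sigma | Sigma in horizons g].
Proof.
have [pm [ps [hmax pos [nb g0] hps ->]]] := max_surface_gravity.
rewrite ler_pdivlMr // mul1r; apply: le_of_sq; [exact: ltW|exact: grad_norm_ge0|].
have hW p : boundary g p -> grad_norm_at g u p ^+ 2 <= grad_norm_at g u ps ^+ 2.
  by move=> bp; rewrite ler_sqr ?nnegrE; [exact: hps|exact: grad_norm_ge0|exact: grad_norm_ge0].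
by have := energy_le hW pm; rewrite /energy g0 expr0n add0r.
Qed.

Lemma energy_of_equality : max_of [set surface_gravity g u Sigma | Sigma in horizons g] = 1 ->
  exists pm, [/\ forall p, u p <= u pm, 0 < u pm & forall p, energy p = u pm ^+ 2].
Proof.
have [pm [ps [hmax pos [nb g0] hps ->]]] := max_surface_gravity => e1.
have es : grad_norm_at g u ps = u pm.
  by rewrite -[LHS](divfK (lt0r_neq0 pos)) e1 mul1r.
exists pm; split=> //.
have hW p : boundary g p -> grad_norm_at g u p ^+ 2 <= u pm ^+ 2.
  move=> bp; rewrite -es ler_sqr ?nnegrE; [exact: hps|exact: grad_norm_ge0|exact: grad_norm_ge0].
have Epm : energy pm = u pm ^+ 2 by rewrite /energy g0 expr0n add0r.
exact: (energy_const (energy_le hW) nb Epm).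
Qed.

(** A constant energy has zero drift, so u |D^2u + u g|^2 = 0. This gives Obata's equation where [u]
    is positive; on the boundary both sides vanish by [hess_boundary]. *)
Lemma hess_of_energy c i : (forall p, energy p = c) ->
  hess (d i) (Gam i) (U i) = - U i *: sG i.
Proof.
move=> hc; have swE : sw i = s_cst _ c.
  by apply: sfun_ext => q; rewrite (ev_val hm) (val_energy (inv_dom hm (svalP q))) hc ev_cst.
set T := hess (d i) (Gam i) (U i) + U i *: sG i.
have D0 : drift (d i) (sGi i) (Gam i) (U i) (sw i) = 0.
  rewrite swE -[s_cst _ c]mulr1 (driftZ (lc i)); last by move=> a; exact: der_cst.
  have d1 a : d i a 1 = 0 by exact: (der1 (lc_der (lc i))).
  have h1 : hess (d i) (Gam i) 1 = 0.
    apply/matrixP => a b; rewrite mxE [RHS]mxE d1 (der0 (lc_der (lc i))) sub0r mulmxE big1 ?oppr0 // => e _.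
    by rewrite grad_colE d1 mulr0.
  rewrite /drift /laplace h1 mulmx0 mxtrace0 mulr0 big1 ?subr0 ?mulr0 // => a _.
  by rewrite d1 mulr0.
suff T0 : T = 0 by apply/eqP; rewrite scaleNr -addr_eq0 -/T T0.
apply: ev_mx_inj => q; rewrite map_mx0.
have dq := inv_dom hm (svalP q).
have [bq|nq] := pselect (boundary g (chart_inv i (sval q))).
  have := hess_boundary dq bq => hb.
  have u0 : ev q (U i) = 0 by rewrite (ev_val hm) (val_fun hm) // (static_vanishing hst bq).
  apply/matrixP => a b; rewrite [LHS]mxE [RHS]mxE addmxE scalemxE evD evM u0 mul0r addr0.
  have := congr1 (fun N : 'M[R]_n => N a b) hb; rewrite [LHS]mxE [RHS]mxE.
  by rewrite -!ext_sval /= (chart_invK hm (svalP q)).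
have iq : interior_pt (sval q).
  by have := interior_chart hm dq nq; rewrite (chart_invK hm (svalP q)).
have upos := interior_pos iq.
have cq := svalP q.
have TT : (map_mx (ev q) T)^T = map_mx (ev q) T.
  rewrite matrix.map_trmx /T trmxD (hessT (lc i)) trmx_scale s_metricT //.
have [_ h] := trace_inv_sq (cm_sym (cod_metric hm i) cq) (cm_pos (cod_metric hm i) cq) TT.
apply: h; have := congr1 (ev q) (drift_energy i); rewrite D0 ev0 !evM rmorph_nat => /esym/eqP.
rewrite mulf_eq0 mulf_eq0 pnatr_eq0 (gt_eqF upos) /= => /eqP e.
by rewrite -(ev_inv (cod_metric hm i)) -!map_mxM trace_map_mx.
Qed.

End StaticTriple.

(** * The flat conformal metric *)

(* [v] is the normalised potential: it satisfies Obata's equation and |dv|^2 = 1 - v^2. *)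
Record obata (R : realType) n (M : topologicalType) (g : riemannian_data R n M) (v : M -> R) : Prop := Obata {
  ob_mfd : riemannian_manifold g;
  ob_connected : connected [set: M];
  ob_compact : compact [set: M];
  ob_smooth : smooth_fun g v;
  ob_le1 : forall p, v p <= 1;
  ob_top : exists p, v p = 1;
  ob_pos : forall p, ~ boundary g p -> 0 < v p;
  ob_bdry : forall p, boundary g p -> v p = 0;
  ob_hess : forall i : chart_idx g,
    hess (sder (cod_open ob_mfd i)) (s_gam (cod_open ob_mfd i) (cod_metric ob_mfd i))
      (chart_fun ob_smooth i) = - chart_fun ob_smooth i *: s_metric (cod_metric ob_mfd i);
  ob_norm : forall i : chart_idx g,
    sqgrad (sder (cod_open ob_mfd i)) (s_inv (cod_metric ob_mfd i)) (chart_fun ob_smooth i) =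
      1 - chart_fun ob_smooth i ^+ 2
}.

Lemma obata_of_static (R : realType) n (M : topologicalType) (g : riemannian_data R n M) (u : M -> R) :
  static_triple g u -> (0 < n)%N ->
  max_of [set surface_gravity g u Sigma | Sigma in horizons g] = 1 ->
  exists2 c, 0 < c & obata g (fun p => u p / c).
Proof.
move=> hst n0 e1; have [pm [hmax pos hE]] := energy_of_equality hst n0 e1.
set c := u pm in hmax pos hE *; exists c => //.
pose hm := static_manifold hst; pose hu := static_smooth hst.
have hv : smooth_fun g (fun p => u p / c).
  move=> i; apply: (smooth_on_eq _ (smooth_on_mul (hu i) (@smooth_on_cst R n _ c^-1))) => x _.
  by [].
have vE i : chart_fun hv i = s_cst _ c^-1 * chart_fun hu i.
  by apply: sfun_ext => q; rewrite evM ev_cst mulrC.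
have dc i a : sder (cod_open hm i) a (s_cst _ c^-1) = 0 by exact: der_cst.
refine (@Obata _ _ _ _ _ hm (static_connected hst) (static_compact hst) hv _ _ _ _ _ _).
- by move=> p; rewrite ler_pdivrMr // mul1r.
- by exists pm; rewrite -/c mulfV // gt_eqF.
- by move=> p /(static_positive hst) up; rewrite divr_gt0.
- by move=> p /(static_vanishing hst) ->; rewrite mul0r.
- move=> i; rewrite vE (hessZ (s_lc (cod_open hm i) (cod_metric hm i)) _ (dc i)).
  by rewrite (hess_of_energy hst i hE) scalerA mulrN.
- move=> i; rewrite vE (sqgradZ (s_lc (cod_open hm i) (cod_metric hm i)) _ (dc i)).
  have e : sqgrad (sder (cod_open hm i)) (s_inv (cod_metric hm i)) (chart_fun hu i) =
      s_cst _ (c ^+ 2) - chart_fun hu i ^+ 2.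
    apply: sfun_ext => q; have dq := inv_dom hm (svalP q).
    have h : ev q (sqgrad (sder (cod_open hm i)) (s_inv (cod_metric hm i)) (chart_fun hu i)) +
        ev q (chart_fun hu i) * ev q (chart_fun hu i) = c ^+ 2.
      by rewrite -evM -evD (ev_val hm) (val_energy hst dq) hE.
    by rewrite evD evN ev_cst -h expr2 evM addrK.
  rewrite e; apply: sfun_ext => q; rewrite evM !evD !evN !expr2 !evM !ev_cst ev1.
  by field; rewrite gt_eqF.
Qed.

Section Rigidity.
Variables (R : realType) (n : nat) (M : topologicalType) (g : riemannian_data R n M) (v : M -> R).
Hypotheses (ob : obata g v) (n0 : (0 < n)%N).

Let hm := ob_mfd ob.
Let hv := ob_smooth ob.
Local Notation V := (chart_fun hv).
Local Notation hA i := (cod_open hm i).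
Local Notation d i := (sder (hA i)).
Local Notation sG i := (s_metric (cod_metric hm i)).
Local Notation sGi i := (s_inv (cod_metric hm i)).
Local Notation Gam i := (s_gam (hA i) (cod_metric hm i)).
Local Notation lc i := (s_lc (hA i) (cod_metric hm i)).

Lemma v_ge0 p : 0 <= v p.
Proof.
have [b|nb] := pselect (boundary g p); first by rewrite (ob_bdry ob b).
exact: ltW (ob_pos ob nb).
Qed.

Lemma V_gt (i : chart_idx g) x : chart_cod i x -> 0 < 1 + local_fun v i x.
Proof. by move=> cx; rewrite ltr_wpDr // v_ge0. Qed.

Definition flat_metric (i : chart_idx g) (x : 'rV[R]_n) : 'M[R]_n :=
  (1 + local_fun v i x)^-1 ^+ 2 *: chart_metric i x.

Lemma psi_smooth (i : chart_idx g) : smooth_on (chart_cod i) (fun x => (1 + local_fun v i x)^-1).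
Proof.
apply: smooth_on_inv => [x /V_gt h|]; first by rewrite gt_eqF.
exact: smooth_on_add (@smooth_on_cst R n _ 1) (@hv i).
Qed.

Definition psi (i : chart_idx g) : sfun (chart_cod i) := mk_sfun (@psi_smooth i).

Lemma psiE (i : chart_idx g) : psi i * (1 + V i) = 1.
Proof.
apply: sfun_ext => q; rewrite evM evD ev1 ev_mk ev_mk mulVf // gt_eqF //; exact: V_gt (svalP q).
Qed.

Lemma flat_metric_on (i : chart_idx g) : chart_metric_on (chart_cod i) (flat_metric i).
Proof.
split.
- move=> a b; apply: (smooth_on_eq _ (smooth_on_mul (smooth_on_mul (@psi_smooth i) (@psi_smooth i))
    (cm_smooth (cod_metric hm i) a b))) => x _.
  by rewrite mxE expr2.
- by move=> x cx; rewrite linearZ /= (cm_sym (cod_metric hm i) cx).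
- move=> x cx w w0; rewrite -scalemxAr -scalemxAl mxE mulr_gt0 ?exprn_gt0 ?invr_gt0 //.
    exact: V_gt.
  exact: (cm_pos (cod_metric hm i) cx).
Qed.

Local Notation sH i := (s_metric (flat_metric_on i)).
Local Notation sHi i := (s_inv (flat_metric_on i)).
Local Notation GamH i := (s_gam (hA i) (flat_metric_on i)).

Lemma s_flat_metric (i : chart_idx g) : sH i = conf_metric (sG i) (psi i).
Proof.
apply: ev_mx_inj => q; rewrite ev_metric /flat_metric /conf_metric -(ev_metric (cod_metric hm i)).
by apply/matrixP => a b; rewrite [LHS]mxE [RHS]mxE scalemxE evM expr2 evM mxE.
Qed.

Lemma conf_lc (i : chart_idx g) : levi_civita (d i) (sH i) (conf_inv (sGi i) (V i)) (conf_gam (d i) (sG i) (sGi i) (Gam i) (V i) (psi i)).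
Proof. rewrite s_flat_metric. have hh := (conf_levi_civita (lc i) (psiE i)). exact: hh. Qed.

Lemma s_flat_gam i a : GamH i a = conf_gam (d i) (sG i) (sGi i) (Gam i) (V i) (psi i) a.
Proof. exact: (levi_civita_unique (ex_half _) (s_lc (hA i) (flat_metric_on i)) (conf_lc i)). Qed.

(** Minus the gradient of [v]: it points away from the maximum of [v] and becomes the position
    vector in the flat coordinates. *)
Definition euler (i : chart_idx g) : 'cV[sfun (chart_cod i)]_n := - grad_vec (d i) (sGi i) (V i).

Lemma euler_homothetic i a : dmx (d i) a (euler i) + (GamH i a)^T *m euler i = delta_mx a 0.
Proof.
rewrite s_flat_gam; exact: (conf_homothetic (lc i) (psiE i) (ob_hess ob i) (ob_norm ob i)).
Qed.

Lemma euler_norm i : ((euler i)^T *m sH i *m euler i) 0 0 = psi i ^+ 2 * (1 - V i ^+ 2).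
Proof. by rewrite s_flat_metric; exact: (conf_norm (lc i) (psi i) (ob_norm ob i)). Qed.

Lemma flat_metric_trans i j x : trans_dom i j x ->
  flat_metric i x = jac (trans i j) x *m flat_metric j (trans i j x) *m (jac (trans i j) x)^T.
Proof.
move=> Tx; rewrite /flat_metric (trans_metric hm Tx) -scalemxAr -scalemxAl; congr (_ *: _).
congr ((1 + _)^-1 ^+ 2); move: Tx => [p [di dj] <-].
by rewrite (transE hm j di) /local_fun !(chartK hm).
Qed.

Local Notation K i := (curvK (hA i) (flat_metric_on i)).

Lemma ev_curvK i q : ev q (K i) = - contract (invmx (flat_metric i (sval q))) (fun b b' =>
  contract (invmx (flat_metric i (sval q))) (fun c c' =>
    \tr (map_mx (ev q) (curv (d i) (GamH i) b c) *m map_mx (ev q) (curv (d i) (GamH i) b' c')))).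
Proof.
rewrite -(ev_inv (flat_metric_on i)) evN; congr (- _).
rewrite /contract ev_sum; apply: eq_bigr => b _; rewrite ev_sum; apply: eq_bigr => b' _.
rewrite evM [in RHS]mxE; congr (_ * _).
rewrite ev_sum; apply: eq_bigr => c _; rewrite ev_sum; apply: eq_bigr => c' _.
by rewrite evM [in RHS]mxE -map_mxM trace_map_mx.
Qed.

Lemma curvK_ge0 i q : 0 <= ev q (K i) /\
  (ev q (K i) = 0 -> forall b c, map_mx (ev q) (curv (d i) (GamH i) b c) = 0).
Proof.
have cq := svalP q; have lcH := s_lc (hA i) (flat_metric_on i).
rewrite ev_curvK; apply: curv_norm_real; [exact: (cm_sym (flat_metric_on i) cq)|exact: (cm_pos (flat_metric_on i) cq)|].
move=> b c; rewrite -(ev_metric (flat_metric_on i)) -map_mxM (curv_antisym lcH b c).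
by rewrite map_mxN map_mxM -matrix.map_trmx.
Qed.

(** An arbitrary chart is chosen at each point; [curvature_normE] removes the choice. *)
Definition curvature_norm p : R :=
  val (K (projT1 (cid (chart_cover hm p)))) p.

Lemma curvature_normE i p : chart_dom i p -> curvature_norm p = val (K i) p.
Proof.
move=> di; rewrite /curvature_norm; case: (cid _) => j dj /=.
exact: (curvK_chart hm flat_metric_on flat_metric_trans dj di).
Qed.

Lemma curvature_norm_cont : continuous curvature_norm.
Proof.
apply: (glue_cont hm) => p; have [i di] := chart_cover hm p.
by exists i, (K i); split=> // q dq; exact: curvature_normE.
Qed.

(* Along the Euler field X of the flat metric X K = -4 K and X v = -(1 - v^2), so v K cannot have a
   positive interior maximum. *)
Lemma curvature_norm_eq0 p : curvature_norm p = 0.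
Proof.
have ge0 q : 0 <= curvature_norm q.
  have [i di] := chart_cover hm q; rewrite (curvature_normE di) (valE _ di).
  by have [] := curvK_ge0 (pt di).
have cv : continuous v by exact: (@smooth_cont _ _ _ _ hm v hv).
pose F q := v q * curvature_norm q.
have cF : continuous F by move=> q; apply: cvgM; [exact: cv|exact: curvature_norm_cont].
have [m _ hmax'] : exists2 c, c \in [set: M] & forall t, t \in [set: M] -> F t <= F c.
  apply: (@compact_EVT_max M R F setT); [by exists p|exact: ob_compact ob|].
  exact: continuous_subspaceT.
have hmax q : F q <= F m by apply: hmax'; rewrite in_setT.
suff Fm : F m <= 0.
  move: p; apply: (eq_off_boundary hm n0 curvature_norm_cont (h := cst 0)) => [q|q nb].
    exact: cvg_cst.
  have vq := ob_pos ob nb; have := le_trans (hmax q) Fm; rewrite /F /cst pmulr_rle0 // => h.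
  by apply/eqP; rewrite eq_le h ge0.
have [bm|nb] := pselect (boundary g m); first by rewrite /F (ob_bdry ob bm) mul0r.
have [i di] := chart_cover hm m.
have im := interior_chart hm di nb.
have FE q : chart_dom i q -> val (V i * K i) q = F q.
  by move=> dq; rewrite (valE _ dq) evM -!valE (val_fun hm hv dq) /F (curvature_normE dq).
have lm : local_max_at (V i * K i) (pt di).
  exists 1 => [|q _]; first exact: ltr01.
  by rewrite (ev_val hm) (FE _ (inv_dom hm (svalP q))) -valE FE.
have [d0 _] := @interior_max _ _ _ _ (hA i) (flat_metric_on i) _ (pt di) im lm.
have lcH := s_lc (hA i) (flat_metric_on i).
have D0 : ev (pt di) (deriv_along (d i) (euler i) (V i * K i)) = 0.
  by rewrite /deriv_along ev_sum big1 // => a _; rewrite evM d0 mulr0.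
move: D0; rewrite (deriv_alongM _ lcH) (deriv_along_curv_norm lcH (ex_half _) (euler_homothetic i)).
rewrite (deriv_along_potential (ob_norm ob i)) evD !evM [ev _ (- (1 - _))]evN [ev _ (- 4%:R)]evN evD [ev _ (- (_ ^+ 2))]evN expr2 evM ev1 rmorph_nat.
rewrite -/(K i) -!valE (val_fun hm hv di) -(curvature_normE di) /F.
(* Up to sign what remains is (1 - v^2) K + 4 v K = 0 with 0 < v <= 1 and K >= 0, so v K = 0 at its
   maximum. *)
have vm := ob_pos ob nb; have v1 := ob_le1 ob m; have k0 := ge0 m.
by nra.
Qed.

Lemma flat i a b : curv (d i) (GamH i) a b = 0.
Proof.
apply: ev_mx_inj => q; rewrite map_mx0.
have [_ h] := curvK_ge0 q; apply: h.
by rewrite (ev_val hm) -curvature_normE ?curvature_norm_eq0 //; exact: (inv_dom hm (svalP q)).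
Qed.

End Rigidity.

(** * Integrable linear systems *)

Lemma cont_dist (R : realType) (T : topologicalType) (f : T -> R) x :
  (forall e, 0 < e -> \forall y \near x, `|f x - f y| < e) -> {for x, continuous f}.
Proof. by move=> h; apply/cvgrPdist_lt. Qed.

Section UnitIntegral.
Variable R : realType.
Implicit Types f g : R -> R.

Local Notation mu := (@lebesgue_measure R).
Local Notation I := (`[0 : R, 1]%classic).

Definition int01 f : R := Rintegral mu I f.

Definition cont01 f := forall t, 0 <= t -> t <= 1 -> {for t, continuous f}.

Lemma cont01_within f : cont01 f -> {within I, continuous f}.
Proof.
move=> cf; apply: (@continuous_in_subspaceT _ _ I) => t /set_mem.
by rewrite /= in_itv /= => /andP[t0 t1]; exact: cf.
Qed.

Lemma cont01_integrable f : cont01 f -> mu.-integrable I (EFin \o f).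
Proof.
move=> cf; apply: continuous_compact_integrable; first exact: segment_compact.
exact: cont01_within.
Qed.

Lemma cont01_cst c : cont01 (cst c).
Proof. by move=> t _ _; exact: cvg_cst. Qed.

Lemma cont01_scale c f : cont01 f -> cont01 (fun t => c * f t).
Proof. by move=> cf t t0 t1; apply: contM; [exact: cvg_cst|exact: cf]. Qed.

Lemma cont01_add f g : cont01 f -> cont01 g -> cont01 (fun t => f t + g t).
Proof. by move=> cf cg t t0 t1; apply: contD; [exact: cf|exact: cg]. Qed.

Lemma int01_ext f g : (forall t, 0 <= t -> t <= 1 -> f t = g t) -> int01 f = int01 g.
Proof.
move=> e; apply: eq_Rintegral => t; rewrite inE /= in_itv /= => /andP[t0 t1].
exact: e.
Qed.

Lemma int01_add f g : cont01 f -> cont01 g -> int01 (fun t => f t + g t) = int01 f + int01 g.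
Proof. by move=> cf cg; apply: RintegralD => //; exact: cont01_integrable. Qed.

Lemma int01_scale c f : cont01 f -> int01 (fun t => c * f t) = c * int01 f.
Proof. by move=> cf; apply: RintegralZl => //; exact: cont01_integrable. Qed.

Lemma int01_cst c : int01 (cst c) = c.
Proof.
rewrite /int01 Rintegral_cst //= lebesgue_measure_itv /= lte_fin ltr01 oppr0 adde0.
by rewrite mulr1.
Qed.

Lemma int01_abs f c : cont01 f -> (forall t, 0 <= t -> t <= 1 -> `|f t| <= c) -> `|int01 f| <= c.
Proof.
move=> cf h.
have le g : cont01 g -> (forall t, 0 <= t -> t <= 1 -> g t <= c) -> int01 g <= c.
  move=> cg hg; rewrite -[leRHS]int01_cst; apply: le_Rintegral => //.
  - exact: cont01_integrable.
  - by apply: cont01_integrable; exact: cont01_cst.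
  by move=> t; rewrite /= in_itv /= => /andP[t0 t1]; exact: hg.
rewrite ler_norml; apply/andP; split.
  rewrite lerNl -mulN1r -int01_scale //; apply: le.
    by move=> t t0 t1; apply: contM; [exact: cvg_cst|exact: cf].
  by move=> t t0 t1; rewrite mulN1r lerNl; have := h t t0 t1; rewrite ler_norml => /andP[].
by apply: le => // t t0 t1; have := h t t0 t1; rewrite ler_norml => /andP[].
Qed.

Lemma int01_ftc (F f : R -> R) : (forall t : R, 0 <= t -> t <= 1 -> is_derive t 1 F (f t)) -> cont01 f ->
  int01 f = F 1 - F 0.
Proof.
move=> dF cf.
have cF (t : R) : 0 <= t -> t <= 1 -> {for t, continuous F}.
  move=> t0 t1; have [d _] := dF t t0 t1.
  by apply: differentiable_continuous; apply/derivable1_diffP.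
rewrite /int01 /Rintegral (@continuous_FTC2 R f F 0 1) //.
- exact: cont01_within.
- split.
  + by move=> t; rewrite in_itv /= => /andP[t0 t1]; have [] := dF t (ltW t0) (ltW t1).
  + by apply: cvg_at_right_filter; exact: (cF 0 (lexx _) ler01).
  + by apply: cvg_at_left_filter; exact: (cF 1 ler01 (lexx _)).
- move=> t; rewrite in_itv /= => /andP[t0 t1]; rewrite derive1E.
  by have [_ ->] := dF t (ltW t0) (ltW t1).
Qed.

End UnitIntegral.

Lemma is_derive_bigsum (R : realType) (V : normedModType R) T (s : seq T) (f : T -> V -> R) df (x v : V) :
  (forall i, is_derive x v (f i) (df i)) ->
  is_derive x v (fun y => \sum_(i <- s) f i y) (\sum_(i <- s) df i).
Proof.
move=> h; elim: s => [|i s IH].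
  rewrite big_nil; have -> : (fun y => \sum_(i <- [::]) f i y) = cst 0.
    by apply/funext => y; rewrite big_nil.
  exact: is_derive_cst.
rewrite big_cons; have -> : (fun y => \sum_(j <- i :: s) f j y) = f i + (fun y => \sum_(j <- s) f j y).
  by apply/funext => y; rewrite big_cons.
exact: is_deriveD.
Qed.

(** * Weighted averages along rays from the origin *)

Section Radial.
Variables (R : realType) (n : nat) (r : R).
Implicit Types (h f : 'rV[R]_n -> R) (x y : 'rV[R]_n).

Definition cube : set 'rV[R]_n := [set x | `|x| < r].
Local Notation U := cube.
Local Notation evec i := (evec R i).

Lemma cube_open : open cube.
Proof.
have -> : cube = (fun x => `|x|) @^-1` [set t | t < r] by [].
by apply: open_comp; [move=> x _; exact: norm_continuous|exact: open_lt].
Qed.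

Lemma cube_scale t x : U x -> 0 <= t -> t <= 1 -> U (t *: x).
Proof.
by move=> Ux t0 t1; rewrite /U /= normrZ (ger0_norm t0); apply: le_lt_trans Ux; rewrite ler_piMl.
Qed.

Definition contU h := forall x, U x -> {for x, continuous h}.

(** Differentiating h(t x) in x brings out one factor t, so the family over all [k] is closed under
    derivatives. *)
Definition rad k h x : R := int01 (fun t => t ^+ k * h (t *: x)).

Lemma scale_cont x (t : R) : {for t, continuous (fun s : R => s *: x)}.
Proof. by apply: cvgZr_tmp; exact: cvg_id. Qed.

Lemma exp_cont k (t : R) : {for t, continuous (fun s : R => s ^+ k)}.
Proof. exact: exprn_continuous. Qed.

Lemma rad_integrand_cont k h x : contU h -> U x -> cont01 (fun t => t ^+ k * h (t *: x)).
Proof.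
move=> ch Ux t t0 t1; apply: contM; first exact: exp_cont.
apply: (@continuous_comp _ _ _ (fun s : R => s *: x) h); first exact: scale_cont.
by apply: ch; exact: cube_scale.
Qed.

Lemma rad_ext k h f x : (forall t, 0 <= t -> t <= 1 -> h (t *: x) = f (t *: x)) ->
  rad k h x = rad k f x.
Proof. by move=> e; apply: int01_ext => t t0 t1; rewrite e. Qed.

Lemma rad_add k h f x : contU h -> contU f -> U x ->
  rad k (fun y => h y + f y) x = rad k h x + rad k f x.
Proof.
move=> ch cf Ux; rewrite /rad -int01_add; [|exact: rad_integrand_cont..].
by apply: int01_ext => t _ _; rewrite mulrDr.
Qed.

Lemma rad_scale k c h x : contU h -> U x -> rad k (fun y => c * h y) x = c * rad k h x.
Proof.
move=> ch Ux; rewrite /rad -int01_scale; last exact: rad_integrand_cont.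
by apply: int01_ext => t _ _; rewrite mulrCA.
Qed.

Lemma contU_sub h f : contU h -> contU f -> contU (fun y => h y - f y).
Proof. by move=> ch cf x Ux; apply: continuousB; [exact: ch|exact: cf]. Qed.

Lemma contU_add h f : contU h -> contU f -> contU (fun y => h y + f y).
Proof. by move=> ch cf x Ux; apply: contD; [exact: ch|exact: cf]. Qed.

Lemma contU_mul h f : contU h -> contU f -> contU (fun y => h y * f y).
Proof. by move=> ch cf x Ux; apply: contM; [exact: ch|exact: cf]. Qed.

Lemma contU_cst c : contU (cst c).
Proof. by move=> x _; exact: (@cst_continuous _ _ c x). Qed.

Lemma contU_sum (I : Type) (s : seq I) (F : I -> 'rV[R]_n -> R) :
  (forall i, contU (F i)) -> contU (fun y => \sum_(i <- s) F i y).
Proof.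
move=> cF; elim: s => [|i s IH].
  by have -> : (fun y => \sum_(i <- [::]) F i y) = cst 0; [apply/funext => y; rewrite big_nil|exact: contU_cst].
have -> : (fun y => \sum_(j <- i :: s) F j y) = (fun y => F i y + \sum_(j <- s) F j y).
  by apply/funext => y; rewrite big_cons.
exact: contU_add.
Qed.

Lemma rad_sub k h f x : contU h -> contU f -> U x ->
  rad k (fun y => h y - f y) x = rad k h x - rad k f x.
Proof.
move=> ch cf Ux; rewrite -mulN1r -rad_scale // -rad_add //.
  by apply: rad_ext => t _ _; rewrite mulN1r.
by apply: contU_mul => //; exact: contU_cst.
Qed.

Lemma rad_sum k (I : Type) (s : seq I) (F : I -> 'rV[R]_n -> R) x : (forall i, contU (F i)) -> U x ->
  rad k (fun y => \sum_(i <- s) F i y) x = \sum_(i <- s) rad k (F i) x.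
Proof.
move=> cF Ux; elim: s => [|i s IH].
  rewrite big_nil; transitivity (rad k (fun y => 0 * 0) x).
    by apply: rad_ext => t _ _; rewrite big_nil mulr0.
  by rewrite (rad_scale k 0 (@contU_cst 0) Ux) mul0r.
rewrite big_cons -IH -rad_add //; last exact: contU_sum.
by apply: rad_ext => t _ _; rewrite big_cons.
Qed.

Lemma rad_abs k h x c : contU h -> U x -> (forall t, 0 <= t -> t <= 1 -> `|h (t *: x)| <= c) ->
  `|rad k h x| <= c.
Proof.
move=> ch Ux hc; apply: int01_abs; first exact: rad_integrand_cont.
move=> t t0 t1; rewrite normrM ger0_norm ?exprn_ge0 //.
apply: le_trans (hc t t0 t1); rewrite ler_piMl //.
exact: exprn_ile1.
Qed.

(** Uniform continuity in a tube around the segment from 0 to [x], from compactness of [0, 1]; it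
    justifies limits under the integral sign. *)
Lemma segment_unif h x (e : R) : contU h -> U x -> 0 < e -> exists2 del : R, 0 < del &
  forall t y, 0 <= t -> t <= 1 -> `|y - t *: x| < del -> `|h y - h (t *: x)| < e.
Proof.
move=> ch Ux e0.
have e2 : 0 < e / 2 by rewrite divr_gt0.
have /compact_near_coveringP cov := @segment_compact R 0 1.
pose P (del t : R) := forall y, `|y - t *: x| < del -> `|h y - h (t *: x)| < e.
have hcov : \forall del \near (0:R)^'+, `[0 : R, 1]%classic `<=` P del.
  apply: cov => t; rewrite /= in_itv /= => /andP[t0 t1].
  have /cvgr_dist_lt/(_ _ e2)/nbhs_ballP[rho /= rho0 hrho] := ch _ (cube_scale Ux t0 t1).
  have rho2 : 0 < rho / 2 by rewrite divr_gt0.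
  have nt : \forall s \near t, `|s *: x - t *: x| < rho / 2.
    have := @scale_cont x t; move/cvgr_dist_lt => /(_ _ rho2).
    by apply: nearS => s; rewrite distrC.
  have nd : \forall del \near (0:R)^'+, del < rho / 2 by exact: nbhs_right_lt.
  exists ([set s | `|s *: x - t *: x| < rho / 2], [set del | del < rho / 2]); first by split.
  move=> [s del] /= [hs hdel] y hy.
  have h1 : `|h (t *: x) - h (s *: x)| < e / 2.
    by apply: hrho; rewrite -ball_normE /= distrC; apply: lt_trans hs _; lra.
  have h2 : `|h (t *: x) - h y| < e / 2.
    apply: hrho; rewrite -ball_normE /= distrC.
    by have := ler_distD (s *: x) y (t *: x); lra.
  by have := ler_distD (h (t *: x)) (h y) (h (s *: x)); rewrite (distrC (h y) (h (t *: x))); lra.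
have pf : ProperFilter (0:R)^'+ by exact: at_right_proper_filter.
have [del [/= hdel del0]] := @filter_ex _ _ pf _ (filterI hcov (nbhs_right_gt (0:R))).
exists del => // t y t0 t1; apply: hdel.
by rewrite /= in_itv /= t0 t1.
Qed.

Lemma rad_sum_sub k (I : Type) (s : seq I) (P Q S : I -> 'rV[R]_n -> R) x :
  (forall i, contU (P i)) -> (forall i, contU (Q i)) -> (forall i, contU (S i)) -> U x ->
  (forall t, 0 <= t -> t <= 1 ->
    \sum_(i <- s) P i (t *: x) - \sum_(i <- s) Q i (t *: x) = \sum_(i <- s) S i (t *: x)) ->
  \sum_(i <- s) rad k (P i) x - \sum_(i <- s) rad k (Q i) x = \sum_(i <- s) rad k (S i) x.
Proof.
move=> cP cQ cS Ux e; rewrite -!rad_sum // -rad_sub //; try exact: contU_sum.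
exact: rad_ext.
Qed.

Lemma rad_cont k h : contU h -> contU (rad k h).
Proof.
move=> ch x Ux; apply: cont_dist => e e0.
have e2 : 0 < e / 2 by rewrite divr_gt0.
have [del del0 hdel] := segment_unif ch Ux e2.
have nU : \forall y \near x, U y by apply: open_nbhs_nbhs; split=> //; exact: cube_open.
have nd : \forall y \near x, `|y - x| < del.
  by apply/nbhs_ballP; exists del => // y; rewrite -ball_normE /= distrC.
apply: nearS (nearI nU nd) => y [Uy yx].
apply: (@le_lt_trans _ _ (e / 2)); last by lra.
rewrite /rad.
have -> : int01 (fun t => t ^+ k * h (t *: x)) - int01 (fun t => t ^+ k * h (t *: y)) =
    int01 (fun t => t ^+ k * h (t *: x) + -1 * (t ^+ k * h (t *: y))).
  rewrite int01_add ?int01_scale ?mulN1r //; try exact: rad_integrand_cont.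
  move=> t t0 t1; apply: contM; first exact: cvg_cst.
  exact: rad_integrand_cont.
apply: int01_abs => [t t0 t1|t t0 t1].
  apply: contD; first exact: rad_integrand_cont.
  by apply: contM; [exact: cvg_cst|exact: rad_integrand_cont].
rewrite mulN1r -mulrBr normrM ger0_norm ?exprn_ge0 //.
apply: (@le_trans _ _ `|h (t *: x) - h (t *: y)|).
  by rewrite ler_piMl // exprn_ile1.
rewrite distrC; apply/ltW/hdel => //.
rewrite -scalerBr normrZ ger0_norm //; apply: le_lt_trans yx.
by rewrite ler_piMl.
Qed.

(** Differentiation under the integral: the mean value theorem rewrites the difference quotient of
    the integrand as a derivative at a nearby point, uniformly close by [segment_unif]. *)
Lemma rad_der k h j x : Ck_on 1 U h -> U x ->
  is_derive x (evec j) (rad k h) (rad k.+1 ('D_(evec j) h) x).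
Proof.
move=> ch Ux.
have c0 : contU h by move=> y Uy; exact: (Ck_on_cont ch).
have c1 : contU ('D_(evec j) h) by move=> y Uy; exact: (Ck_on_cont (Ck_on_derive ch j)).
apply: cvg_is_derive; apply/cvgrPdist_lt => e e0.
have e2 : 0 < e / 2 by rewrite divr_gt0.
have [del del0 hdel] := segment_unif c1 Ux e2.
have evn : `|evec j| <= 1.
  by apply: norm_le_coord => // i; rewrite !mxE; case: (_ && _); rewrite ?normr1 ?normr0.
pose rho := r - `|x|; have rho0 : 0 < rho by rewrite subr_gt0.
have hrho (t s w : R) : 0 <= t -> t <= 1 -> `|s| < rho -> `|w| <= `|t * s| -> U (t *: x + w *: evec j).
  move=> t0 t1 hs hw; rewrite /U /=.
  apply: (@le_lt_trans _ _ (t * (`|x| + `|s|))).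
    apply: le_trans (ler_normD _ _) _; rewrite !normrZ mulrDr (ger0_norm t0) lerD2l.
    rewrite normrM (ger0_norm t0) in hw; apply: le_trans hw.
    by rewrite ler_piMr.
  have hs' : `|x| + `|s| < r by rewrite -ltrBrDl.
  by apply: le_lt_trans hs'; rewrite ler_piMl // addr_ge0.
have near0 : \forall s \near (0:R)^', s != 0 /\ `|s| < Num.min rho del.
  rewrite near_withinE; have m0 : 0 < Num.min rho del by rewrite lt_min rho0 del0.
  apply/nbhs_ballP; exists (Num.min rho del) => // s; rewrite -ball_normE /= sub0r normrN => hs s0.
  by split.
move: near0; apply: filterS => s [s0]; rewrite lt_min => /andP[s1 s2].
have Uy : U (s *: evec j + x).
  by have := hrho 1 s s ler01 (lexx _) s1; rewrite mul1r scale1r addrC; apply.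
set y := s *: evec j + x in Uy *.
apply: (@le_lt_trans _ _ (e / 2)); last by lra.
have icx := @rad_integrand_cont k h x c0 Ux; have icy := @rad_integrand_cont k h y c0 Uy.
have icd := @rad_integrand_cont k.+1 _ x c1 Ux.
have -> : rad k.+1 ('D_(evec j) h) x - s^-1 * (rad k h y - rad k h x) =
    int01 (fun t => t ^+ k.+1 * 'D_(evec j) h (t *: x) +
      - s^-1 * (t ^+ k * h (t *: y) + -1 * (t ^+ k * h (t *: x)))).
  rewrite int01_add ?int01_scale ?int01_add ?int01_scale //; try by [].
  - by rewrite mulN1r mulNr.
  - exact: cont01_scale.
  - by apply: cont01_add => //; exact: cont01_scale.
  - by apply: cont01_scale; apply: cont01_add => //; exact: cont01_scale.
apply: int01_abs => [|t t0 t1].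
  by apply: cont01_add => //; apply: cont01_scale; apply: cont01_add => //; exact: cont01_scale.
have dth (th : R) : `|th| <= `|t * s| -> derivable h (t *: x + th *: evec j) (evec j).
  by move=> hth; apply: (@Ck_on_derivable R n 0 U h ch j _ (hrho t s th t0 t1 s1 hth)).
have [th th1 hth] := mvt_line dth.
have -> : t *: y = t *: x + (t * s) *: evec j by rewrite /y scalerDr scalerA addrC.
have -> : t ^+ k.+1 * 'D_(evec j) h (t *: x) + - s^-1 *
   (t ^+ k * h (t *: x + (t * s) *: evec j) + -1 * (t ^+ k * h (t *: x))) =
   t ^+ k.+1 * ('D_(evec j) h (t *: x) - 'D_(evec j) h (t *: x + th *: evec j)).
  have -> : h (t *: x + (t * s) *: evec j) = h (t *: x) + t * s * 'D_(evec j) h (t *: x + th *: evec j).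
    by rewrite -hth [RHS]addrC subrK.
  by rewrite exprS; field.
rewrite normrM ger0_norm ?exprn_ge0 //; apply: (@le_trans _ _ (1 * (e / 2))); last by rewrite mul1r.
apply: ler_pM => //; first exact: exprn_ge0; first exact: exprn_ile1.
rewrite distrC; apply/ltW/hdel => //.
rewrite addrC addKr normrZ; apply: le_lt_trans s2.
apply: (@le_trans _ _ (`|s| * 1)); last by rewrite mulr1.
apply: ler_pM => //; apply: le_trans th1 _.
by rewrite normrM (ger0_norm t0) ler_piMl.
Qed.

Lemma rad_Ck m k h : Ck_on m U h -> Ck_on m U (rad k h).
Proof.
elim: m k h => [|m IH] k h ch.
  by split=> // x Ux; apply: rad_cont => // y Uy; exact: (Ck_on_cont ch).
apply: (@Ck_on_intro R n m U (rad k h) (fun j => rad k.+1 ('D_(evec j) h))); first exact: cube_open.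
- by move=> x Ux; apply: rad_cont => // y Uy; exact: (Ck_on_cont ch).
- move=> j x Ux; apply: rad_der => //.
  exact: (Ck_on_le (ltn0Sn m) ch).
- by move=> j; apply: IH; exact: Ck_on_derive.
Qed.

(* Integrating d/dt (t h(t x)) over [0, 1]. *)
Lemma rad_euler h x : Ck_on 1 U h -> U x ->
  h x = rad 0 h x + \sum_b x 0 b * rad 1 ('D_(evec b) h) x.
Proof.
move=> ch Ux.
have c0 : contU h by move=> y Uy; exact: (Ck_on_cont ch).
have c1 b : contU ('D_(evec b) h) by move=> y Uy; exact: (Ck_on_cont (Ck_on_derive ch b)).
pose D y := \sum_b x 0 b * 'D_(evec b) h y.
have cD : contU D.
  by apply: contU_sum => b; apply: contU_mul => //; exact: contU_cst.
have -> : \sum_b x 0 b * rad 1 ('D_(evec b) h) x = rad 1 D x.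
  rewrite (@rad_sum 1 _ _ (fun b y => x 0 b * 'D_(evec b) h y)) //.
    by apply: eq_bigr => b _; rewrite rad_scale.
  by move=> b; apply: contU_mul => //; exact: contU_cst.
have i0 := @rad_integrand_cont 0 h x c0 Ux; have i1 := @rad_integrand_cont 1 D x cD Ux.
rewrite /rad -int01_add //.
have dF (t : R) : 0 <= t -> t <= 1 ->
    is_derive t 1 (fun t => t * h (t *: x)) (t ^+ 0 * h (t *: x) + t ^+ 1 * D (t *: x)).
  move=> t0 t1; have Ut := cube_scale Ux t0 t1.
  have d1 : is_derive t 1 (fun s : R => h (s *: x)) (D (t *: x)).
    have := @line_Ck R n U h 0 x t cube_open ch; rewrite add0r => /(_ Ut).
    by under eq_fun do rewrite add0r.
  have d2 := is_deriveM (is_derive_id t 1) d1.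
  have -> : t ^+ 0 * h (t *: x) + t ^+ 1 * D (t *: x) = t *: D (t *: x) + h (t *: x) *: (1 : R).
    by rewrite expr0 mul1r expr1 addrC -[RHS]/(t * D (t *: x) + h (t *: x) * 1) mulr1.
  exact: d2.
rewrite (int01_ftc dF); last exact: cont01_add.
by rewrite scale1r mul1r mul0r subr0.
Qed.

End Radial.

Section Geometric.
Variable R : realType.
Implicit Types (a b c X : R).

Lemma le_geo X a b : (forall m, X <= a + b / 2 ^+ m) -> X <= a.
Proof.
move=> h; rewrite leNgt; apply/negP => lt.
have d0 : 0 < X - a by rewrite subr_gt0.
have [b0|b0] := leP b 0.
  by have := h 0%N; rewrite expr0 divr1; lra.
pose m := Num.bound (b / (X - a)).
have hm : b / (X - a) < m%:R by apply: archi_boundP; rewrite divr_ge0 // ltW.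
have m2 : m%:R <= 2 ^+ m :> R by rewrite -natrX ler_nat ltnW // ltn_expl.
have := lt_le_trans hm m2; rewrite ltr_pdivrMr // mulrC => k.
have := h m; have p0 : 0 < 2 ^+ m :> R by rewrite exprn_gt0.
have : b / 2 ^+ m < X - a by rewrite ltr_pdivrMr // mulrC.
lra.
Qed.

(** The limit is fixed before the constant [c]: it will be chosen pointwise, whereas [c] depends on
    the smaller cube considered. *)
Lemma geo_limit (u : nat -> R) : exists l, forall c, (forall m, `|u m.+1 - u m| <= c / 2 ^+ m) ->
  forall m, `|u m - l| <= 2 * c / 2 ^+ m.
Proof.
have [[c0 hc0]|nc] := pselect (exists c, forall m, `|u m.+1 - u m| <= c / 2 ^+ m); last first.
  by exists 0 => c hc; exfalso; apply: nc; exists c.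
have inc c : (forall m, `|u m.+1 - u m| <= c / 2 ^+ m) -> forall k m, (k <= m)%N ->
    u k - 2 * c / 2 ^+ k <= u m - 2 * c / 2 ^+ m /\ u m + 2 * c / 2 ^+ m <= u k + 2 * c / 2 ^+ k.
  move=> hc k m; elim: m => [|m IH]; first by rewrite leqn0 => /eqP ->.
  rewrite leq_eqVlt ltnS => /predU1P[->|/IH]; first by split.
  have := hc m; rewrite ler_norml => /andP[h1 h2].
  have e : 2 * c / 2 ^+ m.+1 = c / 2 ^+ m.
    by rewrite exprS; field; rewrite expf_neq0.
  have e2 : 2 * c / 2 ^+ m = c / 2 ^+ m + c / 2 ^+ m by field; rewrite expf_neq0.
  by rewrite e e2; lra.
pose S := range (fun m => u m - 2 * c0 / 2 ^+ m).
have ubS m : ubound S (u m + 2 * c0 / 2 ^+ m).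
  move=> _ [k _ <-]; have [km|mk] := leqP k m.
    have [h1 h2] := inc _ hc0 k m km.
    have : 0 <= 2 * c0 / 2 ^+ m.
      by have := le_trans (normr_ge0 _) (hc0 m); rewrite -mulrA => h; rewrite mulr_ge0.
    lra.
  have [h1 h2] := inc _ hc0 m k (ltnW mk).
  have : 0 <= 2 * c0 / 2 ^+ k.
    by have := le_trans (normr_ge0 _) (hc0 k); rewrite -mulrA => h; rewrite mulr_ge0.
  lra.
have hl m : `|u m - sup S| <= 2 * c0 / 2 ^+ m.
  have h1 : sup S <= u m + 2 * c0 / 2 ^+ m.
    by apply: ge_sup; [exists (u 0%N - 2 * c0 / 2 ^+ 0); exists 0%N|exact: ubS].
  have h2 : u m - 2 * c0 / 2 ^+ m <= sup S.
    by apply: ub_le_sup; [exists (u 0%N + 2 * c0 / 2 ^+ 0); exact: ubS|exists m].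
  by rewrite ler_norml; apply/andP; split; lra.
exists (sup S) => c hc m; apply: (@le_geo _ _ (2 * c + 2 * c0)) => k0.
pose k := maxn m k0.
have [h1 h2] := inc _ hc m k (leq_maxl _ _).
have hk := hl k.
have le_k : (2 * c + 2 * c0) / 2 ^+ k <= (2 * c + 2 * c0) / 2 ^+ k0.
  have p : 0 <= 2 * c + 2 * c0.
    have := le_trans (normr_ge0 _) (hc 0%N); have := le_trans (normr_ge0 _) (hc0 0%N).
    by rewrite expr0 !divr1; lra.
  apply: ler_wpM2l => //; rewrite lef_pV2 ?posrE ?exprn_gt0 //.
  by apply: ler_weXn2l; [rewrite ler1n|exact: leq_maxr].
apply: le_trans (_ : 2 * c / 2 ^+ m + (2 * c + 2 * c0) / 2 ^+ k <= _); last by rewrite lerD2l.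
rewrite mulrDl; have e0 : 0 <= 2 * c / 2 ^+ k.
  have := le_trans (normr_ge0 _) (hc k); rewrite -mulrA => h; rewrite mulr_ge0 //.
move: hk; rewrite !ler_norml => /andP[h3 h4]; apply/andP; split; lra.
Qed.

End Geometric.

(** * Picard iteration along rays and regularity of its limit *)

Section LinearSystem.
Variables (R : realType) (n : nat) (r : R) (I : finType).
Local Notation U := (@cube R n r).
Local Notation evec i := (evec R i).
Variables (A : 'I_n -> I -> I -> 'rV[R]_n -> R) (al : R).
Hypothesis cA : forall a i j, Cinf_on U (A a i j).
Hypothesis hal : forall a i j x, U x -> `|A a i j x| <= al.
Hypothesis small : n%:R * #|I|%:R * r * al <= 4^-1.
Implicit Types (F G h : I -> 'rV[R]_n -> R) (x y : 'rV[R]_n).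

Let contA a i j : contU r (A a i j).
Proof. by move=> x Ux; exact: (Ck_on_cont (cA a i j 0%N)). Qed.

Definition contI F := forall i, contU r (F i).

Let contAF a i j F : contI F -> contU r (fun y => A a i j y * F j y).
Proof. by move=> cF; apply: contU_mul. Qed.

(* On a ray from 0 the system [D_a F_i = sum_j A_a i j F_j] integrates to [F = F(0) + ray_op 0 F]. *)
Definition ray_op k F (i : I) x : R :=
  \sum_a \sum_j x 0 a * rad k (fun y => A a i j y * F j y) x.

Lemma coord_contU a : contU r (fun x : 'rV[R]_n => x 0 a).
Proof. by move=> x _; exact: coord_continuous. Qed.

Lemma ray_op_cont k F : contI F -> contI (ray_op k F).
Proof.
move=> cF i; apply: contU_sum => a; apply: contU_sum => j.
by apply: contU_mul; [exact: coord_contU|apply: rad_cont; exact: contAF].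
Qed.

Lemma ray_op_sub k F G i x : contI F -> contI G -> U x ->
  ray_op k (fun j y => F j y - G j y) i x = ray_op k F i x - ray_op k G i x.
Proof.
move=> cF cG Ux; rewrite /ray_op -sumrB; apply: eq_bigr => a _; rewrite -sumrB; apply: eq_bigr => j _.
rewrite -mulrBr -(rad_sub (r := r)) //; try exact: contAF.
by congr (_ * _); apply: rad_ext => t _ _; rewrite mulrBr.
Qed.

Lemma sum2_bound (f : 'I_n -> I -> R) c : (forall a j, `|f a j| <= c) ->
  `|\sum_a \sum_j f a j| <= n%:R * #|I|%:R * c.
Proof.
move=> h; apply: le_trans (ler_norm_sum _ _ _) _.
apply: (@le_trans _ _ (\sum_(a < n) #|I|%:R * c)); last first.
  by rewrite sumr_const card_ord -[X in X <= _]mulr_natl mulrA.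
apply: ler_sum => a _; apply: le_trans (ler_norm_sum _ _ _) _.
apply: (@le_trans _ _ (\sum_(j : I) c)); first by apply: ler_sum.
by rewrite sumr_const -[leLHS]mulr_natl.
Qed.

(** There are n |I| terms of size at most r al c, and [small] bounds the total. The room left below
    1/2 absorbs the source term in the estimate of derivatives and a factor 2 in the flatness
    defect. *)
Lemma ray_op_abs k F i x c : contI F -> U x -> 0 <= c ->
  (forall j t, 0 <= t -> t <= 1 -> `|F j (t *: x)| <= c) -> `|ray_op k F i x| <= c / 4.
Proof.
move=> cF Ux c0 hF.
apply: le_trans (@sum2_bound _ (r * (al * c)) _) _.
  move=> a j; rewrite normrM; apply: ler_pM => //.
    by apply: le_trans (coord_le_norm x a) (ltW Ux).
  apply: (rad_abs (r := r)) => //; first exact: contAF.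
  move=> t t0 t1; rewrite normrM; apply: ler_pM => //; last exact: hF.
  by apply: hal; exact: cube_scale.
have -> : n%:R * #|I|%:R * (r * (al * c)) = (n%:R * #|I|%:R * r * al) * c by ring.
by rewrite [leRHS]mulrC; exact: ler_wpM2r.
Qed.

Definition solves k h F := forall i x, U x -> F i x = h i x + ray_op k F i x.

Lemma cube_bounded (J : finType) (F : J -> 'rV[R]_n -> R) rho : (forall i, contU r (F i)) -> rho < r ->
  exists2 c, 0 <= c & forall i x, `|x| <= rho -> `|F i x| <= c.
Proof.
move=> cF rr.
have /choice[c hc] : forall i, exists c, forall x, `|x| <= rho -> `|F i x| <= c.
  move=> i; have [rho0|rho0] := leP 0 rho; last first.
    by exists 0 => x hx; have := le_lt_trans hx rho0; rewrite ltNge normr_ge0.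
  have [m _ hm] : exists2 m, m \in [set y : 'rV[R]_n | `|y - 0| <= rho] &
      forall t, t \in [set y : 'rV[R]_n | `|y - 0| <= rho] -> `|F i t| <= `|F i m|.
    apply: (@EVT_max_rV R n (fun y => `|F i y|)).
    - by exists 0; rewrite /= subrr normr0.
    - exact: closed_cube_compact.
    - apply: (@continuous_in_subspaceT _ _ [set y : 'rV[R]_n | `|y - 0| <= rho]) => x /set_mem /=.
      rewrite subr0 => hx; apply: (@continuous_comp _ _ _ (F i) Num.norm).
        by apply: cF; exact: le_lt_trans hx rr.
      exact: norm_continuous.
  by exists `|F i m| => x hx; apply: hm; rewrite inE /= subr0.
exists (\sum_i `|c i|) => [|i x hx]; first by apply: sumr_ge0.
apply: le_trans (hc i x hx) _; rewrite (bigD1 i) //=.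
by apply: le_trans (ler_norm _) _; rewrite lerDl; apply: sumr_ge0.
Qed.

Fixpoint picard k h m : I -> 'rV[R]_n -> R :=
  if m is m'.+1 then fun i x => h i x + ray_op k (picard k h m') i x else h.

Lemma picardS k h m i x : picard k h m.+1 i x = h i x + ray_op k (picard k h m) i x.
Proof. by []. Qed.

Lemma picard_cont k h m : contI h -> contI (picard k h m).
Proof.
move=> ch; elim: m => [|m IH] //= i.
by apply: contU_add; [exact: ch|exact: ray_op_cont].
Qed.

Lemma seg_le x rho (t : R) : `|x| <= rho -> 0 <= t -> t <= 1 -> `|t *: x : 'rV[R]_n| <= rho.
Proof. by move=> hx t0 t1; rewrite normrZ ger0_norm //; apply: le_trans hx; rewrite ler_piMl. Qed.

Lemma picard_err k h F rho : rho < r -> contI h -> contI F -> solves k h F ->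
  exists2 c, 0 <= c & forall m i x, `|x| <= rho -> `|picard k h m i x - F i x| <= c / 4 ^+ m.
Proof.
move=> rr ch cF sF.
have cd : contI (fun i y => h i y - F i y) by move=> i; exact: contU_sub.
have [c c0 hc] := cube_bounded cd rr; exists c => //.
elim=> [|m IH] i x hx; first by rewrite expr0 divr1; exact: hc.
have Ux : U x by exact: le_lt_trans hx rr.
rewrite /= sF // opprD addrACA subrr add0r -ray_op_sub //; last exact: picard_cont.
rewrite exprSr invfM mulrA; apply: ray_op_abs => //.
- by move=> j; apply: contU_sub; [exact: picard_cont|exact: cF].
- by rewrite divr_ge0 // exprn_ge0.
- by move=> j t t0 t1; apply: IH; exact: seg_le.
Qed.

Lemma pow4_le2 m : (4 ^+ m)^-1 <= (2 ^+ m)^-1 :> R.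
Proof. by rewrite lef_pV2 ?posrE ?exprn_gt0 // lerXn2r ?nnegrE // ler_nat. Qed.

Lemma picard_step k h rho : rho < r -> contI h ->
  exists2 c, 0 <= c & forall m i x, `|x| <= rho -> `|picard k h m.+1 i x - picard k h m i x| <= c / 2 ^+ m.
Proof.
move=> rr ch.
have cT : contI (ray_op k h) by exact: ray_op_cont.
have [c c0 hc] := cube_bounded cT rr; exists c => //.
suff st m i x : `|x| <= rho -> `|picard k h m.+1 i x - picard k h m i x| <= c / 4 ^+ m.
  by move=> m i x hx; apply: le_trans (st m i x hx) _; rewrite ler_wpM2l // pow4_le2.
elim: m i x => [|m IH] i x hx.
  by rewrite expr0 divr1 /= addrAC subrr add0r; exact: hc.
have Ux : U x by exact: le_lt_trans hx rr.
rewrite (picardS k h m.+1) (picardS k h m).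
rewrite opprD addrACA subrr add0r -ray_op_sub //; try exact: (@picard_cont k h m.+1 ch); try exact: (@picard_cont k h m ch).
rewrite exprSr invfM mulrA; apply: ray_op_abs => //.
- by move=> j; apply: contU_sub; [exact: (@picard_cont k h m.+1 ch j)|exact: picard_cont].
- by rewrite divr_ge0 // exprn_ge0.
- by move=> j t t0 t1; apply: IH; exact: seg_le.
Qed.

(** The Picard iterates converge geometrically on every smaller cube; since [geo_limit] gives a
    limit independent of the constants, one function solves on the whole open cube. *)
Lemma exists_solution k h : contI h -> exists2 F, contI F & solves k h F.
Proof.
move=> ch.
have /choice[F hF] : forall ix : I * 'rV[R]_n, exists l, forall c,
    (forall m, `|picard k h m.+1 ix.1 ix.2 - picard k h m ix.1 ix.2| <= c / 2 ^+ m) ->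
    forall m, `|picard k h m ix.1 ix.2 - l| <= 2 * c / 2 ^+ m.
  by move=> ix; exact: (geo_limit (fun m => picard k h m ix.1 ix.2)).
pose F' i x := F (i, x).
have err rho : rho < r -> exists2 c, 0 <= c & forall m i x, `|x| <= rho -> `|picard k h m i x - F' i x| <= c / 2 ^+ m.
  move=> rr; have [c c0 hc] := picard_step k rr ch; exists (2 * c); first by rewrite mulr_ge0.
  by move=> m i x hx; apply: (hF (i, x)) => m'; exact: hc.
have between x : U x -> exists2 rho, `|x| < rho & rho < r.
  by move=> Ux; exists ((`|x| + r) / 2); rewrite /U /= in Ux; lra.
have cF : contI F'.
  move=> i x Ux; have [rho xr rr] := between x Ux; have [c c0 hc] := err rho rr.
  apply: cont_dist => e e0.
  have [m hm] : exists m, c / 2 ^+ m < e / 3.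
    apply: contrapT => nm; have : e / 3 <= 0; last by lra.
    apply: (@le_geo _ _ _ c) => m; rewrite add0r leNgt; apply/negP => lt; apply: nm; by exists m.
  have := @picard_cont k h m ch i x Ux.
  have e3 : 0 < e / 3 by rewrite divr_gt0.
  move/cvgr_dist_lt => /(_ _ e3) n1.
  have n2 : \forall y \near x, `|y| < rho.
    by have := @norm_continuous _ _ x; move/cvgr_lt; apply.
  apply: nearS (nearI n1 n2) => y [h1 h2].
  have h3 := hc m i x (ltW xr); have h4 := hc m i y (ltW h2).
  have := ler_distD (picard k h m i x) (F' i x) (F' i y).
  have := ler_distD (picard k h m i y) (picard k h m i x) (F' i y).
  by rewrite (distrC (F' i x) (picard k h m i x)); lra.
exists F' => // i x Ux; have [rho xr rr] := between x Ux; have [c c0 hc] := err rho rr.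
apply/eqP; rewrite -subr_eq0 -normr_eq0 eq_le normr_ge0 andbT.
apply: (@le_geo _ _ _ (2 * c)) => m; rewrite add0r.
have h1 := hc m.+1 i x (ltW xr).
have h2 : `|ray_op k (picard k h m) i x - ray_op k F' i x| <= c / 2 ^+ m / 4.
  rewrite -ray_op_sub //; last exact: picard_cont.
  apply: ray_op_abs => //.
  - by move=> j; apply: contU_sub; [exact: picard_cont|exact: cF].
  - by rewrite divr_ge0 // exprn_ge0.
  - by move=> j t t0 t1; apply: hc; apply: seg_le => //; exact: ltW.
have p0 : 0 <= c / 2 ^+ m by rewrite divr_ge0 // exprn_ge0.
have e1 : c / 2 ^+ m.+1 = c / 2 ^+ m / 2 by rewrite exprSr invfM mulrA.
rewrite e1 in h1; rewrite -mulrA.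
have := ler_distD (picard k h m.+1 i x) (F' i x) (h i x + ray_op k F' i x).
have -> : picard k h m.+1 i x - (h i x + ray_op k F' i x) =
    ray_op k (picard k h m) i x - ray_op k F' i x.
  by rewrite picardS opprD addrACA subrr add0r.
by rewrite (distrC (F' i x) (picard k h m.+1 i x)); lra.
Qed.

(** For a fixed increment s the difference quotient of [f] is compared with that of the m-th
    approximation at a cost of order |s|^-1 2^-m, which [le_geo] removes before s tends to 0. *)
Lemma limit_is_derive (f : 'rV[R]_n -> R) (fm : nat -> 'rV[R]_n -> R) (G : 'rV[R]_n -> R) j x rho c :
  `|x| < rho -> rho < r -> (forall m, Ck_on 1 U (fm m)) -> contU r G ->
  (forall m y, `|y| <= rho -> `|fm m y - f y| <= c / 2 ^+ m) ->
  (forall m y, `|y| <= rho -> `|'D_(evec j) (fm m) y - G y| <= c / 2 ^+ m) ->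
  is_derive x (evec j) f (G x).
Proof.
move=> xr rr cf cG h0 h1; have Ux : U x by exact: lt_trans xr rr.
apply: cvg_is_derive; apply/cvgrPdist_lt => e e0.
have e2 : 0 < e / 2 by rewrite divr_gt0.
have /cvgr_dist_lt/(_ _ e2)/nbhs_ballP[d /= d0 hd] := cG x Ux.
pose d1 := Num.min d (rho - `|x|); have d10 : 0 < d1 by rewrite lt_min d0 subr_gt0.
have near0 : \forall s \near (0:R)^', s != 0 /\ `|s| < d1.
  rewrite near_withinE; apply/nbhs_ballP; exists d1 => // s.
  by rewrite -ball_normE /= sub0r normrN => hs s0; split.
move: near0; apply: filterS => s [s0]; rewrite lt_min => /andP[s1 s2].
apply: (@le_lt_trans _ _ (e / 2)); last by lra.
have evn : `|evec j| <= 1.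
  by apply: norm_le_coord => // i; rewrite !mxE; case: (_ && _); rewrite ?normr1 ?normr0.
have hy (w : R) : `|w| <= `|s| -> `|x + w *: evec j| <= rho /\ `|G x - G (x + w *: evec j)| < e / 2.
  move=> ws; have le1 : `|w *: evec j| <= `|s|.
    by rewrite normrZ; apply: le_trans ws; rewrite ler_piMr.
  split; first by apply: le_trans (ler_normD _ _) _; move: le1 s2; lra.
  by apply: hd; rewrite -ball_normE /= opprD addrA subrr add0r normrN; apply: le_lt_trans le1 s1.
apply: (@le_geo _ _ _ (`|s|^-1 * (2 * c) + c)) => m.
have dth (th : R) : `|th| <= `|s| -> derivable (fm m) (x + th *: evec j) (evec j).
  move=> /hy[th1 _]; apply: (@Ck_on_derivable R n 0 U (fm m) (cf m) j).
  exact: le_lt_trans th1 rr.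
have [th th1 hth] := mvt_line dth.
have [ty1 ty2] := hy th th1; have [sy1 _] := hy s (lexx _).
have g1 := h1 m _ ty1; have g2 := h0 m _ sy1; have g3 := h0 m x (ltW xr).
set y := x + s *: evec j in hth sy1 g2 *.
rewrite [s *: evec j + x]addrC -/y.
have p0 : 0 < 2 ^+ m :> R by rewrite exprn_gt0.
have E : G x - s^-1 * (f y - f x) = (G x - G (x + th *: evec j)) -
    ('D_(evec j) (fm m) (x + th *: evec j) - G (x + th *: evec j)) +
    s^-1 * ((fm m y - f y) - (fm m x - f x)).
  have -> : (fm m y - f y) - (fm m x - f x) = (fm m y - fm m x) - (f y - f x) by ring.
  by rewrite hth; field.
rewrite E; apply: le_trans (ler_normD _ _) _; rewrite normrM normfV.
have b1 : `|(fm m y - f y) - (fm m x - f x)| <= 2 * (c / 2 ^+ m).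
  by apply: le_trans (ler_normB _ _) _; lra.
have b2 : `|s|^-1 * `|(fm m y - f y) - (fm m x - f x)| <= `|s|^-1 * (2 * (c / 2 ^+ m)).
  by apply: ler_wpM2l => //; rewrite invr_ge0.
have b3 : `|(G x - G (x + th *: evec j)) -
    ('D_(evec j) (fm m) (x + th *: evec j) - G (x + th *: evec j))| <= e / 2 + c / 2 ^+ m.
  by apply: le_trans (ler_normB _ _) _; lra.
have -> : e / 2 + (`|s|^-1 * (2 * c) + c) / 2 ^+ m = (e / 2 + c / 2 ^+ m) + `|s|^-1 * (2 * (c / 2 ^+ m)).
  by field; rewrite !gt_eqF // normr_gt0.
exact: lerD.
Qed.

Let A' j a i l : 'rV[R]_n -> R := 'D_(evec j) (A a i l).

Let cA' j a i l : Cinf_on U (A' j a i l).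
Proof. by move=> k; exact: Ck_on_derive (cA a i l k.+1) j. Qed.

(** The part of the j-th derivative of [h + ray_op k F] free of derivatives of [F]. The rest is
    [ray_op k.+1] of these derivatives, so differentiation preserves the shape of the system. *)
Definition source k j h F (i : I) x : R := 'D_(evec j) (h i) x
  + \sum_l rad k (fun y => A j i l y * F l y) x
  + \sum_a \sum_l x 0 a * rad k.+1 (fun y => A' j a i l y * F l y) x.

Lemma ray_op_Ck m k F : (forall i, Ck_on m U (F i)) -> forall i, Ck_on m U (ray_op k F i).
Proof.
move=> cF i; apply: Ck_on_sum => [|a _]; first exact: cube_open.
apply: Ck_on_sum => [|j _]; first exact: cube_open.
apply: (Ck_on_mul (@cube_open R n r) (Ck_on_coord m a (@cube_open R n r))).
apply: rad_Ck; apply: (Ck_on_mul (@cube_open R n r)) => //; exact: cA.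
Qed.

Lemma source_Ck m k j h F : (forall i, Ck_on m.+1 U (h i)) -> (forall i, Ck_on m U (F i)) ->
  forall i, Ck_on m U (source k j h F i).
Proof.
move=> ch cF i; have oU := @cube_open R n r.
apply: (Ck_on_add oU); first apply: (Ck_on_add oU).
- exact: Ck_on_derive.
- by apply: Ck_on_sum => // l _; apply: rad_Ck; apply: (Ck_on_mul oU) => //; exact: cA.
- apply: Ck_on_sum => // a _; apply: Ck_on_sum => // l _.
  apply: (Ck_on_mul oU (Ck_on_coord m a oU)).
  by apply: rad_Ck; apply: (Ck_on_mul oU) => //; exact: cA'.
Qed.

Lemma der_ray_op k j h F i x : (forall i, Ck_on 1 U (h i)) -> (forall i, Ck_on 1 U (F i)) -> U x ->
  'D_(evec j) (fun y => h i y + ray_op k F i y) x =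
  source k j h F i x + ray_op k.+1 (fun l => 'D_(evec j) (F l)) i x.
Proof.
move=> ch cF Ux; have oU := @cube_open R n r.
have cAF a l : Ck_on 1 U (fun y => A a i l y * F l y) by apply: (Ck_on_mul oU) => //; exact: cA.
have dT a l : is_derive x (evec j) (fun y => y 0 a * rad k (fun y => A a i l y * F l y) y)
    ((j == a)%:R * rad k (fun y => A a i l y * F l y) x +
     x 0 a * rad k.+1 (fun y => A' j a i l y * F l y + A a i l y * 'D_(evec j) (F l) y) x).
  have d1 := is_derive_coord x j a; have d2 := rad_der k j (cAF a l) Ux.
  have d3 := is_deriveM d1 d2.
  have -> : rad k.+1 (fun y => A' j a i l y * F l y + A a i l y * 'D_(evec j) (F l) y) x =
      rad k.+1 ('D_(evec j) (fun y => A a i l y * F l y)) x.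
    apply: rad_ext => t t0 t1; have Ut := cube_scale Ux t0 t1.
    have dA := Ck_on_is_derive (cA a i l 1%N) j Ut; have dF := Ck_on_is_derive (cF l) j Ut.
    have [_ ->] := is_deriveM dA dF.
    by rewrite addrC [in RHS]addrC -[RHS]/(F l _ * _ + A a i l _ * _) [F l _ * _]mulrC addrC.
  by apply: is_derive_eq d3 _; rewrite addrC -[X in X + _]/(rad k _ x * _) mulrC.
have dsum : is_derive x (evec j) (fun y => h i y + ray_op k F i y) ('D_(evec j) (h i) x +
   \sum_a \sum_l ((j == a)%:R * rad k (fun y => A a i l y * F l y) x +
     x 0 a * rad k.+1 (fun y => A' j a i l y * F l y + A a i l y * 'D_(evec j) (F l) y) x)).
  apply: is_deriveD; first exact: (Ck_on_is_derive (ch i)).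
  by apply: is_derive_bigsum => a; apply: is_derive_bigsum => l; exact: dT.
have [_ ->] := dsum; rewrite /source -!addrA; congr (_ + _).
have cF0 l : contU r (F l) by move=> y Uy; exact: (Ck_on_cont (cF l)).
have cD l : contU r ('D_(evec j) (F l)) by move=> y Uy; exact: (Ck_on_cont (Ck_on_derive (cF l) j)).
have cA0 a l : contU r (A' j a i l) by move=> y Uy; exact: (Ck_on_cont (cA' j a i l 0%N)).
have -> : \sum_l rad k (fun y => A j i l y * F l y) x = \sum_a \sum_l (j == a)%:R * rad k (fun y => A a i l y * F l y) x.
  rewrite (bigD1 j) //= [X in _ + X]big1 ?addr0 => [|a aj].
    by apply: eq_bigr => l _; rewrite eqxx mul1r.
  by rewrite big1 // => l _; rewrite eq_sym (negbTE aj) mul0r.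
rewrite -!big_split; apply: eq_bigr => a _ /=; rewrite -!big_split; apply: eq_bigr => l _ /=.
congr (_ + _); rewrite (rad_add (r := r)) ?mulrDr //; exact: contU_mul.
Qed.

Lemma picard_Ck m k h : (forall i, Ck_on m U (h i)) -> forall p i, Ck_on m U (picard k h p i).
Proof.
move=> ch; elim=> [|p IH] i; first exact: ch.
exact: (Ck_on_add (@cube_open R n r) (ch i) (ray_op_Ck k IH i)).
Qed.

Lemma source_cont k j h F : (forall i, Ck_on 1 U (h i)) -> contI F -> contI (source k j h F).
Proof.
move=> ch cF i x Ux; apply: (@Ck_on_cont R n 0 U) => //; apply: source_Ck => // l.
by split=> // y Uy; exact: cF.
Qed.

Lemma source_diff k j h rho : rho < r -> exists2 K, 0 <= K & forall F G e, contI F -> contI G -> 0 <= e ->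
  (forall l y, `|y| <= rho -> `|F l y - G l y| <= e) ->
  forall i y, `|y| <= rho -> `|source k j h F i y - source k j h G i y| <= K * e.
Proof.
move=> rr; pose A3 (q : 'I_n * I * I) := A' j q.1.1 q.1.2 q.2.
have cA3 q : contU r (A3 q) by move=> y Uy; exact: (Ck_on_cont (cA' _ _ _ _ 0%N)).
have [be be0 hbe] := cube_bounded cA3 rr.
exists (#|I|%:R * `|al| + n%:R * #|I|%:R * (`|r| * be)).
  by rewrite addr_ge0 // mulr_ge0 // mulr_ge0.
move=> F G e cF cG e0 hFG i y hy; have Uy : U y by exact: le_lt_trans hy rr.
have cA3' q l : contU r (fun y => A3 q y * F l y) by exact: contU_mul.
have cA3'' q l : contU r (fun y => A3 q y * G l y) by exact: contU_mul.
have -> : source k j h F i y - source k j h G i y =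
    (\sum_l (rad k (fun y => A j i l y * F l y) y - rad k (fun y => A j i l y * G l y) y)) +
    (\sum_a \sum_l (y 0 a * (rad k.+1 (fun y => A' j a i l y * F l y) y - rad k.+1 (fun y => A' j a i l y * G l y) y))).
  rewrite sumrB; under [X in _ = _ + X]eq_bigr do (under eq_bigr do rewrite mulrBr; rewrite sumrB).
  by rewrite sumrB /source; ring.
rewrite mulrDl; apply: le_trans (ler_normD _ _) _; apply: lerD.
  apply: le_trans (ler_norm_sum _ _ _) _.
  apply: (@le_trans _ _ (\sum_(l : I) `|al| * e)); last by rewrite sumr_const -[leLHS]mulr_natl mulrA.
  apply: ler_sum => l _; rewrite -(rad_sub (r := r)) //; try exact: contAF.
  apply: (rad_abs (r := r)) => //; first by apply: contU_sub; exact: contAF.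
  move=> t t0 t1; rewrite -mulrBr normrM; apply: ler_pM => //.
    by apply: le_trans (ler_norm _); apply: hal; exact: cube_scale.
  by apply: hFG; exact: seg_le.
rewrite -[leRHS]mulrA; apply: sum2_bound => a l; rewrite normrM -mulrA; apply: ler_pM => //.
  by apply: le_trans (coord_le_norm y a) _; apply: le_trans (ler_norm _); exact: ltW Uy.
rewrite -(rad_sub (r := r)) //; try exact: (cA3' (a, i, l) l); try exact: (cA3'' (a, i, l) l).
apply: (rad_abs (r := r)) => //.
  by apply: contU_sub; [exact: (cA3' (a, i, l) l)|exact: (cA3'' (a, i, l) l)].
move=> t t0 t1; rewrite -mulrBr normrM; apply: ler_pM => //.
  by apply: (hbe (a, i, l)); exact: seg_le.
by apply: hFG; exact: seg_le.
Qed.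

(* The partial derivatives of a solution solve the differentiated system: the derivatives of the
   Picard iterates converge to its solution. *)
Lemma solution_derive k h F j : (forall i, Ck_on 1 U (h i)) -> contI F -> solves k h F ->
  exists G, [/\ contI G, solves k.+1 (source k j h F) G &
    forall i x, U x -> is_derive x (evec j) (F i) (G i x)].
Proof.
move=> ch cF sF; have cs := @source_cont k j h F ch cF.
have [G cG sG] := exists_solution k.+1 cs; exists G; split=> // i x Ux.
pose rho := (`|x| + r) / 2; have [xr rr] : `|x| < rho /\ rho < r by rewrite /rho; rewrite /U /= in Ux; lra.
have ch0 : contI h by move=> l y Uy; exact: (Ck_on_cont (ch l)).
have [c c0 hc] := picard_err rr ch0 cF sF.
have [K K0 hK] := source_diff k j h rr.
have cP m := picard_Ck k ch m.
have cP0 m : contI (picard k h m) by exact: picard_cont.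
have cDP m : contI (fun l => 'D_(evec j) (picard k h m l)).
  by move=> l y Uy; exact: (Ck_on_cont (Ck_on_derive (cP m l) j)).
have ce0 l : contU r (fun y => 'D_(evec j) (picard k h 0 l) y - G l y).
  by apply: contU_sub; [exact: cDP|exact: cG].
have [C0 C00 hC0] := cube_bounded ce0 rr.
(* Chosen so that K c <= C / 4: then the source error and the contracted error add up to at most C /
   2, which is one step of the induction. *)
pose C := C0 + 4 * (K * c); have C_ge : 0 <= C by rewrite addr_ge0 // mulr_ge0 // mulr_ge0.
have err m l y : `|y| <= rho -> `|'D_(evec j) (picard k h m l) y - G l y| <= C / 2 ^+ m.
  elim: m l y => [|m IH] l y hy.
    rewrite expr0 divr1; apply: le_trans (hC0 l y hy) _.
    by rewrite /C lerDl mulr_ge0 // mulr_ge0.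
  have Uy : U y by exact: le_lt_trans hy rr.
  have -> : 'D_(evec j) (picard k h m.+1 l) y = source k j h (picard k h m) l y +
      ray_op k.+1 (fun l => 'D_(evec j) (picard k h m l)) l y by exact: der_ray_op.
  rewrite (sG l y Uy) opprD addrACA -ray_op_sub //.
  apply: le_trans (ler_normD _ _) _.
  have b1 : `|source k j h (picard k h m) l y - source k j h F l y| <= K * (c / 2 ^+ m).
    apply: hK => //; first by rewrite divr_ge0 // exprn_ge0.
    by move=> l' y' hy'; apply: le_trans (hc m l' y' hy') _; rewrite ler_wpM2l // pow4_le2.
  have b2 : `|ray_op k.+1 (fun l y => 'D_(evec j) (picard k h m l) y - G l y) l y| <= C / 2 ^+ m / 4.
    apply: ray_op_abs => //.
    - by move=> l'; apply: contU_sub; [exact: cDP|exact: cG].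
    - by rewrite divr_ge0 // exprn_ge0.
    - by move=> l' t t0 t1; apply: IH; exact: seg_le.
  have e1 : C / 2 ^+ m.+1 = C / 2 ^+ m / 2 by rewrite exprSr invfM mulrA.
  have e2 : C / 2 ^+ m = C0 / 2 ^+ m + 4 * (K * (c / 2 ^+ m)).
    by rewrite /C mulrDl -!mulrA.
  have e3 : 0 <= C0 / 2 ^+ m by rewrite divr_ge0 // exprn_ge0.
  rewrite e1; move: (C / 2 ^+ m) (C0 / 2 ^+ m) (K * (c / 2 ^+ m)) b1 b2 e2 e3 => X Y Z.
  by move: `|_| `|_| => P Q; lra.
apply: (@limit_is_derive (F i) (fun m => picard k h m i) (G i) j x rho (c + C)) => //.
- by move=> m y hy; apply: le_trans (hc m i y hy) _; apply: ler_pM => //;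
    [rewrite lerDl|exact: pow4_le2].
- by move=> m y hy; apply: le_trans (err m i y hy) _; rewrite ler_wpM2r ?invr_ge0 ?exprn_ge0 // lerDr.
Qed.

(** Induction on the order: the derivatives solve a system of the same shape whose source has one
    derivative less than [h]. *)
Lemma solution_Ck m k h F : (forall i, Ck_on m U (h i)) -> contI F -> solves k h F ->
  forall i, Ck_on m U (F i).
Proof.
elim: m k h F => [|m IH] k h F ch cF sF i; first by split=> //; exact: cF.
have ch' l : Ck_on m U (h l) by exact: Ck_on_pred.
have cFm := IH k h F ch' cF sF.
have ch1 l : Ck_on 1 U (h l) by exact: (Ck_on_le (ltn0Sn m)).
have /choice[G hG] := fun j => solution_derive j ch1 cF sF.
apply: (@Ck_on_intro R n m U (F i) (fun j => G j i)); first exact: cube_open.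
- exact: cF.
- by move=> j x Ux; have [_ _] := hG j; apply.
- move=> j; have [cG sG _] := hG j.
  exact: (IH k.+1 (source k j h F) (G j) (source_Ck k j ch cFm) cG sG).
Qed.


(* The defect [D_a F - A_a F] solves a homogeneous linear system on the rays in [C], where the
   connection is flat. *)
Lemma flat_solution (C : set 'rV[R]_n) (c0 : I -> R) F :
  (forall x t, C x -> 0 <= t -> t <= 1 -> C (t *: x)) ->
  (forall a b i l x, U x -> C x -> 'D_(evec a) (A b i l) x - 'D_(evec b) (A a i l) x =
    \sum_j (A a i j x * A b j l x - A b i j x * A a j l x)) ->
  contI F -> solves 0 (fun i => cst (c0 i)) F ->
  forall a i x, U x -> C x -> 'D_(evec a) (F i) x = \sum_j A a i j x * F j x.
Proof.
move=> starC flatA cF sF; have oU := @cube_open R n r.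
have cC m i : Ck_on m U (cst (c0 i)) by exact: Ck_on_cst.
have cFm m i : Ck_on m U (F i) by apply: (@solution_Ck m 0 _ F (cC m) cF sF).
pose E a i x := 'D_(evec a) (F i) x - \sum_j A a i j x * F j x.
have cAF m a i j : Ck_on m U (fun y => A a i j y * F j y) by apply: (Ck_on_mul oU) => //; exact: cA.
have cSF m a i : Ck_on m U (fun y => \sum_j A a i j y * F j y).
  by apply: Ck_on_sum => [|j _]; [exact: oU|exact: cAF].
have cD a i : contU r ('D_(evec a) (F i)) by move=> y Uy; exact: (Ck_on_cont (Ck_on_derive (cFm 1%N i) a)).
have cE a i : contU r (E a i).
  by apply: contU_sub => // y Uy; exact: (Ck_on_cont (cSF 0%N a i)).
have cA0 a i j : contU r (A a i j) by move=> y Uy; exact: (Ck_on_cont (cA a i j 0%N)).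
have cAD a b i j : contU r (fun y => A a i j y * 'D_(evec b) (F j) y) by exact: contU_mul.
have cA'F a b i j : contU r (fun y => A' a b i j y * F j y).
  by apply: contU_mul => // y Uy; exact: (Ck_on_cont (cA' a b i j 0%N)).
(* Compare the derivative of the integral equation with [rad_euler] applied to the right-hand side
   of the system; flatness then exchanges derivatives of [A] for products. *)
have eqE a i x : U x -> C x -> E a i x =
    \sum_b \sum_j x 0 b * rad 1 (fun y => A b i j y * E a j y - A a i j y * E b j y) x.
  move=> Ux Cx; rewrite /E.
  have -> : 'D_(evec a) (F i) x = source 0 a (fun i => cst (c0 i)) F i x + ray_op 1 (fun l => 'D_(evec a) (F l)) i x.
    rewrite -(@der_ray_op 0 a _ F i x (cC 1%N) (cFm 1%N) Ux).
    by apply: (eq_on_derive _ oU) => // y Uy; exact: sF.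
  rewrite (rad_euler (cSF 1%N a i) Ux) /source.
  have -> : 'D_(evec a) (cst (c0 i)) x = 0 by rewrite derive_cst.
  rewrite (rad_sum (r := r)) //; last by move=> j; apply: contAF.
  have cancel (S T Q X : R) : 0 + S + T + Q - (S + X) = T + Q - X by ring.
  rewrite [LHS]cancel /ray_op -big_split -sumrB /=.
  apply: eq_bigr => b _.
  have -> : rad 1 ('D_(evec b) (fun y => \sum_j A a i j y * F j y)) x =
      \sum_j rad 1 (fun y => A' b a i j y * F j y + A a i j y * 'D_(evec b) (F j) y) x.
    rewrite -(rad_sum (r := r)) //; last by move=> j; exact: contU_add.
    apply: rad_ext => t t0 t1; have Ut := cube_scale Ux t0 t1.
    have [_ ->] : is_derive (t *: x) (evec b) (fun y => \sum_j A a i j y * F j y)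
       (\sum_j (A' b a i j (t *: x) * F j (t *: x) + A a i j (t *: x) * 'D_(evec b) (F j) (t *: x))); last by [].
    apply: is_derive_bigsum => j.
    have dA := Ck_on_is_derive (cA a i j 1%N) b Ut; have dF := Ck_on_is_derive (cFm 1%N j) b Ut.
    apply: is_derive_eq (is_deriveM dA dF) _.
    by rewrite addrC -[LHS]/(F j _ * _ + A a i j _ * _) [F j _ * _]mulrC.
  rewrite -big_split /=.
  under eq_bigr do rewrite -mulrDr.
  rewrite -mulr_sumr -mulrBr -mulr_sumr; congr (_ * _).
  have cE1 j : contU r (fun y => A b i j y * E a j y - A a i j y * E b j y).
    by apply: contU_sub; apply: contU_mul.
  have -> : \sum_l (rad 1 (fun y => A' a b i l y * F l y) x + rad 1 (fun y => A b i l y * 'D_(evec a) (F l) y) x) =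
      \sum_l rad 1 (fun y => A' a b i l y * F l y + A b i l y * 'D_(evec a) (F l) y) x.
    by apply: eq_bigr => l _; symmetry; apply: (rad_add (r := r)).
  apply: (rad_sum_sub (r := r)) => //; try by move=> j; apply: contU_add.
  move=> t t0 t1; have Ut := cube_scale Ux t0 t1; have Ct := starC x t Cx t0 t1.
  move: (t *: x) Ut Ct => {Ux Cx}x Ux Cx.
  rewrite !big_split /= opprD addrACA -!sumrB.
  have -> : \sum_i0 (A' a b i i0 x * F i0 x - A' b a i i0 x * F i0 x) =
      \sum_j (A a i j x * (\sum_l A b j l x * F l x) - A b i j x * (\sum_l A a j l x * F l x)).
    under eq_bigr do rewrite -mulrBl flatA //.
    under eq_bigr do rewrite mulr_suml.
    rewrite exchange_big /=; apply: eq_bigr => j _.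
    by rewrite !mulr_sumr -sumrB; apply: eq_bigr => l _; rewrite mulrBl !mulrA.
  by rewrite -!big_split /=; apply: eq_bigr => j _; ring.
move=> a i x Ux Cx; apply/eqP; rewrite -subr_eq0 -normr_eq0 eq_le normr_ge0 andbT.
have cE2 (q : 'I_n * I) : contU r (E q.1 q.2) by exact: cE.
have [rho xr rr] : exists2 rho, `|x| <= rho & rho < r.
  by exists `|x|.
have [c c0' hc] := cube_bounded cE2 rr.
apply: (@le_geo _ _ _ c) => m; rewrite add0r -/(E a i x).
elim: m a i x {Ux} Cx xr => [|m IH] a i x Cx xr; first by rewrite expr0 divr1; exact: (hc (a, i)).
have Ux : U x by exact: le_lt_trans xr rr.
have p0 : 0 <= c / 2 ^+ m by rewrite divr_ge0 // exprn_ge0.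
rewrite (eqE a i x Ux Cx); apply: le_trans (@sum2_bound _ (r * (al * (2 * (c / 2 ^+ m)))) _) _.
  move=> b j; rewrite normrM; apply: ler_pM => //.
    by apply: le_trans (coord_le_norm x b) (ltW Ux).
  apply: (rad_abs (r := r)) => //; first by apply: contU_sub; apply: contU_mul.
  move=> t t0 t1; have Ut := cube_scale Ux t0 t1; have Ct := starC x t Cx t0 t1.
  have tr : `|t *: x| <= rho by exact: seg_le.
  apply: le_trans (ler_normB _ _) _; rewrite !normrM.
  have h1 : `|A b i j (t *: x)| * `|E a j (t *: x)| <= al * (c / 2 ^+ m).
    by apply: ler_pM => //; [exact: hal|exact: IH].
  have h2 : `|A a i j (t *: x)| * `|E b j (t *: x)| <= al * (c / 2 ^+ m).
    by apply: ler_pM => //; [exact: hal|exact: IH].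
  by rewrite mulrCA; lra.
have -> : n%:R * #|I|%:R * (r * (al * (2 * (c / 2 ^+ m)))) = (n%:R * #|I|%:R * r * al) * (2 * (c / 2 ^+ m)) by ring.
(* The two products in the equation for the defect double the contraction factor 1/4 to 1/2, so the
   defect is halved at every step and vanishes. *)
have -> : c / 2 ^+ m.+1 = 4^-1 * (2 * (c / 2 ^+ m)) by rewrite exprSr; field; rewrite expf_neq0.
by apply: ler_wpM2r => //; rewrite mulr_ge0.
Qed.

End LinearSystem.

Lemma Ck_on_translate (R : realType) n k (V : set 'rV[R]_n) F (x0 : 'rV[R]_n) : open V -> Ck_on k V F ->
  Ck_on k [set x | V (x + x0)] (fun x => F (x + x0)).
Proof.
move=> oV cF; set V' := [set x | V (x + x0)].
have oV' : open V'.
  have -> : V' = (fun x => x + x0) @^-1` V by [].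
  apply: open_comp oV => x _; apply: (@continuousD _ _ _ id (cst x0)) => //; exact: cst_continuous.
apply: (@Ck_on_comp R n n k V' V F (fun x => x + x0)) => // i.
have -> : (fun x : 'rV[R]_n => (x + x0) 0 i) = (fun x => x 0 i + cst (x0 0 i) x).
  by apply/funext => x; rewrite mxE.
by apply: Ck_on_add => //; [exact: Ck_on_coord|exact: Ck_on_cst].
Qed.

Lemma derive_translate (R : realType) n (F : 'rV[R]_n -> R) (x0 x v : 'rV[R]_n) :
  'D_v (fun x => F (x + x0)) x = 'D_v F (x + x0).
Proof.
rewrite /derive /=; under [in RHS]eq_fun do rewrite addrA.
by [].
Qed.

(** Translation to the origin and shrinking give the smallness condition. The radius depends on the
    coefficients only, so all initial values [c0] share it. The star-shaped set [C] is where the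
    extended coefficients are still known to be flat. *)
Lemma flat_system (R : realType) n (I : finType) (A : 'I_n -> I -> I -> 'rV[R]_n -> R)
    (O C : set 'rV[R]_n) (x0 : 'rV[R]_n) : open O -> O x0 ->
  (forall a i j, Cinf_on O (A a i j)) ->
  (forall x t, C x -> 0 <= t -> t <= 1 -> C (x0 + t *: (x - x0))) ->
  (forall a b i l x, O x -> C x -> 'D_(evec R a) (A b i l) x - 'D_(evec R b) (A a i l) x =
    \sum_j (A a i j x * A b j l x - A b i j x * A a j l x)) ->
  exists2 r, 0 < r & forall c0 : I -> R, exists F : I -> 'rV[R]_n -> R, [/\
    forall i, Cinf_on [set x | `|x - x0| < r] (F i), forall i, F i x0 = c0 i &
    forall a i x, `|x - x0| < r -> C x -> O x /\ 'D_(evec R a) (F i) x = \sum_j A a i j x * F j x].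
Proof.
move=> oO Ox0 cA starC flatA.
pose B a i j x := A a i j (x + x0).
have oO' : open [set x | O (x + x0)].
  have -> : [set x | O (x + x0)] = (fun x => x + x0) @^-1` O by [].
  apply: open_comp oO => x _; apply: (@continuousD _ _ _ id (cst x0)) => //; exact: cst_continuous.
have cB a i j : Cinf_on [set x | O (x + x0)] (B a i j) by move=> k; exact: Ck_on_translate (cA a i j k).
have nO : \forall x \near (0 : 'rV[R]_n), O (x + x0).
  by apply: open_nbhs_nbhs; split=> //=; rewrite add0r.
have nb a i j : \forall x \near (0 : 'rV[R]_n), `|B a i j x| <= `|B a i j 0| + 1.
  have c0 : {for 0, continuous (B a i j)} by apply: (Ck_on_cont (cB a i j 0%N)); rewrite /= add0r.
  move/cvgr_dist_lt: c0 => /(_ 1 ltr01); apply: nearS => x hx.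
  by have := ler_distD (B a i j 0) (B a i j x) 0; rewrite !subr0 distrC in hx *; lra.
have nb' : \forall x \near (0 : 'rV[R]_n), forall a i j, `|B a i j x| <= `|B a i j 0| + 1.
  by apply: near_forall => a; apply: near_forall => i; apply: near_forall => j.
have [r0 /= r00 hr0] := (nbhs_ballP _ _).1 (nearI nO nb').
pose al := \sum_a \sum_i \sum_j (`|B a i j 0| + 1).
have B0 a i j : 0 <= `|B a i j 0| + 1 by rewrite addr_ge0.
have leal a i j : `|B a i j 0| + 1 <= al.
  have le1 (T : finType) (f : T -> R) t : (forall t, 0 <= f t) -> f t <= \sum_t f t.
    by move=> f0; rewrite (bigD1 t) //= lerDl sumr_ge0.
  apply: le_trans (le1 _ (fun j => `|B a i j 0| + 1) j _) _; first by [].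
  apply: le_trans (le1 _ (fun i => \sum_j (`|B a i j 0| + 1)) i _) _; first by move=> ?; exact: sumr_ge0.
  apply: (le1 _ (fun a => \sum_i \sum_j (`|B a i j 0| + 1))) => ?.
  by apply: sumr_ge0 => ? _; exact: sumr_ge0.
have al0 : 0 <= al by do 3 (apply: sumr_ge0 => ? _).
pose s := n%:R * #|I|%:R * al + 1; have s0 : 0 < s by rewrite ltr_wpDl // !mulr_ge0.
(* As [s] exceeds n |I| al, this yields the bound 1/4 required by [small]. *)
pose r := Num.min r0 (s^-1 / 4).
have rp : 0 < r by rewrite lt_min r00 divr_gt0 // invr_gt0.
have small : n%:R * #|I|%:R * r * al <= 4^-1.
  have -> : n%:R * #|I|%:R * r * al = (s - 1) * r by rewrite /s addrK; ring.
  apply: (@le_trans _ _ (s * (s^-1 / 4))); last by rewrite mulrA divff ?gt_eqF // mul1r.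
  apply: ler_pM; rewrite ?(ltW rp) //.
  - by rewrite /s addrK !mulr_ge0.
  - by rewrite gerBl.
  - by rewrite ge_min lexx orbT.
have inU x : cube r x -> O (x + x0) /\ forall a i j, `|B a i j x| <= al.
  rewrite /cube /= lt_min => /andP[hx _].
  have [h1 h2] : O (x + x0) /\ forall a i j, `|B a i j x| <= `|B a i j 0| + 1.
    by apply: hr0; rewrite -ball_normE /= sub0r normrN.
  by split=> // a i j; apply: le_trans (h2 a i j) (leal a i j).
exists r => // c0.
have cBU a i j : Cinf_on (@cube R n r) (B a i j).
  by move=> k; apply: Ck_on_sub (cB a i j k) => x /inU[].
have hal a i j x : cube r x -> `|B a i j x| <= al by move=> /inU[_]; apply.
have cc : contI r (fun i : I => cst (c0 i) : 'rV[R]_n -> R) by move=> i; exact: contU_cst.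
have [F cF sF] := exists_solution cBU hal small 0 cc.
have cFm m i : Ck_on m (@cube R n r) (F i).
  by apply: (solution_Ck cBU hal small _ cF sF) => l; exact: Ck_on_cst.
have F0 i : F i 0 = c0 i.
  rewrite sF; last by rewrite /cube /= normr0.
  rewrite /ray_op big1 ?addr0 // => a _; rewrite big1 // => j _.
  by rewrite mxE mul0r.
have fs := flat_solution cBU hal small (C := [set x | C (x + x0)]) _ _ cF sF.
exists (fun i x => F i (x - x0)); split.
- move=> i k; have := @Ck_on_translate R n k (cube r) (F i) (- x0) (@cube_open R n r) (cFm k i).
  by [].
- by move=> i; rewrite subrr F0.
- move=> a i x hx Cx; have [Ox _] := inU _ hx; rewrite subrK in Ox; split=> //.
  rewrite derive_translate fs //; try by rewrite /= subrK.
  + by apply: eq_bigr => j _; rewrite /B subrK.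
  + move=> {hx Ox Cx}x t /= Cx t0 t1; have := starC _ t Cx t0 t1.
    by rewrite addrK addrC.
  + move=> {hx Ox Cx a i}a b i l {}x Ux /= Cx; rewrite !derive_translate; apply: flatA => //.
    by have [] := inU _ Ux.
Qed.

(** * The inverse function theorem *)

Lemma common_radius (R : realType) (I : finType) (P : I -> R -> Prop) :
  (forall i r r', r' <= r -> P i r -> P i r') -> (forall i, exists2 r, 0 < r & P i r) ->
  exists2 r, 0 < r & forall i, P i r.
Proof.
move=> mono h.
suff [r r0 hr] : exists2 r, 0 < r & forall i, i \in index_enum I -> P i r.
  by exists r => // i; apply: hr; rewrite mem_index_enum.
elim: (index_enum I) => [|i s [r r0 hr]]; first by exists 1.
have [r' r'0 hr'] := h i.
exists (Num.min r r'); first by rewrite lt_min r0 r'0.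
move=> j; rewrite inE => /predU1P[->|js].
  by apply: mono hr'; rewrite ge_min lexx orbT.
by apply: mono (hr j js); rewrite ge_min lexx.
Qed.

Lemma mulmx_bound (R : realType) n (L : 'M[R]_n) : exists2 C : R, 0 < C & forall x : 'rV[R]_n, `|x *m L| <= C * `|x|.
Proof.
pose C := \sum_a \sum_b `|L a b|.
have C0 : 0 <= C by apply: sumr_ge0 => a _; apply: sumr_ge0.
exists (C + 1); first by lra.
move=> x; apply: norm_le_coord => [|k]; first by rewrite mulr_ge0 // addr_ge0.
rewrite mxE; apply: le_trans (ler_norm_sum _ _ _) _.
apply: (@le_trans _ _ (\sum_a `|x| * `|L a k|)).
  by apply: ler_sum => a _; rewrite normrM ler_wpM2r // coord_le_norm.
rewrite -mulr_sumr mulrC ler_wpM2r //.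
apply: (@le_trans _ _ C); last by rewrite lerDl.
by apply: ler_sum => a _; rewrite (bigD1 k) //= lerDl sumr_ge0.
Qed.

Lemma half_contraction_fixed (R : realType) n (f : 'rV[R]_n -> 'rV[R]_n) x0 (r : R) : 0 <= r ->
  (forall x, `|x - x0| <= r -> `|f x - x0| <= r) ->
  (forall x z, `|x - x0| <= r -> `|z - x0| <= r -> `|f x - f z| <= `|x - z| / 2) ->
  exists2 x, `|x - x0| <= r & f x = x.
Proof.
move=> r0 hf cf; pose u m := iter m f x0.
have hu m : `|u m - x0| <= r by elim: m => [|m IH]; [rewrite subrr normr0|exact: hf].
pose c := `|u 1%N - u 0%N|.
have du m : `|u m.+1 - u m| <= c / 2 ^+ m.
  elim: m => [|m IH]; first by rewrite expr0 divr1.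
  have h : `|u m.+2 - u m.+1| <= `|u m.+1 - u m| / 2 by exact: (cf (u m.+1) (u m) (hu _) (hu _)).
  apply: le_trans h _.
  by rewrite exprSr invfM mulrA ler_wpM2r ?invr_ge0.
have /choice[l hl] : forall k, exists l, forall m, `|u m 0 k - l| <= 2 * c / 2 ^+ m.
  move=> k; have [l hl] := geo_limit (fun m => u m 0 k); exists l; apply: hl => m.
  by have := le_trans (coord_le_norm _ k) (du m); rewrite !mxE.
pose x := (\row_k l k) : 'rV[R]_n.
have ux m : `|u m - x| <= 2 * c / 2 ^+ m.
  apply: norm_le_coord => [|k]; last by rewrite !mxE.
  by rewrite divr_ge0 ?exprn_ge0 // mulr_ge0 // normr_ge0.
have xr : `|x - x0| <= r.
  apply: (@le_geo _ _ _ (2 * c)) => m.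
  by have := ler_distD (u m) x x0; have := hu m; have := ux m; rewrite (distrC (u m) x); lra.
exists x => //; apply/eqP; rewrite -subr_eq0 -normr_eq0 eq_le normr_ge0 andbT.
apply: (@le_geo _ _ _ (2 * (2 * c))) => m.
have h1 := ux m.+1; have h2 := cf _ _ (hu m) xr; have h3 := ux m.
have e : 2 * c / 2 ^+ m.+1 = 2 * c / 2 ^+ m / 2 by rewrite exprSr invfM mulrA.
have h4 := ler_distD (u m.+1) (f x) x; rewrite (distrC (f x) (u m.+1)) in h4.
have p0 : 0 <= 2 * c / 2 ^+ m by rewrite divr_ge0 ?exprn_ge0 // mulr_ge0 // normr_ge0.
rewrite e in h1; rewrite add0r -mulrA.
by move: h1 h2 h3 h4; rewrite -/(u m.+1) -/(f (u m)); lra.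
Qed.

Section InverseFunction.
Variables (R : realType) (n : nat) (D : 'rV[R]_n -> 'rV[R]_n) (U : set 'rV[R]_n) (x0 : 'rV[R]_n).
Hypotheses (oU : open U) (cD : forall k, Cinf_on U (fun x => D x 0 k)) (Ux0 : U x0).
Implicit Types (x y z : 'rV[R]_n).

Definition jac_at x : 'M[R]_n := \matrix_(a, k) 'D_(evec R a) (fun x => D x 0 k) x.

Lemma strict_jac x (e : R) : U x -> 0 < e -> exists2 r : R, 0 < r &
  forall y z, `|y - x| < r -> `|z - x| < r -> `|D y - D z - (y - z) *m jac_at x| <= e * `|y - z|.
Proof.
move=> Ux e0.
pose P (k : 'I_n) (r : R) := forall y z, `|y - x| < r -> `|z - x| < r ->
  `|(D y - D z - (y - z) *m jac_at x) 0 k| <= e * `|y - z|.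
have [|k|r r0 hr] := @common_radius R _ P.
- by move=> k r r' rr h y z hy hz; apply: h; exact: lt_le_trans rr.
- have [r r0 hr] := strict_derivative oU (cD k 1%N) Ux e0; exists r => // y z hy hz.
  have := hr y z; rewrite (distrC x y) (distrC x z) => /(_ hy hz).
  rewrite !mxE; congr (`| _ - _ | <= _).
  by apply: eq_bigr => a _; rewrite !mxE.
exists r => // y z hy hz; apply: norm_le_coord => [|k]; first by rewrite mulr_ge0 // ltW.
exact: hr.
Qed.

Lemma jac_at_Ck m a k : Ck_on m U (fun x => jac_at x a k).
Proof.
apply: (@Ck_on_eq R n m U ('D_(evec R a) (fun x => D x 0 k))) => //.
  by move=> x _; rewrite mxE.
exact: (Ck_on_derive (cD k m.+1)).
Qed.

Lemma jac_unit_near : jac_at x0 \in unitmx -> \forall x \near x0, jac_at x \in unitmx.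
Proof.
move=> J0.
have cdet : Ck_on 0 U (fun x => \det (jac_at x)).
  apply: (@closure_det _ _ U (Ck_on 0 U)) => //.
  - by move=> f g fg; exact: (@Ck_on_eq R n 0 U f g oU fg).
  - by move=> c; exact: Ck_on_cst.
  - by move=> f g; exact: Ck_on_add.
  - by move=> f g; exact: Ck_on_mul.
  - by move=> i j; exact: jac_at_Ck.
have c0 : {for x0, continuous (fun x => \det (jac_at x))} by exact: (Ck_on_cont cdet).
have d0 : 0 < `|\det (jac_at x0)| by rewrite normr_gt0 -unitfE -unitmxE.
move/cvgr_dist_lt: c0 => /(_ _ d0); apply: nearS => x hx.
rewrite unitmxE unitfE; apply: contraTneq hx => ->.
by rewrite subr0 ltxx.
Qed.

Hypothesis J0 : jac_at x0 \in unitmx.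

(** The simplified Newton map x + (y - D x) L, with L the inverse Jacobian at [x0], is a contraction
    whose fixed point solves D x = y. The same estimate shows that the inverse is Lipschitz, hence
    differentiable by the strict derivative of [D]. *)
Lemma inverse_function (r0 : R) : 0 < r0 -> exists (r d : R) (E : 'rV[R]_n -> 'rV[R]_n),
  [/\ 0 < r /\ r <= r0, 0 < d, forall x, `|x - x0| < r -> U x /\ jac_at x \in unitmx &
   [/\ forall y, `|y - D x0| < d -> `|E y - x0| < r /\ D (E y) = y,
      forall x, `|x - x0| < r -> `|D x - D x0| < d -> E (D x) = x &
      forall k, Cinf_on [set y | `|y - D x0| < d] (fun y => E y 0 k)]].
Proof.
move=> r00; pose L := invmx (jac_at x0); have [C C0 hC] := mulmx_bound L.
(* With this tolerance in the strict derivative and |x L| <= C |x|, the Newton map contracts by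
   1/2. *)
have e0 : 0 < (2 * C)^-1 by rewrite invr_gt0 mulr_gt0.
have [r1 r10 hr1] := strict_jac Ux0 e0.
have nU : nbhs x0 U by exact: open_nbhs_nbhs.
have [r2 /= r20 hr2] := (nbhs_ballP _ _).1 (nearI nU (jac_unit_near J0)).
pose r := Num.min r0 (Num.min r1 r2).
have rp : 0 < r by rewrite !lt_min r00 r10.
have inr x : `|x - x0| < r -> [/\ `|x - x0| < r1, U x & jac_at x \in unitmx].
  rewrite /r !lt_min => /and3P[_ h1 h2]; split=> //.
    by have := hr2 x; rewrite -ball_normE /= distrC => /(_ h2)[].
  by have := hr2 x; rewrite -ball_normE /= distrC => /(_ h2)[].
pose f y x := x + (y - D x) *m L.
have fE y y' x z : f y x - f y' z = (y - y') *m L - (D x - D z - (x - z) *m jac_at x0) *m L.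
  rewrite /f [in RHS](mulmxBl (D x - D z)) mulmxK // !mulmxBl.
  by rewrite !opprB !opprD !opprK; apply/rowP => k; rewrite !mxE; ring.
have ctr y y' x z : `|x - x0| < r -> `|z - x0| < r ->
    `|f y x - f y' z| <= C * `|y - y'| + `|x - z| / 2.
  move=> /inr[hx _ _] /inr[hz _ _]; rewrite fE; apply: le_trans (ler_normB _ _) _.
  apply: lerD => //; apply: le_trans (hC _) _.
  apply: (@le_trans _ _ (C * ((2 * C)^-1 * `|x - z|))).
    by rewrite ler_wpM2l ?(ltW C0) //; exact: hr1.
  by rewrite le_eqVlt; apply/orP; left; apply/eqP; field; rewrite gt_eqF.
(* Moving y by [d] moves the Newton map by at most r/4, and the contraction adds r/4; so the closed
   cube of half-width r/2 is preserved. *)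
pose d := r / (4 * C); have d0 : 0 < d by rewrite divr_gt0 // mulr_gt0.
have fixf y : `|y - D x0| < d -> exists2 x, `|x - x0| <= r / 2 & f y x = x.
  move=> hy; have half x : `|x - x0| <= r / 2 -> `|x - x0| < r by move: (`|_|) => t; lra.
  apply: half_contraction_fixed => [|x hx|x z hx hz]; first by lra.
  - have -> : f y x - x0 = f y x - f (D x0) x0 by rewrite /f subrr mul0mx addr0.
    apply: le_trans (ctr _ _ _ _ (half _ hx) _) _; first by rewrite subrr normr0.
    have : C * `|y - D x0| <= C * d by rewrite ler_wpM2l ?(ltW C0) // ltW.
    have -> : C * d = r / 4 by rewrite /d; field; rewrite gt_eqF.
    by move: hx; move: (`|x - x0|) (C * _) => t s; lra.
  - have := ctr y y _ _ (half _ hx) (half _ hz).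
    by rewrite subrr normr0 mulr0 add0r.
have /choice[E hE] : forall y, exists x, `|y - D x0| < d -> `|x - x0| <= r / 2 /\ f y x = x.
  move=> y; have [hy|nhy] := pselect (`|y - D x0| < d); last by exists x0.
  by have [x h1 h2] := fixf y hy; exists x.
have DE y : `|y - D x0| < d -> D (E y) = y.
  move=> /hE[_ /eqP]; rewrite /f -subr_eq0 addrAC subrr add0r => /eqP e.
  have := congr1 (mulmx^~ (jac_at x0)) e; rewrite mulmxKV // mul0mx => /eqP.
  by rewrite subr_eq0 => /eqP <-.
have Er y : `|y - D x0| < d -> `|E y - x0| < r by move=> /hE[]; move: (`|E y - x0|) => t; lra.
have fid x : f (D x) x = x by rewrite /f subrr mul0mx addr0.
have lip x z : `|x - x0| < r -> `|z - x0| < r -> `|x - z| <= 2 * C * `|D x - D z|.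
  by move=> hx hz; have := ctr (D x) (D z) x z hx hz; rewrite !fid; lra.
have inj x z : `|x - x0| < r -> `|z - x0| < r -> D x = D z -> x = z.
  move=> hx hz e; apply/eqP; rewrite -subr_eq0 -normr_le0.
  by have := lip x z hx hz; rewrite e subrr normr0 mulr0.
exists r, d, E; split=> //.
- by split=> //; rewrite ge_min lexx.
- by move=> x /inr[].
split.
- by move=> y hy; split; [exact: Er|exact: DE].
- by move=> x hx hd; apply: inj; [exact: Er|by []|exact: DE].
set V := [set y | `|y - D x0| < d].
have oV : open V.
  have -> : V = (fun y => `|y - D x0|) @^-1` [set t | t < d] by [].
  apply: open_comp (@open_lt _ d) => y _; apply: (@continuous_comp _ _ _ (fun y => y - D x0) Num.norm).
    by apply: continuousB; [exact: cvg_id|exact: cst_continuous].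
  exact: norm_continuous.
have lipE y y' : V y -> V y' -> `|E y - E y'| <= 2 * C * `|y - y'|.
  move=> hy hy'; have := lip _ _ (Er y hy) (Er y' hy').
  by rewrite !DE.
have nV y : V y -> \forall y' \near y, V y' by move=> hy; exact: open_nbhs_nbhs.
have cE k y : V y -> {for y, continuous (fun y => E y 0 k)}.
  move=> hy; apply: cont_dist => e e0'.
  have e1 : 0 < e / (2 * C) by rewrite divr_gt0 // mulr_gt0.
  have n1 : \forall y' \near y, `|y' - y| < e / (2 * C).
    by apply/nbhs_ballP; exists (e / (2 * C)) => // y'; rewrite -ball_normE /= distrC.
  apply: nearS (nearI n1 (nV y hy)) => y' [h1 h2].
  apply: (@le_lt_trans _ _ `|E y - E y'|).
    by have := coord_le_norm (E y - E y') k; rewrite !mxE.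
  apply: le_lt_trans (lipE _ _ hy h2) _.
  by rewrite -ltr_pdivlMl ?mulr_gt0 // mulrC distrC.
have dE j k y : V y -> is_derive y (evec R j) (fun y => E y 0 k) (invmx (jac_at (E y)) j k).
  move=> hy; have [_ Ux Ju] := inr _ (Er y hy); set Li := invmx _.
  have [C' C'0 hC'] := mulmx_bound Li.
  apply: cvg_is_derive; apply/cvgrPdist_lt => e e0'.
  pose e' := e / (4 * C * C'); have e'0 : 0 < e' by rewrite divr_gt0 // !mulr_gt0.
  have [rho rho0 hrho] := strict_jac Ux e'0.
  have [s1 /= s10 hs1] := (nbhs_ballP _ _).1 (nV y hy).
  pose m := Num.min s1 (rho / (2 * C)); have m0 : 0 < m by rewrite lt_min s10 divr_gt0 // mulr_gt0.
  have near0 : \forall s \near (0:R)^', s != 0 /\ `|s| < m.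
    rewrite near_withinE; apply/nbhs_ballP; exists m => // s; rewrite -ball_normE /= sub0r normrN => hs s0.
    by split.
  move: near0; apply: filterS => s [s0]; rewrite lt_min => /andP[s1' s2].
  have evn : `|evec R j| <= 1.
    by apply: norm_le_coord => // i; rewrite !mxE; case: (_ && _); rewrite ?normr1 ?normr0.
  have sn : `|s *: evec R j| <= `|s| by rewrite normrZ ler_piMr.
  have Vs : V (s *: evec R j + y).
    by apply: hs1; rewrite -ball_normE /= opprD addrCA subrr addr0 normrN; exact: le_lt_trans sn s1'.
  have le1 : `|E (s *: evec R j + y) - E y| <= 2 * C * `|s|.
    apply: le_trans (lipE _ _ Vs hy) _; rewrite addrK.
    by rewrite ler_wpM2l // mulr_ge0 // ltW.
  have h1 : `|E (s *: evec R j + y) - E y| < rho.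
    apply: le_lt_trans le1 _; rewrite -ltr_pdivlMl ?mulr_gt0 //.
    by rewrite mulrC.
  have := hrho (E (s *: evec R j + y)) (E y) h1; rewrite subrr normr0 => /(_ rho0).
  rewrite !DE // addrK => h2.
  set w := E _ - E y in le1 h2.
  have h3 : `|s *: evec R j *m Li - w| <= C' * (e' * (2 * C * `|s|)).
    have -> : s *: evec R j *m Li - w = (s *: evec R j - w *m jac_at (E y)) *m Li.
      by rewrite mulmxBl mulmxK.
    apply: le_trans (hC' _) _; rewrite ler_wpM2l ?(ltW C'0) //.
    by apply: le_trans h2 _; rewrite ler_wpM2l ?(ltW e'0).
  have h4 := le_trans (coord_le_norm _ k) h3.
  have e4 : (s *: evec R j *m Li - w) 0 k = s * (Li j k - s^-1 * (E (s *: evec R j + y) 0 k - E y 0 k)).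
    rewrite !mxE (bigD1 j) //= big1 ?addr0 => [|b bj]; last by rewrite !mxE (negbTE bj) mulr0 mul0r.
    by rewrite !mxE !eqxx /= mulr1; field.
  rewrite e4 normrM in h4.
  have s0' : 0 < `|s| by rewrite normr_gt0.
  rewrite -(ltr_pM2l s0'); apply: le_lt_trans h4 _.
  have -> : C' * (e' * (2 * C * `|s|)) = `|s| * (e / 2) by rewrite /e'; field; rewrite !gt_eqF.
  by rewrite ltr_pM2l //; lra.
(* The derivative of [E] is the inverse Jacobian of [D] evaluated at [E], so C^m regularity of [E]
   gives C^(m+1). *)
suff cEm m k : Ck_on m V (fun y => E y 0 k) by move=> k m; exact: cEm.
elim: m k => [|m IH] k; first by split=> // y; exact: cE.
apply: (@Ck_on_intro R n m V _ (fun j y => invmx (jac_at (E y)) j k)) => //.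
- by move=> y; exact: cE.
move=> j; apply: (@closure_invmx _ _ V (Ck_on m V)) => //.
- by move=> g h gh; exact: (@Ck_on_eq R n m V g h oV gh).
- by move=> c; exact: Ck_on_cst.
- by move=> g h; exact: Ck_on_add.
- by move=> g h; exact: Ck_on_mul.
- by move=> g g0; exact: Ck_on_inv.
- move=> a b; apply: (@Ck_on_comp R n n m V U (fun x => jac_at x a b) E) => //; last exact: jac_at_Ck.
  by move=> y /Er/inr[].
- by move=> y /Er/inr[].
Qed.

End InverseFunction.

(** * Flat coordinates *)

Definition oball (R : realType) n (x : 'rV[R]_n) (r : R) : set 'rV[R]_n := [set y | `|y - x| < r].

Lemma oball_open (R : realType) n (x : 'rV[R]_n) r : open (oball x r).
Proof.
have -> : oball x r = (fun y : 'rV[R]_n => `|y - x|) @^-1` [set t | t < r] by [].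
apply: open_comp (@open_lt _ r) => y _; apply: (@continuous_comp _ _ _ (fun y : 'rV[R]_n => y - x) Num.norm).
  by apply: continuousB; [exact: cvg_id|exact: cst_continuous].
exact: norm_continuous.
Qed.

Lemma oball_center (R : realType) n (x : 'rV[R]_n) r : 0 < r -> oball x r x.
Proof. by rewrite /oball /= subrr normr0. Qed.

Lemma oball_sub (R : realType) n (x : 'rV[R]_n) r r' : r' <= r -> oball x r' `<=` oball x r.
Proof. by move=> h y /= hy; exact: lt_le_trans h. Qed.

Lemma rel_open_half (R : realType) n (U : set 'rV[R]_n) : open U -> rel_open (U `&` @half_space R n).
Proof. by move=> oU; exists U. Qed.

Lemma open_oball (R : realType) n (U : set 'rV[R]_n) x : open U -> U x ->
  exists2 r : R, 0 < r & oball x r `<=` U.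
Proof.
move=> oU Ux; have [r /= r0 hr] := (nbhs_ballP _ _).1 (open_nbhs_nbhs (conj oU Ux)).
by exists r => // y hy; apply: hr; rewrite -ball_normE /= distrC.
Qed.

Lemma half_space_seg (R : realType) n (x y : 'rV[R]_n) (t : R) : half_space x -> half_space y -> 0 <= t -> t <= 1 ->
  half_space (x + t *: (y - x)).
Proof.
move=> hx hy t0 t1 i i0; rewrite !mxE.
have := hx i i0; have := hy i i0 => h1 h2.
have -> : x 0 i + t * (y 0 i - x 0 i) = (1 - t) * x 0 i + t * y 0 i by ring.
by rewrite addr_ge0 // mulr_ge0 // subr_ge0.
Qed.

Lemma oball_seg (R : realType) n (x y : 'rV[R]_n) (t r : R) : oball x r y -> 0 <= t -> t <= 1 ->
  oball x r (x + t *: (y - x)).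
Proof.
move=> hy t0 t1; rewrite /oball /= addrAC subrr add0r normrZ ger0_norm //.
by apply: le_lt_trans hy; rewrite ler_piMl.
Qed.

Section LocalExtension.
Variables (R : realType) (n : nat).
Implicit Types (A C : set 'rV[R]_n) (x y : 'rV[R]_n).

Lemma common_ext (I : finType) A (f : I -> 'rV[R]_n -> R) x : (forall i, smooth_on A (f i)) -> A x ->
  exists (r : R) (F : I -> 'rV[R]_n -> R), [/\ 0 < r, forall i, Cinf_on (oball x r) (F i) &
    forall i y, A y -> oball x r y -> F i y = f i y].
Proof.
move=> sf Ax.
pose P i (r : R) := exists F, Cinf_on (oball x r) F /\ forall y, A y -> oball x r y -> F y = f i y.
have [|i|r r0 hr] := @common_radius R I P.
- move=> i r r' rr [F [cF eF]]; exists F; split.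
    by apply: Cinf_on_sub cF; exact: oball_sub.
  by move=> y Ay hy; apply: eF => //; exact: oball_sub hy.
- have [U [F [oU Ux cF eF]]] := sf i x Ax; have [r r0 hr] := open_oball oU Ux.
  exists r => //; exists F; split; first by apply: Cinf_on_sub cF.
  by move=> y Ay hy; apply: eF => //; exact: hr.
have [F hF] := choice hr.
by exists r, F; split=> // i; have [] := hF i.
Qed.

Lemma ball_const C x (r : R) (F : 'rV[R]_n -> R) : Ck_on 1 (oball x r) F -> C x ->
  (forall y t, C y -> 0 <= t -> t <= 1 -> C (x + t *: (y - x))) ->
  (forall y, C y -> oball x r y -> forall a, 'D_(evec R a) F y = 0) ->
  forall y, C y -> oball x r y -> F y = F x.
Proof.
move=> cF Cx sC dF y Cy hy.
pose phi (t : R) := F (x + t *: (y - x)).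
have dphi (t : R) : 0 <= t -> t <= 1 -> is_derive t 1 phi 0.
  move=> t0 t1; have := @line_Ck R n (oball x r) F x (y - x) t (@oball_open R n x r) cF (oball_seg hy t0 t1).
  rewrite big1 // => b _; rewrite dF ?mulr0 //; [exact: sC|exact: oball_seg].
have [t ht||c _] := @MVT_segment R phi (cst 0) 0 1 ler01.
- by move: ht; rewrite in_itv /= => /andP[/ltW t0 /ltW t1]; exact: dphi.
- apply: (@continuous_in_subspaceT _ _ (`[0 : R, 1]%classic)) => t /set_mem.
  rewrite /= in_itv /= => /andP[t0 t1]; have [d _] := dphi t t0 t1.
  by apply: differentiable_continuous; apply/derivable1_diffP.
by rewrite mul0r /phi scale1r scale0r addr0 addrCA subrr addr0 => /eqP; rewrite subr_eq0 => /eqP.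
Qed.

Lemma sfun_local_const A (hA : rel_open A) (f : sfun A) x : A x -> (forall a, sder hA a f = 0) ->
  exists2 r : R, 0 < r & forall y, half_space y -> oball x r y -> A y /\ ext (sfun_val f) y = ext (sfun_val f) x.
Proof.
move=> Ax df; have [U [F [oU Ux cF eF dF]]] := sder_local hA f Ax.
have hx : half_space x by have [W _ e] := hA; move: (Ax); rewrite {1}e => -[].
have [r1 r10 hr1] := open_oball oU Ux; have [r2 r20 hr2] := rel_open_ball hA Ax.
exists (Num.min r1 r2); first by rewrite lt_min r10.
move=> y hy yr; have yr1 : oball x r1 y by apply: oball_sub yr; rewrite ge_min lexx.
have inA z : half_space z -> oball x (Num.min r1 r2) z -> A z /\ U z.
  move=> hz zr; split; first by apply: hr2 => //; apply: (oball_sub _ zr); rewrite ge_min lexx orbT.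
  by apply: hr1; apply: (oball_sub _ zr); rewrite ge_min lexx.
have [Ay Uy] := inA y hy yr.
split=> //; rewrite -(eF y Ay Uy) -(eF x Ax Ux).
apply: (@ball_const (@half_space R n) x (Num.min r1 r2) F) => //.
- apply: Ck_on_sub (cF 1%N) => z zr; apply: hr1; apply: (oball_sub _ zr); by rewrite ge_min lexx.
- by move=> z t hz t0 t1; exact: half_space_seg.
- move=> z hz zr a; have [Az Uz] := inA z hz zr.
  by rewrite -(dF a z Az Uz) -(ev_sder hA a f (exist _ z Az)) df ev0.
Qed.

Lemma pd_ball A (hA : rel_open A) (f F : 'rV[R]_n -> R) a x y (r : R) : Ck_on 1 (oball x r) F ->
  (forall z, A z -> oball x r z -> F z = f z) -> A y -> oball x r y -> pd a f y = 'D_(evec R a) F y.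
Proof. move=> cF eF Ay yr; exact: (pd_ext a hA (@oball_open R n x r) cF Ay yr eF). Qed.

End LocalExtension.

Section RestrictRing.
Variables (R : realType) (n : nat) (A B : set 'rV[R]_n) (G : 'rV[R]_n -> 'M[R]_n).
Hypotheses (hA : rel_open A) (hB : rel_open B) (AB : A `<=` B) (cB : chart_metric_on B G).

Definition sid b : smooth_on A (fun x => (@id 'rV[R]_n x) 0 b) := @smooth_on_coord R n A b.

Definition cA_sub := chart_metric_on_sub AB cB.

Definition res : sfun B -> sfun A := pullS AB sid.

HB.instance Definition _ := GRing.RMorphism.on res.

Lemma ev_res (p : {x | A x}) (q : {x | B x}) f : sval p = sval q -> ev p (res f) = ev q f.
Proof.
move=> e; rewrite /res ev_pullS -!ext_sval; congr (ext _ _).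
exact: e.
Qed.

Lemma sder_res a f : sder hA a (res f) = res (sder hB a f).
Proof.
rewrite /res pullS_chain.
have -> : s_jac hA sid = 1%:M.
  apply: ev_mx_inj => p; rewrite ev_jac (jac_id hA (svalP p)).
  by rewrite map_mx1.
rewrite (bigD1 a) //= big1 ?addr0 => [|c ca]; first by rewrite mxE eqxx mul1r.
by rewrite mxE eq_sym (negbTE ca) mul0r.
Qed.

Lemma gam_res a : s_gam hA cA_sub a = map_mx res (s_gam hB cB a).
Proof.
apply/matrixP => b c; apply: sfun_ext => p; rewrite [in RHS]mxE.
by rewrite (@ev_res p (pull_pt AB p)) // !ev_gam.
Qed.

Lemma dmx_res a p q (X : 'M[sfun B]_(p, q)) : dmx (sder hA) a (map_mx res X) = map_mx res (dmx (sder hB) a X).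
Proof. by apply/matrixP => i j; rewrite !mxE sder_res. Qed.

Lemma homothetic_res (X : 'cV[sfun B]_n) :
  (forall a, dmx (sder hB) a X + (s_gam hB cB a)^T *m X = delta_mx a 0) ->
  forall a, dmx (sder hA) a (map_mx res X) + (s_gam hA cA_sub a)^T *m map_mx res X = delta_mx a 0.
Proof.
move=> hX a; rewrite gam_res dmx_res matrix.map_trmx -map_mxM -map_mxD hX.
exact: map_delta_mx.
Qed.

End RestrictRing.

Section FlatCoordinates.
Variables (R : realType) (n : nat) (B : set 'rV[R]_n) (G : 'rV[R]_n -> 'M[R]_n).
Hypotheses (hB : rel_open B) (cB : chart_metric_on B G).
Hypothesis flatB : forall a b, curv (sder hB) (s_gam hB cB) a b = 0.
Variable x0 : 'rV[R]_n.
Hypothesis Bx0 : B x0.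

Lemma half_x0 : half_space x0.
Proof. by case: hB Bx0 => W _ -> []. Qed.

(** The system d J = Gam J for a parallel coframe is integrable because the curvature vanishes. Its
    coefficients are first extended across the boundary hyperplane; the extension is flat on the
    half space only, which is star-shaped about [x0]. *)
Lemma parallel_frame_exists : exists (r : R) (J : 'rV[R]_n -> 'M[R]_n), [/\ 0 < r,
  forall x, half_space x -> oball x0 r x -> B x,
  forall b k, Cinf_on (oball x0 r) (fun x => J x b k),
  J x0 *m (J x0)^T = G x0 &
  forall x, half_space x -> oball x0 r x -> forall a b k,
    pd a (fun x => J x b k) x = \sum_c christoffel G c a b x * J x c k].
Proof.
pose gam (q : 'I_n * 'I_n * 'I_n) := ext (sfun_val (s_gam hB cB q.1.1 q.1.2 q.2)).
have sgam q : smooth_on B (gam q) by exact: sfun_smooth.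
have [r1 [F [r10 cF eF]]] := common_ext sgam Bx0.
have [r2 r20 hr2] := rel_open_ball hB Bx0.
pose r := Num.min r1 r2; have r0 : 0 < r by rewrite lt_min r10.
have rr1 : oball x0 r `<=` oball x0 r1 by apply: oball_sub; rewrite ge_min lexx.
have inB x : half_space x -> oball x0 r x -> B x.
  by move=> hx xr; apply: hr2 => //; apply: (oball_sub _ xr); rewrite ge_min lexx orbT.
pose A a b c := F (a, b, c).
have cA a b c : Cinf_on (oball x0 r) (A a b c) by apply: Cinf_on_sub (cF _).
have eA a b c x (Bx : B x) : oball x0 r x -> A a b c x = ev (exist _ x Bx) (s_gam hB cB a b c).
  by move=> xr; rewrite /A eF //; [rewrite /gam ext_ev|exact: rr1].
have dA a b c e x (Bx : B x) : oball x0 r x ->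
    'D_(evec R e) (A a b c) x = ev (exist _ x Bx) (sder hB e (s_gam hB cB a b c)).
  move=> xr; rewrite ev_sder /=; symmetry.
  apply: (@pd_ball R n B hB _ (A a b c) e x0 x r (cA a b c 1%N)) => // z Bz zr.
  by rewrite (eA a b c z Bz zr) ext_ev.
have flatA a b i l x : oball x0 r x -> half_space x ->
    'D_(evec R a) (A b i l) x - 'D_(evec R b) (A a i l) x =
    \sum_j (A a i j x * A b j l x - A b i j x * A a j l x).
  move=> xr hx; have Bx := inB x hx xr.
  have := congr1 (fun N : 'M[sfun B]_n => ev (exist _ x Bx) (N i l)) (flatB a b).
  rewrite curvE [X in _ = ev _ X]mxE !evD !evN !evD !evN !ev_sum ev0 => /eqP; rewrite subr_eq0 => /eqP.
  rewrite !(dA _ _ _ _ x Bx xr) => ->; rewrite sumrB; congr (_ - _).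
    by apply: eq_bigr => j _; rewrite evM !(eA _ _ _ x Bx xr).
  by apply: eq_bigr => j _; rewrite evM !(eA _ _ _ x Bx xr).
have starH x (t : R) : half_space x -> 0 <= t -> t <= 1 -> half_space (x0 + t *: (x - x0)).
  by move=> hx t0 t1; apply: half_space_seg => //; exact: half_x0.
have [r' r'0 hr'] := flat_system (@oball_open R n x0 r) (oball_center x0 r0) cA starH flatA.
have [P Pu PG] := orthonormal_frame (cm_sym cB Bx0) (cm_pos cB Bx0).
(* Orthonormality is imposed at [x0] only; it then propagates, as the Gram matrix of a parallel
   coframe is constant. *)
pose J0 := invmx P.
have J0G : J0 *m J0^T = G x0.
  have -> : G x0 = invmx P *m (P *m G x0 *m P^T) *m (invmx P)^T.
    by rewrite !mulmxA mulVmx // mul1mx -mulmxA -trmx_mul mulVmx // trmx1 mulmx1.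
  by rewrite PG mulmx1.
have /choice[H hH] := fun k => hr' (fun b => J0 b k).
pose rho := Num.min r r'; have rho0 : 0 < rho by rewrite lt_min r0 r'0.
have rhor : oball x0 rho `<=` oball x0 r by apply: oball_sub; rewrite ge_min lexx.
have rhor' : oball x0 rho `<=` oball x0 r' by apply: oball_sub; rewrite ge_min lexx orbT.
have cH k b : Cinf_on (oball x0 rho) (H k b).
  by have [c _ _] := hH k; apply: Cinf_on_sub (c b).
have JE b k : (fun x => (\matrix_(b, k) H k b x : 'M[R]_n) b k) = H k b.
  by apply/funext => x; rewrite mxE.
exists rho, (fun x => \matrix_(b, k) H k b x); split=> //.
- by move=> x hx xr; apply: inB => //; exact: rhor.
- by move=> b k; rewrite JE.
- rewrite -J0G; have -> : \matrix_(b, k) H k b x0 = J0; last by [].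
  by apply/matrixP => b k; rewrite mxE; have [_ -> _] := hH k.
- move=> x hx xr a b k; have Bx := inB x hx (rhor x xr).
  rewrite JE (@pd_ball R n _ (rel_open_half (@oball_open R n x0 rho)) _ (H k b) a x0 x rho (cH k b 1%N) _ (conj xr hx) xr) //.
  have [_ _ h] := hH k; have [_ ->] := h a b x (rhor' x xr) hx.
  by apply: eq_bigr => c _; rewrite mxE (eA _ _ _ x Bx) ?ev_gam //; exact: rhor.
Qed.

Variable X : 'cV[sfun B]_n.
Hypothesis homX : forall a, dmx (sder hB) a X + (s_gam hB cB a)^T *m X = delta_mx a 0.

(** The coordinates are the components of the homothetic field in a parallel orthonormal coframe. By
    [parallel_coord] the coframe consists of their differentials, so the metric is Euclidean, and
    |D|^2 is the squared length of the field: this fixes the origin of the coordinates as well. *)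
Lemma flat_coordinates : exists (r : R) (D : 'rV[R]_n -> 'rV[R]_n), [/\ 0 < r,
  forall x, half_space x -> oball x0 r x -> B x,
  forall k, Cinf_on (oball x0 r) (fun x => D x 0 k) &
  forall x, half_space x -> oball x0 r x ->
    jacobian_mx D x *m (jacobian_mx D x)^T = G x /\
    sqnorm (D x) = ext (sfun_val ((X^T *m s_metric cB *m X) 0 0)) x].
Proof.
have [r [J [r0 inB cJ J0G dJ]]] := parallel_frame_exists.
pose A := oball x0 r `&` @half_space R n.
have hA : rel_open A by apply: rel_open_half; exact: oball_open.
have AB : A `<=` B by move=> x [xr hx]; exact: inB.
have Ax0 : A x0 by split; [exact: oball_center|exact: half_x0].
pose cA := cA_sub AB cB.
have sJ b k : smooth_on A (fun x => J x b k).
  apply: (Cinf_smooth_on (@oball_open R n x0 r) (cJ b k)) => x [] //.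
pose JS : 'M[sfun A]_n := \matrix_(b, k) mk_sfun (sJ b k).
have evJ p : map_mx (ev p) JS = J (sval p) by apply/matrixP => b k; rewrite !mxE ev_mk.
have dJS a : dmx (sder hA) a JS = s_gam hA cA a *m JS.
  apply/matrixP => b k; apply: sfun_ext => p; rewrite !mxE ev_sder_mk ev_sum.
  have [pr hp] := svalP p; rewrite (dJ _ hp pr); apply: eq_bigr => c _.
  by rewrite evM ev_gam mxE ev_mk.
pose X' := map_mx (res AB) X.
have homX' := homothetic_res hA AB homX.
have lc := s_lc hA cA.
pose N : 'M[sfun A]_n := JS^T *m s_inv cA *m JS.
have dN := parallel_gram lc dJS.
have dD := parallel_coord lc dJS homX'.
have N0 (p : {x | A x}) : sval p = x0 -> map_mx (ev p) N = 1%:M.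
  move=> e; rewrite /N !map_mxM -matrix.map_trmx evJ ev_inv e.
  rewrite -J0G; have Gu : J x0 *m (J x0)^T \in unitmx by rewrite J0G; exact: posdef_unit (cm_pos cB Bx0).
  have Ju : J x0 \in unitmx by move: Gu; rewrite unitmx_mul => /andP[].
  have Jtu : (J x0)^T \in unitmx by rewrite unitmx_tr.
  apply: (can_inj (mulKmx Ju)); apply: (can_inj (mulmxK Jtu)).
  transitivity (J x0 *m (J x0)^T *m invmx (J x0 *m (J x0)^T) *m (J x0 *m (J x0)^T)).
    by rewrite !mulmxA.
  by rewrite mulmxV // mul1mx mulmx1.
pose P (q : 'I_n * 'I_n) (rr : R) := forall y, half_space y -> oball x0 rr y ->
  A y /\ ext (sfun_val (N q.1 q.2)) y = ext (sfun_val (N q.1 q.2)) x0.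
have [||r1 r10 hr1] := @common_radius R _ P.
- by move=> q rr rr' le h y hy yr; apply: h => //; exact: oball_sub yr.
- move=> q; apply: (sfun_local_const (hA := hA)) => // a.
  by have := congr1 (fun Z : 'M[sfun A]_n => Z q.1 q.2) (dN a); rewrite !mxE.
pose Dc : 'cV[sfun A]_n := JS^T *m X'.
have sD k : smooth_on A (ext (sfun_val (Dc k 0))) by exact: sfun_smooth.
have [r2 [F [r20 cF eF]]] := common_ext sD Ax0.
pose rho := Num.min r (Num.min r1 r2); have rho0 : 0 < rho by rewrite !lt_min r0 r10.
have sub y : oball x0 rho y -> [/\ oball x0 r y, oball x0 r1 y & oball x0 r2 y].
  by rewrite /oball /= !lt_min => /and3P[].
have N1 (p : {x | A x}) : oball x0 r1 (sval p) -> map_mx (ev p) N = 1%:M.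
  move=> pr; rewrite -(N0 (exist _ x0 Ax0)) //; apply/matrixP => a b; rewrite [LHS]mxE [RHS]mxE -!ext_sval.
  by have [_ ->] := hr1 (a, b) (sval p) (svalP p).2 pr.
have JJ (p : {x | A x}) : oball x0 r1 (sval p) -> J (sval p) *m (J (sval p))^T = G (sval p).
  move=> pr; have := N1 p pr; rewrite /N !map_mxM -matrix.map_trmx evJ ev_inv => e.
  have Gu : G (sval p) \in unitmx by exact: posdef_unit (cm_pos cA (svalP p)).
  have := mulmx1C e => /(congr1 (mulmx (G (sval p)))).
  rewrite mulmx1 !mulmxA.
  have e2 : (J (sval p))^T *m (invmx (G (sval p)) *m J (sval p)) = 1%:M by rewrite mulmxA.
  move=> _; have := mulmx1C e2 => /(congr1 (mulmx (G (sval p)))).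
  by rewrite mulmx1 !mulmxA mulmxV // mul1mx.
pose D x : 'rV[R]_n := \row_k F k x.
have DE k : (fun x => D x 0 k) = F k by apply/funext => x; rewrite mxE.
exists rho, D; split=> //.
- by move=> x hx /sub[xr _ _]; exact: inB.
- by move=> k; rewrite DE; apply: Cinf_on_sub (cF k) => y /sub[].
move=> x hx xr; have [xr0 xr1 xr2] := sub x xr.
have Ax : A x by split.
pose p : {x | A x} := exist _ x Ax.
have jE : jacobian_mx D x = J x.
  apply/matrixP => a k; rewrite mxE DE.
  rewrite (@pd_ball R n A hA (F k) (F k) a x0 x r2 (cF k 1%N) (fun _ _ _ => erefl) Ax xr2).
  rewrite -(@pd_ball R n A hA _ (F k) a x0 x r2 (cF k 1%N) (eF k) Ax xr2).
  have e := congr1 (fun Z : 'cV[sfun A]_n => Z k 0) (dD a).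
  rewrite [LHS]mxE [RHS]mxE [RHS]mxE [RHS]mxE in e.
  by have := congr1 (ev p) e; rewrite ev_sder ev_mk.
rewrite jE (JJ p xr1); split=> //.
have evX : map_mx (ev p) X' = map_mx (ev (pull_pt AB p)) X.
  by apply/matrixP => a b; rewrite !mxE; apply: ev_res.
have -> : sqnorm (D x) = ((map_mx (ev p) Dc)^T *m map_mx (ev p) Dc) 0 0.
  rewrite mxE; apply: eq_bigr => k _.
  have e : D x 0 k = (map_mx (ev p) Dc) k 0 by rewrite mxE eF // (ext_ev _ Ax) [RHS]mxE.
  by rewrite e [X in _ = X * _]mxE expr2.
rewrite /Dc map_mxM -matrix.map_trmx evJ trmx_mul trmxK !mulmxA -[_ *m J _ *m _]mulmxA JJ //.
have -> (Q : 'M[sfun B]_1) : ext (sfun_val (Q 0 0)) x = (map_mx (ev (pull_pt AB p)) Q) 0 0.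
  by rewrite [RHS]mxE; exact: ext_ev.
by rewrite evX !map_mxM -matrix.map_trmx ev_metric.
Qed.

End FlatCoordinates.

(** * Development onto the unit ball *)

Section Euclid.
Variables (R : realType) (n : nat).
Implicit Types (x y z w : 'rV[R]_n) (A : 'M[R]_n) (S : set 'rV[R]_n).

Lemma sqnormE x : sqnorm x = (x *m x^T) 0 0.
Proof. by rewrite mxE; apply: eq_bigr => i _; rewrite mxE expr2. Qed.

Lemma sqnorm_orth x A : A *m A^T = 1%:M -> sqnorm (x *m A) = sqnorm x.
Proof. by move=> AA; rewrite !sqnormE trmx_mul -mulmxA [A *m _]mulmxA AA mul1mx. Qed.

Lemma sqnorm_add x y : sqnorm (x + y) <= 2 * (sqnorm x + sqnorm y).
Proof.
rewrite /sqnorm -big_split mulr_sumr; apply: ler_sum => i _; rewrite !mxE /=.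
have := sqr_ge0 (x 0 i - y 0 i); rewrite sqrrB sqrrD.
by move: (x 0 i ^+ 2) (y 0 i ^+ 2) (x 0 i * y 0 i) => a b c; rewrite !mulr2n; lra.
Qed.

Lemma sqnorm_scale (t : R) x : sqnorm (t *: x) = t ^+ 2 * sqnorm x.
Proof. by rewrite /sqnorm mulr_sumr; apply: eq_bigr => i _; rewrite mxE exprMn. Qed.

Lemma sqnorm_sub x y : sqnorm (x - y) = sqnorm (y - x).
Proof. by rewrite -opprB -scaleN1r sqnorm_scale sqrrN expr1n mul1r. Qed.

Lemma sqnorm_convex x y c (t : R) : 0 <= t -> t <= 1 ->
  sqnorm (x + t *: (y - x) - c) <= (1 - t) * sqnorm (x - c) + t * sqnorm (y - c).
Proof.
move=> t0 t1; rewrite /sqnorm !mulr_sumr -big_split; apply: ler_sum => i _; rewrite !mxE /=.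
set a := x 0 i; set b := y 0 i; set d := c 0 i.
rewrite -subr_ge0; have -> : (1 - t) * (a - d) ^+ 2 + t * (b - d) ^+ 2 - (a + t * (b - a) - d) ^+ 2 =
  t * (1 - t) * (a - b) ^+ 2 by ring.
by rewrite mulr_ge0 ?sqr_ge0 // mulr_ge0 // subr_ge0.
Qed.

Lemma near_sqball w (d : R) : 0 < d -> \forall y \near w, sqnorm (y - w) < d.
Proof.
move=> d0; have := @sqdist_cont R n w w; move/cvgr_dist_lt => /(_ _ d0).
by apply: nearS => y; rewrite subrr sqnorm0 sub0r normrN; apply: le_lt_trans; exact: ler_norm.
Qed.

Definition convex_rV S := forall x y (t : R), S x -> S y -> 0 <= t -> t <= 1 -> S (x + t *: (y - x)).

Lemma convex_sqball c (d : R) : convex_rV [set y | sqnorm (y - c) < d].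
Proof.
move=> x y t /= hx hy t0 t1; apply: le_lt_trans (sqnorm_convex x y c t0 t1) _.
have [->|/negP tn] := eqVneq t 0; first by rewrite subr0 mul1r mul0r addr0.
have tp : 0 < t by rewrite lt_neqAle t0 andbT eq_sym; apply/negP.
have h1 : t * sqnorm (y - c) < t * d by rewrite ltr_pM2l.
have h2 : (1 - t) * sqnorm (x - c) <= (1 - t) * d by rewrite ler_wpM2l ?subr_ge0 // ltW.
by apply: lt_le_trans (ler_ltD h2 h1) _; rewrite -mulrDl subrK mul1r.
Qed.

Lemma convex_closed_sqball (d : R) : convex_rV [set y | sqnorm y <= d].
Proof.
move=> x y t /= hx hy t0 t1; have := sqnorm_convex x y 0 t0 t1; rewrite !subr0 => h.
apply: le_trans h _.
have h1 : t * sqnorm y <= t * d by rewrite ler_wpM2l.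
have h2 : (1 - t) * sqnorm x <= (1 - t) * d by rewrite ler_wpM2l // subr_ge0.
by apply: le_trans (lerD h2 h1) _; rewrite -mulrDl subrK mul1r.
Qed.

Lemma convexI S S' : convex_rV S -> convex_rV S' -> convex_rV (S `&` S').
Proof. by move=> h h' x y t [? ?] [? ?] t0 t1; split; [exact: h|exact: h']. Qed.

(** Local inverses of flat charts are determined up to a rotation; on a thick set such a rotation is
    detected near every point, including boundary points. *)
Definition thick S := forall w A, S w -> (\forall y \near w, S y -> y *m A = y) -> A = 1%:M.

(** A homothety centered at [w] shrinks a ball around [c] into the neighborhood fixed by [A], and
    stays in [S] by convexity. A linear map fixing a small ball pointwise is the identity. *)
Lemma convex_thick S (c : 'rV[R]_n) : convex_rV S -> (\forall y \near c, S y) -> thick S.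
Proof.
move=> cS nc w A Sw nA.
have [rho /= rho0 hrho] := (nbhs_ballP _ _).1 nc; have [r /= r0 hr] := (nbhs_ballP _ _).1 nA.
pose K := `|c - w| + rho; have K0 : 0 < K by rewrite ltr_wpDl.
pose t := r / (K + r); have Kr : 0 < K + r by rewrite addr_gt0.
have t0 : 0 < t by rewrite divr_gt0.
have t1 : t <= 1 by rewrite ler_pdivrMr // mul1r lerDr ltW.
have tK : t * K < r.
  by rewrite /t mulrAC ltr_pdivrMr // ltr_pM2l // ltrDl.
have fix_y (v : 'rV[R]_n) : `|v| < rho -> (w + t *: (c + v - w)) *m A = w + t *: (c + v - w).
  move=> hv; apply: hr.
    rewrite -ball_normE /= opprD addrA subrr add0r normrN normrZ gtr0_norm //.
    apply: le_lt_trans tK; rewrite ler_pM2l // addrAC; apply: le_trans (ler_normD _ _) _.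
    by rewrite /K lerD2l ltW.
  apply: cS => //; last exact: ltW.
  by apply: hrho; rewrite -ball_normE /= opprD addrA subrr add0r normrN.
have fix_v (v : 'rV[R]_n) : `|v| < rho -> v *m A = v.
  move=> hv; have h0 := fix_y 0; rewrite normr0 addr0 in h0.
  have := fix_y v hv; have -> : w + t *: (c + v - w) = w + t *: (c - w) + t *: v.
    by rewrite addrAC scalerDr addrA.
  rewrite mulmxDl h0 // => /addrI; rewrite -scalemxAl => /(scalerI _); apply.
  by rewrite gt_eqF.
apply/row_matrixP => j; rewrite row1.
have e0 : rho / 2 != 0 by rewrite gt_eqF // divr_gt0.
have := fix_v ((rho / 2) *: delta_mx 0 j).
rewrite -scalemxAl -rowE => h; apply: (scalerI e0); apply: h.
rewrite normrZ gtr0_norm ?divr_gt0 //; apply: (@le_lt_trans _ _ (rho / 2)); last by lra.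
rewrite ler_piMr ?(ltW (divr_gt0 rho0 _)) //.
by apply: norm_le_coord => // i; rewrite !mxE; case: (_ && _); rewrite ?normr1 ?normr0.
Qed.

Lemma near_orth (w : 'rV[R]_n) A (P : 'rV[R]_n -> Prop) : A *m A^T = 1%:M ->
  (\forall y \near (w *m A), P y) -> \forall y \near w, P (y *m A).
Proof.
move=> AA nP; have [r /= r0 hr] := (nbhs_ballP _ _).1 nP.
apply: nearS (near_sqball w (exprn_gt0 2 r0)) => y hy; apply: hr; rewrite -ball_normE /=.
by apply: sqnorm_norm => //; rewrite -mulmxBl sqnorm_orth // sqnorm_sub.
Qed.

End Euclid.

(** * Continuation of local inverses over the closed ball *)

Section Developing.
Variables (R : realType) (n : nat) (M : topologicalType).
Local Notation H := (@closed_unit_ball R n).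
Implicit Types (W : set M) (D : M -> 'rV[R]_n) (E Psi : 'rV[R]_n -> M) (S : set 'rV[R]_n) (A : 'M[R]_n).

(* [D] maps the open set [W] homeomorphically onto a relatively open subset of the ball, and [E] is
   meaningful only on its image, where it is the inverse. *)
Record ball_chart W D E : Prop := BallChart {
  bc_open : open W;
  bc_cont : forall p, W p -> {for p, continuous D};
  bc_ball : forall p, W p -> H (D p);
  bc_K : forall p, W p -> E (D p) = p;
  bc_inv : forall p (N : set M), W p -> nbhs p N ->
    \forall y \near D p, H y -> [/\ N (E y), W (E y) & D (E y) = y]
}.

Variable Fl : set M -> (M -> 'rV[R]_n) -> ('rV[R]_n -> M) -> Prop.
Hypotheses (flC : forall W D E, Fl W D E -> ball_chart W D E)
  (fl_cover : forall p, exists W D E, Fl W D E /\ W p)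
  (fl_rot : forall A W D E, A *m A^T = 1%:M -> Fl W D E ->
     Fl W (fun p => D p *m A) (fun y => E (y *m A^T)))
  (fl_overlap : forall W1 D1 E1 W2 D2 E2 p, Fl W1 D1 E1 -> Fl W2 D2 E2 -> W1 p -> W2 p ->
     exists2 A, A *m A^T = 1%:M & \forall q \near p, D2 q = D1 q *m A).
Variable p0 : M.
Hypothesis fl_origin : forall W D E, Fl W D E -> W p0 -> D p0 = 0.
Hypotheses (hM : hausdorff_space M) (cM : compact [set: M]) (conM : connected [set: M]).

Lemma bc_near W D E p : Fl W D E -> W p -> \forall q \near p, W q.
Proof. by move=> /flC/bc_open oW Wp; exact: open_nbhs_nbhs. Qed.

(* On [S], [Psi] is locally the inverse of charts in [Fl]. *)
Definition sec S Psi := forall w, S w -> exists W D E, [/\ Fl W D E, W (Psi w), D (Psi w) = w &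
  \forall y \near w, S y -> Psi y = E y].

Lemma sec_sub S S' Psi : S' `<=` S -> sec S Psi -> sec S' Psi.
Proof.
move=> sub h w /sub/h [W [D [E [fl Ww Dw nE]]]]; exists W, D, E; split=> //.
by apply: nearS nE => y hy /sub.
Qed.

Lemma sec_cont S Psi w (N : set M) : S `<=` H -> sec S Psi -> S w -> nbhs (Psi w) N ->
  \forall y \near w, S y -> N (Psi y).
Proof.
move=> SH h Sw nN; have [W [D [E [fl Ww Dw nE]]]] := h w Sw.
have := bc_inv (flC fl) Ww nN; rewrite Dw => nI.
by apply: nearS (nearI nE nI) => y [h1 h2] Sy; have [h3 _ _] := h2 (SH y Sy); rewrite h1.
Qed.

(** A Lebesgue number from compactness of [M]. It is what lets the continuation reach the boundary
    of the ball in finitely many steps. *)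
Lemma uniform_radius : exists2 d : R, 0 < d & forall q, exists W D E, [/\ Fl W D E, W q &
  forall y, H y -> sqnorm (y - D q) < d -> W (E y) /\ D (E y) = y].
Proof.
pose P (d : R) q := exists W D E, [/\ Fl W D E, W q &
  forall y, H y -> sqnorm (y - D q) < d -> W (E y) /\ D (E y) = y].
have /compact_near_coveringP cov := cM.
have hcov : \forall d \near (0:R)^'+, [set: M] `<=` P d.
  apply: cov => q _; have [W [D [E [fl Wq]]]] := fl_cover q.
  have nT : nbhs q [set: M] by exact: filterT.
  have nI := bc_inv (flC fl) Wq nT.
  have [r /= r0 hr] := (nbhs_ballP _ _).1 nI.
  (* By [sqnorm_add] two squared distances below r^2/4 combine to one below r^2. *)
  have r2 : 0 < r ^+ 2 / 4 by rewrite divr_gt0 // exprn_gt0.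
  have nD : \forall q' \near q, sqnorm (D q' - D q) < r ^+ 2 / 4.
    exact: (bc_cont (flC fl) Wq (near_sqball (D q) r2)).
  have nd : \forall d \near (0:R)^'+, d < r ^+ 2 / 4 by exact: nbhs_right_lt.
  exists ([set q' | W q' /\ sqnorm (D q' - D q) < r ^+ 2 / 4], [set d | d < r ^+ 2 / 4]).
    by split=> //; exact: nearI (bc_near fl Wq) nD.
  move=> [q' d] /= [[Wq' hD] hd]; exists W, D, E; split=> // y Hy hy.
  have [_ h1 h2] : [/\ setT (E y), W (E y) & D (E y) = y]; last by [].
  apply: hr => //; rewrite -ball_normE /= distrC; apply: sqnorm_norm => //.
  have -> : y - D q = (y - D q') + (D q' - D q) by rewrite addrA subrK.
  by apply: le_lt_trans (sqnorm_add _ _) _; lra.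
have pf : ProperFilter (0:R)^'+ by exact: at_right_proper_filter.
have [d [/= hd d0]] := @filter_ex _ _ pf _ (filterI hcov (nbhs_right_gt (0:R))).
by exists d => // q; exact: hd.
Qed.

(** The chart of uniform size at [q] need not match the given one, but it differs from it by a
    rotation near [q], and rotated charts are again in [Fl]. *)
Lemma recenter (d : R) W D E q :
  (forall q, exists W D E, [/\ Fl W D E, W q &
     forall y, H y -> sqnorm (y - D q) < d -> W (E y) /\ D (E y) = y]) ->
  Fl W D E -> W q -> exists W' D' E', [/\ Fl W' D' E', W' q, D' q = D q,
    forall y, H y -> sqnorm (y - D q) < d -> W' (E' y) /\ D' (E' y) = y &
    \forall y \near D q, H y -> E' y = E y].
Proof.
move=> uni fl Wq; have [W1 [D1 [E1 [fl1 W1q h1]]]] := uni q.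
have [A AA nA] := fl_overlap fl1 fl W1q Wq; have AA' := mulmx1C AA.
have Dq : D q = D1 q *m A by exact: nbhs_singleton nA.
exists W1, (fun p => D1 p *m A), (fun y => E1 (y *m A^T)); split=> //.
- exact: fl_rot.
- move=> y Hy hy.
  have Hy' : H (y *m A^T) by rewrite /closed_unit_ball /= sqnorm_orth // trmxK.
  have hy' : sqnorm (y *m A^T - D1 q) < d.
    have -> : y *m A^T - D1 q = (y - D q) *m A^T.
      by rewrite mulmxBl Dq -mulmxA AA mulmx1.
    by rewrite sqnorm_orth // trmxK.
  have [h2 h3] := h1 _ Hy' hy'.
  by split=> //; rewrite h3 -mulmxA AA' mulmx1.
- have nI := bc_inv (flC fl) Wq (nearI nA (bc_near fl1 W1q)).
  apply: nearS nI => y hI Hy; have [[e1 W1y] Wy e2] := hI Hy.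
  by rewrite -{1}e2 e1 -mulmxA AA mulmx1 (bc_K (flC fl1) W1y).
Qed.

(* The two local inverses at [w] differ by a rotation fixing [w]; if it is not the identity it cannot
   fix a neighborhood of any point of a thick set. *)
Lemma agree_local S Psi1 Psi2 w : S `<=` H -> thick S -> sec S Psi1 -> sec S Psi2 -> S w ->
  let agr w := \forall y \near w, S y -> Psi1 y = Psi2 y in
  \forall w' \near w, S w' -> (agr w' <-> agr w).
Proof.
move=> SH tS s1 s2 Sw agr.
(* If the values at [w] differ, Hausdorff separation keeps them different nearby, so agreement fails
   at all nearby points. *)
have [e|ne] := pselect (Psi1 w = Psi2 w); last first.
  have nagr w' : S w' -> Psi1 w' <> Psi2 w' -> ~ agr w'.
    by move=> Sw' h /nbhs_singleton/(_ Sw').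
  have hM' := hM; rewrite open_hausdorff in hM'.
  have [[U V] /= [Uw Vw] [oU oV /eqP UV]] := hM' _ _ (introN eqP ne).
  have nU := sec_cont SH s1 Sw (open_nbhs_nbhs (conj oU (set_mem Uw))).
  have nV := sec_cont SH s2 Sw (open_nbhs_nbhs (conj oV (set_mem Vw))).
  apply: nearS (nearI nU nV) => w' [hU hV] Sw'; split=> h; exfalso.
    apply: (nagr w' Sw' _ h) => e; have : (U `&` V) (Psi1 w') by split; [exact: hU|rewrite e; exact: hV].
    by rewrite UV.
  exact: (nagr w Sw ne).
have [W1 [D1 [E1 [fl1 W1w D1w n1]]]] := s1 w Sw; have [W2 [D2 [E2 [fl2 W2w D2w n2]]]] := s2 w Sw.
have W2w1 : W2 (Psi1 w) by rewrite e.
have [A AA nA] := fl_overlap fl1 fl2 W1w W2w1.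
have nI1 := bc_inv (flC fl1) W1w nA; rewrite D1w in nI1.
have nA2 : \forall q \near Psi2 w, D2 q = D1 q *m A by rewrite -e.
have W1w2 : W1 (Psi2 w) by rewrite -e.
have nI2 := bc_inv (flC fl2) W2w (nearI nA2 (bc_near fl1 W1w2)); rewrite D2w in nI2.
have key : \forall y \near w, S y -> [/\ D1 (Psi1 y) = y, D2 (Psi1 y) = y *m A, D2 (Psi2 y) = y,
    W1 (Psi2 y) & W1 (Psi1 y)].
  apply: nearS (nearI (nearI n1 n2) (nearI nI1 nI2)) => y [[h1 h2] [h3 h4]] Sy.
  have [a1 a2 a3] := h3 (SH y Sy); have [[b1 b1'] b2 b3] := h4 (SH y Sy).
  by rewrite h1 // h2 //; split=> //; rewrite a1 a3.
have key' := nbhs_interior key.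
have [A1|nA1] := pselect (A = 1%:M).
  have ag : \forall y \near w, S y -> Psi1 y = Psi2 y.
    apply: nearS (nearI key (nearI nI2 n2)) => y [h [h' h2]] Sy; have [a1 a2 a3 a4 a5] := h Sy.
    have [[b1 b1'] b2 b3] := h' (SH y Sy).
    rewrite -(bc_K (flC fl1) a5) -(bc_K (flC fl1) a4) a1; congr (E1 _).
    by rewrite h2 // -[in LHS]b3 b1 A1 mulmx1.
  apply: nearS (nbhs_interior ag) => w' hw' Sw'; split=> _; first exact: ag.
  exact: hw'.
apply: nearS key' => w' kw' Sw'.
have no w1 : S w1 -> (\forall y \near w1, S y -> [/\ D1 (Psi1 y) = y, D2 (Psi1 y) = y *m A, D2 (Psi2 y) = y,
    W1 (Psi2 y) & W1 (Psi1 y)]) -> ~ agr w1.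
  move=> Sw1 k1 ag; apply: nA1; apply: (tS w1) => //.
  apply: nearS (nearI k1 ag) => y [h1 h2] Sy; have [_ a2 a3 _ _] := h1 Sy.
  by rewrite -a2 (h2 Sy).
by split=> ag; exfalso; [exact: (no w' Sw' kw' ag)|exact: (no w Sw key ag)].
Qed.

Lemma sec_unique S Psi1 Psi2 a z : S `<=` H -> convex_rV S -> thick S -> sec S Psi1 -> sec S Psi2 ->
  S a -> (\forall y \near a, S y -> Psi1 y = Psi2 y) -> S z -> Psi1 z = Psi2 z.
Proof.
move=> SH cS tS s1 s2 Sa na Sz.
pose gam (t : R) := a + t *: (z - a).
have cg (t : R) : {for t, continuous gam}.
  apply: continuousD; first exact: cst_continuous.
  exact: scale_cont.
have Sg (t : R) : `[0 : R, 1]%classic t -> S (gam t).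
  by rewrite /= in_itv /= => /andP[t0 t1]; exact: cS.
have h := @connected_const R (`[0 : R, 1]%classic) (fun t => \forall y \near gam t, S y -> Psi1 y = Psi2 y) 0.
have i0 : `[0 : R, 1]%classic (0 : R) by rewrite /= in_itv /= lexx ler01.
have i1 : `[0 : R, 1]%classic (1 : R) by rewrite /= in_itv /= lexx ler01.
have g0 : gam 0 = a by rewrite /gam scale0r addr0.
have g1 : gam 1 = z by rewrite /gam scale1r addrCA subrr addr0.
have := h (@segment_connected R 0 1) i0; rewrite g0 => /(_ na) h'.
have hloc (p : R) : `[0 : R, 1]%classic p -> \forall q \near p, `[0 : R, 1]%classic q ->
    ((\forall y \near gam q, S y -> Psi1 y = Psi2 y) <-> (\forall y \near gam p, S y -> Psi1 y = Psi2 y)).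
  move=> ip; have := agree_local SH tS s1 s2 (Sg p ip) => /= nl.
  by apply: nearS (cg p _ nl) => q hq iq; apply: hq; exact: Sg.
by have := h' hloc 1 i1; rewrite g1 => /nbhs_singleton/(_ Sz).
Qed.

Definition sub_ball (rho : R) : set 'rV[R]_n := [set y | sqnorm y <= rho].

Lemma near_sub_ball (rho : R) w : sqnorm w < rho -> \forall y \near w, sub_ball rho y.
Proof.
move=> hw; have h0 : 0 < rho - sqnorm w by rewrite subr_gt0.
have := @sqnorm_cont R n w; move/cvgr_dist_lt => /(_ _ h0); apply: nearS => y.
rewrite distrC => hy; rewrite /sub_ball /=.
by have := ler_norm (sqnorm y - sqnorm w); lra.
Qed.

(* [Psi] is continued along the rays: the new value at [z] is that of the inverse chart centered at
   [lam z], whose image contains [z]. *)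
Lemma sec_extend (d lam rho : R) Psi :
  (forall q, exists W D E, [/\ Fl W D E, W q &
     forall y, H y -> sqnorm (y - D q) < d -> W (E y) /\ D (E y) = y]) ->
  0 < lam -> lam < 1 -> (1 - lam) ^+ 2 < d -> 0 < rho -> rho <= 1 ->
  sec (sub_ball (lam ^+ 2 * rho)) Psi -> exists Psi', sec (sub_ball rho) Psi'.
Proof.
move=> uni l0 l1 ld r0 r1 sP; set B := sub_ball (lam ^+ 2 * rho) in sP *.
have l2 : lam ^+ 2 < 1 by rewrite expr_lt1 // ltW.
have lr : lam ^+ 2 * rho < 1 by apply: lt_le_trans r1; rewrite gtr_pMl.
have lr0 : 0 < lam ^+ 2 * rho by rewrite mulr_gt0 // exprn_gt0.
have BH : B `<=` H by move=> y /= hy; apply: le_trans hy (ltW lr).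
pose good w Ew := exists W D, [/\ Fl W D Ew,
  forall y, H y -> sqnorm (y - w) < d -> W (Ew y) /\ D (Ew y) = y &
  \forall y \near w, B y -> Psi y = Ew y].
have /choice[Ew hEw] : forall w, exists Ew, B w -> good w Ew.
  move=> w; have [Bw|nB] := pselect (B w); last by exists Psi.
  have [W [D [E [fl Ww Dw nE]]]] := sP w Bw.
  have [W' [D' [E' [fl' W'w D'w uE nE']]]] := recenter uni fl Ww.
  rewrite Dw in uE nE' D'w; exists E' => _; exists W', D'; split=> //.
  by apply: nearS (nearI nE nE') => y [h1 h2] By; rewrite h1 // h2 //; exact: BH.
pose S w := H `&` [set y | sqnorm (y - w) < d].
have secE w : B w -> sec (S w) (Ew w).
  move=> Bw y [Hy hy]; have [W [D [fl uE _]]] := hEw w Bw; have [h1 h2] := uE y Hy hy.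
  by exists W, D, (Ew w); split=> //; apply: nearS filterT => ? _.
exists (fun z => Ew (lam *: z) z) => z0 hz0.
have Hz (z : 'rV[R]_n) : sub_ball rho z -> H z by move=> h; apply: le_trans h r1.
have Bl (z : 'rV[R]_n) : sub_ball rho z -> B (lam *: z).
  by move=> h; rewrite /B /sub_ball /= sqnorm_scale ler_pM2l // exprn_gt0.
have Sl (z : 'rV[R]_n) : sub_ball rho z -> S (lam *: z) z.
  move=> h; split; first exact: Hz.
  rewrite /=; have -> : z - lam *: z = (1 - lam) *: z by rewrite scalerBl scale1r.
  rewrite sqnorm_scale; apply: le_lt_trans ld; rewrite ler_piMr ?sqr_ge0 //.
  exact: Hz.
have Bw0 := Bl z0 hz0; set w0 := lam *: z0 in Bw0 *.
have [W [D [fl uE n0]]] := hEw w0 Bw0.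
have [h1 h2] := uE z0 (Hz z0 hz0) (Sl z0 hz0).2.
exists W, D, (Ew w0); split=> //.
have [e0 /= e00 he0] := (nbhs_ballP _ _).1 n0.
have n1 : \forall z \near z0, sqnorm (z - w0) < d.
  have hd : 0 < d - sqnorm (z0 - w0) by rewrite subr_gt0; exact: (Sl z0 hz0).2.
  have := @sqdist_cont R n w0 z0; move/cvgr_dist_lt => /(_ _ hd); apply: nearS => z.
  by rewrite distrC; have := ler_norm (sqnorm (z - w0) - sqnorm (z0 - w0)); lra.
have n2 : \forall z \near z0, `|z - z0| < e0.
  by apply/nbhs_ballP; exists e0 => // z; rewrite -ball_normE /= distrC.
have n3 : \forall z \near z0, sqnorm (lam *: z - w0) < d.
  have ld0 : 0 < d by apply: le_lt_trans ld; exact: sqr_ge0.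
  have := near_sqball z0 ld0; apply: nearS => z hz.
  rewrite /w0 -scalerBr sqnorm_scale; apply: le_lt_trans hz.
  by rewrite ler_piMl ?sqnorm_ge0 // ltW.
apply: nearS (nearI (nearI n1 n2) n3) => z [[hz1 hz2] hz3] hz.
have Bw := Bl z hz; set w := lam *: z in Bw hz3 *.
have [W1 [D1 [fl1 uE1 nw]]] := hEw w Bw.
have hwe : `|w - w0| < e0.
  by rewrite /w /w0 -scalerBr normrZ gtr0_norm //; apply: le_lt_trans hz2; rewrite ler_piMl // ltW.
have nw0 : \forall y \near w, B y -> Psi y = Ew w0 y.
  have nb : \forall y \near w, ball w0 e0 y.
    by apply: open_nbhs_nbhs; split; [exact: ball_open|rewrite -ball_normE /= distrC].
  by apply: nearS nb => y hy; exact: he0.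
have d0 : 0 < d by apply: le_lt_trans ld; exact: sqr_ge0.
have nall : \forall y \near w, (B y -> Ew w y = Ew w0 y) /\ (sqnorm (y - w) < d /\ sqnorm (y - w0) < d).
  have hd : 0 < d - sqnorm (w - w0) by rewrite subr_gt0.
  have n4 : \forall y \near w, sqnorm (y - w0) < d.
    have := @sqdist_cont R n w0 w; move/cvgr_dist_lt => /(_ _ hd); apply: nearS => y.
    by rewrite distrC; have := ler_norm (sqnorm (y - w0) - sqnorm (w - w0)); lra.
  apply: nearS (nearI (nearI nw nw0) (nearI (near_sqball w d0) n4)) => y [[a1 a2] [a3 a4]].
  by split=> // By; rewrite -a1 // a2.
have [e /= ep he] := (nbhs_ballP _ _).1 (nbhs_interior nall).
(* Pulling [w] slightly towards the origin gives a point [a] strictly inside the smaller ball, where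
   both local inverses equal [Psi] on a full neighborhood; [sec_unique] carries the agreement from
   [a] to [z]. *)
pose s := e / (`|w| + 1 + e); have q0 : 0 < `|w| + 1 + e by rewrite addr_gt0 // ltr_wpDl.
have s0 : 0 < s by rewrite divr_gt0.
have s1 : s < 1 by rewrite ltr_pdivrMr // mul1r ltrDr ltr_wpDl.
pose a := (1 - s) *: w.
have aw : ball w e a.
  rewrite -ball_normE /= /a scalerBl scale1r opprB addrCA subrr addr0 normrZ gtr0_norm //.
  rewrite /s mulrAC ltr_pdivrMr // ltr_pM2l //.
  by rewrite -addrA ltrDl addr_gt0.
have aB : sqnorm a < lam ^+ 2 * rho.
  rewrite /a sqnorm_scale.
  apply: (@le_lt_trans _ _ ((1 - s) ^+ 2 * (lam ^+ 2 * rho))).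
    by rewrite ler_wpM2l ?sqr_ge0.
  rewrite gtr_pMl // expr_lt1 //; first by rewrite gtrBl.
  by rewrite subr_ge0 ltW.
have na := he a aw; rewrite /interior /= in na.
have nB := near_sub_ball aB.
pose S' := S w `&` S w0.
have nS : \forall y \near a, S' y.
  by apply: nearS (nearI na nB) => y [[_ [k1 k2]] By]; split; split=> //; exact: BH.
have cS' : convex_rV S'.
  have cH : convex_rV H by exact: convex_closed_sqball.
  by apply: convexI; apply: convexI => //; exact: convex_sqball.
apply: (@sec_unique S' (Ew w) (Ew w0) a z) => //.
- by move=> y [[]].
- exact: convex_thick cS' nS.
- by apply: sec_sub (secE w Bw) => y [].
- by apply: sec_sub (secE w0 Bw0) => y [].
- exact: nbhs_singleton nS.
- by apply: nearS (nearI na nB) => y [[k1 _] By] _; exact: k1.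
- by split; [exact: Sl|split=> //; exact: Hz].
Qed.

(** A chart at [p0] covers a small ball; each extension enlarges the radius by the fixed factor 1 /
    lam, so finitely many steps reach the unit ball. *)
Lemma sec_exists : exists Psi, sec H Psi.
Proof.
have [d d0 uni] := uniform_radius.
(* With lam = 1 - s one has (1 - lam)^2 = s^2 <= s < d, as [sec_extend] requires, and the ball of
   squared radius s lies in the initial chart. *)
pose s := Num.min (d / 2) 2^-1; have s0 : 0 < s by rewrite lt_min; apply/andP; split; lra.
have sd : s <= d / 2 by rewrite ge_min lexx.
have s2 : s <= 2^-1 by rewrite ge_min lexx orbT.
pose lam := 1 - s; have l0 : 0 < lam by rewrite /lam; lra.
have l1 : lam < 1 by rewrite /lam; lra.
have ld : (1 - lam) ^+ 2 < d.
  rewrite /lam opprB addrCA subrr addr0; apply: (@le_lt_trans _ _ (s * 1)).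
    by rewrite expr2 ler_pM2l //; lra.
  by rewrite mulr1; lra.
suff h m : exists Psi, sec (sub_ball ((lam ^+ 2) ^+ m)) Psi.
  by have := h 0%N; rewrite expr0.
have l2 : lam ^+ 2 < 1 by rewrite expr_lt1 // ltW.
have l20 : 0 < lam ^+ 2 by rewrite exprn_gt0.
have base : exists Psi, sec (sub_ball s) Psi.
  have [W [D [E [fl Wp hE]]]] := uni p0; have D0 := fl_origin fl Wp.
  exists E => w hw; have [h1 h2] : W (E w) /\ D (E w) = w.
    apply: hE; first by rewrite /closed_unit_ball /=; apply: le_trans hw _; lra.
    by rewrite D0 subr0; apply: le_lt_trans hw _; lra.
  by exists W, D, E; split=> //; apply: nearS filterT => ? _.
have [m0 hm0] : exists m0, (lam ^+ 2) ^+ m0 < s.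
  have := @cvg_expr R (lam ^+ 2); rewrite ger0_norm ?(ltW l20) // => /(_ l2).
  move/cvgr_dist_lt => /(_ _ s0) [N _ hN]; exists N.
  have := hN N (leqnn N); rewrite sub0r normrN ger0_norm // exprn_ge0 // ltW //.
have step k : exists Psi, sec (sub_ball ((lam ^+ 2) ^+ (m0 - k))) Psi.
  elim: k => [|k [Psi hP]].
    rewrite subn0; have [Psi hP] := base; exists Psi; apply: sec_sub hP => y /= hy.
    by apply: le_trans hy (ltW hm0).
  have [km|km] := leqP m0 k.
    have -> : (m0 - k.+1 = m0 - k)%N by rewrite subnS; move: km; rewrite -subn_eq0 => /eqP ->.
    by exists Psi.
  have e : (m0 - k = (m0 - k.+1).+1)%N by rewrite subnSK.
  rewrite e exprS in hP; apply: sec_extend uni l0 l1 ld _ _ hP; first exact: exprn_gt0.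
  by apply: exprn_ile1; exact: ltW.
have [mm|mm] := leqP m m0; first by have := step (m0 - m)%N; rewrite subKn.
have [Psi hP] := step 0%N; exists Psi; rewrite subn0 in hP; apply: sec_sub hP => y /= hy.
apply: le_trans hy _; apply: ler_wiXn2l; [exact: ltW|exact: ltW|exact: ltnW].
Qed.

Lemma sec_rot Psi A : A *m A^T = 1%:M -> sec H Psi -> sec H (fun y => Psi (y *m A)).
Proof.
move=> AA sP w Hw; have AA' := mulmx1C AA.
have HA y : H y -> H (y *m A) by rewrite /closed_unit_ball /= sqnorm_orth.
have [W [D [E [fl Ww Dw nE]]]] := sP _ (HA w Hw).
exists W, (fun p => D p *m A^T), (fun y => E (y *m A)); split=> //.
- have := @fl_rot A^T W D E; rewrite trmxK; exact.
- by rewrite Dw -mulmxA AA mulmx1.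
- by have := near_orth AA nE; apply: nearS => y h Hy; apply: h; exact: HA.
Qed.

Lemma H_convex : convex_rV H.
Proof. exact: convex_closed_sqball. Qed.

Lemma H_near0 : \forall y \near (0 : 'rV[R]_n), H y.
Proof. by apply: (@near_sub_ball 1); rewrite sqnorm0 ltr01. Qed.

Lemma H_thick : thick H.
Proof. exact: convex_thick H_convex H_near0. Qed.

(** [Psi] is surjective because its image is open and compact in a connected space. For injectivity,
    two points with the same image give a rotation carrying one to the other, under which [Psi] is
    invariant near one of them and hence everywhere; at the fixed point 0, where [Psi] is locally
    injective, the rotation must be the identity. *)
Lemma developing : exists (z : M -> 'rV[R]_n) Psi,
  [/\ forall p, H (z p), forall p, Psi (z p) = p, forall y, H y -> z (Psi y) = y &
    forall p, exists W D E, [/\ Fl W D E, W p, \forall q \near p, z q = D q &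
      \forall y \near z p, H y -> Psi y = E y]].
Proof.
have [Psi sP] := sec_exists.
have Hid : H `<=` H by [].
have inj z1 z2 : H z1 -> H z2 -> Psi z1 = Psi z2 -> z1 = z2.
  move=> H1 H2 e.
  have [W1 [D1 [E1 [fl1 W1z D1z n1]]]] := sP z1 H1; have [W2 [D2 [E2 [fl2 W2z D2z n2]]]] := sP z2 H2.
  have W1z2 : W1 (Psi z2) by rewrite -e.
  have [A AA nA] := fl_overlap fl1 fl2 W1z2 W2z; have AA' := mulmx1C AA.
  have AT : A^T *m (A^T)^T = 1%:M by rewrite trmxK.
  have z21 : z2 *m A^T = z1.
    by rewrite -D2z (nbhs_singleton nA) -e D1z -mulmxA AA mulmx1.
  have HA y : H y -> H (y *m A^T) by rewrite /closed_unit_ball /= sqnorm_orth.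
  have ag : \forall y \near z2, H y -> Psi y = Psi (y *m A^T).
    have nI := bc_inv (flC fl2) W2z (nearI nA (bc_near fl1 W1z2)); rewrite D2z in nI.
    have n1' : \forall y \near z2, H (y *m A^T) -> Psi (y *m A^T) = E1 (y *m A^T).
      have n1b : \forall y \near z2 *m A^T, H y -> Psi y = E1 y by rewrite z21.
      exact: (@near_orth R n z2 A^T (fun y => H y -> Psi y = E1 y) AT n1b).
    apply: nearS (nearI (nearI nI n2) n1') => y [[h1 h2] h3] Hy.
    have [[a1 a1'] a2 a3] := h1 Hy; rewrite (h3 (HA y Hy)) h2 //.
    by rewrite -{2}a3 a1 -mulmxA AA mulmx1 (bc_K (flC fl1) a1').
  have eqP y : H y -> Psi y = Psi (y *m A^T).
    move=> Hy; exact: (sec_unique Hid H_convex H_thick sP (sec_rot AT sP) H2 ag Hy).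
  have H0 : H 0 by exact: nbhs_singleton H_near0.
  have [W [D [E [fl W0 D0 n0]]]] := sP 0 H0.
  suff A1 : A^T = 1%:M by rewrite -z21 A1 mulmx1.
  apply: (H_thick H0).
  have nT : nbhs (Psi 0) [set: M] by exact: filterT.
  have nI := bc_inv (flC fl) W0 nT; rewrite D0 in nI.
  have n0' : \forall y \near (0 : 'rV[R]_n), (H (y *m A^T) -> Psi (y *m A^T) = E (y *m A^T)) /\
      (H (y *m A^T) -> [/\ setT (E (y *m A^T)), W (E (y *m A^T)) & D (E (y *m A^T)) = y *m A^T]).
    have n0b : \forall y \near 0 *m A^T, (H y -> Psi y = E y) /\ (H y -> [/\ setT (E y), W (E y) & D (E y) = y]).
      by rewrite mul0mx; exact: nearI n0 nI.
    exact: (@near_orth R n 0 A^T (fun y => (H y -> Psi y = E y) /\ (H y -> [/\ setT (E y), W (E y) & D (E y) = y])) AT n0b).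
  apply: nearS (nearI (nearI n0 nI) n0') => y [[h1 h2] [h3 h4]] Hy.
  have [_ _ a1] := h2 Hy; have [_ _ a2] := h4 (HA y Hy).
  by rewrite -[RHS]a1 -[LHS]a2 -(h3 (HA y Hy)) -(h1 Hy) -(eqP y Hy).
have surj p : exists2 y, H y & Psi y = p.
  have := @connected_const M setT (fun p => exists2 y, H y & Psi y = p) (Psi 0) conM I.
  apply=> //; first by exists 0 => //; exact: nbhs_singleton H_near0.
  move=> q _; have [[y Hy yq]|nq] := pselect (exists2 y, H y & Psi y = q).
    have [W [D [E [fl Wy Dy nE]]]] := sP y Hy; rewrite yq in Wy Dy.
    have nD : \forall q' \near q, H (D q') -> Psi (D q') = E (D q').
      have nE' : \forall y' \near D q, H y' -> Psi y' = E y' by rewrite Dy.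
      exact: (bc_cont (flC fl) Wy nE').
    apply: nearS (nearI nD (bc_near fl Wy)) => q' [h1 Wq'] _; split=> _; first by exists y.
    by exists (D q'); [exact: (bc_ball (flC fl) Wq')|rewrite h1 ?(bc_K (flC fl) Wq') //; exact: (bc_ball (flC fl) Wq')].
  suff : closed [set p | exists2 y, H y & Psi y = p].
    move/closed_openC => oC; have : nbhs q (~` [set p | exists2 y, H y & Psi y = p]) by exact: open_nbhs_nbhs.
    by apply: nearS => q' nq' _; split=> h; [case: (nq' h)|case: (nq h)].
  have -> : [set p | exists2 y, H y & Psi y = p] = Psi @` H.
    by apply/seteqP; split=> x [y Hy yx]; exists y.
  apply: compact_closed => //; apply: continuous_compact.
    by apply/subspace_continuousP => w Hw N nN; exact: (sec_cont Hid sP Hw nN).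
  apply: (subclosed_compact _ (@closed_cube_compact R n 0 1)).
    apply: (@closed_comp _ _ (@sqnorm R n) [set t | t <= 1]); last exact: closed_le.
    by move=> y _; exact: sqnorm_cont.
  move=> y Hy; rewrite /= subr0; have := norm_le_sqnorm y => h.
  by rewrite -(@expr_le1 _ 2) //; apply: le_trans h Hy.
have /choice[z hz] : forall p, exists y, H y /\ Psi y = p by move=> p; have [y] := surj p; exists y.
exists z, Psi; split=> [p|p|y Hy|p].
- by have [] := hz p.
- by have [] := hz p.
- by apply: inj => //; have [] := hz (Psi y).
- have [Hzp Pz] := hz p; have [W [D [E [fl Wz Dz nE]]]] := sP (z p) Hzp.
  rewrite Pz in Wz Dz; exists W, D, E; split=> //.
  have nD : \forall q \near p, H (D q) -> Psi (D q) = E (D q).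
    have nE' : \forall y' \near D p, H y' -> Psi y' = E y' by rewrite Dz.
    exact: (bc_cont (flC fl) Wz nE').
  apply: nearS (nearI nD (bc_near fl Wz)) => q [h1 Wq].
  have HD := bc_ball (flC fl) Wq; have [Hzq Pzq] := hz q.
  by apply: inj => //; rewrite h1 // (bc_K (flC fl) Wq).
Qed.

End Developing.

(** * Flat charts of the manifold *)

Section BoundarySide.
Variables (R : realType) (n : nat) (n0 : (0 < n)%N) (D : 'rV[R]_n -> 'rV[R]_n) (x0 : 'rV[R]_n) (r : R).
Local Notation o := (ordz n0).
Hypotheses (r0 : 0 < r) (cD : forall k, Cinf_on (oball x0 r) (fun x => D x 0 k)).
Hypotheses (Ju : jac_at D x0 \in unitmx) (hx0 : half_space x0).
Hypothesis hle : forall x, half_space x -> oball x0 r x -> sqnorm (D x) <= 1.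
Hypothesis hbd : forall x, half_space x -> oball x0 r x -> x 0 o = 0 -> sqnorm (D x) = 1.

Lemma half_spaceE (x : 'rV[R]_n) : half_space x <-> 0 <= x 0 o.
Proof.
split=> [|h i i0]; first exact.
by have -> : i = o by apply: val_inj.
Qed.

Let phi x := sqnorm (D x).

Let cphi m : Ck_on m (oball x0 r) phi.
Proof.
apply: Ck_on_sum => [|k _]; first exact: oball_open.
apply: (@Ck_on_eq R n m _ (fun x => D x 0 k * D x 0 k)) => [|x _|]; first exact: oball_open.
  by rewrite expr2.
by apply: Ck_on_mul; [exact: oball_open|exact: cD|exact: cD].
Qed.

Let dphi a : 'D_(evec R a) phi x0 = 2 * (jac_at D x0 *m (D x0)^T) a 0.
Proof.
have Ux := oball_center x0 r0.
have [_ ->] : is_derive x0 (evec R a) phi (\sum_k 2 * (jac_at D x0 a k * D x0 0 k)).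
  apply: is_derive_bigsum => k.
  have d := Ck_on_is_derive (cD k 1%N) a Ux.
  have -> : (fun y => D y 0 k ^+ 2) = (fun y => D y 0 k) * (fun y => D y 0 k).
    by apply/funext => y; rewrite expr2.
  apply: is_derive_eq (is_deriveM d d) _.
  by rewrite -[LHS]/(D x0 0 k * _ + D x0 0 k * _) mxE; ring.
by rewrite -mulr_sumr; congr (_ * _); rewrite [RHS]mxE; apply: eq_bigr => k _; rewrite [X in _ = _ * X]mxE.
Qed.

(* On the boundary of the half space |D|^2 has its maximum 1 and is not critical, as [D] is
   nonzero and its Jacobian invertible; hence |D|^2 > 1 outside the half space. *)
Lemma half_space_of_norm : exists r1, [/\ 0 < r1, r1 <= r & forall x, oball x0 r1 x -> sqnorm (D x) <= 1 -> half_space x].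
Proof.
have [x00|x00] := ltP 0 (x0 0 o).
  exists (Num.min r (x0 0 o)); split; [by rewrite lt_min r0|by rewrite ge_min lexx|].
  move=> x; rewrite /oball /= lt_min => /andP[_ hx] _; apply/half_spaceE.
  have := le_lt_trans (coord_le_norm (x - x0) o) hx; rewrite !mxE ltr_norml => /andP[h _].
  by lra.
have x0o : x0 0 o = 0 by apply/eqP; rewrite eq_le x00; exact/half_spaceE.
have Ux := oball_center x0 r0.
have phi0 : phi x0 = 1 by exact: hbd.
have evn a : `|evec R a : 'rV[R]_n| <= 1.
  by apply: norm_le_coord => // i; rewrite !mxE; case: (_ && _); rewrite ?normr1 ?normr0.
(* Along the boundary hyperplane |D|^2 is constantly 1, so tangential derivatives vanish. *)
have tang a : a != o -> 'D_(evec R a) phi x0 = 0.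
  move=> ao; have c := derivable_cvg (@Ck_on_derivable R n 0 _ phi (cphi 1) a x0 Ux).
  have c0 : h^-1 * (phi (h *: evec R a + x0) - phi x0) @[h --> (0:R)^'] --> 0.
    apply: cvg_near_cst.
    have near0 : \forall s \near (0:R)^', s != 0 /\ `|s| < r.
      rewrite near_withinE; apply/nbhs_ballP; exists r => // s; rewrite -ball_normE /= sub0r normrN => hs s0.
      by split.
    move: near0; apply: filterS => s [s0 sr].
    have e : (s *: evec R a + x0) 0 o = 0.
      by rewrite !mxE x0o addr0 eq_sym (negbTE ao) andbF mulr0.
    rewrite [phi _]hbd ?phi0 ?subrr ?mulr0 //; first by apply/half_spaceE; rewrite e.
    by rewrite /oball /= addrK normrZ; apply: le_lt_trans sr; rewrite ler_piMr.
  exact: (cvg_unique _ c c0).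
have cd : {for x0, continuous ('D_(evec R o) phi)} by exact: (Ck_on_cont (Ck_on_derive (cphi 1) o)).
(* The differential of |D|^2 is twice the Jacobian applied to [D], which is nonzero because the
   Jacobian is invertible and |D| = 1. *)
have nz : 'D_(evec R o) phi x0 != 0.
  apply/eqP => d0; have JD : jac_at D x0 *m (D x0)^T = 0.
    apply/colP => a; have := dphi a.
    have -> : 'D_(evec R a) phi x0 = 0 by have [->|/tang] := eqVneq a o.
    by move/eqP; rewrite eq_sym mulf_eq0 pnatr_eq0 /= mxE => /eqP ->; rewrite mxE.
  have D0 : (D x0)^T = 0 by rewrite -(mulKmx Ju (D x0)^T) JD mulmx0.
  have : D x0 = 0 by rewrite -(trmxK (D x0)) D0 trmx0.
  by move=> e; have := phi0; rewrite /phi e sqnorm0 => /eqP; rewrite eq_sym oner_eq0.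
have line x (s : R) rr : oball x0 rr x -> oball x0 rr (x + s *: evec R o) -> rr <= r ->
    (forall th, `|th| <= `|s| -> oball x0 rr (x + th *: evec R o)) ->
    exists2 th, oball x0 rr (x + th *: evec R o) & phi (x + s *: evec R o) - phi x = s * 'D_(evec R o) phi (x + th *: evec R o).
  move=> h1 h2 rr' hh.
  have dth (th : R) : `|th| <= `|s| -> derivable phi (x + th *: evec R o) (evec R o).
    move=> hth; apply: (@Ck_on_derivable R n 0 (oball x0 r) phi (cphi 1) o); exact: (oball_sub rr' (hh th hth)).
  by have [th th1 hth] := mvt_line dth; exists th => //; exact: hh.
(* A positive normal derivative would push |D|^2 above 1 inside the half space. *)
have dn : 'D_(evec R o) phi x0 < 0.
  rewrite ltNge; apply/negP => d0; have dp : 0 < 'D_(evec R o) phi x0 by rewrite lt_neqAle eq_sym nz.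
  move/cvgr_dist_lt: cd => /(_ _ dp)/nbhs_ballP[e /= e0 he].
  pose rr := Num.min r e; have rr0 : 0 < rr by rewrite lt_min r0.
  have hth (th : R) : `|th| <= `|rr / 2| -> oball x0 rr (x0 + th *: evec R o).
    move=> hth; rewrite /oball /= addrAC subrr add0r normrZ; apply: (@le_lt_trans _ _ (rr / 2)); last by lra.
    apply: (@le_trans _ _ (`|th| * 1)); first by rewrite ler_wpM2l.
    by rewrite mulr1; apply: le_trans hth _; rewrite ger0_norm // divr_ge0 // ltW.
  have hs := hth (rr / 2) (lexx _).
  have rrr : rr <= r by rewrite ge_min lexx.
  have [th /= ht eth] := line x0 (rr / 2) rr (oball_center x0 rr0) hs rrr hth.
  have hp : 0 < 'D_(evec R o) phi (x0 + th *: evec R o).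
    have : ball x0 e (x0 + th *: evec R o).
      by rewrite -ball_normE /= distrC; apply: lt_le_trans ht _; rewrite ge_min lexx orbT.
    by move/he => /=; rewrite ltr_distl => /andP[_ h]; lra.
  have : phi (x0 + (rr / 2) *: evec R o) <= 1.
    apply: hle; last by apply: oball_sub hs; rewrite ge_min lexx.
    by apply/half_spaceE; rewrite !mxE x0o !eqxx mulr1 add0r divr_ge0 // ltW.
  have : 0 < rr / 2 * 'D_(evec R o) phi (x0 + th *: evec R o) by rewrite mulr_gt0 // divr_gt0.
  by rewrite -eth phi0; lra.
have dn' : 0 < - 'D_(evec R o) phi x0 by rewrite oppr_gt0.
move/cvgr_dist_lt: cd => /(_ _ dn')/nbhs_ballP[e /= e0 he].
pose rr := Num.min r e; have rr0 : 0 < rr by rewrite lt_min r0.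
have rrr : rr <= r by rewrite ge_min lexx.
exists rr; split=> // x hx nx; apply/half_spaceE; rewrite leNgt; apply/negP => xo.
pose x' := x + (- x 0 o) *: evec R o.
have inb (th : R) : `|th| <= `|x 0 o| -> oball x0 rr (x' + th *: evec R o).
  move=> hth; rewrite /oball /=; apply: norm_lt_coord => // k.
  have := le_lt_trans (coord_le_norm (x - x0) k) hx; rewrite !mxE.
  have [->|ko] := eqVneq k o.
    rewrite !eqxx /= x0o subr0 !mulr1 subrr add0r subr0 => h; exact: le_lt_trans h.
  by rewrite !andbF /= !mulr0 !addr0.
have ex : x' + x 0 o *: evec R o = x by rewrite /x' -addrA -scalerDl addNr scale0r addr0.
have hx' : oball x0 rr x' by have := inb 0; rewrite normr0 scale0r addr0; apply.
have x'o : x' 0 o = 0 by rewrite !mxE !eqxx mulr1 subrr.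
have phi' : phi x' = 1 by apply: hbd => //; [apply/half_spaceE; rewrite x'o|exact: oball_sub hx'].
have [|th ht] := line x' (x 0 o) rr hx' _ rrr inb; first by rewrite ex.
rewrite ex phi' => eth.
have hn : 'D_(evec R o) phi (x' + th *: evec R o) < 0.
  have : ball x0 e (x' + th *: evec R o).
    by rewrite -ball_normE /= distrC; apply: lt_le_trans ht _; rewrite ge_min lexx orbT.
  by move/he => /=; rewrite ltr_distl => /andP[h _]; lra.
have : 0 < x 0 o * 'D_(evec R o) phi (x' + th *: evec R o) by rewrite nmulr_rgt0.
by rewrite -eth; move: nx; rewrite -/(phi x); lra.
Qed.

End BoundarySide.

(** * Two systems of flat coordinates differ by a rotation *)

Section TwoFlatCharts.
Variables (R : realType) (n : nat) (A : set 'rV[R]_n) (G : 'rV[R]_n -> 'M[R]_n).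
Hypotheses (hA : rel_open A) (cA : chart_metric_on A G).

Definition s_jacobian (f : 'I_n -> sfun A) : 'M[sfun A]_n := \matrix_(a, k) sder hA a (f k).

Lemma s_jacobian_inv f : s_jacobian f *m (s_jacobian f)^T = s_metric cA ->
  s_jacobian f *m ((s_jacobian f)^T *m s_inv cA) = 1%:M.
Proof. by move=> JJ; rewrite mulmxA JJ s_metric_inv. Qed.

Lemma s_jacobian_parallel f : s_jacobian f *m (s_jacobian f)^T = s_metric cA ->
  forall a, dmx (sder hA) a (s_jacobian f) = s_gam hA cA a *m s_jacobian f.
Proof.
move=> JJ; apply: (isometric_parallel (s_lc hA cA) (ex_half A) (s_jacobian_inv JJ) JJ) => a b c.
by rewrite ![s_jacobian f _ _]mxE (der_comm (sder_derivations hA)).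
Qed.

(** The two Jacobians are parallel orthonormal coframes, so their quotient [Q] is orthogonal and
    constant. Equality of the squared norms excludes a translation: differentiated, it relates the
    coordinate vectors themselves by [Q]. *)
Lemma two_flat (f1 f2 : 'I_n -> sfun A) :
  s_jacobian f1 *m (s_jacobian f1)^T = s_metric cA -> s_jacobian f2 *m (s_jacobian f2)^T = s_metric cA ->
  \sum_k f1 k * f1 k = \sum_k f2 k * f2 k ->
  exists Q : 'M[sfun A]_n, [/\ Q *m Q^T = 1%:M, forall a, dmx (sder hA) a Q = 0 &
    \row_k f2 k = (\row_k f1 k) *m Q].
Proof.
move=> J1 J2 e; set K1 := s_jacobian f1 in J1 *; set K2 := s_jacobian f2 in J2 *.
have i1 := s_jacobian_inv J1; have i1' := mulmx1C i1.
set Ki := (K1^T *m s_inv cA) in i1 i1'.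
have QQ : (Ki *m K2) *m (Ki *m K2)^T = 1%:M.
  rewrite trmx_mul -mulmxA (mulmxA K2) J2 -J1 -(mulmxA K1) mulmxA i1' mul1mx -trmx_mul i1'.
  by rewrite trmx1.
exists (Ki *m K2); split=> //.
  exact: (parallel_quotient (s_lc hA cA) i1 (s_jacobian_parallel J1) (s_jacobian_parallel J2)).
have hd := sder_derivations hA.
have dsq (f : 'I_n -> sfun A) a : sder hA a (\sum_k f k * f k) = (s_jacobian f *m (\row_k f k)^T) a 0 *+ 2.
  rewrite (der_sum hd) [X in X *+ 2]mxE -sumrMnl; apply: eq_bigr => k _.
  by rewrite (der_mul hd) [s_jacobian f a k]mxE [X in _ * X *+ 2]mxE mxE mulr2n [f k * _]mulrC.
have KK : K1 *m (\row_k f1 k)^T = K2 *m (\row_k f2 k)^T.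
  have [h hh] := ex_half A.
  have half_cancel (x y : sfun A) : x *+ 2 = y *+ 2 -> x = y.
    by move=> xy; rewrite -[x]mul1r -[y]mul1r -hh !mulrDl -!mulrDr -!mulr2n xy.
  by apply/colP => a; apply: half_cancel; rewrite -(dsq f1 a) -(dsq f2 a) e.
have : (\row_k f1 k)^T = Ki *m K2 *m (\row_k f2 k)^T.
  by rewrite -mulmxA -KK mulmxA i1' mul1mx.
move/(congr1 trmx); rewrite trmxK trmx_mul trmxK => ->.
by rewrite -mulmxA (mulmx1C QQ) mulmx1.
Qed.

End TwoFlatCharts.

Section FlatCharts.
Variables (R : realType) (n : nat) (M : topologicalType) (g : riemannian_data R n M) (v : M -> R).
Hypotheses (ob : obata g v) (n0 : (0 < n)%N).
Let hm := ob_mfd ob.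
Let hv := ob_smooth ob.
Local Notation H := (@closed_unit_ball R n).
Implicit Types (W : set M) (D : M -> 'rV[R]_n) (E : 'rV[R]_n -> M).

(* The value of |D|^2 for the flat coordinates [D] centered at the maximum of [v]. *)
Definition sq_radius p : R := (1 - v p) / (1 + v p).

Lemma v1_gt0 p : 0 < 1 + v p.
Proof. by rewrite ltr_wpDr // (v_ge0 ob). Qed.

Lemma sq_radius_le1 p : sq_radius p <= 1.
Proof. by rewrite ler_pdivrMr ?v1_gt0 // mul1r; have := v_ge0 ob p; lra. Qed.

Definition chart_img (i : chart_idx g) W : set 'rV[R]_n := chart i @` (chart_dom i `&` W).

Definition pull_map D (i : chart_idx g) (x : 'rV[R]_n) : 'rV[R]_n := D (chart_inv i x).

Definition flat_in (i : chart_idx g) W D :=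
  (forall k, smooth_on (chart_img i W) (fun x => pull_map D i x 0 k)) /\
  forall x, chart_img i W x ->
    jacobian_mx (pull_map D i) x *m (jacobian_mx (pull_map D i) x)^T = flat_metric v i x.

Definition inv_smooth (i : chart_idx g) W D E :=
  forall k, smooth_on (D @` (W `&` chart_dom i)) (fun y => chart i (E y) 0 k).

(** The class of charts fed to [developing]. Prescribing |D|^2 pins down the origin, so that
    overlaps are rotations rather than rigid motions. *)
Record flat_chart W D E : Prop := FlatChart {
  fc_chart : ball_chart W D E;
  fc_norm : forall p, W p -> sqnorm (D p) = sq_radius p;
  fc_flat : forall i : chart_idx g, flat_in i W D;
  fc_inv : forall i : chart_idx g, inv_smooth i W D E
}.

Lemma chart_img_cod (i : chart_idx g) W : chart_img i W `<=` chart_cod i.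
Proof. by move=> _ [p [dp _] <-]; exact: chart_in. Qed.

(** Flatness and smoothness need checking in one chart only; the chain rule transports them to every
    other chart. *)
Lemma flat_in_trans (i j : chart_idx g) W D : open W -> W `<=` chart_dom i -> flat_in i W D -> flat_in j W D.
Proof.
move=> oW Wi [sD jD].
have hA : rel_open (chart_img j W) by exact: chart_img_open.
have hB : rel_open (chart_img i W) by exact: chart_img_open.
have sub : chart_img j W `<=` trans_dom j i.
  by move=> _ [p [dj Wp] <-]; apply: trans_in => //; exact: Wi.
have hT x : chart_img j W x -> chart_img i W (trans j i x).
  by move=> [p [dj Wp] <-]; rewrite (transE hm i dj); exists p => //; split=> //; exact: Wi.
have sT b : smooth_on (chart_img j W) (fun x => trans j i x 0 b).
  exact: smooth_on_sub sub (trans_smooth hm (i := j) (j := i) b).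
have eD x : chart_img j W x -> pull_map D i (trans j i x) = pull_map D j x.
  by move=> [p [dj Wp] <-]; rewrite (transE hm i dj) /pull_map !(chartK hm) //; exact: Wi.
split=> [k|x Ax].
  apply: (@smooth_on_eq _ _ _ (fun x => pull_map D i (trans j i x) 0 k)); first by move=> y Ay; rewrite eD.
  exact: (smooth_on_comp hT sT (sD k)).
have jE : jacobian_mx (pull_map D j) x = jac (trans j i) x *m jacobian_mx (pull_map D i) (trans j i x).
  apply/matrixP => a k; rewrite [LHS]mxE.
  rewrite (pd_congr (g := fun y => pull_map D i (trans j i y) 0 k) a hA Ax); last by move=> y Ay; rewrite eD.
  rewrite (pd_comp hA hB hT sT a (sD k) Ax) [RHS]mxE; apply: eq_bigr => c _.
  by rewrite [in RHS]mxE [in RHS]mxE.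
rewrite jE trmx_mul -mulmxA (mulmxA (jacobian_mx _ _) _ (jac _ _)^T) jD; last exact: hT.
by rewrite mulmxA -(flat_metric_trans ob (sub x Ax)).
Qed.

Lemma inv_smooth_trans (i j : chart_idx g) W D E : (forall p, W p -> E (D p) = p) -> W `<=` chart_dom i ->
  inv_smooth i W D E -> inv_smooth j W D E.
Proof.
move=> EK Wi sE k; set S := D @` (W `&` chart_dom j).
have sT b : smooth_on S (fun y => chart i (E y) 0 b).
  by apply: smooth_on_sub (sE b) => _ [p [Wp dj] <-]; exists p => //; split=> //; exact: Wi.
have hT y : S y -> trans_dom i j (chart i (E y)).
  by move=> [p [Wp dj] <-]; rewrite EK //; apply: trans_in => //; exact: Wi.
apply: (@smooth_on_eq _ _ _ (fun y => trans i j (chart i (E y)) 0 k)).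
  by move=> _ [p [Wp dj] <-]; rewrite EK // (transE hm j (Wi p Wp)).
exact: (@smooth_on_comp _ _ _ S (trans_dom i j) (fun x => trans i j x 0 k) (fun y => chart i (E y))) hT sT (trans_smooth hm (i := i) (j := j) k).
Qed.

(** Flat coordinates extend smoothly across the boundary, where the inverse function theorem applies
    to them. What is specific to the boundary is that the inverse must send points of the closed
    ball back into the half space. *)
Lemma flat_chart_exists p : exists W D E, flat_chart W D E /\ W p.
Proof.
have [i di] := chart_cover hm p; set x0 := chart i p.
have Bx0 : chart_cod i x0 by exact: chart_in.
have hB := cod_open hm i; have cB := flat_metric_on ob i.
have [r [Dh [r0 inB cD hD]]] := flat_coordinates (flat ob n0 i) Bx0 (euler_homothetic ob i).
have hx0 : half_space x0 by exact: cod_half Bx0.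
have Ux := oball_center x0 r0.
have nrm x : half_space x -> oball x0 r x -> sqnorm (Dh x) = sq_radius (chart_inv i x).
  move=> hx xr; have Bx := inB x hx xr; have [_ ->] := hD x hx xr.
  rewrite euler_norm (ext_ev _ Bx) expr2 !evM evD evN ev1 expr2 evM ev_mk ev_mk /=.
  rewrite /sq_radius -/(local_fun v i x) /local_fun.
  have := v1_gt0 (chart_inv i x); move: (v _) => t t0.
  by field; rewrite gt_eqF.
have jacE x : half_space x -> oball x0 r x -> jacobian_mx Dh x = jac_at Dh x.
  move=> hx xr; apply/matrixP => a k; rewrite !mxE.
  exact: (@pd_ball R n _ (rel_open_half (@oball_open R n x0 r)) _ _ a x0 x r (cD k 1%N) (fun _ _ _ => erefl) (conj xr hx) xr).
have Ju : jac_at Dh x0 \in unitmx.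
  have [e _] := hD x0 hx0 Ux; rewrite jacE // in e.
  have := posdef_unit (cm_pos cB Bx0); rewrite -e unitmx_mul => /andP[]//.
have [|x hx xr x00|r1 [r10 r1r half]] := @half_space_of_norm R n n0 Dh x0 r r0 cD Ju hx0.
- by move=> x hx xr; rewrite nrm //; exact: sq_radius_le1.
- rewrite nrm // /sq_radius (ob_bdry ob) ?subr0 ?addr0 ?divr1 //.
  exists i, (ordz n0); split=> //; first by apply: (inv_dom hm); exact: inB.
  by rewrite (chart_invK hm) //; exact: inB.
have [r' [d [E' [[r'0 r'1] d0 inU [hE EK cE]]]]] :=
  inverse_function (@oball_open R n x0 r) cD Ux Ju r10.
have r'r : oball x0 r' `<=` oball x0 r by apply: oball_sub; exact: le_trans r'1 r1r.
pose W := [set q | chart_dom i q /\ (oball x0 r' (chart i q) /\ oball (Dh x0) d (Dh (chart i q)))].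
pose D q := Dh (chart i q); pose E y := chart_inv i (E' y).
have cDh x : oball x0 r x -> {for x, continuous Dh}.
  by move=> xr; apply: rV_cont => b; exact: (Cinf_cont (cD b)).
have Dcont q : W q -> {for q, continuous D}.
  move=> [dq [h1 h2]]; apply: (@continuous_comp _ _ _ (chart i) Dh); first exact: chart_cont.
  exact: cDh (r'r _ h1).
have Wi : W `<=` chart_dom i by move=> q [].
have oW : open W.
  rewrite openE => q Wq; have [dq [h1 h2]] := Wq.
  have n1 : \forall q' \near q, oball x0 r' (chart i q').
    have := chart_cont hm dq; apply; apply: open_nbhs_nbhs; split=> //; exact: oball_open.
  have n2 : \forall q' \near q, oball (Dh x0) d (D q').
    have := Dcont q Wq; apply; apply: open_nbhs_nbhs; split=> //; exact: oball_open.
  by apply: nearS (nearI (dom_near hm dq) (nearI n1 n2)).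
(* [half] supplies the missing fact: a preimage of a point of norm at most 1 lies in the half space,
   so [E] lands in the manifold. *)
have inW y : H y -> oball (Dh x0) d y -> [/\ chart_cod i (E' y), W (E y) & D (E y) = y].
  move=> Hy yd; have [h1 h2] := hE y yd.
  have hh : half_space (E' y).
    by apply: half; [exact: oball_sub h1|rewrite h2].
  have cy : chart_cod i (E' y) by apply: inB => //; exact: r'r.
  split=> //; last by rewrite /D /E (chart_invK hm).
  split; first exact: (inv_dom hm).
  by rewrite /E (chart_invK hm) // h2.
have img x : chart_img i W x -> oball x0 r' x /\ half_space x.
  by move=> [q [dq [_ [h1 _]]] <-]; split=> //; exact: cod_half (chart_in dq).
have eqD x : chart_img i W x -> Dh x = pull_map D i x.
  by move=> [q [dq _] <-]; rewrite /pull_map /D (chartK hm).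
have hA : rel_open (chart_img i W) by exact: chart_img_open.
have EDK q : W q -> E (D q) = q.
  by move=> [dq [h1 h2]]; rewrite /E /D EK // (chartK hm).
exists W, D, E; split; last first.
  by split=> //; split; apply: oball_center.
split.
- split=> //.
  + move=> q [dq [h1 _]]; rewrite /closed_unit_ball /= /D nrm; first exact: sq_radius_le1.
      exact: cod_half (chart_in dq).
    exact: r'r.
  + move=> q N Wq nN; have [dq [h1 h2]] := Wq.
    have cq : chart_cod i (chart i q) by exact: chart_in.
    have [e e0 he] : exists2 e : R, 0 < e & forall y, half_space y -> `|y - chart i q| < e ->
        chart_cod i y /\ N (chart_inv i y).
      by apply: inv_near => //; rewrite (chartK hm).
    have cE' : {for D q, continuous E'}.
      by apply: rV_cont => b; exact: (Cinf_cont (cE b)).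
    have n1 : \forall y \near D q, oball (Dh x0) d y.
      by apply: open_nbhs_nbhs; split=> //; exact: oball_open.
    have n2 : \forall y \near D q, oball (chart i q) e (E' y).
      apply: cE'; rewrite /D EK //; apply: open_nbhs_nbhs; split; first exact: oball_open.
      exact: oball_center.
    apply: nearS (nearI n1 n2) => y [y1 y2] Hy; have [a1 a2 a3] := inW y Hy y1.
    by split=> //; have [_] := he (E' y) (cod_half hm a1) y2.
- move=> q [dq [h1 _]]; rewrite /D nrm ?(chartK hm) //; last exact: r'r.
  exact: cod_half (chart_in dq).
- move=> j; apply: (@flat_in_trans i j) => //; split=> [k|x Ax].
    apply: smooth_on_eq (Cinf_smooth_on (@oball_open R n x0 r) (cD k) _) => [y Ay|y /img[yr _]].
      by rewrite eqD.
    exact: r'r.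
  have [xr hx] := img x Ax.
  have -> : jacobian_mx (pull_map D i) x = jacobian_mx Dh x.
    apply/matrixP => a k; rewrite !mxE; apply: (pd_congr a hA Ax) => y Ay; by rewrite eqD.
  by have [] := hD x hx (r'r x xr).
- move=> j; apply: (@inv_smooth_trans i j) => // k.
  apply: smooth_on_eq (Cinf_smooth_on (@oball_open R n (Dh x0) d) (cE k) _).
    by move=> _ [q [Wq dq] <-]; rewrite EDK // /D; have [_ [h1 h2]] := Wq; rewrite EK.
  by move=> _ [q [Wq dq] <-]; have [_ [_]] := Wq.
Qed.

Lemma flat_chart_origin p W D E : v p = 1 -> flat_chart W D E -> W p -> D p = 0.
Proof.
move=> vp fc Wp; apply/eqP; rewrite -sqnorm_eq0 (fc_norm fc Wp) /sq_radius vp subrr mul0r.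
exact: eqxx.
Qed.

Lemma mulmx_coord (x : 'rV[R]_n) (A : 'M[R]_n) k : (x *m A) 0 k = \sum_l A l k * x 0 l.
Proof. by rewrite mxE; apply: eq_bigr => l _; rewrite mulrC. Qed.

Lemma smooth_on_mulmx (S : set 'rV[R]_n) (f : 'rV[R]_n -> 'rV[R]_n) (A : 'M[R]_n) :
  (forall k, smooth_on S (fun x => f x 0 k)) -> forall k, smooth_on S (fun x => (f x *m A) 0 k).
Proof.
move=> sf k; apply: (@smooth_on_eq _ _ _ (fun x => \sum_l A l k * f x 0 l)).
  by move=> x _; rewrite mulmx_coord.
apply: smooth_on_sum => l _.
exact: (smooth_on_mul (@smooth_on_cst R n S (A l k)) (sf l)).
Qed.

Lemma flat_chart_rot A W D E : A *m A^T = 1%:M -> flat_chart W D E ->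
  flat_chart W (fun p => D p *m A) (fun y => E (y *m A^T)).
Proof.
move=> AA fc; have bc := fc_chart fc; have AA' := mulmx1C AA.
have AT : A^T *m (A^T)^T = 1%:M by rewrite trmxK.
have HA y : H y -> H (y *m A^T) by rewrite /closed_unit_ball /= sqnorm_orth.
split.
- split.
  + exact: bc_open bc.
  + move=> p Wp; apply: (@continuous_comp _ _ _ D (fun y : 'rV[R]_n => y *m A)); first exact: bc_cont bc p Wp.
    apply: rV_cont => k; apply: (@Ck_on_cont R n 0 setT) => //.
    apply: (@Ck_on_eq R n 0 setT (fun x => \sum_l A l k * x 0 l)) => [|x _|]; first exact: openT.
      by rewrite mulmx_coord.
    apply: Ck_on_sum => [|l _]; first exact: openT.
    by apply: Ck_on_scale; [exact: openT|apply: Ck_on_coord; exact: openT].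
  + by move=> p Wp; rewrite /closed_unit_ball /= sqnorm_orth //; exact: bc_ball bc p Wp.
  + by move=> p Wp; rewrite -mulmxA AA mulmx1 (bc_K bc Wp).
  + move=> p N Wp nN; have nI := bc_inv bc Wp nN.
    have nIb : \forall y \near (D p *m A) *m A^T, H y -> [/\ N (E y), W (E y) & D (E y) = y].
      by rewrite -mulmxA AA mulmx1.
    have := @near_orth R n (D p *m A) A^T (fun y => H y -> [/\ N (E y), W (E y) & D (E y) = y]) AT nIb.
    apply: nearS => y h Hy; have [h1 h2 h3] := h (HA y Hy).
    by split=> //; rewrite h3 -mulmxA AA' mulmx1.
- by move=> p Wp; rewrite sqnorm_orth // (fc_norm fc Wp).
- move=> i; have [sD jD] := fc_flat fc i.
  have hA : rel_open (chart_img i W) by apply: chart_img_open; [exact: hm|exact: bc_open bc].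
  split=> [k|x Ax]; first exact: (smooth_on_mulmx (f := pull_map D i) A sD k).
  have -> : jacobian_mx (pull_map (fun p => D p *m A) i) x = jacobian_mx (pull_map D i) x *m A.
    apply/matrixP => a k; rewrite [LHS]mxE.
    have sm := smooth_on_mulmx (f := pull_map D i) A sD k.
    pose p : {x | chart_img i W x} := exist _ x Ax.
    rewrite -[LHS](ev_sder_mk hA a sm p).
    have -> : mk_sfun sm = \sum_l mk_sfun (@smooth_on_cst R n (chart_img i W) (A l k)) * mk_sfun (sD l).
      by apply: sfun_ext => q; rewrite ev_sum ev_mk mulmx_coord; apply: eq_bigr => l _; rewrite evM !ev_mk.
    rewrite (der_sum (sder_derivations hA)) ev_sum [RHS]mxE; apply: eq_bigr => l _.
    rewrite (der_mul (sder_derivations hA)) evD !evM !ev_sder_mk !ev_mk [in RHS]mxE.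
    have -> : pd a (cst (A l k)) x = 0 by have := congr1 (ev p) (der_cst hA a (A l k)); rewrite ev_sder_mk ev0.
    by rewrite mul0r add0r mulrC.
  by rewrite trmx_mul mulmxA -[_ *m A *m A^T]mulmxA AA mulmx1; exact: jD.
- move=> i k; have sE : inv_smooth i W D E by case: fc.
  apply: (@smooth_on_comp _ _ _ _ (D @` (W `&` chart_dom i)) (fun y => chart i (E y) 0 k) (fun y => y *m A^T)) => //.
    by move=> _ [p [Wp dp] <-]; exists p => //; rewrite -mulmxA AA mulmx1.
  by apply: (smooth_on_mulmx (f := id)) => l; exact: smooth_on_coord.
Qed.

Lemma flat_in_sub (i : chart_idx g) W W' D : open W' -> W' `<=` W -> open W -> flat_in i W D -> flat_in i W' D.
Proof.
move=> oW' sub oW [sD jD]; have si : chart_img i W' `<=` chart_img i W.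
  by move=> _ [p [dp /sub Wp] <-]; exists p.
by split=> [k|x /si]; [exact: smooth_on_sub si (sD k)|exact: jD].
Qed.

(** [two_flat] yields an orthogonal matrix of functions with vanishing derivatives; it is constant
    near [p], and its value there is the rotation. *)
Lemma flat_chart_overlap W1 D1 E1 W2 D2 E2 p : flat_chart W1 D1 E1 -> flat_chart W2 D2 E2 -> W1 p -> W2 p ->
  exists2 A : 'M[R]_n, A *m A^T = 1%:M & \forall q \near p, D2 q = D1 q *m A.
Proof.
move=> fc1 fc2 W1p W2p; have [i di] := chart_cover hm p.
have oW1 := bc_open (fc_chart fc1); have oW2 := bc_open (fc_chart fc2).
pose W := W1 `&` W2; have oW : open W by exact: openI.
have fl1 : flat_in i W1 D1 by case: fc1.
have fl2 : flat_in i W2 D2 by case: fc2.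
have [|s1 j1] := flat_in_sub oW _ oW1 fl1; first by move=> ? [].
have [|s2 j2] := flat_in_sub oW _ oW2 fl2; first by move=> ? [].
pose A := chart_img i W; have hA : rel_open A by exact: chart_img_open.
have cA : chart_metric_on A (flat_metric v i).
  exact: chart_metric_on_sub (@chart_img_cod i W) (flat_metric_on ob i).
pose f1 k : sfun A := mk_sfun (s1 k); pose f2 k : sfun A := mk_sfun (s2 k).
have evJ D' (s' : forall k, smooth_on A (fun x => pull_map D' i x 0 k)) q :
    map_mx (ev q) (s_jacobian hA (fun k => mk_sfun (s' k))) = jacobian_mx (pull_map D' i) (sval q).
  by apply/matrixP => a k; rewrite [LHS]mxE [X in ev q X]mxE ev_sder_mk [RHS]mxE.
have J1 : s_jacobian hA f1 *m (s_jacobian hA f1)^T = s_metric cA.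
  apply: ev_mx_inj => q; rewrite map_mxM -matrix.map_trmx evJ ev_metric; exact: j1 (svalP q).
have J2 : s_jacobian hA f2 *m (s_jacobian hA f2)^T = s_metric cA.
  apply: ev_mx_inj => q; rewrite map_mxM -matrix.map_trmx evJ ev_metric; exact: j2 (svalP q).
have inW (q : {x | A x}) : exists2 p', W p' & chart_inv i (sval q) = p'.
  by have [p' [dp' Wp'] eq] := svalP q; exists p' => //; rewrite -eq; exact: chartK.
have ee : \sum_k f1 k * f1 k = \sum_k f2 k * f2 k.
  apply: sfun_ext => q; rewrite !ev_sum; have [p' [W1p' W2p'] eq] := inW q.
  transitivity (sq_radius p').
    rewrite -(fc_norm fc1 W1p'); apply: eq_bigr => k _.
    by rewrite evM ev_mk /pull_map eq expr2.
  rewrite -(fc_norm fc2 W2p'); apply: eq_bigr => k _.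
  by rewrite evM ev_mk /pull_map eq expr2.
have [Q [QQ dQ fQ]] := two_flat J1 J2 ee.
have Ax0 : A (chart i p) by exists p.
pose P (q : 'I_n * 'I_n) (rr : R) := forall y, half_space y -> oball (chart i p) rr y ->
  A y /\ ext (sfun_val (Q q.1 q.2)) y = ext (sfun_val (Q q.1 q.2)) (chart i p).
have [||r r0 hr] := @common_radius R _ P.
- by move=> q rr rr' le h y hy yr; apply: h => //; exact: oball_sub yr.
- move=> q; apply: (sfun_local_const (hA := hA)) => // a.
  by have := congr1 (fun Z : 'M[sfun A]_n => Z q.1 q.2) (dQ a); rewrite mxE [X in _ = X]mxE.
pose q0 : {x | A x} := exist _ (chart i p) Ax0.
exists (map_mx (ev q0) Q).
  by rewrite matrix.map_trmx -map_mxM QQ map_mx1.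
have [e0 e00 he0] := rel_open_ball hA Ax0.
have m0 : 0 < Num.min r e0 by rewrite lt_min r0.
have nr := @chart_near _ _ _ _ hm i p (fun y => half_space y /\ oball (chart i p) (Num.min r e0) y) _ di m0
  (fun y cy h => conj (cod_half hm cy) h).
apply: nearS nr => q [dq [hq hq2]].
have hq1 : oball (chart i p) r (chart i q) by apply: oball_sub hq2; rewrite ge_min lexx.
have Aq : A (chart i q) by apply: he0 => //; apply: (oball_sub _ hq2); rewrite ge_min lexx orbT.
pose q' : {x | A x} := exist _ (chart i q) Aq.
have eQ : map_mx (ev q') Q = map_mx (ev q0) Q.
  apply/matrixP => a b; rewrite [LHS]mxE [RHS]mxE -!ext_sval.
  by have [_ ->] := hr (a, b) (chart i q) hq hq1.
have := congr1 (map_mx (ev q')) fQ; rewrite map_mxM eQ.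
have ef D' (s' : forall k, smooth_on A (fun x => pull_map D' i x 0 k)) : map_mx (ev q') (\row_k mk_sfun (s' k)) = D' q.
  by apply/rowP => k; rewrite [LHS]mxE [X in ev _ X]mxE ev_mk /pull_map /= (chartK hm dq).
by rewrite !ef.
Qed.

Lemma flat_development : exists (z : M -> 'rV[R]_n) Psi,
  [/\ forall p, H (z p), forall p, Psi (z p) = p, forall y, H y -> z (Psi y) = y &
    forall p, exists W D E, [/\ flat_chart W D E, W p, \forall q \near p, z q = D q &
      \forall y \near z p, H y -> Psi y = E y]].
Proof.
have [p0 vp0] := ob_top ob.
apply: (@developing R n M flat_chart _ flat_chart_exists flat_chart_rot flat_chart_overlap p0).
- by move=> W D E [].
- by move=> W D E fc Wp; exact: flat_chart_origin vp0 fc Wp.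
- exact: mfd_hausdorff hm.
- exact: ob_compact ob.
- exact: ob_connected ob.
Qed.

End FlatCharts.

(** * The isometry with the hemisphere *)

Section SmoothLocal.
Variables (R : realType) (n : nat).
Implicit Types (A S : set 'rV[R]_n) (f : 'rV[R]_n -> R).

Lemma smooth_on_local A f : (forall x, A x -> exists2 r : R, 0 < r & exists2 h, smooth_on (A `&` oball x r) h &
  forall y, A y -> oball x r y -> h y = f y) -> smooth_on A f.
Proof.
move=> loc x Ax; have [r r0 [h sh hf]] := loc x Ax.
have [U [F [oU Ux cF eF]]] := sh x (conj Ax (oball_center x r0)).
exists (U `&` oball x r), F; split.
- by apply: openI => //; exact: oball_open.
- by split=> //; exact: oball_center.
- by move=> k; apply: Ck_on_sub (cF k) => y [].
- by move=> y Ay [Uy yr]; rewrite eF // hf.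
Qed.

Lemma smooth_on_near A (f : 'rV[R]_n -> 'rV[R]_n) x (rho : R) : (forall k, smooth_on A (fun y => f y 0 k)) -> A x -> 0 < rho ->
  exists2 e : R, 0 < e & forall y, A y -> oball x e y -> oball (f x) rho (f y).
Proof.
move=> sf Ax rho0; have [r [F [r0 cF eF]]] := common_ext sf Ax.
have Ux := oball_center x r0.
have nF : \forall y \near x, forall k, `|F k x - F k y| < rho.
  apply: near_forall => k; have c : {for x, continuous (F k)} by exact: (Cinf_cont (cF k)).
  by move/cvgr_dist_lt: c; exact.
have [e /= e0 he] := (nbhs_ballP _ _).1 nF.
exists (Num.min r e); first by rewrite lt_min r0.
move=> y Ay yr; have yr1 : oball x r y by apply: oball_sub yr; rewrite ge_min lexx.
have yr2 : oball x e y by apply: oball_sub yr; rewrite ge_min lexx orbT.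
have hy : ball x e y by rewrite -ball_normE /= distrC.
have := he y hy => /= h.
rewrite /oball /=; apply: norm_lt_coord => // k; rewrite !mxE -!eF // distrC; exact: h.
Qed.

Lemma smooth_on_sqrt A f : (forall x, A x -> 0 < f x) -> smooth_on A f -> smooth_on A (fun x => Num.sqrt (f x)).
Proof.
move=> fp sf x Ax; have [U [F [oU Ux cF eF]]] := sf x Ax.
have oV : open (U `&` F @^-1` [set t | 0 < t]).
  exact: (cont_open oU (Cinf_cont cF) (@open_gt _ 0)).
exists (U `&` F @^-1` [set t | 0 < t]), (fun y => Num.sqrt (F y)); split=> //.
- by split=> //=; rewrite eF //; exact: fp.
- move=> k; apply: (@Ck_on_root R n k _ F) => //.
  + move=> y [Uy _]; apply: (@continuous_comp _ _ _ F (@Num.sqrt R)); first exact: (Cinf_cont cF).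
    exact: sqrt_continuous.
  + move=> y [_ /= Fy]; rewrite sqrtr_eq0 -ltNge; split=> //.
    by rewrite -expr2 sqr_sqrtr // ltW.
  + by apply: Ck_on_sub (cF k) => y [].
- by move=> y Ay [Uy _]; rewrite eF.
Qed.

Lemma smooth_on_sqnorm A (f : 'rV[R]_n -> 'rV[R]_n) : (forall k, smooth_on A (fun y => f y 0 k)) ->
  smooth_on A (fun y => sqnorm (f y)).
Proof.
by move=> sf; apply: smooth_on_sum => k _; apply: smooth_on_eq (smooth_on_mul (sf k) (sf k)) => y _; rewrite expr2.
Qed.

End SmoothLocal.

(** * The hemisphere in its charts *)

Section DeSitterModel.
Variables (R : realType) (n : nat).
Implicit Types (d : dS R n) (j : option ('I_n * bool)) (x y : 'rV[R]_n).
Local Notation H := (@closed_unit_ball R n).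

Lemma dS_ball d : sqnorm (dS_val d) <= 1.
Proof. by have := svalP d; rewrite inE. Qed.

Lemma dS_val_to x : H x -> dS_val (to_dS x) = x.
Proof. by move=> Hx; rewrite /dS_val /to_dS /insubd insubT // inE. Qed.

Lemma to_dS_val d : to_dS (dS_val d) = d.
Proof. by rewrite /to_dS /dS_val; exact: valKd. Qed.

Lemma dS_potential_ge0 d : 0 <= dS_potential d.
Proof. exact: sqrtr_ge0. Qed.

Lemma dS_potential_sq d : dS_potential d ^+ 2 = 1 - sqnorm (dS_val d).
Proof. by rewrite sqr_sqrtr // subr_ge0 dS_ball. Qed.

Lemma dS_val_cont : continuous (@dS_val R n).
Proof. exact: initial_continuous. Qed.

Lemma dS_potential_cont : continuous (@dS_potential R n).
Proof.
move=> d; apply: (@continuous_comp _ _ _ (fun d => 1 - sqnorm (dS_val d)) (@Num.sqrt R)); last exact: sqrt_continuous.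
apply: (@continuous_comp _ _ _ (@dS_val R n) (fun x => 1 - sqnorm x)); first exact: dS_val_cont.
by apply: continuousB; [exact: cst_continuous|exact: sqnorm_cont].
Qed.

(* [chart_coord u j x t] are the coordinates of the point [(x, t)] of the sphere in the chart [j],
   where [u] is the translation in the chart [None] (1 for points, 0 for vectors); [extra_coord] is
   the coordinate dropped by the chart. *)
Definition chart_coord (T : zmodType) (u : T) j (x : 'I_n -> T) (t : T) (b : 'I_n) : T :=
  match j with
  | None => x b + u
  | Some (a, _) => if b == ord_zero a then t else x (tperm (ord_zero a) a b)
  end.

Definition extra_coord (T : Type) j (x : 'I_n -> T) (t : T) : T :=
  match j with None => t | Some (a, _) => x a end.

Lemma dS_chartE j d b : dS_chart j d 0 b = chart_coord 1 j (dS_val d 0) (dS_potential d) b.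
Proof. by case: j => [[a s]|] /=; rewrite !mxE. Qed.

(** A chart permutes the n + 1 coordinates (x, t) and drops one of them; adding the dropped one
    restores the full sum. *)
Lemma sum_chart_coord (T : Type) (V : zmodType) (f : T -> V) (a : 'I_n) (x : 'I_n -> T) (t : T) :
  \sum_b f (if b == ord_zero a then t else x (tperm (ord_zero a) a b)) + f (x a) = \sum_k f (x k) + f t.
Proof.
rewrite [in RHS](reindex_inj (@perm_inj _ (tperm (ord_zero a) a))) /=.
rewrite (bigD1 (ord_zero a)) //= ?eqxx [in RHS](bigD1 (ord_zero a)) //= tpermL.
rewrite (eq_bigr (fun b => f (x (tperm (ord_zero a) a b)))) => [|b /negbTE -> //].
move: (\sum_(b < n | _) _) => S.
by rewrite addrAC [f t + f (x a)]addrC -addrA [f t + S]addrC addrA.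
Qed.

Lemma sum_coord2 j (x x' : 'I_n -> R) (t t' : R) :
  \sum_b chart_coord 0 j x t b * chart_coord 0 j x' t' b + extra_coord j x t * extra_coord j x' t' =
  \sum_k x k * x' k + t * t'.
Proof.
case: j => [[a s]|] /=; last by congr (_ + _); apply: eq_bigr => b _; rewrite !addr0.
rewrite -(sum_chart_coord (fun p : R * R => p.1 * p.2) a (fun k => (x k, x' k)) (t, t')).
by congr (_ + _); apply: eq_bigr => b _; case: (b == ord_zero a).
Qed.

(** [w] holds the derivatives of the dropped coordinate [e]. Differentiating |Y|^2 + e^2 = 1 gives w
    = - K Y^T / e, and then [w *m w^T] is the second term of the graph metric. *)
Lemma graph_gram (Y : 'rV[R]_n) (K G : 'M[R]_n) (w : 'cV[R]_n) (e : R) : sqnorm Y + e ^+ 2 = 1 ->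
  K *m Y^T + e *: w = 0 -> K *m K^T + w *m w^T = G -> e != 0 -> K *m graph_metric Y *m K^T = G.
Proof.
move=> hY hK <- e0; have hs : 1 - sqnorm Y = e ^+ 2 by rewrite -hY addrAC subrr add0r.
have KY : K *m Y^T = - e *: w by rewrite scaleNr; apply/eqP; rewrite -addr_eq0 hK.
rewrite /graph_metric hs mulmxDr mulmx1 mulmxDl; congr (_ + _).
rewrite -scalemxAr -scalemxAl mulmxA KY -[_ *m Y *m _]mulmxA.
have -> : Y *m K^T = - e *: w^T by rewrite -[LHS]trmxK trmx_mul trmxK KY linearZ.
rewrite -scalemxAl -scalemxAr !scalerA.
have -> : (e ^+ 2)^-1 * - e * - e = 1 by field.
by rewrite scale1r.
Qed.

Definition inv_val j y : 'rV[R]_n :=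
  match j with
  | None => y - const_mx 1
  | Some (a, s) => \row_b if b == a then (-1) ^+ s * Num.sqrt (1 - sqnorm y)
                          else y 0 (tperm (ord_zero a) a b)
  end.

Definition inv_pot j y : R :=
  match j with
  | None => Num.sqrt (1 - sqnorm (y - const_mx 1))
  | Some (a, _) => y 0 (ord_zero a)
  end.

Lemma sqnorm_chart (a : 'I_n) (s : bool) d : 1 - sqnorm (dS_chart (Some (a, s)) d) = dS_val d 0 a ^+ 2.
Proof.
have h := sum_coord2 (Some (a, s)) (dS_val d 0) (dS_val d 0) (dS_potential d) (dS_potential d).
have e1 : sqnorm (dS_chart (Some (a, s)) d) =
    \sum_b chart_coord 0 (Some (a, s)) (dS_val d 0) (dS_potential d) b * chart_coord 0 (Some (a, s)) (dS_val d 0) (dS_potential d) b.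
  by apply: eq_bigr => b _; rewrite dS_chartE expr2.
have e2 : \sum_k dS_val d 0 k * dS_val d 0 k = sqnorm (dS_val d) by apply: eq_bigr => k _; rewrite expr2.
move: h; rewrite -e1 e2 -expr2 -expr2 dS_potential_sq addrCA subrr addr0 => h.
by rewrite -h addrAC subrr add0r.
Qed.

Lemma inv_val_chart j d : dS_dom j d -> inv_val j (dS_chart j d) = dS_val d.
Proof.
case: j => [[a s]|] /= dj; last by rewrite addrK.
apply/rowP => b; rewrite mxE; have [->|ba] := eqVneq b a.
  have q : Num.sqrt (1 - sqnorm (dS_chart (Some (a, s)) d)) = `|dS_val d 0 a|.
    by rewrite sqnorm_chart; exact: sqrtr_sqr.
  rewrite [Num.sqrt _]q; case: s dj {q} => /=; rewrite ?expr0 ?expr1 ?mul1r ?mulN1r => dj.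
    by rewrite ltr0_norm ?opprK // -oppr_gt0.
  by rewrite gtr0_norm.
rewrite mxE tpermK; case: ifP => // /eqP e.
by have := tpermK (ord_zero a) a b; rewrite e tpermL => e'; rewrite e' eqxx in ba.
Qed.

Lemma inv_pot_chart j d : dS_dom j d -> inv_pot j (dS_chart j d) = dS_potential d.
Proof. by case: j => [[a s]|] /= dj; [rewrite mxE eqxx|rewrite addrK]. Qed.

Lemma dS_chartK j d : dS_dom j d -> dS_chart_inv j (dS_chart j d) = d.
Proof.
move=> dj; rewrite -[RHS]to_dS_val -(inv_val_chart dj).
by case: j dj => [[a s]|].
Qed.

Lemma extra_coord_neq0 j d : dS_dom j d -> extra_coord j (dS_val d 0) (dS_potential d) != 0.
Proof.
case: j => [[a s]|] /= dj; last by rewrite sqrtr_eq0 -ltNge subr_gt0.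
by apply: contraTneq dj => ->; rewrite mulr0 ltxx.
Qed.

Definition dS_img j : set 'rV[R]_n := dS_chart j @` dS_dom j.

Lemma inv_val_smooth j k : smooth_on (dS_img j) (fun y => inv_val j y 0 k).
Proof.
case: j => [[a s]|] /=; last first.
  apply: (@smooth_on_eq _ _ _ (fun y => y 0 k + cst (-1) y)); first by move=> y _; rewrite !mxE.
  exact: smooth_on_add (smooth_on_coord k) (smooth_on_cst _).
have [->|ka] := eqVneq k a; last first.
  apply: (@smooth_on_eq _ _ _ (fun y => y 0 (tperm (ord_zero a) a k))); last exact: smooth_on_coord.
  by move=> y _; rewrite mxE (negbTE ka).
apply: (@smooth_on_eq _ _ _ (fun y => cst ((-1) ^+ s) y * Num.sqrt (1 - sqnorm y))).
  by move=> y _; rewrite mxE eqxx.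
apply: smooth_on_mul; first exact: smooth_on_cst.
apply: smooth_on_sqrt => [_ [d dj <-]|].
  rewrite sqnorm_chart lt_neqAle sqr_ge0 andbT eq_sym sqrf_eq0.
  exact: (extra_coord_neq0 (j := Some (a, s)) dj).
apply: smooth_on_add; first exact: (@smooth_on_cst R n _ 1).
by apply: smooth_on_opp; apply: (smooth_on_sqnorm (f := id)) => k'; exact: smooth_on_coord.
Qed.

Lemma inv_pot_smooth j : smooth_on (dS_img j) (inv_pot j).
Proof.
case: j => [[a s]|] /=; first exact: smooth_on_coord.
apply: smooth_on_sqrt => [_ [d /= dj <-]|]; first by rewrite addrK subr_gt0.
apply: smooth_on_add; first exact: (@smooth_on_cst R n _ 1).
by apply: smooth_on_opp; apply: smooth_on_sqnorm => k; exact: (inv_val_smooth (j := None)).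
Qed.

End DeSitterModel.

Lemma gram_expand (R : realType) n (x x' c : R) (z z1 z2 : 'I_n -> R) :
  \sum_k (x * z k + c * z1 k) * (x' * z k + c * z2 k) =
  x * x' * (\sum_k z k * z k) + c * x' * (\sum_k z1 k * z k) + c * x * (\sum_k z2 k * z k)
  + c ^+ 2 * (\sum_k z1 k * z2 k).
Proof. by rewrite !mulr_sumr -!big_split; apply: eq_bigr => k _ /=; ring. Qed.

(** * Inverse stereographic projection of the flat coordinates *)

Section FinalIsometry.
Variables (R : realType) (n : nat) (M : topologicalType) (g : riemannian_data R n M) (v : M -> R).
Hypothesis ob : obata g v.
Let hm := ob_mfd ob.
Let hv := ob_smooth ob.
Local Notation H := (@closed_unit_ball R n).
Variables (z : M -> 'rV[R]_n) (Psi : 'rV[R]_n -> M).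
Hypotheses (zK : forall p, Psi (z p) = p) (PsiK : forall y, H y -> z (Psi y) = y).
Hypothesis zloc : forall p, exists W D E, [/\ flat_chart g v W D E, W p, \forall q \near p, z q = D q &
      \forall y \near z p, H y -> Psi y = E y].

Lemma z_norm p : sqnorm (z p) = sq_radius v p.
Proof.
have [W [D [E [fc Wp nz _]]]] := zloc p.
by rewrite (nbhs_singleton nz) (fc_norm fc Wp).
Qed.

Lemma z_cont : continuous z.
Proof.
move=> p N nN; have [W [D [E [fc Wp nz _]]]] := zloc p.
have nN' : nbhs (D p) N by rewrite -(nbhs_singleton nz).
by apply: nearS (nearI nz (bc_cont (fc_chart fc) Wp nN')) => q [e h] /=; rewrite e.
Qed.

Lemma z_chart (i : chart_idx g) x : chart_cod i x -> exists2 e : R, 0 < e &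
  exists W D E, [/\ flat_chart g v W D E, chart_img i W x &
   forall y, chart_cod i y -> oball x e y -> chart_img i W y /\ z (chart_inv i y) = pull_map D i y].
Proof.
move=> cx; have [W [D [E [fc Wp nz _]]]] := zloc (chart_inv i x).
have nW := bc_near (Fl := flat_chart g v) (fun _ _ _ h => fc_chart h) fc Wp.
have [e e0 he] := inv_near hm cx (nearI nW nz).
have img y : chart_cod i y -> W (chart_inv i y) -> chart_img i W y.
  by move=> cy Wy; exists (chart_inv i y); [split=> //; exact: (inv_dom hm)|exact: (chart_invK hm)].
exists e => //; exists W, D, E; split=> //; first exact: img.
move=> y cy yr; have [_ [Wy zy]] := he y (cod_half hm cy) yr.
by split; [exact: img|exact: zy].
Qed.

Lemma z_smooth (i : chart_idx g) k : smooth_on (chart_cod i) (fun x => z (chart_inv i x) 0 k).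
Proof.
apply: smooth_on_local => x cx; have [e e0 [W [D [E [fc _ he]]]]] := z_chart cx.
have [sD _] : flat_in v i W D by case: fc.
exists e => //; exists (fun x => pull_map D i x 0 k).
  by apply: smooth_on_sub (sD k) => y [cy yr]; have [] := he y cy yr.
by move=> y cy yr; have [_ ->] := he y cy yr.
Qed.

Section Chart.
Variable i : chart_idx g.
Local Notation hA := (cod_open hm i).
Local Notation S := (sfun (chart_cod i)).
Local Notation V := (chart_fun hv i).

Definition sZ k : S := mk_sfun (@z_smooth i k).
(** Since |z|^2 = (1 - v) / (1 + v), inverse stereographic projection 2 z / (1 + |z|^2) becomes (1 +
    v) z, with last coordinate (1 - |z|^2) / (1 + |z|^2) = v. *)
Definition sX k : S := (1 + V) * sZ k.

Lemma sZ_gram q a b : \sum_k ev q (sder hA a (sZ k)) * ev q (sder hA b (sZ k)) = flat_metric v i (sval q) a b.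
Proof.
have cx := svalP q; have [e e0 [W [D [E [fc Wx he]]]]] := z_chart cx.
have [_ jD] : flat_in v i W D by case: fc.
have hA' : rel_open (chart_cod i `&` oball (sval q) e) by apply: rel_openI hA _; exact: oball_open.
have dE c k : ev q (sder hA c (sZ k)) = jacobian_mx (pull_map D i) (sval q) c k.
  rewrite ev_sder_mk mxE; apply: (pd_congr c hA'); first by split=> //; exact: oball_center.
  by move=> y [cy yr]; have [_ ->] := he y cy yr.
by rewrite -(jD _ Wx) [RHS]mxE; apply: eq_bigr => k _; rewrite !dE [X in _ = _ * X]mxE.
Qed.

Lemma sZ_norm : (1 + V) * \sum_k sZ k * sZ k = 1 - V.
Proof.
apply: sfun_ext => q; rewrite evM !evD evN ev1 ev_sum ev_mk.
have -> : \sum_k ev q (sZ k * sZ k) = sq_radius v (chart_inv i (sval q)).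
  by rewrite -z_norm; apply: eq_bigr => k _; rewrite evM ev_mk expr2.
by rewrite /sq_radius mulrC divfK // gt_eqF // (v1_gt0 ob).
Qed.

Lemma sX_norm : \sum_k sX k * sX k + V * V = 1.
Proof.
have -> : \sum_k sX k * sX k = (1 + V) * ((1 + V) * \sum_k sZ k * sZ k).
  by rewrite !mulr_sumr; apply: eq_bigr => k _; rewrite /sX; ring.
by rewrite sZ_norm; ring.
Qed.

Let hd := sder_derivations hA.

Let double_inj (x y : S) : x *+ 2 = y *+ 2 -> x = y.
Proof.
have [h hh] := ex_half (chart_cod i) => xy.
by rewrite -[x]mul1r -[y]mul1r -hh !mulrDl -!mulrDr -!mulr2n xy.
Qed.

Let der_sq (f : 'I_n -> S) a : sder hA a (\sum_k f k * f k) = (\sum_k sder hA a (f k) * f k) *+ 2.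
Proof.
rewrite (der_sum hd) -sumrMnl; apply: eq_bigr => k _.
by rewrite (der_mul hd) mulr2n [f k * _]mulrC.
Qed.

Lemma sX_ortho a : \sum_k sder hA a (sX k) * sX k + sder hA a V * V = 0.
Proof.
apply: double_inj; rewrite mul0rn mulrnDl -der_sq.
have -> : (sder hA a V * V) *+ 2 = sder hA a (V * V) by rewrite (der_mul hd) mulr2n [V * _]mulrC.
by rewrite -(der_add hd) sX_norm (der1 hd).
Qed.

(** Expanding the derivatives of (1 + v) z, the term in dz dz is (1 + v)^2 times the flat metric,
    that is [g]; the terms in dv dv, including those from the cross products, cancel against the
    last coordinate. *)
Lemma sX_gram q a b : \sum_k ev q (sder hA a (sX k)) * ev q (sder hA b (sX k)) +
  ev q (sder hA a V) * ev q (sder hA b V) = chart_metric i (sval q) a b.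
Proof.
have vp := v1_gt0 ob (chart_inv i (sval q)); set t := v (chart_inv i (sval q)) in vp.
have t1 : 1 + t != 0 by rewrite gt_eqF.
have dX c k : ev q (sder hA c (sX k)) = ev q (sder hA c V) * ev q (sZ k) + (1 + t) * ev q (sder hA c (sZ k)).
  by rewrite (der_mul hd) evD !evM (der_add hd) (der1 hd) add0r evD ev1.
have nz : \sum_k ev q (sZ k) * ev q (sZ k) = (1 - t) / (1 + t).
  by rewrite -[RHS]/(sq_radius v _) -z_norm; apply: eq_bigr => k _; rewrite ev_mk expr2.
(* The cross products follow by differentiating the norm identity [sZ_norm]. *)
have dz c : \sum_k ev q (sder hA c (sZ k)) * ev q (sZ k) = - ev q (sder hA c V) / (1 + t) ^+ 2.
  have := congr1 (fun f => ev q (sder hA c f)) sZ_norm.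
  rewrite (der_mul hd) der_sq (der_add hd) (derB hd) (der1 hd) add0r sub0r evD !evM evN mulr2n !evD ev1 !ev_sum.
  under [\sum_k ev q (sZ k * sZ k)]eq_bigr do rewrite evM.
  under [\sum_k ev q (sder hA c (sZ k) * sZ k)]eq_bigr do rewrite evM.
  rewrite nz -/t; move: (\sum_k _) (ev q (sder hA c V)) => s nu e.
  apply: (mulfI (_ : 2 * (1 + t) != 0)); first by rewrite mulf_neq0 // pnatr_eq0.
  have -> : 2 * (1 + t) * s = - nu - nu * ((1 - t) / (1 + t)) by rewrite -e -[ev q V]/t; ring.
  by field.
transitivity (\sum_k (ev q (sder hA a V) * ev q (sZ k) + (1 + t) * ev q (sder hA a (sZ k))) *
    (ev q (sder hA b V) * ev q (sZ k) + (1 + t) * ev q (sder hA b (sZ k))) + ev q (sder hA a V) * ev q (sder hA b V)).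
  by congr (_ + _); apply: eq_bigr => k _; rewrite dX dX.
rewrite (@gram_expand _ _ (ev q (sder hA a V)) (ev q (sder hA b V)) (1 + t) (fun k => ev q (sZ k))
  (fun k => ev q (sder hA a (sZ k))) (fun k => ev q (sder hA b (sZ k)))).
rewrite nz !dz sZ_gram /flat_metric mxE -/(local_fun v i (sval q)) -[local_fun v i (sval q)]/t.
move: (ev q (sder hA a V)) (ev q (sder hA b V)) (chart_metric _ _ _ _) => x y w.
by field.
Qed.

End Chart.

(* In the flat coordinates [z] the point of the sphere is obtained by inverse stereographic
   projection. *)
Definition Phi p : dS R n := to_dS ((1 + v p) *: z p).

Definition Phi_inv (d : dS R n) : M := Psi ((1 + dS_potential d)^-1 *: dS_val d).

Lemma Phi_ball p : sqnorm ((1 + v p) *: z p) = 1 - v p ^+ 2.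
Proof.
rewrite sqnorm_scale z_norm /sq_radius; have := v1_gt0 ob p; move: (v p) => t t0.
by field; rewrite gt_eqF.
Qed.

Lemma Phi_val p : dS_val (Phi p) = (1 + v p) *: z p.
Proof. by apply: dS_val_to; rewrite /closed_unit_ball /= Phi_ball gerBl sqr_ge0. Qed.

Lemma Phi_potential p : dS_potential (Phi p) = v p.
Proof.
rewrite /dS_potential Phi_val Phi_ball opprB addrCA subrr addr0 sqrtr_sqr ger0_norm //.
exact: (v_ge0 ob).
Qed.

Lemma PhiK : cancel Phi Phi_inv.
Proof.
move=> p; rewrite /Phi_inv Phi_potential Phi_val scalerA mulVf ?scale1r ?zK //.
by rewrite gt_eqF // (v1_gt0 ob).
Qed.

Lemma pot1_gt0 (d : dS R n) : 0 < 1 + dS_potential d.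
Proof. by rewrite ltr_wpDr // dS_potential_ge0. Qed.

Lemma Phi_inv_norm (d : dS R n) : sqnorm ((1 + dS_potential d)^-1 *: dS_val d) = (1 - dS_potential d) / (1 + dS_potential d).
Proof.
have e : sqnorm (dS_val d) = 1 - dS_potential d ^+ 2 by rewrite dS_potential_sq opprB addrCA subrr addr0.
rewrite sqnorm_scale e; have := pot1_gt0 d; move: (dS_potential d) => t t0.
by field; rewrite gt_eqF.
Qed.

Lemma Phi_inv_ball (d : dS R n) : H ((1 + dS_potential d)^-1 *: dS_val d).
Proof.
rewrite /closed_unit_ball /= Phi_inv_norm ler_pdivrMr ?pot1_gt0 // mul1r.
by have := dS_potential_ge0 d; lra.
Qed.

Lemma z_Phi_inv (d : dS R n) : z (Phi_inv d) = (1 + dS_potential d)^-1 *: dS_val d.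
Proof. by rewrite PsiK //; exact: Phi_inv_ball. Qed.

(** Both values have the same image under t -> (1 - t) / (1 + t), which is injective for t > -1. *)
Lemma v_Phi_inv (d : dS R n) : v (Phi_inv d) = dS_potential d.
Proof.
have := z_norm (Phi_inv d); rewrite z_Phi_inv Phi_inv_norm /sq_radius.
have := v1_gt0 ob (Phi_inv d); have := pot1_gt0 d.
move: (dS_potential d) (v _) => t s t0 s0 /eqP; rewrite eqr_div; [move=> /eqP e|by rewrite gt_eqF..].
have : 2 * (s - t) = (1 - t) * (1 + s) - (1 - s) * (1 + t) by ring.
by rewrite e subrr; lra.
Qed.

Lemma Phi_invK : cancel Phi_inv Phi.
Proof.
move=> d; rewrite /Phi v_Phi_inv z_Phi_inv scalerA mulfV ?scale1r ?to_dS_val //.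
by rewrite gt_eqF // pot1_gt0.
Qed.

Lemma Phi_cont : continuous Phi.
Proof.
apply: (@continuous_comp_initial _ _ _ (@set_val _ H)).
have -> : (@set_val _ H) \o Phi = fun p => (1 + v p) *: z p.
  by apply/funext => p; exact: Phi_val.
move=> p; apply: cvgZ; last exact: z_cont.
by apply: continuousD; [exact: cst_continuous|exact: (smooth_cont hm hv)].
Qed.

Lemma Phi_inv_cont : continuous Phi_inv.
Proof.
move=> d N nN; have [W [D [E [fc Wp nz nE]]]] := zloc (Phi_inv d).
have nI := bc_inv (fc_chart fc) Wp nN; rewrite -(nbhs_singleton nz) in nI.
rewrite z_Phi_inv in nE nI.
have c : {for d, continuous (fun d => (1 + dS_potential d)^-1 *: dS_val d)}.
  have c1 : {for d, continuous (fun d => 1 + dS_potential d)}.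
    by apply: continuousD; [exact: cst_continuous|exact: dS_potential_cont].
  have nz1 : 1 + dS_potential d != 0 by rewrite gt_eqF // pot1_gt0.
  exact: (cvgZ (cvgV nz1 c1) (@dS_val_cont R n d)).
apply: nearS (c _ (nearI nE nI)) => d' [h1 h2].
have Hd := Phi_inv_ball d'; have [h3 _ _] := h2 Hd.
by rewrite -(h1 Hd) in h3.
Qed.

Section ChartPair.
Variables (i : chart_idx g) (j : option ('I_n * bool)).
Local Notation hA := (cod_open hm i).
Local Notation S := (sfun (chart_cod i)).
Local Notation V := (chart_fun hv i).
Let hd := sder_derivations hA.

Definition s_chart_coord b : S := chart_coord 1 j (sX i) V b.

Lemma ev_s_chart_coord q b : ev q (s_chart_coord b) = dS_chart j (Phi (chart_inv i (sval q))) 0 b.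
Proof.
rewrite dS_chartE Phi_potential Phi_val /s_chart_coord.
have eX k : ev q (sX i k) = ((1 + v (chart_inv i (sval q))) *: z (chart_inv i (sval q))) 0 k.
  by rewrite evM evD ev1 ev_mk ev_mk [RHS]mxE.
by case: j => [[a s]|] /=; [case: ifP => _; [rewrite ev_mk|exact: eX]|rewrite evD ev1 eX].
Qed.

Lemma sder_s_chart_coord a b : sder hA a (s_chart_coord b) = chart_coord 0 j (fun k => sder hA a (sX i k)) (sder hA a V) b.
Proof.
rewrite /s_chart_coord; case: j => [[c s]|] /=; first by case: ifP.
by rewrite (der_add hd) (der1 hd).
Qed.

Lemma local_map_ev q b : local_map (h := dS_metric R n) Phi i j (sval q) 0 b = ev q (s_chart_coord b).
Proof. by rewrite ev_s_chart_coord. Qed.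

Lemma Phi_smooth b : smooth_on (chart_cod i) (fun x => local_map (h := dS_metric R n) Phi i j x 0 b).
Proof.
apply: smooth_on_eq (sfun_smooth (s_chart_coord b)) => x cx.
by rewrite (ext_ev _ cx) -local_map_ev.
Qed.

(** [J] and [w] together hold the derivatives of all n + 1 sphere coordinates, whose Gram matrix is
    [g] by [sX_gram]; [sX_ortho] is the differentiated sphere equation that [graph_gram] asks
    for. *)
Lemma Phi_metric p : overlap (h := dS_metric R n) Phi i j p ->
  let J := jacobian_mx (local_map (h := dS_metric R n) Phi i j) (chart i p) in
  chart_metric i (chart i p) = J *m dS_chart_metric j (dS_chart j (Phi p)) *m J^T.
Proof.
move=> [di dj] J; have cx : chart_cod i (chart i p) by exact: chart_in.
pose q : {x | chart_cod i x} := exist _ (chart i p) cx.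
pose xi a k := ev q (sder hA a (sX i k)); pose nu a := ev q (sder hA a V).
pose x := dS_val (Phi p) 0; pose t := dS_potential (Phi p).
have eX k : ev q (sX i k) = x k.
  by rewrite evM evD ev1 ev_mk ev_mk /x Phi_val [RHS]mxE /= /local_fun (chartK hm di).
have eV : ev q V = t by rewrite ev_mk /t Phi_potential /= /local_fun (chartK hm di).
pose Y : 'rV[R]_n := \row_b chart_coord 0 j x t b.
have JE : J = \matrix_(a, b) chart_coord 0 j (xi a) (nu a) b.
  apply/matrixP => a b; rewrite !mxE.
  rewrite -(@pd_ext_ev _ _ _ hA (s_chart_coord b) _ a q); last by move=> q'; rewrite local_map_ev.
  by rewrite sder_s_chart_coord; case: j => [[c s]|] /=; [case: ifP|rewrite !addr0].
have -> : dS_chart_metric j (dS_chart j (Phi p)) = graph_metric Y.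
  rewrite /Y; case: j dj => [[a s]|] /= dj.
    by congr graph_metric; apply/rowP => b; rewrite !mxE.
  rewrite addrK polar_metricE //; congr graph_metric; apply/rowP => b; by rewrite mxE addr0.
pose w : 'cV[R]_n := \col_a extra_coord j (xi a) (nu a).
symmetry; apply: (@graph_gram _ _ Y J _ w (extra_coord j x t)).
- have := sum_coord2 j x x t t.
  have -> : \sum_k x k * x k + t * t = 1.
    have := congr1 (ev q) (sX_norm i); rewrite evD evM ev1 ev_sum eV => <-; congr (_ + _).
    by apply: eq_bigr => k _; rewrite evM eX.
  by move=> <-; rewrite expr2; congr (_ + _); apply: eq_bigr => b _; rewrite mxE expr2.
- apply/colP => a; rewrite [LHS]mxE [X in X + _]mxE [X in _ + X]mxE [RHS]mxE.
  have := sum_coord2 j (xi a) x (nu a) t.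
  have -> : \sum_k xi a k * x k + nu a * t = 0.
    have h := congr1 (ev q) (sX_ortho i a); rewrite evD evM ev0 ev_sum eV in h; rewrite -[RHS]h.
    by apply: (congr1 (fun s => s + _)); apply: eq_bigr => k _; rewrite evM eX.
  move=> h; rewrite -[RHS]h; congr (_ + _); last by rewrite mulrC [w a 0]mxE.
  by apply: eq_bigr => b _; rewrite JE mxE [Y^T b 0]mxE [Y 0 b]mxE.
- apply/matrixP => a b; rewrite [LHS]mxE [X in X + _]mxE [X in _ + X]mxE big_ord1.
  rewrite -(sX_gram q a b) -(sum_coord2 j (xi a) (xi b) (nu a) (nu b)); congr (_ + _).
    by apply: eq_bigr => c _; rewrite JE mxE [X in _ * X]mxE mxE.
  by rewrite !mxE.
- exact: extra_coord_neq0.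
Qed.

(** Locally the inverse is [E] of a flat chart after the stereographic map [zeta]; the denominator 1
    + t is positive and the inverse flat chart is smooth up to the boundary by [inv_smooth]. *)
Lemma Phi_inv_smooth k : smooth_on (dS_chart j @` (dS_dom j `&` Phi_inv @^-1` chart_dom i))
  (fun y => chart i (Phi_inv (dS_chart_inv j y)) 0 k).
Proof.
set A := dS_chart j @` _.
pose zeta (y : 'rV[R]_n) := (1 + inv_pot j y)^-1 *: inv_val j y.
have subA : A `<=` dS_img j by move=> _ [d [dj _] <-]; exists d.
have zE (d : dS R n) : dS_dom j d -> zeta (dS_chart j d) = (1 + dS_potential d)^-1 *: dS_val d.
  by move=> dj; rewrite /zeta inv_pot_chart // inv_val_chart.
have sz b : smooth_on A (fun y => zeta y 0 b).
  apply: smooth_on_sub subA _.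
  apply: (@smooth_on_eq _ _ _ (fun y => (1 + inv_pot j y)^-1 * inv_val j y 0 b)); first by move=> y _; rewrite [RHS]mxE.
  apply: smooth_on_mul; last exact: inv_val_smooth.
  apply: smooth_on_inv => [_ [d dj <-]|]; first by rewrite inv_pot_chart // gt_eqF // pot1_gt0.
  exact: smooth_on_add (@smooth_on_cst R n _ 1) (@inv_pot_smooth R n j).
apply: smooth_on_local => _ [d [dj di] <-].
have Ay : A (dS_chart j d) by exists d.
have [W [D [E [fc Wp nz nE]]]] := zloc (Phi_inv d).
have nI := bc_inv (fc_chart fc) Wp (bc_near (Fl := flat_chart g v) (fun _ _ _ h => fc_chart h) fc Wp).
rewrite -(nbhs_singleton nz) in nI; rewrite z_Phi_inv in nE nI.
have [rho /= rho0 hrho] := (nbhs_ballP _ _).1 (nearI nE nI).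
have [e e0 he] := smooth_on_near sz Ay rho0.
have key y : A y -> oball (dS_chart j d) e y -> exists d', [/\ dS_dom j d', dS_chart j d' = y, chart_dom i (Phi_inv d'),
    W (Phi_inv d') & D (Phi_inv d') = zeta y /\ Phi_inv d' = E (zeta y)].
  move=> Ay' yr; have := he y Ay' yr; case: Ay' => d' [dj' di'] ey; rewrite -ey !zE // => hz.
  exists d'; have [|h1 h2] := hrho ((1 + dS_potential d')^-1 *: dS_val d'); first by rewrite -ball_normE /= distrC.
  have Hd := Phi_inv_ball d'; have [_ h3 h4] := h2 Hd.
  by rewrite -(h1 Hd) in h3 h4 *; split.
have sE : inv_smooth i W D E by case: fc.
exists e => //; exists (fun y => chart i (E (zeta y)) 0 k).
  apply: (@smooth_on_comp _ _ _ _ (D @` (W `&` chart_dom i)) (fun y => chart i (E y) 0 k) zeta) => //.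
    by move=> y [Ay' yr]; have [d' [_ _ di' Wd' [h _]]] := key y Ay' yr; exists (Phi_inv d').
  by move=> b; apply: smooth_on_sub (sz b) => y [].
by move=> y Ay' yr; have [d' [dj' <- _ _ [_ <-]]] := key y Ay' yr; rewrite dS_chartK.
Qed.

End ChartPair.

Lemma Phi_isometry : riemannian_isometry g (dS_metric R n) Phi.
Proof.
split.
- split; first exact: Phi_cont.
  move=> i j a; apply: smooth_on_sub (@Phi_smooth i j a) => _ [p [di _] <-]; exact: chart_in.
- exists Phi_inv; split; [exact: PhiK|exact: Phi_invK|split; first exact: Phi_inv_cont].
  by move=> j i a; exact: Phi_inv_smooth.
- by move=> i j p; exact: Phi_metric.
Qed.

End FinalIsometry.

Lemma obata_isometry (R : realType) n (M : topologicalType) (g : riemannian_data R n M) (v : M -> R) :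
  obata g v -> (0 < n)%N ->
  exists Phi : M -> dS R n, riemannian_isometry g (dS_metric R n) Phi /\ forall p, v p = dS_potential (Phi p).
Proof.
move=> ob n0; have [z [Psi [zH zK PsiK zloc]]] := flat_development ob n0.
exists (Phi v z); split; first exact: (Phi_isometry ob zK PsiK zloc).
by move=> p; rewrite (Phi_potential ob zloc).
Qed.

Theorem theorem2p1 (R : realType) (n : nat) (hn : (3 <= n)%N)
    (M : topologicalType) (g : riemannian_data R n M) (u : M -> R)
    (Hstatic : static_triple g u) :
  1 <= max_of [set surface_gravity g u Sigma | Sigma in horizons g] /\
  (max_of [set surface_gravity g u Sigma | Sigma in horizons g] = 1 ->
   exists (c : R) (Phi : M -> dS R n),
     [/\ 0 < c, riemannian_isometry g (dS_metric R n) Phi &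
         forall p, u p = c * dS_potential (Phi p)]).
Proof.
have n0 : (0 < n)%N by exact: leq_trans hn.
split; first exact: max_surface_gravity_ge1 Hstatic n0.
move=> e1; have [c c0 ob] := obata_of_static Hstatic n0 e1.
have [Phi [iso hPhi]] := obata_isometry ob n0.
by exists c, Phi; split=> // p; rewrite -hPhi mulrC divfK // gt_eqF.
Qed.
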